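(* Let $d\ge2$, $\alpha\in(1,2)$, and let $\mu$ be a nondegenerate $\alpha$-stable distribution on $\mathbb{R}^d$ with no shift and characteristic exponent $|z|^\alpha V(u_z)$. Let $\varrho_0=\sup_{u\in\mathbb{S}^{d-1}}|V(u)|^2/(2\Re V(u))$, fix $R>\varrho_0$, let $V_*=R-V$ and $S^*_{j,k}=(-i)^j\pi_j(V_*^k)$ for $j,k\in\mathbb{Z}_+$. Then the density of $\mu$ is $$g(x)=\frac{2^{1-d}}{\pi^{d/2}\alpha}\sum_{n=0}^\infty\Big(\frac{|x|}{2}\Big)^n\sum_{m=0}^{\lfloor n/2\rfloor}\frac{(-1)^m}{m!\,\Gamma(n-m+d/2)}\sum_{k=0}^\infty\frac{\Gamma(k+(n+d)/\alpha)}{k!\,R^{k+(n+d)/\alpha}}S^*_{n-2m,k}(u_x),\qquad x\in\mathbb{R}^d,$$ the series converging absolutely and uniformly on $\{x:|x|\le M\}$ for every $M>0$. If $X\sim\mu$, then $|X|$ has density $$g_{|X|}(r)=\frac{(r/2)^{d-1}}{\pi^{d/2}\alpha}\sum_{n=0}^\infty\frac{(-r^2/4)^n}{n!\,\Gamma(n+d/2)}\sum_{k=0}^\infty\frac{\Gamma(k+(2n+d)/\alpha)}{k!\,R^{k+(2n+d)/\alpha}}\int_{\mathbb{S}^{d-1}}V_*^k\,d\omega.$$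
   Context: Let $d\ge 2$, $\mathbb{S}^{d-1}$ the unit sphere, $\omega$ its surface measure, $u_x=x/|x|$ for $x\ne0$. $\pi_j$ is the orthogonal projection of $L^2(\mathbb{S}^{d-1},\omega)$ onto spherical harmonics of degree $j$ (restrictions of homogeneous harmonic polynomials of degree $j$). An $\alpha$-stable distribution ($\alpha\ne1$) with no shift has $\hat\mu(z)=\exp\{-|z|^\alpha V(u_z)\}$, $V(u)=\int_{\mathbb{S}^{d-1}}|\langle u,v\rangle|^\alpha[1-i\tan(\pi\alpha/2)\mathrm{sgn}\langle u,v\rangle]\lambda(dv)$, $\lambda$ a finite nonzero Borel measure on the sphere. Nondegenerate: support not contained in a proper affine subspace; then $\inf\Re V>0$ and $\varrho_0<\infty$. *)

(* Defs.v *)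
From HB Require Import structures.
From mathcomp Require Import all_boot all_order all_algebra.
From mathcomp Require Import mpoly.
From mathcomp Require Import all_classical all_reals all_analysis.
From mathcomp Require Import complex.
Set Implicit Arguments.
Unset Strict Implicit.
Unset Printing Implicit Defensive.
Import Order.TTheory GRing.Theory Num.Theory.
Import numFieldNormedType.Exports.
Local Open Scope classical_set_scope.
Local Open Scope ring_scope.

(* Euclidean space R^d, realised as d.-tuple R (its canonical sigma-algebra *)
(* is the product = Borel sigma-algebra).                                   *)

Definition dotp {R : realType} {d : nat} (x y : d.-tuple R) : R :=
  \sum_(i < d) tnth x i * tnth y i.

Definition enorm {R : realType} {d : nat} (x : d.-tuple R) : R :=
  Num.sqrt (dotp x x).

(* u_x = x / |x| (for x = 0 this returns 0; it is only used for x <> 0,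
   or multiplied by a vanishing factor). *)
Definition unitv {R : realType} {d : nat} (x : d.-tuple R) : d.-tuple R :=
  [tuple (enorm x)^-1 * tnth x i | i < d].

Definition vsub {R : realType} {d : nat} (x y : d.-tuple R) : d.-tuple R :=
  [tuple tnth x i - tnth y i | i < d].

Definition acomb {R : realType} {d : nat} (t : R) (x y : d.-tuple R)
  : d.-tuple R := [tuple (1 - t) * tnth x i + t * tnth y i | i < d].

Definition sphere (R : realType) (d : nat) : set (d.-tuple R) :=
  [set u | enorm u = 1].

(* Lebesgue integral on R^d (iterated one-dimensional Lebesgue integrals;  *)
(* by Tonelli this is the integral w.r.t. d-dimensional Lebesgue measure    *)
(* for nonnegative measurable integrands).                                  *)
Fixpoint leb_int (R : realType) (n : nat)
  : (n.-tuple R -> \bar R) -> \bar R :=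
  match n return (n.-tuple R -> \bar R) -> \bar R with
  | 0 => fun f => f [tuple]
  | n'.+1 => fun f =>
      (\int[@lebesgue_measure R]_t leb_int (fun x => f (cons_tuple t x)))%E
  end.

(* Surface measure omega on S^{d-1} (cone-measure definition):
   int_S h d omega = d * int_{0 < |x| <= 1} h(x/|x|) dx. *)
Definition sph_int {R : realType} {d : nat} (h : d.-tuple R -> R) : R :=
  d%:R * fine (leb_int (fun x : d.-tuple R =>
     (if (0 < enorm x) && (enorm x <= 1) then h (unitv x) else 0)%:E)).

Definition csph_int {R : realType} {d : nat} (h : d.-tuple R -> R[i]) : R[i] :=
  Complex (sph_int (fun u => complex.Re (h u))) (sph_int (fun u => complex.Im (h u))).

Definition rc {R : realType} (x : R) : R[i] := Complex x 0.
Definition ci {R : realType} : R[i] := Complex 0 1.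
Definition cmod {R : realType} (z : R[i]) : R :=
  Num.sqrt (complex.Re z ^+ 2 + complex.Im z ^+ 2).
Definition cexp {R : realType} (w : R[i]) : R[i] :=
  Complex (expR (complex.Re w) * cos (complex.Im w)) (expR (complex.Re w) * sin (complex.Im w)).

Definition csum_to {R : realType} (a : nat -> R[i]) (l : R[i]) : Prop :=
  ((fun N => complex.Re (\sum_(k < N) a k)) @ \oo --> (complex.Re l : R)) /\
  ((fun N => complex.Im (\sum_(k < N) a k)) @ \oo --> (complex.Im l : R)).

Definition Gamma {R : realType} (s : R) : R :=
  Rintegral (@lebesgue_measure R) `]0, +oo[%classic
    (fun t => t `^ (s - 1) * expR (- t)).

(* Spherical harmonics of degree j: restrictions to S^{d-1} of homogeneous *)
(* harmonic polynomials of degree j (complex coefficients); pi_j is the     *)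
(* orthogonal projection of L^2(S^{d-1}, omega) onto them.                  *)
Definition laplacian {R : realType} {d : nat} (p : {mpoly R[i][d]})
  : {mpoly R[i][d]} := \sum_(i < d) mderiv i (mderiv i p).

Definition homog_harmonic {R : realType} {d : nat} (j : nat)
  (p : {mpoly R[i][d]}) : Prop :=
  (forall m, m \in msupp p -> mdeg m = j) /\ laplacian p = 0.

Definition peval {R : realType} {d : nat} (p : {mpoly R[i][d]})
  (u : d.-tuple R) : R[i] := meval (fun i => rc (tnth u i)) p.

Definition is_proj_harm {R : realType} {d : nat} (j : nat)
  (f : d.-tuple R -> R[i]) (p : {mpoly R[i][d]}) : Prop :=
  homog_harmonic j p /\
  forall q, homog_harmonic j q ->
    csph_int (fun u => (f u - peval p u) * conjc (peval q u)) = 0.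

Definition proj_harm {R : realType} {d : nat} (j : nat)
  (f : d.-tuple R -> R[i]) : d.-tuple R -> R[i] :=
  peval (xget 0 (is_proj_harm j f)).

Definition stableV {R : realType} {d : nat} (alpha : R)
  (lam : {measure set (d.-tuple R) -> \bar R}) (u : d.-tuple R) : R[i] :=
  Complex (Rintegral lam setT (fun v => `|dotp u v| `^ alpha))
    (- tan (pi * alpha / 2) *
       Rintegral lam setT (fun v => `|dotp u v| `^ alpha * Num.sg (dotp u v))).

Definition charfun {R : realType} {d : nat}
  (mu : {measure set (d.-tuple R) -> \bar R}) (z : d.-tuple R) : R[i] :=
  Complex (Rintegral mu setT (fun x => cos (dotp z x)))
          (Rintegral mu setT (fun x => sin (dotp z x))).

Definition msupport {R : realType} {d : nat}
  (mu : {measure set (d.-tuple R) -> \bar R}) : set (d.-tuple R) :=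
  [set x | forall e : R, 0 < e -> (0 < mu [set y | (enorm (vsub y x) < e)%R])%E].

Definition affine_subspace {R : realType} {d : nat} (A : set (d.-tuple R))
  : Prop :=
  A !=set0 /\ forall x y t, A x -> A y -> A (acomb t x y).

Definition nondegenerate_law {R : realType} {d : nat}
  (mu : {measure set (d.-tuple R) -> \bar R}) : Prop :=
  ~ exists A, affine_subspace A /\ A != setT /\ msupport mu `<=` A.

Definition rho0 {R : realType} {d : nat} (V : d.-tuple R -> R[i]) : R :=
  sup [set (cmod (V u)) ^+ 2 / (2 * complex.Re (V u)) | u in @sphere R d].

Definition Sstar {R : realType} {d : nat} (V : d.-tuple R -> R[i]) (Rr : R)
  (j k : nat) : d.-tuple R -> R[i] :=
  fun u => (- ci) ^+ j * proj_harm j (fun v => (rc Rr - V v) ^+ k) u.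

Definition gterm {R : realType} {d : nat} (alpha : R) (V : d.-tuple R -> R[i])
  (Rr : R) (n m k : nat) (x : d.-tuple R) : R[i] :=
  rc ((enorm x / 2) ^+ n * (-1) ^+ m
        / (m`!%:R * Gamma (n%:R - m%:R + d%:R / 2))
      * Gamma (k%:R + (n%:R + d%:R) / alpha)
        / (k`!%:R * Rr `^ (k%:R + (n%:R + d%:R) / alpha)))
  * Sstar V Rr (n - 2 * m) k (unitv x).

Definition gconst {R : realType} (d : nat) (alpha : R) : R :=
  2 `^ (1 - d%:R) / (pi `^ (d%:R / 2) * alpha).

Definition rterm {R : realType} {d : nat} (alpha : R) (V : d.-tuple R -> R[i])
  (Rr : R) (n k : nat) (r : R) : R[i] :=
  rc ((- r ^+ 2 / 4) ^+ n / (n`!%:R * Gamma (n%:R + d%:R / 2))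
      * Gamma (k%:R + (2 * n%:R + d%:R) / alpha)
        / (k`!%:R * Rr `^ (k%:R + (2 * n%:R + d%:R) / alpha)))
  * csph_int (fun v : d.-tuple R => (rc Rr - V v) ^+ k).

Definition rconst {R : realType} (d : nat) (alpha r : R) : R :=
  (r / 2) ^+ d.-1 / (pi `^ (d%:R / 2) * alpha).

(* Main.v *)
Require Import Defs.
From HB Require Import structures.
From mathcomp Require Import all_boot all_order all_algebra.
From mathcomp Require Import mpoly.
From mathcomp Require Import all_classical all_reals all_analysis.
From mathcomp Require Import measurable_realfun.
From mathcomp Require Import complex.
From mathcomp Require Import ring lra zify.
Set Implicit Arguments.
Unset Strict Implicit.
Unset Printing Implicit Defensive.
Import Order.TTheory GRing.Theory Num.Theory.
Import numFieldNormedType.Exports.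
Local Open Scope classical_set_scope.
Local Open Scope ring_scope.
(**
Nondegeneracy makes Re V bounded below on the sphere, so the characteristic
function Phi(z) = exp(-|z|^alpha V(u_z)) is integrable and mu has the density
g(x) = (2 pi)^-d int exp(-i<x,z>) Phi(z) dz; this is Fourier inversion by
Gaussian smoothing.  Expand exp(-i<x,z>) in powers of <x,z>, and
Phi(z) = exp(-R|z|^alpha) exp(|z|^alpha V_*(u_z)) in powers of V_*: the condition
R > rho_0 says exactly that |V_*| <= q < R on the sphere, which keeps everything
dominated by exp(|x||z| - (R-q)|z|^alpha), integrable since alpha > 1.  In polar
coordinates the radial integrals are Gamma values, and the spherical integrals
int <u_x,v>^n V_*^k(v) d omega(v) are given by a Funk-Hecke formula as combinations
of the projections pi_(n-2m)(V_*^k)(u_x).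

The Funk-Hecke formula and the bound |pi_j f| <= A B^j sup|f| come from the Gaussian
functional G(p) = int p exp(-|x|^2/2): integration by parts, G(x_i p) = G(d_i p),
makes harmonic polynomials orthogonal to all polynomials of lower degree, and
homogeneity transfers this to the sphere.

Integrating the series of g over spheres annihilates every pi_j with j > 0, so only
the terms n = 2m survive in the density of |X|.
*)

(** * Lebesgue measure on tuples and polar coordinates *)

(** All harmonic analysis is kept algebraic. A bounded function [f] on the sphere enters only
    through the functional [p |-> int f p] on polynomials, and a point [xi] only through
    [p |-> p(xi)]; neither sees a factor [|x|^2]. Every such functional [T] yields polynomials
    [Pn n T] whose harmonic parts are explicit, so projections exist by a formula. Exchanging the
    roles of the two functionals gives the value of a projection at a point, hence its bound.

    Geometric growth [A B^j] of the projections is harmless: [1 / (m! Gamma(n-m+d/2))] is at most a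
    constant times [C^n / n!], and the sum over [k] is bounded by a multiple of the integral of
    [r^(n+d-1) exp(-(R-q) r^alpha)]. The triple series is thus majorised by the integral of
    [exp(K r - (R-q) r^alpha) r^(d-1)], with [K] proportional to the radius of the ball.

    Two encodings shape the details. The surface integral is given by iterated integrals, so a
    measure on tuples with these integrals is built. And [unitv] is null at the origin, where
    [|x|^n] vanishes for [n > 0] while harmonic polynomials of degree 0 are constant. *)

Section pushforward_pack.
Context d1 d2 (T1 : measurableType d1) (T2 : measurableType d2) (R : realType).
Variables (m : {measure set T1 -> \bar R}) (f : T1 -> T2).
Hypothesis mf : measurable_fun setT f.

Definition pfm : {measure set T2 -> \bar R}.
Proof. refine [the {measure set T2 -> \bar R} of pushforward m f]; exact: mf. Defined.

Lemma pfmE A : pfm A = m (f @^-1` A). Proof. by []. Qed.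

Lemma ge0_integral_pfm (h : T2 -> \bar R) :
  measurable_fun setT h -> (forall x, 0 <= h x)%E ->
  (\int[pfm]_x h x = \int[m]_x h (f x))%E.
Proof. by move=> mh h0; rewrite ge0_integral_pushforward. Qed.

Lemma integral_pfm (h : T2 -> \bar R) : measurable_fun setT h ->
  (\int[pfm]_x h x = \int[m]_x h (f x))%E.
Proof.
move=> mh; rewrite integralE [RHS]integralE !ge0_integral_pfm//.
- by congr (_ - _)%E; apply: eq_integral => x _; rewrite ?funeposE ?funenegE.
- exact: measurable_funeneg.
- exact: measurable_funepos.
Qed.

Lemma integrable_pfm (h : T2 -> \bar R) : measurable_fun setT h ->
  pfm.-integrable setT h <-> m.-integrable setT (h \o f).
Proof.
move=> mh.
have mah : measurable_fun setT (abse \o h) by exact: measurableT_comp.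
have ah0 x : (0 <= (abse \o h) x)%E by exact: abse_ge0.
have E := ge0_integral_pfm mah ah0.
split=> /integrableP[_ ih]; apply/integrableP; split=> //.
- exact: measurableT_comp.
- by rewrite -[X in (X < _)%E]E.
- by rewrite [X in (X < _)%E]E.
Qed.

End pushforward_pack.

Section lebesgue_tuple.
Context (R : realType).
Local Notation leb := (@lebesgue_measure R).

Lemma measurable_consp n :
  measurable_fun setT (fun p : R * n.-tuple R => cons_tuple p.1 p.2 : n.+1.-tuple R).
Proof. exact: measurable_cons. Qed.

Lemma measurable_cons2 n (t : R) :
  measurable_fun setT (fun x : n.-tuple R => cons_tuple t x : n.+1.-tuple R).
Proof. by apply: measurable_cons => //; exact: measurable_cst. Qed.

(** In dimension [n+1] the measure is the image, under [cons_tuple], of the product with the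
    one-dimensional one. Sigma-finiteness is carried through the induction because Tonelli needs it;
    agreement with [leb_int] on nonnegative functions determines the measure. *)
Lemma lebn_exists n : exists m : {sigma_finite_measure set (n.-tuple R) -> \bar R},
  forall f : n.-tuple R -> \bar R, measurable_fun setT f -> (forall x, 0 <= f x)%E ->
  (\int[m]_x f x = leb_int f)%E.
Proof.
elim: n => [|n [m IH]].
  exists [the {sigma_finite_measure set (0.-tuple R) -> \bar R} of
     \d_([tuple] : 0.-tuple R)] => f mf f0.
  by rewrite integral_dirac//= diracT mul1e.
pose m' := pfm (leb \x m)%E (@measurable_consp n).
have sf : sigma_finite setT m'.
  have /sigma_finiteP[F [TF ndF Foo]] := sigma_finiteT leb.
  have /sigma_finiteP[G [TG ndG Goo]] := sigma_finiteT m.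
  (* [h] inverts [cons_tuple]; it pulls back the product of the two given exhaustions. *)
  pose h (x : n.+1.-tuple R) : R * n.-tuple R := (thead x, [tuple of behead x]).
  have hE (t : R) (y : n.-tuple R) : h (cons_tuple t y) = (t, y).
    by congr pair; exact/val_inj.
  have mh : measurable_fun setT h.
    apply: measurable_fun_pair => /=; [exact: measurable_tnth|exact: measurable_behead].
  exists (fun k => h @^-1` (F k `*` G k)).
    rewrite predeqE => x; split=> // _.
    have : [set: R] (thead x) by []. rewrite TF => -[i _ Fi].
    have : [set: n.-tuple R] [tuple of behead x] by []. rewrite TG => -[j _ Gj].
    exists (maxn i j) => //; split => /=.
    - by move: Fi; apply/subsetPset/ndF/leq_maxl.
    - by move: Gj; apply/subsetPset/ndG/leq_maxr.
  move=> k; have [? ?] := Foo k; have [? ?] := Goo k.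
  have mFG : measurable (F k `*` G k) by exact: measurableX.
  split; first by rewrite -[X in measurable X]setTI; exact: mh.
  rewrite /m' /pfm/= /pushforward.
  rewrite (_ : _ @^-1` _ = F k `*` G k); last first.
    by apply/funext => -[t y]; rewrite /preimage/mkset hE.
  by rewrite product_measure1E// lte_mul_pinfty// ge0_fin_numE.
pose sfm := Measure_isSigmaFinite.Build _ _ _ m' sf.
pose m'' : {sigma_finite_measure set (n.+1.-tuple R) -> \bar R} := HB.pack (Measure.sort m') sfm.
exists m'' => f mf f0.
rewrite [LHS](@ge0_integral_pfm _ _ _ _ _ (leb \x m)%E _ (@measurable_consp n))//.
rewrite fubini_tonelli1//=; last first.
  by apply: measurableT_comp => //; exact: measurable_consp.
apply: eq_integral => t _; rewrite -IH//.
by apply: measurableT_comp => //; exact: measurable_cons2.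
Qed.

Definition lebn n : {sigma_finite_measure set (n.-tuple R) -> \bar R} :=
  projT1 (cid (lebn_exists n)).

Lemma integral_lebn n (f : n.-tuple R -> \bar R) :
  measurable_fun setT f -> (forall x, 0 <= f x)%E ->
  (\int[lebn n]_x f x = leb_int f)%E.
Proof. by rewrite /lebn; case: cid => m /= h; exact: h. Qed.

(** [lebn] is picked from an existence statement, so its recursive structure has to be recovered;
    indicator functions are enough for that. *)
Lemma lebnS n (A : set (n.+1.-tuple R)) : measurable A ->
  lebn n.+1 A = pfm (leb \x lebn n)%E (@measurable_consp n) A.
Proof.
move=> mA; rewrite -(setIT A) -!integral_indic//.
have mi : measurable_fun setT (fun x : n.+1.-tuple R => (\1_A x)%:E : \bar R).
  by apply/measurable_EFinP.
rewrite integral_lebn// ge0_integral_pfm//.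
rewrite fubini_tonelli1//=; last first.
  exact: (measurableT_comp mi (@measurable_consp n)).
apply: eq_integral => t _; rewrite -integral_lebn//.
exact: (measurableT_comp mi (measurable_cons2 t)).
Qed.

Lemma integral_lebnS n (f : n.+1.-tuple R -> \bar R) : measurable_fun setT f ->
  (\int[lebn n.+1]_x f x = \int[(leb \x lebn n)]_p f (cons_tuple p.1 p.2))%E.
Proof.
move=> mf; transitivity (\int[pfm (leb \x lebn n) (@measurable_consp n)]_x f x)%E.
  by apply: eq_measure_integral => A mA _; exact: lebnS.
exact: (integral_pfm (leb \x lebn n)%E (@measurable_consp n) mf).
Qed.

Lemma integrable_lebnS n (f : n.+1.-tuple R -> \bar R) : measurable_fun setT f ->
  (lebn n.+1).-integrable setT f <->
  (leb \x lebn n)%E.-integrable setT (fun p => f (cons_tuple p.1 p.2)).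
Proof.
move=> mf; apply: iff_trans (integrable_pfm (leb \x lebn n)%E (@measurable_consp n) mf).
have E g : (\int[lebn n.+1]_x g x = \int[pfm (leb \x lebn n)%E (@measurable_consp n)]_x g x)%E.
  by apply: eq_measure_integral => A mA _; exact: lebnS.
by split => /integrableP[_ h]; apply/integrableP; split => //; rewrite ?E// -?E.
Qed.

Lemma ge0_integral_lebnS n (f : n.+1.-tuple R -> \bar R) :
  measurable_fun setT f -> (forall x, 0 <= f x)%E ->
  (\int[lebn n.+1]_x f x = \int[leb]_t \int[lebn n]_x f (cons_tuple t x))%E.
Proof.
move=> mf f0; rewrite integral_lebnS//.
rewrite fubini_tonelli1//=.
by apply: measurableT_comp => //; exact: measurable_consp.
Qed.

End lebesgue_tuple.

(** * Affine changes of variables *)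

Section affine_change.
Context (R : realType).
Local Notation leb := (@lebesgue_measure R).

(** Both sides are measures, so half-open intervals suffice. A negative slope reverses the interval
    and moves its closed end, which leaves the length unchanged. *)
Lemma lebesgue_measure_affine (a b : R) (A : set R) : a != 0 -> measurable A ->
  (leb A = `|a|%:E * leb ((fun t : R => b + a * t)%R @^-1` A))%E.
Proof.
move=> a0 mA.
have mf : measurable_fun setT (fun t : measurableTypeR R => (b + a * t)%R : measurableTypeR R).
  by apply: measurable_funD => //; exact: measurable_funM.
pose m' := pfm leb mf.
pose k : {nonneg R} := NngNum (normr_ge0 a).
pose m : {measure set (measurableTypeR R) -> \bar R} :=
  [the {measure set (measurableTypeR R) -> \bar R} of mscale k m'].
suff : forall X, ocitv X -> leb X = m X.
  by move/(@lebesgue_measure_unique R m); apply.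
move=> X [[x y] _ <-].
rewrite /m/= /mscale/= /m' /pfm/= /pushforward.
have [a_gt0|a_lt0|] := ltgtP 0 a; last by move=> aE; rewrite -aE eqxx in a0.
- rewrite (_ : _ @^-1` _ = `](x - b) / a, (y - b) / a]%classic); last first.
    apply/seteqP; split => t /=; rewrite !in_itv/= ltr_pdivrMr// ler_pdivlMr//;
      rewrite ltrBlDr lerBrDr (mulrC t) addrC; move=> /andP[-> ->] //; lra.
  rewrite !lebesgue_measure_itv/= !lte_fin ltr_pM2r ?invr_gt0// ltrD2r gtr0_norm//.
  case: ifPn => xy; rewrite ?mule0// -EFinM; congr EFin; field; lra.
- rewrite (_ : _ @^-1` _ = `[(y - b) / a, (x - b) / a[%classic); last first.
    apply/seteqP; split => t /=; rewrite !in_itv/= ltr_ndivlMr// ler_ndivrMr//;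
      rewrite ltrBlDr lerBrDr (mulrC t) addrC; move=> /andP[-> ->] //; lra.
  rewrite !lebesgue_measure_itv/= !lte_fin ltr_nM2r ?invr_lt0// ltrD2r ltr0_norm//.
  case: ifPn => xy; rewrite ?mule0// -EFinM; congr EFin; field; lra.
Qed.

Lemma ge0_integral_affine1 (a b : R) (f : R -> \bar R) : a != 0 ->
  measurable_fun setT f -> (forall x, 0 <= f x)%E ->
  (\int[leb]_t f (b + a * t)%R = (`|a|^-1)%:E * \int[leb]_t f t)%E.
Proof.
move=> a0 mfm f0.
have mf : measurable_fun setT (fun t : measurableTypeR R => (b + a * t)%R : measurableTypeR R).
  by apply: measurable_funD => //; exact: measurable_funM.
have k0 : 0 <= `|a|^-1 by rewrite invr_ge0.
pose k : {nonneg R} := NngNum k0.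
transitivity (\int[pfm leb mf]_t f t)%E; first by rewrite ge0_integral_pfm.
transitivity (\int[[the {measure set (measurableTypeR R) -> \bar R} of mscale k leb]]_t f t)%E.
  apply: eq_measure_integral => A mA _ /=.
  rewrite /mscale/= (lebesgue_measure_affine b a0 mA) muleA -EFinM mulVf ?mul1e//.
  by rewrite normr_eq0.
by rewrite ge0_integral_mscale.
Qed.

Definition aff n (y : n.-tuple R) (c : R) (x : n.-tuple R) : n.-tuple R :=
  [tuple tnth y i + c * tnth x i | i < n].

Lemma measurable_aff n (y : n.-tuple R) c : measurable_fun setT (aff y c).
Proof.
apply/measurable_fun_tnthP => i.
rewrite (_ : _ \o _ = fun x => tnth y i + c * tnth x i); last first.
  by apply/funext => x /=; rewrite tnth_mktuple.
by apply: measurable_funD => //; apply: measurable_funM => //; exact: measurable_tnth.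
Qed.

Lemma aff_cons n (y : n.+1.-tuple R) c t (x : n.-tuple R) :
  aff y c (cons_tuple t x) =
  cons_tuple (thead y + c * t) (aff [tuple of behead y] c x).
Proof.
apply: eq_from_tnth => i; rewrite tnth_mktuple.
case: (unliftP ord0 i) => [j ->|->]; last by rewrite !tnth0.
rewrite !tnthS tnth_mktuple; congr (_ + _).
by rewrite {1}(tuple_eta y) tnthS.
Qed.

Lemma ge0_integral_aff n (y : n.-tuple R) (c : R) (f : n.-tuple R -> \bar R) :
  c != 0 -> measurable_fun setT f -> (forall x, 0 <= f x)%E ->
  (\int[lebn R n]_x f (aff y c x) = (`|c| ^- n)%:E * \int[lebn R n]_x f x)%E.
Proof.
move=> c0; elim: n => [|n IH] in y f * => mf f0.
  have mfa : measurable_fun setT (fun x => f (aff y c x)).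
    by apply: measurableT_comp => //; exact: measurable_aff.
  rewrite !integral_lebn//= expr0 invr1 mul1e; congr f; exact: tuple0.
have mfa : measurable_fun setT (fun x => f (aff y c x)).
  by apply: measurableT_comp => //; exact: measurable_aff.
rewrite !ge0_integral_lebnS//.
have mft t : measurable_fun setT (fun x => f (cons_tuple t x)).
  by apply: measurableT_comp => //; exact: measurable_cons2.
under eq_integral => t _.
  under eq_integral do rewrite aff_cons.
  rewrite (IH _ (fun x => f (cons_tuple (thead y + c * t) x)))//.
  over.
have mF : measurable_fun setT (fun t => \int[lebn R n]_x f (cons_tuple t x))%E.
  have mfc : measurable_fun setT (fun p : R * n.-tuple R => f (cons_tuple p.1 p.2)).
    by apply: measurableT_comp => //; exact: measurable_consp.
  exact: (@measurable_fun_fubini_tonelli_F _ _ _ _ _ (lebn R n) _ mfc (fun p => f0 _)).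
have mFa : measurable_fun setT
    ((fun t => \int[lebn R n]_x f (cons_tuple t x)) \o (fun t : R => thead y + c * t)%R)%E.
  by apply: measurableT_comp => //; apply: measurable_funD => //; exact: measurable_funM.
rewrite (@ge0_integralZl _ _ _ leb setT measurableT _ mFa) => [|t _|]; last 2 first.
- exact: integral_ge0.
- by rewrite lee_fin invr_ge0 exprn_ge0.
rewrite (ge0_integral_affine1 _ c0 mF)//; last by move=> t; exact: integral_ge0.
by rewrite muleA -EFinM -invfM -exprSr.
Qed.

Lemma integral_aff n (y : n.-tuple R) (c : R) (f : n.-tuple R -> \bar R) :
  c != 0 -> measurable_fun setT f -> (lebn R n).-integrable setT f ->
  (\int[lebn R n]_x f (aff y c x) = (`|c| ^- n)%:E * \int[lebn R n]_x f x)%E.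
Proof.
move=> c0 mf intf; rewrite integralE [in RHS]integralE.
have -> : (fun x => f (aff y c x))^\+%E = (fun x => f^\+ (aff y c x))%E.
  by apply/funext => x; rewrite !funeposE.
have -> : (fun x => f (aff y c x))^\-%E = (fun x => f^\- (aff y c x))%E.
  by apply/funext => x; rewrite !funenegE.
rewrite !ge0_integral_aff//; [|exact: measurable_funeneg|exact: measurable_funepos].
rewrite [RHS]muleBr//.
by apply: fin_num_adde_defl; rewrite fin_numN; exact: integrable_neg_fin_num.
Qed.

Lemma integrable_aff n (y : n.-tuple R) (c : R) (f : n.-tuple R -> \bar R) :
  c != 0 -> (lebn R n).-integrable setT f ->
  (lebn R n).-integrable setT (fun x => f (aff y c x)).
Proof.
move=> c0 /integrableP[mf intf]; apply/integrableP; split.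
  by apply: measurableT_comp => //; exact: measurable_aff.
rewrite (ge0_integral_aff y c0 (f := fun x => `|f x|%E))//; last exact: measurableT_comp.
by rewrite lte_mul_pinfty// lee_fin invr_ge0 exprn_ge0.
Qed.

(** A set of finite measure that contains the unit ball and, unlike it, splits coordinate by
    coordinate along the recursion of [leb_int]. *)
Definition unit_box n : set (n.-tuple R) := [set x | forall i, `|tnth x i| <= 1].

Arguments unit_box : clear implicits.

Lemma unit_box_cons n t (x : n.-tuple R) :
  unit_box n.+1 (cons_tuple t x) <-> `|t| <= 1 /\ unit_box n x.
Proof.
split=> [h|[ht hx] i].
  split; first by have := h ord0; rewrite tnth0.
  by move=> i; have := h (lift ord0 i); rewrite tnthS.
by case: (unliftP ord0 i) => [j ->|->]; rewrite ?tnthS ?tnth0.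
Qed.

Lemma measurable_unit_box n : measurable (unit_box n).
Proof.
rewrite (_ : unit_box _ = \bigcap_(i in [set: 'I_n])
    ((fun x : n.-tuple R => tnth x i) @^-1` `[-1, 1]%classic)); last first.
  apply/seteqP; split => x /= h i; first by rewrite /= in_itv/= -ler_norml.
  by have := h i I; rewrite /= in_itv/= -ler_norml.
apply: fin_bigcap_measurable => // i _.
by rewrite -[X in measurable X]setTI; exact: measurable_tnth.
Qed.

Lemma lebn_unit_box n : (lebn R n (unit_box n) < +oo)%E.
Proof.
elim: n => [|n IH].
  rewrite -(setIT (unit_box _)) -integral_indic//; last exact: measurable_unit_box.
  rewrite integral_lebn//= ?ltry//; first by apply/measurable_EFinP; apply: measurable_indic; exact: measurable_unit_box.
rewrite -(setIT (unit_box _)) -integral_indic//; last exact: measurable_unit_box.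
rewrite ge0_integral_lebnS//; last first.
  by apply/measurable_EFinP; apply: measurable_indic; exact: measurable_unit_box.
rewrite (_ : (fun t => _) = fun t => ((\1_`[-1, 1]%classic t)%:E * lebn R n (unit_box n))%E); last first.
  apply/funext => t; rewrite -[X in lebn R n X]setIT -integral_indic//; last exact: measurable_unit_box.
  rewrite -ge0_integralZl//; last first.
    by apply/measurable_EFinP; apply: measurable_indic; exact: measurable_unit_box.
  apply: eq_integral => x _; rewrite -EFinM; congr EFin; rewrite !indicE -natrM mulnb.
  congr (_%:R); congr nat_of_bool; apply/idP/idP.
    rewrite !inE => /unit_box_cons[? ?]; apply/andP; split; rewrite inE//=.
    by rewrite in_itv/= -ler_norml.
  move=> /andP[]; rewrite !inE/= in_itv/= -ler_norml => ? ?; exact/unit_box_cons.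
rewrite ge0_integralZr//; last by apply/measurable_EFinP.
have l2 : leb `[-1, 1]%classic = 2%:E.
  by rewrite lebesgue_measure_itv/= lte_fin ifT -?EFinD; [congr EFin|]; lra.
rewrite (_ : (\int[_]_x _)%E = 2%:E); last by rewrite integral_indic// setIT; exact: l2.
by rewrite lte_mul_pinfty// lee_fin.
Qed.

(** For signed integrands the iterated integral is the integral against [lebn] only through Fubini.
    Boundedness and a support in the box make every section integrable at each stage of the
    recursion; this covers the integrands of [sph_int]. *)
Lemma leb_int_bounded n (f : n.-tuple R -> R) (C : R) :
  measurable_fun setT f -> (forall x, `|f x| <= C) ->
  (forall x, ~ unit_box n x -> f x = 0) ->
  leb_int (fun x => (f x)%:E) = (\int[lebn R n]_x (f x)%:E)%E.
Proof.
elim: n => [|n IH] in f *.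
  move=> mf fC fz /=.
  have mE : measurable_fun setT (EFin \o f) by apply/measurable_EFinP.
  rewrite integralE !integral_lebn//=; [|exact: measurable_funeneg|exact: measurable_funepos].
  exact: (congr1 (fun g => g [tuple]) (funeposneg (fun x => (f x)%:E))).
move=> mf fC fz /=.
have mE : measurable_fun setT (EFin \o f) by apply/measurable_EFinP.
have C0 : 0 <= C by exact: le_trans (fC [tuple of nseq _ 0]).
have intf : (lebn R n.+1).-integrable setT (EFin \o f).
  apply: (@le_integrable _ _ _ _ _ _ _ (fun x => C%:E * (\1_(unit_box n.+1) x)%:E)%E) => //.
    move=> x _ /=; rewrite lee_fin indicE; case: (boolP (x \in _)) => [_|].
      by rewrite mulr1 (ger0_norm C0).
    by rewrite notin_setE => /fz ->; rewrite normr0 mulr0 normr0.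
  apply: integrableZl => //; apply/integrableP; split.
    by apply/measurable_EFinP; apply: measurable_indic; exact: measurable_unit_box.
  rewrite (eq_integral (fun x => (\1_(unit_box n.+1) x)%:E)); last first.
    by move=> x _; rewrite gee0_abs.
  by rewrite integral_indic ?setIT ?lebn_unit_box//; exact: measurable_unit_box.
rewrite integral_lebnS//; rewrite -[RHS]integral12_prod_meas1; last first.
  exact/(integrable_lebnS mE).
apply: eq_integral => t _; rewrite (IH (fun x => f (cons_tuple t x)))//.
- by apply: measurableT_comp => //; exact: measurable_cons2.
- by move=> x xb; apply: fz => /unit_box_cons[].
Qed.

(** Dilation by 2 fixes the origin and scales the measure by a power of 2. A finite mass equal to a
    proper fraction of itself is zero. *)
Lemma lebn_set1_0 n (A : set (n.+1.-tuple R)) : A `<=` [set [tuple of nseq n.+1 0]] ->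
  measurable A -> lebn R n.+1 A = 0%E.
Proof.
move=> A0 mA.
have Ab : A `<=` unit_box n.+1.
  by move=> x /A0 -> i; rewrite tnth_nseq normr0.
have Afin : lebn R n.+1 A \is a fin_num.
  rewrite ge0_fin_numE//; apply: le_lt_trans (lebn_unit_box n.+1).
  by apply: le_measure => //; rewrite inE//; exact: measurable_unit_box.
have mI : measurable_fun setT (fun x => (\1_A x)%:E : \bar R) by apply/measurable_EFinP.
have : lebn R n.+1 A = ((`|2 : R| ^- n.+1)%:E * lebn R n.+1 A)%E.
  rewrite -[in LHS](setIT A) -[in RHS](setIT A) -!integral_indic//.
  rewrite -(ge0_integral_aff [tuple of nseq n.+1 0])//.
  apply: eq_integral => x _; congr EFin; rewrite !indicE; congr (_%:R); congr nat_of_bool.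
  apply/idP/idP; rewrite !inE => hx.
    have -> // : aff [tuple of nseq n.+1 0] 2 x = x.
    by rewrite (A0 _ hx); apply: eq_from_tnth => i; rewrite tnth_mktuple !tnth_nseq mulr0 addr0.
  have := A0 _ hx => E.
  have <- // : aff [tuple of nseq n.+1 0] 2 x = x.
  rewrite E; apply: eq_from_tnth => i; rewrite tnth_nseq.
  have := congr1 (fun y => tnth y i) E; rewrite tnth_mktuple !tnth_nseq add0r => /eqP.
  by rewrite mulf_eq0 pnatr_eq0/= => /eqP.
rewrite -(fineK Afin) -EFinM => -[]; set a := fine _ => aE; congr EFin.
have : (1 - `|2 : R| ^- n.+1) * a = 0 by rewrite mulrBl mul1r -aE subrr.
move=> /eqP; rewrite mulf_eq0 subr_eq0 => /orP[|/eqP//].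
rewrite normr_nat eq_sym invr_eq1 => /eqP h; exfalso.
have : (1 : R) < 2 ^+ n.+1 by rewrite exprn_egt1// ltr1n.
by rewrite h ltxx.
Qed.

End affine_change.

Section density_measure.
Context d (T : measurableType d) (R : realType).
Variables (m : {measure set T -> \bar R}) (w : T -> R).
Hypotheses (mw : measurable_fun setT w) (w0 : forall x, 0 <= w x).

Let dens (A : set T) := (\int[m]_(x in A) (w x)%:E)%E.

Let dens0 : dens set0 = 0%E. Proof. exact: integral_set0. Qed.

Let dens_ge0 A : (0 <= dens A)%E.
Proof. by apply: integral_ge0 => x _; rewrite lee_fin. Qed.

Let dens_sigma_additive : semi_sigma_additive dens.
Proof.
move=> F mF tF mUF; rewrite /dens; apply: cvg_toP.
  apply: ereal_nondecreasing_is_cvgn => i j ij.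
  by apply: lee_sum_nneg_natr => // k _ _; exact: dens_ge0.
rewrite ge0_integral_bigcup//=.
- by apply/measurable_EFinP; exact: measurable_funTS.
- by move=> x _; rewrite lee_fin.
Qed.

Definition mdens : {measure set T -> \bar R} :=
  HB.pack dens (isMeasure.Build _ _ _ dens dens0 dens_ge0 dens_sigma_additive).

Lemma mdensE A : mdens A = (\int[m]_(x in A) (w x)%:E)%E.
Proof. by []. Qed.

Import HBNNSimple.

(** True for simple functions by linearity, and for the others by monotone convergence. *)
Lemma ge0_integral_mdens (f : T -> \bar R) :
  measurable_fun setT f -> (forall x, 0 <= f x)%E ->
  (\int[mdens]_x f x = \int[m]_x (f x * (w x)%:E))%E.
Proof.
move=> mf f0.
have mwE : measurable_fun setT (fun x => (w x)%:E) by apply/measurable_EFinP.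
pose f_ := nnsfun_approx measurableT mf.
have cvgf x : (f_ n x)%:E @[n --> \oo] --> f x by apply: cvg_nnsfun_approx.
transitivity (limn (fun n => \int[mdens]_x (f_ n x)%:E))%E.
  rewrite -monotone_convergence//.
  - by apply: eq_integral => y _; apply/esym/cvg_lim => //; exact: cvgf.
  - by move=> n; exact/measurable_EFinP/measurable_funP.
  - by move=> n y _; rewrite lee_fin.
  - by move=> y _ k n kn; rewrite lee_fin; exact/lefP/nd_nnsfun_approx.
rewrite [X in limn X](_ : _ =
    (fun n => \int[m]_x ((f_ n x)%:E * (w x)%:E))%E); last first.
  apply/funext => n.
  under eq_integral do rewrite fimfunE -fsumEFin//.
  rewrite [RHS](_ : _ = \int[m]_x (\sum_(r \in range (f_ n))
      ((r * \1_(f_ n @^-1` [set r]) x)%:E * (w x)%:E)))%E; last first.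
    apply: eq_integral => x _; rewrite fimfunE -fsumEFin// ge0_mule_fsuml// => r.
    exact: nnfun_muleindic_ge0.
  rewrite ge0_integral_fsum//; last 2 first.
  - by move=> y; exact/measurable_EFinP/measurable_funM.
  - by move=> y x _; rewrite nnfun_muleindic_ge0.
  rewrite ge0_integral_fsum//; last 2 first.
  - move=> y; apply: emeasurable_funM => //.
    exact/measurable_EFinP/measurable_funM.
  - move=> y x _; apply: mule_ge0; last by rewrite lee_fin.
    by rewrite EFinM nnfun_muleindic_ge0.
  apply: eq_fsbigr => r; rewrite inE => -[x _ rE].
  have r0 : 0 <= r by rewrite -rE.
  under eq_integral do rewrite EFinM.
  rewrite ge0_integralZl//; last by apply/measurable_EFinP.
  rewrite integral_indic// setIT mdensE.
  under [RHS]eq_integral do rewrite EFinM -muleA.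
  rewrite [RHS]ge0_integralZl//; last 2 first.
  - by apply: emeasurable_funM => //; apply/measurable_EFinP.
  - by move=> y _; apply: mule_ge0; rewrite lee_fin.
  congr (_ * _)%E; rewrite integral_mkcond; apply: eq_integral => y _.
  by rewrite patchE indicE; case: ifP => _; rewrite ?mul1e ?mul0e.
rewrite -monotone_convergence//; last 3 first.
- by move=> n; apply: emeasurable_funM => //; exact/measurable_EFinP/measurable_funP.
- by move=> n x _; apply: mule_ge0; rewrite lee_fin.
- move=> x _ k n kn; rewrite lee_pmul// ?lee_fin//.
  exact/lefP/nd_nnsfun_approx.
apply: eq_integral => x _; apply/cvg_lim => //.
by apply: cvgeZr => //; exact: cvgf.
Qed.

End density_measure.

(** * Measures on the line and the substitution [t = r^p] *)

Section itv_unique.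
Context (R : realType).
Local Notation leb := (@lebesgue_measure R).

Lemma measure_unique_itv (m1 m2 : {measure set (measurableTypeR R) -> \bar R}) :
  (forall a b, a < b -> m1 `]a, b]%classic = m2 `]a, b]%classic) ->
  (forall a b, (m1 `]a, b]%classic < +oo)%E) ->
  forall A, measurable A -> m1 A = m2 A.
Proof.
move=> m12 fin A mA.
have U := @measure_unique _ R (measurableTypeR R) (@ocitv R)
  (fun n : nat => `](- n%:R), n%:R]%classic).
apply: (U _ _ _ _ m1 m2 _ _ A mA) => //.
- exact: ocitvI.
- by move=> i; exists (- i%:R, i%:R).
- apply/seteqP; split => // x _; exists (Num.truncn `|x|).+1 => //=.
  rewrite in_itv/=; have := truncnS_gt `|x|; have := ler_norm x; have := ler_norm (- x).
  rewrite normrN => h1 h2 h3; apply/andP; split; [rewrite ltrNl|]; lra.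
- move=> _ [[a b] _ <-] /=; have [ab|ba] := ltP a b; first exact: m12.
  by rewrite set_itv_ge -?leNgt ?bnd_simp// !measure0.
Qed.

Lemma powR_continuous_itv (p a b : R) : 0 < p -> 0 <= a -> a < b ->
  derivable_oo_LRcontinuous (fun x => x `^ p) a b.
Proof.
move=> p0 a0 ab; split.
- move=> x; rewrite in_itv/= => /andP[ax _]; apply: derivable_powR.
  by rewrite in_itv/= andbT (le_lt_trans a0).
- have [->|a_neq0] := eqVneq a 0.
    by rewrite powR0 ?gt_eqF//; exact: powR_cvg0.
  have a_gt0 : 0 < a by rewrite lt_neqAle eq_sym a_neq0.
  have : derivable (@powR R ^~ p) a 1 by apply: derivable_powR; rewrite in_itv/= andbT.
  by move=> /derivable1_diffP/differentiable_continuous; exact: cvg_at_right_filter.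
- have : derivable (@powR R ^~ p) b 1.
    by apply: derivable_powR; rewrite in_itv/= andbT (le_lt_trans a0).
  by move=> /derivable1_diffP/differentiable_continuous; exact: cvg_at_left_filter.
Qed.

(** The condition [1 < p] keeps the derivative continuous at [0], so the fundamental theorem of
    calculus applies up to the left end [a = 0]. *)
Lemma integral_powR_itv (p a b : R) : 1 < p -> 0 <= a -> a < b ->
  (\int[leb]_(r in `]a, b]) (p * r `^ (p - 1))%:E = (b `^ p - a `^ p)%:E)%E.
Proof.
move=> p1 a0 ab; rewrite integral_itv_obnd_cbnd; last first.
  by apply/measurable_EFinP; apply: measurable_funTS; exact: measurable_funM.
rewrite (@continuous_FTC2 _ _ (fun x => x `^ p))//.
- have h : {within `[a, b], continuous (fun x : R => x `^ (p - 1))}.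
    by apply: derivable_oo_LRcontinuous_within; apply: powR_continuous_itv => //; lra.
  have hc : {within `[a, b], continuous ((cst p : R -> R) * (fun x : R => x `^ (p - 1)))%R}.
    by move=> x; apply: continuousM; [exact: cst_continuous|exact: h].
  exact: hc.
- by apply: powR_continuous_itv => //; lra.
- move=> x; rewrite in_itv/= => /andP[ax _]; rewrite powR_derive1//.
  by rewrite in_itv/= andbT (le_lt_trans a0).
Qed.

(* The image of [p r^(p-1) dr] on the half-line under [r |-> r^p] is Lebesgue measure. *)
Lemma ge0_integral_powR_change (p : R) (f : R -> \bar R) : 1 < p ->
  measurable_fun setT f -> (forall x, 0 <= f x)%E ->
  (\int[leb]_(t in `]0%R, +oo[) f t =
   \int[leb]_(r in `]0%R, +oo[) (f (r `^ p)%R * (p * r `^ (p - 1))%:E))%E.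
Proof.
move=> p1 mf f0.
pose pos (r : R) : R := (0 < r)%R%:R.
have mpos : measurable_fun (setT : set (measurableTypeR R)) pos.
  rewrite (_ : pos = \1_`]0%R, +oo[%classic) //.
  by apply/funext => x; rewrite indicE /pos mem_setE /= in_itv/= andbT.
pose w (r : R) : R := pos r * (p * r `^ (p - 1)).
have mw : measurable_fun (setT : set (measurableTypeR R)) w.
  by apply: measurable_funM => //; exact: measurable_funM.
have w0 r : 0 <= w r by rewrite !mulr_ge0 ?powR_ge0//; lra.
have mpow : measurable_fun (setT : set (measurableTypeR R)) (fun r : R => r `^ p : measurableTypeR R).
  exact: measurable_powR.
pose m1 := mdens leb mpos (fun r => ler0n _ _).
pose m2 := pfm (mdens leb mw w0) mpow.
have m12 A : measurable A -> m1 A = m2 A.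
  have aux a b : a < b -> m2 `]a, b]%classic = m1 `]a, b]%classic.
    move=> ab; rewrite /m1 /m2 pfmE !mdensE.
    (* Neither measure charges the negative half-line, so a left end below [0] is moved to [0]. *)
    pose a' := Num.max 0 a.
    have [b0|b0] := leP b 0.
      rewrite !integral0_eq//.
        move=> x /=; rewrite in_itv/= /pos => /andP[_ xb].
        by rewrite ltNge (le_trans xb b0).
      move=> x /=; rewrite in_itv/= => /andP[_ xb]; rewrite /w /pos.
      case: ltP => [x0|_]; last by rewrite mul0r.
      by have := lt_le_trans (powR_gt0 p x0) (le_trans xb b0); rewrite ltxx.
    have a'0 : 0 <= a' by rewrite le_max lexx.
    have a'b : a' < b by rewrite gt_max b0.
    transitivity (\int[leb]_(r in `](a' `^ p^-1)%R, (b `^ p^-1)%R]) (p * r `^ (p - 1))%:E)%E.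
      rewrite [LHS]integral_mkcond [RHS]integral_mkcond; apply: eq_integral => r _.
      rewrite !patchE /w /pos !mem_setE/= !in_itv/=.
      have [r0|r0] := ltP 0 r; last first.
        rewrite mul0r; have -> : (a' `^ p^-1 < r) = false; last by rewrite /=; case: ifP.
        by apply/negbTE; rewrite -leNgt (le_trans r0)// powR_ge0.
      rewrite mul1r; congr (if _ then _ else _).
      have pp : 0 < p by lra.
      have ip : 0 < p^-1 by rewrite invr_gt0.
      have rp : r = (r `^ p) `^ p^-1 by rewrite -powRrM mulfV ?powRr1 ?ltW// gt_eqF.
      have rp0 : 0 < r `^ p by rewrite powR_gt0.
      have h1 : (a < r `^ p) = (a' `^ p^-1 < r).
        rewrite [in RHS]rp.
        have -> : (a < r `^ p) = (a' < r `^ p) by rewrite gt_max rp0.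
        apply/idP/idP => h.
          by apply: gt0_ltr_powR => //; rewrite nnegrE// ltW.
        rewrite ltNge; apply/negP => h'.
        have : (r `^ p) `^ p^-1 <= a' `^ p^-1.
          by apply: ge0_ler_powR => //; rewrite ?nnegrE// ltW.
        by rewrite leNgt h.
      have h2 : (r `^ p <= b) = (r <= b `^ p^-1).
        rewrite [in RHS]rp; apply/idP/idP => h.
          by apply: ge0_ler_powR => //; rewrite ?nnegrE// ltW.
        rewrite leNgt; apply/negP => h'.
        have : b `^ p^-1 < (r `^ p) `^ p^-1.
          by apply: gt0_ltr_powR => //; rewrite ?nnegrE// ltW.
        by rewrite ltNge h.
      by congr (_ && _); [exact: h1|exact: h2].
    have pN0 : p != 0 by rewrite gt_eqF//; lra.
    rewrite integral_powR_itv ?powR_ge0//; last first.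
      by apply: gt0_ltr_powR; rewrite ?nnegrE ?invr_gt0//; lra.
    rewrite -!powRrM mulVf// (powRr1 a'0) (powRr1 (ltW b0)).
    rewrite (_ : (fun x => _) = (fun x => (\1_`]0%R, +oo[%classic x)%:E)); last first.
      by apply/funext => x; rewrite indicE /pos mem_setE /= in_itv/= andbT.
    rewrite integral_indic//.
    rewrite (_ : _ `&` _ = `]a', b]%classic); last first.
      apply/seteqP; split => x /=; rewrite !in_itv/= ?andbT gt_max.
        by move=> [-> /andP[-> ->]].
      by move=> /andP[/andP[-> ->] ->].
    by rewrite [RHS]lebesgue_measure_itv/= lte_fin a'b.
  apply: measure_unique_itv => [a b ab|a b]; first by rewrite aux.
  rewrite mdensE; apply: (@le_lt_trans _ _ (\int[leb]_(x in `]a, b]) (cst 1) x)%E).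
    apply: ge0_le_integral => //; try by move=> x _; rewrite lee_fin /pos; case: (_ < _).
    by apply/measurable_EFinP; exact: measurable_funTS.
  have l : (leb `]a, b]%classic < +oo)%E.
    by rewrite lebesgue_measure_itv/=; case: ifP => _; rewrite -?EFinD ltry.
  by rewrite integral_cst// mul1e; exact: l.
transitivity (\int[m1]_x f x)%E.
  rewrite [RHS]ge0_integral_mdens// [LHS]integral_mkcond; apply: eq_integral => x _.
  by rewrite patchE mem_setE/= in_itv/= andbT /pos; case: ifP => _; rewrite ?mule1 ?mule0.
transitivity (\int[m2]_x f x)%E; first by apply: eq_measure_integral => A mA _; exact: m12.
rewrite ge0_integral_pfm// ge0_integral_mdens//; last exact: measurableT_comp.
rewrite [RHS]integral_mkcond; apply: eq_integral => x _.
rewrite patchE mem_setE/= in_itv/= andbT /w /pos.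
by case: ifP => _; rewrite ?mul1r ?mul0r ?mule0.
Qed.

End itv_unique.

(** * Euclidean norm and directions *)

Section euclid.
Context (R : realType) (d : nat).
Implicit Types (x y u v : d.-tuple R) (c : R).

Definition vscale c x : d.-tuple R := [tuple c * tnth x i | i < d].
Definition vzero : d.-tuple R := [tuple of nseq d 0].

Lemma tnth_vscale c x i : tnth (vscale c x) i = c * tnth x i.
Proof. by rewrite tnth_mktuple. Qed.

Lemma unitvE x : unitv x = vscale (enorm x)^-1 x.
Proof. by []. Qed.

Lemma dotpC x y : dotp x y = dotp y x.
Proof. by apply: eq_bigr => i _; rewrite mulrC. Qed.

Lemma dotpZl c x y : dotp (vscale c x) y = c * dotp x y.
Proof. by rewrite /dotp mulr_sumr; apply: eq_bigr => i _; rewrite tnth_vscale mulrA. Qed.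

Lemma dotpZr c x y : dotp x (vscale c y) = c * dotp x y.
Proof. by rewrite dotpC dotpZl dotpC. Qed.

Lemma dotpBr x y z : dotp x (vsub y z) = dotp x y - dotp x z.
Proof.
rewrite /dotp -sumrB; apply: eq_bigr => i _.
by rewrite /vsub tnth_mktuple mulrBr.
Qed.

Lemma dotpBl x y z : dotp (vsub y z) x = dotp y x - dotp z x.
Proof. by rewrite dotpC dotpBr !(dotpC x). Qed.

Lemma dotp0 x : dotp x vzero = 0.
Proof. by apply: big1 => i _; rewrite tnth_nseq mulr0. Qed.

Lemma dotp_ge0 x : 0 <= dotp x x.
Proof. by apply: sumr_ge0 => i _; rewrite -expr2 sqr_ge0. Qed.

Lemma enorm_ge0 x : 0 <= enorm x.
Proof. exact: sqrtr_ge0. Qed.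

Lemma enorm_sqr x : enorm x ^+ 2 = dotp x x.
Proof. by rewrite sqr_sqrtr// dotp_ge0. Qed.

Lemma enormZ c x : enorm (vscale c x) = `|c| * enorm x.
Proof.
rewrite /enorm dotpZl dotpZr mulrA -expr2 sqrtrM ?sqr_ge0// sqrtr_sqr.
by [].
Qed.

Lemma enorm0_eq0 x : enorm x = 0 -> x = vzero.
Proof.
move=> /(congr1 (fun t => t ^+ 2)); rewrite enorm_sqr expr0n/= => /eqP.
rewrite psumr_eq0; last by move=> i _; rewrite -expr2 sqr_ge0.
move=> /allP h; apply: eq_from_tnth => i; rewrite tnth_nseq.
have := h i (mem_index_enum i); rewrite -expr2 sqrf_eq0.
by move=> /eqP.
Qed.

Lemma enorm_vzero : enorm vzero = 0.
Proof. by rewrite /enorm dotp0 sqrtr0. Qed.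

Lemma enorm_unitv x : 0 < enorm x -> enorm (unitv x) = 1.
Proof.
move=> x0; rewrite unitvE enormZ ger0_norm ?invr_ge0 ?ltW//.
by rewrite mulVf// gt_eqF.
Qed.

Lemma vscale_unitv x : 0 < enorm x -> vscale (enorm x) (unitv x) = x.
Proof.
move=> x0; apply: eq_from_tnth => i.
by rewrite tnth_vscale unitvE tnth_vscale mulrA mulfV ?mul1r// gt_eqF.
Qed.

Lemma unitvZ c x : 0 < c -> unitv (vscale c x) = unitv x.
Proof.
move=> c0; apply: eq_from_tnth => i.
rewrite !unitvE !tnth_vscale enormZ gtr0_norm// invfM mulrACA mulVf ?mul1r//.
by rewrite gt_eqF.
Qed.

Lemma unitv_id u : enorm u = 1 -> unitv u = u.
Proof.
move=> u1; apply: eq_from_tnth => i.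
by rewrite unitvE tnth_vscale u1 invr1 mul1r.
Qed.

Lemma unitv_vzero : unitv vzero = vzero.
Proof.
by apply: eq_from_tnth => i; rewrite unitvE tnth_vscale !tnth_nseq mulr0.
Qed.

Lemma cauchy_schwarz x y : `|dotp x y| <= enorm x * enorm y.
Proof.
have [x0|x0] := eqVneq (enorm x) 0.
  by rewrite (enorm0_eq0 x0) dotpC dotp0 normr0 mulr_ge0 ?enorm_ge0.
have xp : 0 < dotp x x by rewrite -enorm_sqr exprn_gt0// lt_neqAle eq_sym x0 enorm_ge0.
rewrite -(ler_pXn2r (n:=2))// ?nnegrE ?mulr_ge0 ?enorm_ge0//.
rewrite exprMn !enorm_sqr real_normK ?num_real//.
(* The vector [|x|^2 y - <x,y> x] has squared norm [|x|^2 (|x|^2 |y|^2 - <x,y>^2)]. *)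
have := dotp_ge0 (vsub (vscale (dotp x x) y) (vscale (dotp x y) x)).
rewrite dotpBr !dotpBl !dotpZl !dotpZr !(dotpC y x).
set a := dotp x x in xp *; set b := dotp x y; set c := dotp y y => h.
have : 0 <= a * (a * c - b ^+ 2).
  by move: h; rewrite (_ : _ - _ = a * (a * c - b ^+ 2))//; ring.
by rewrite pmulr_rge0// subr_ge0.
Qed.

Lemma measurable_dotp dd (T : measurableType dd) (f g : T -> d.-tuple R) :
  measurable_fun setT f -> measurable_fun setT g ->
  measurable_fun setT (fun t => dotp (f t) (g t)).
Proof.
move=> mf mg; rewrite /dotp.
apply: measurable_sum => i; apply: measurable_funM.
  by move/measurable_fun_tnthP : mf; apply.
by move/measurable_fun_tnthP : mg; apply.
Qed.

Lemma measurable_enorm : measurable_fun setT (@enorm R d).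
Proof.
apply: (@measurableT_comp _ _ _ _ _ _ (@Num.sqrt R)); last exact: measurable_dotp.
by apply: continuous_measurable_fun; exact: sqrt_continuous.
Qed.

Lemma measurable_unitv : measurable_fun setT (@unitv R d).
Proof.
apply/measurable_fun_tnthP => i.
rewrite (_ : _ \o _ = fun x => enorm x `^ (-1) * tnth x i); last first.
  by apply/funext => x /=; rewrite tnth_mktuple powR_inv1 ?enorm_ge0.
apply: measurable_funM; last exact: measurable_tnth.
apply: (@measurableT_comp _ _ _ _ _ _ (@powR R ^~ (-1))); last exact: measurable_enorm.
exact: measurable_powR.
Qed.

Lemma measurable_vscale dd (T : measurableType dd) (c : T -> R) (f : T -> d.-tuple R) :
  measurable_fun setT c -> measurable_fun setT f ->
  measurable_fun setT (fun t => vscale (c t) (f t)).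
Proof.
move=> mc mf; apply/measurable_fun_tnthP => i.
rewrite (_ : _ \o _ = fun x : T => c x * tnth (f x) i); last first.
  by apply/funext => x /=; rewrite tnth_mktuple.
by apply: measurable_funM => //; move/measurable_fun_tnthP : mf; apply.
Qed.

Lemma vscale_aff c x : vscale c x = aff vzero c x.
Proof.
by apply: eq_from_tnth => i; rewrite !tnth_mktuple tnth_nseq add0r.
Qed.

Lemma enorm_le1_box x : enorm x <= 1 -> @unit_box R d x.
Proof.
move=> x1 i; rewrite -(ler_pXn2r (n:=2)) ?nnegrE// real_normK ?num_real// expr1n.
apply: (@le_trans _ _ (enorm x ^+ 2)); last by rewrite exprn_ile1 ?enorm_ge0.
rewrite enorm_sqr /dotp (bigD1 i)//= -expr2 lerDl.
by apply: sumr_ge0 => j _; rewrite -expr2 sqr_ge0.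
Qed.

End euclid.

Arguments vzero {R d}.

(** * Surface measure and polar coordinates *)

Section polar.
Context (R : realType) (d' : nat).
Local Notation d := d'.+1.
Local Notation leb := (@lebesgue_measure R).
Local Notation lebd := (lebn R d).

Definition nz_ball : set (d.-tuple R) := [set x | 0 < enorm x <= 1].
Definition nz_sector (B : set (d.-tuple R)) : set (d.-tuple R) :=
  [set x | 0 < enorm x] `&` (@unitv R d @^-1` B).

Lemma measurable_enorm_itv (i : interval R) : measurable [set x : d.-tuple R | enorm x \in i].
Proof.
rewrite -[X in measurable X]setTI.
by apply: (@measurable_enorm R d measurableT [set` i]) => //; exact: measurable_itv.
Qed.

Lemma measurable_nz_ball : measurable nz_ball.
Proof.
rewrite (_ : nz_ball = [set x | enorm x \in `]0, 1]]); first exact: measurable_enorm_itv.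
by apply/seteqP; split => x; rewrite /nz_ball/= in_itv.
Qed.

Lemma measurable_nz : measurable [set x : d.-tuple R | 0 < enorm x].
Proof.
rewrite (_ : [set _ | _] = [set x | enorm x \in `]0%R, +oo[]); first exact: measurable_enorm_itv.
by apply/seteqP; split => x /=; rewrite in_itv/= andbT.
Qed.

Lemma measurable_nz_sector B : measurable B -> measurable (nz_sector B).
Proof.
move=> mB; apply: measurableI; first exact: measurable_nz.
by rewrite -[X in measurable X]setTI; exact: measurable_unitv.
Qed.

Lemma lebn_nz_ball : (lebd nz_ball < +oo)%E.
Proof.
apply: le_lt_trans (lebn_unit_box R d).
apply: le_measure; rewrite ?inE; [exact: measurable_nz_ball|exact: measurable_unit_box|].
by move=> x /andP[_]; exact: enorm_le1_box.
Qed.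

Lemma lebn_enorm0 : lebd (~` [set x | 0 < enorm x]) = 0%E.
Proof.
apply: lebn_set1_0; last by apply: measurableC; exact: measurable_nz.
move=> x /= /negP; rewrite -leNgt => x0; apply: enorm0_eq0.
by apply/eqP; rewrite eq_le x0 enorm_ge0.
Qed.

Let mnzb := [the {measure set (d.-tuple R) -> \bar R} of mrestr lebd measurable_nz_ball].
Let dnn : {nonneg R} := NngNum (ler0n R d).

(** The measure behind [sph_int]: a function on the sphere is extended with degree 0 to the
    punctured ball and integrated there. It is a measure on the whole tuple space, so polynomials
    and [V] need no restriction; it charges the unit sphere only. *)
Definition sphm0 : {measure set (d.-tuple R) -> \bar R} :=
  [the {measure set (d.-tuple R) -> \bar R} of mscale dnn (pfm mnzb (@measurable_unitv R d))].

Lemma sphm0E B : sphm0 B = (d%:R%:E * lebd ((@unitv R d @^-1` B) `&` nz_ball))%E.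
Proof. by []. Qed.

Let sphm0_fin : fin_num_fun sphm0.
Proof.
apply: lty_fin_num_fun; rewrite /= sphm0E preimage_setT setTI.
by rewrite lte_mul_pinfty// ?lee_fin// lebn_nz_ball.
Qed.

Definition sphm : {finite_measure set (d.-tuple R) -> \bar R} :=
  HB.pack (Measure.sort sphm0) (@Measure_isFinite.Build _ _ _ sphm0 sphm0_fin).

Lemma sphmE B : sphm B = (d%:R%:E * lebd ((@unitv R d @^-1` B) `&` nz_ball))%E.
Proof. by []. Qed.

Lemma ge0_integral_sphm (f : d.-tuple R -> \bar R) :
  measurable_fun setT f -> (forall u, 0 <= f u)%E ->
  (\int[sphm]_u f u = d%:R%:E * \int[lebd]_(x in nz_ball) f (unitv x))%E.
Proof.
move=> mf f0; rewrite [LHS]ge0_integral_mscale//; congr (_ * _)%E.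
rewrite ge0_integral_pfm//.
pose w : d.-tuple R -> R := \1_nz_ball.
have mw : measurable_fun setT w by apply: measurable_indic; exact: measurable_nz_ball.
have w0 x : 0 <= w x by [].
have mfu : measurable_fun setT (fun x => f (unitv x)).
  by apply: measurableT_comp => //; exact: measurable_unitv.
transitivity (\int[mdens lebd mw w0]_x f (unitv x))%E.
  apply: eq_measure_integral => A mA _.
  rewrite mdensE /mnzb/= /mrestr/= /w integral_indic//; last exact: measurable_nz_ball.
  by rewrite setIC.
rewrite ge0_integral_mdens// [RHS]integral_mkcond; apply: eq_integral => x _.
by rewrite patchE /w indicE; case: ifP => _; rewrite ?mule1 ?mule0.
Qed.

Lemma ge0_eq_integral_sphm (f g : d.-tuple R -> \bar R) :
  measurable_fun setT f -> (forall u, 0 <= f u)%E ->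
  measurable_fun setT g -> (forall u, 0 <= g u)%E ->
  (forall u, enorm u = 1 -> f u = g u) ->
  (\int[sphm]_u f u = \int[sphm]_u g u)%E.
Proof.
move=> mf f0 mg g0 fg; rewrite !ge0_integral_sphm//; congr (_ * _)%E.
apply: eq_integral => x; rewrite inE => /andP[x0 _]; apply: fg.
exact: enorm_unitv.
Qed.

Lemma eq_integral_sphm (f g : d.-tuple R -> \bar R) :
  measurable_fun setT f -> measurable_fun setT g ->
  (forall u, enorm u = 1 -> f u = g u) ->
  (\int[sphm]_u f u = \int[sphm]_u g u)%E.
Proof.
move=> mf mg fg; rewrite integralE [RHS]integralE; congr (_ - _)%E.
- apply: ge0_eq_integral_sphm => //; [exact: measurable_funepos|exact: measurable_funepos|].
  by move=> u u1; rewrite !funeposE fg.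
- apply: ge0_eq_integral_sphm => //; [exact: measurable_funeneg|exact: measurable_funeneg|].
  by move=> u u1; rewrite !funenegE fg.
Qed.

(** A bound on the sphere bounds the integrand of [sph_int] on the whole ball, so [leb_int_bounded]
    turns the signed iterated integral into a true one. The positive and negative parts are then
    finite and can be treated separately. *)
Lemma sph_intE (h : d.-tuple R -> R) (C : R) :
  measurable_fun setT h -> (forall u, enorm u = 1 -> `|h u| <= C) ->
  sph_int h = Rintegral sphm setT h.
Proof.
move=> mh hC.
pose H (x : d.-tuple R) := if (0 < enorm x) && (enorm x <= 1) then h (unitv x) else 0.
have HE : H = (h \o @unitv R d) \_ nz_ball.
  by apply/funext => x; rewrite /H patchE mem_setE.
have C0 : 0 <= C.
  pose e := unitv [tuple of nseq d (1 : R)].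
  have e1 : enorm e = 1.
    apply: enorm_unitv; rewrite lt_neqAle enorm_ge0 andbT eq_sym.
    apply/eqP => /enorm0_eq0/(congr1 (fun x => tnth x ord0)).
    by rewrite !tnth_nseq => /eqP; rewrite oner_eq0.
  exact: le_trans (hC e e1).
have mhu : measurable_fun setT (h \o @unitv R d) by apply: measurableT_comp => //; exact: measurable_unitv.
have mH : measurable_fun setT H.
  rewrite HE; apply/(measurable_restrict _ measurable_nz_ball) => //.
  exact: measurable_funTS.
have HC x : `|H x| <= C.
  rewrite /H; case: ifPn => [/andP[x0 _]|_]; last by rewrite normr0.
  by apply: hC; exact: enorm_unitv.
rewrite /sph_int (leb_int_bounded (C:=C) mH)//; last first.
  move=> x xb; rewrite /H; case: ifPn => // /andP[_ x1].
  by exfalso; apply: xb; exact: enorm_le1_box.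
rewrite /Rintegral [in RHS]integralE.
have mhE : measurable_fun setT (fun x => (h x)%:E) by apply/measurable_EFinP.
rewrite !ge0_integral_sphm//; [|exact: measurable_funeneg|exact: measurable_funepos].
have intH : lebd.-integrable nz_ball (fun x => (h (unitv x))%:E).
  apply: measurable_bounded_integrable.
  - exact: measurable_nz_ball.
  - exact: lebn_nz_ball.
  - exact: measurable_funTS.
  - exists C; split; first by rewrite num_real.
    move=> M CM x /andP[x0 _] /=; apply: le_trans (ltW CM).
    by apply: hC; exact: enorm_unitv.
have -> : (\int[lebd]_x (H x)%:E = \int[lebd]_(x in nz_ball) (h (unitv x))%:E)%E.
  by rewrite [RHS]integral_mkcond; apply: eq_integral => x _; rewrite HE !patchE; case: ifP.
set A := (\int[lebd]_(x in nz_ball) _)%E.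
have -> : A = (\int[lebd]_(x in nz_ball) (fun x => (h x)%:E)^\+ (unitv x) -
               \int[lebd]_(x in nz_ball) (fun x => (h x)%:E)^\- (unitv x))%E.
  rewrite /A integralE; congr (_ - _)%E; apply: eq_integral => x _.
    by rewrite !funeposE.
  by rewrite !funenegE.
have p1 : (\int[lebd]_(x in nz_ball) (fun x => (h x)%:E)^\+ (unitv x))%E \is a fin_num.
  have := integrable_pos_fin_num measurable_nz_ball intH.
  by under eq_integral do rewrite funeposE; under [in X in _ -> X]eq_integral do rewrite funeposE.
have p2 : (\int[lebd]_(x in nz_ball) (fun x => (h x)%:E)^\- (unitv x))%E \is a fin_num.
  have := integrable_neg_fin_num measurable_nz_ball intH.
  by under eq_integral do rewrite funenegE; under [in X in _ -> X]eq_integral do rewrite funenegE.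
by rewrite -(fineK p1) -(fineK p2) -!EFinM -!EFinB/= mulrBr.
Qed.

(** Dilation by [t] maps the sector over [B] in the unit ball onto the one in the ball of radius
    [t]. Differences in [t] then measure the shells used in [polar_rect]. *)
Lemma lebn_sector_ball (B : set (d.-tuple R)) (t : R) : measurable B -> 0 <= t ->
  lebd (nz_sector B `&` [set x | enorm x <= t]) =
  ((t ^+ d)%:E * lebd ((@unitv R d @^-1` B) `&` nz_ball))%E.
Proof.
move=> mB t0.
have mS : measurable (nz_sector B `&` [set x | enorm x <= t]).
  apply: measurableI; first exact: measurable_nz_sector.
  rewrite (_ : [set _ | _] = [set x | enorm x \in `]-oo, t]]); first exact: measurable_enorm_itv.
  by apply/seteqP; split => x /=; rewrite in_itv.
have mS1 : measurable ((@unitv R d @^-1` B) `&` nz_ball).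
  apply: measurableI; last exact: measurable_nz_ball.
  by rewrite -[X in measurable X]setTI; exact: measurable_unitv.
have [t_eq0|t_neq0] := eqVneq t 0.
  rewrite (_ : _ `&` _ = set0) ?measure0 ?t_eq0 ?expr0n ?mul0e//.
  apply/seteqP; split => // x [[/= x0 _]] /(lt_le_trans x0).
  by rewrite ltxx.
have tp : 0 < t by rewrite lt_neqAle eq_sym t_neq0.
rewrite -[in LHS](setIT (_ `&` _)) -[in RHS](setIT (_ `&` _)) -!integral_indic//.
pose St := nz_sector B `&` [set x | enorm x <= t].
have mI : measurable_fun setT (fun x => (\1_St x)%:E : \bar R).
  by apply/measurable_EFinP; exact: measurable_indic.
have i0 x : (0 <= (\1_St x)%:E :> \bar R)%E by rewrite lee_fin.
have h := ge0_integral_aff vzero t_neq0 mI i0.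
rewrite [in RHS](eq_integral (fun x => (\1_St (aff vzero t x))%:E)).
  by rewrite h muleA -EFinM gtr0_norm// mulfV ?mul1e// expf_neq0.
move=> x _; congr EFin; rewrite !indicE; congr (_%:R); congr nat_of_bool.
apply/idP/idP; rewrite !inE /St -vscale_aff /nz_sector /nz_ball /setI/=;
  rewrite enormZ gtr0_norm// unitvZ// pmulr_rgt0// ger_pMr//.
  by move=> [? /andP[? ?]].
by move=> [[? ?] ?]; split => //; apply/andP.
Qed.

Definition radial_w (r : R) : R := (0 < r)%R%:R * r ^+ d'.

Lemma radial_w_ge0 r : 0 <= radial_w r.
Proof.
by rewrite /radial_w; case: ltP => r0; rewrite ?mul0r// mul1r exprn_ge0// ltW.
Qed.

Lemma measurable_radial_w : measurable_fun (setT : set (measurableTypeR R)) radial_w.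
Proof.
apply: measurable_funM; last exact: exprn_measurable.
rewrite (_ : (fun r => _) = \1_`]0%R, +oo[%classic) //.
by apply/funext => x; rewrite indicE mem_setE /= in_itv/= andbT.
Qed.

Definition radm0 : {measure set (measurableTypeR R) -> \bar R} :=
  mdens leb measurable_radial_w radial_w_ge0.

Lemma radm0_itv (a b : R) : a < b ->
  radm0 `]a, b]%classic = ((Num.max 0 b ^+ d - Num.max 0 a ^+ d) / d%:R)%:E.
Proof.
move=> ab; rewrite /radm0 mdensE.
have [b0|b0] := leP b 0.
  rewrite integral0_eq; last first.
    move=> x /=; rewrite in_itv/= /radial_w => /andP[_ xb].
    by rewrite ltNge (le_trans xb b0) mul0r.
  by rewrite !max_l ?subrr ?mul0r//; exact: ltW (lt_le_trans ab b0).
set a' := Num.max 0 a.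
have a'0 : 0 <= a' by rewrite le_max lexx.
have a'b : a' < b by rewrite gt_max b0.
transitivity (\int[leb]_(r in `]a', b]) (r ^+ d')%:E)%E.
  rewrite [LHS]integral_mkcond [RHS]integral_mkcond; apply: eq_integral => r _.
  rewrite !patchE /radial_w !mem_setE/= !in_itv/= gt_max.
  have [r0|r0] := ltP 0 r; first by rewrite mul1r.
  by rewrite mul0r; case: ifP.
rewrite integral_itv_obnd_cbnd; last first.
  by apply/measurable_EFinP; apply: measurable_funTS; exact: exprn_measurable.
rewrite (@continuous_FTC2 _ _ (fun x => x ^+ d / d%:R))//.
- by rewrite -EFinB mulrBl.
- by apply: continuous_subspaceT => x; exact: exprn_continuous.
- have c : continuous ((fun x : R => x ^+ d) * cst (d%:R^-1))%R.
    by move=> x; apply: continuousM; [exact: exprn_continuous|exact: cst_continuous].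
  split.
  + by move=> x _; apply: derivableM => //; exact: exprn_derivable.
  + by apply: cvg_at_right_filter; exact: c.
  + by apply: cvg_at_left_filter; exact: c.
- move=> x _; rewrite derive1E deriveM//=; last exact: exprn_derivable.
  rewrite derive_cst scaler0 add0r exp_derive/= -mulr_natl scaler1.
  by rewrite /GRing.scale/= mulrA mulVf ?mul1r.
Qed.

Let radm0_sigma_finite : sigma_finite setT radm0.
Proof.
exists (fun n : nat => `](- n%:R), n%:R]%classic).
  apply/esym/seteqP; split => // x _; exists (Num.truncn `|x|).+1 => //=.
  rewrite in_itv/=; have := truncnS_gt `|x|; have := ler_norm x; have := ler_norm (- x).
  rewrite normrN => h1 h2 h3; apply/andP; split; [rewrite ltrNl|]; lra.
move=> n; split; first exact: measurable_itv.
have [n0|n0] := ltP (- n%:R : R) n%:R; first by rewrite radm0_itv// ltry.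
by rewrite set_itv_ge -?leNgt ?bnd_simp// measure0.
Qed.

Definition radm : {sigma_finite_measure set (measurableTypeR R) -> \bar R} :=
  HB.pack (Measure.sort radm0) (@Measure_isSigmaFinite.Build _ _ _ radm0 radm0_sigma_finite).

Let polar_map (x : d.-tuple R) : measurableTypeR R * d.-tuple R := (enorm x, unitv x).

Let measurable_polar_map : measurable_fun setT polar_map.
Proof.
apply: measurable_fun_pair; [exact: measurable_enorm|exact: measurable_unitv].
Qed.

Let mnz := [the {measure set (d.-tuple R) -> \bar R} of mrestr lebd measurable_nz].

(** For fixed [B] both sides are measures in [A], so it suffices to take [A = ]a, b]]. There the
    left side is a difference of two sectors, whose measure grows like [t^d], and [t^d / d] is the
    primitive of the weight in [radm0]. *)
Let polar_rect (A : set (measurableTypeR R)) (B : set (d.-tuple R)) :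
  measurable A -> measurable B ->
  pfm mnz measurable_polar_map (A `*` B) = (radm A * sphm B)%E.
Proof.
move=> mA mB.
have mS := measurable_nz_sector mB.
have men : measurable_fun setT (@enorm R d : d.-tuple R -> measurableTypeR R).
  exact: measurable_enorm.
pose m1 := pfm [the {measure set (d.-tuple R) -> \bar R} of mrestr lebd mS] men.
have sB : (sphm B \is a fin_num) by exact: fin_num_measure.
have sB0 : 0 <= fine (sphm B) by exact: fine_ge0.
pose kB : {nonneg R} := NngNum sB0.
pose m2 : {measure set (measurableTypeR R) -> \bar R} :=
  [the {measure set (measurableTypeR R) -> \bar R} of mscale kB radm].
have m1E X : m1 X = lebd ((@enorm R d @^-1` X) `&` nz_sector B) by [].
have m2E X : m2 X = ((fine (sphm B))%:E * radm0 X)%E by [].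
transitivity (m1 A).
  rewrite m1E !pfmE /mnz/= /mrestr/=; congr (lebd _).
  by apply/seteqP; split => x /=; rewrite /polar_map/= /nz_sector/=; tauto.
transitivity (m2 A); last first.
  by rewrite m2E fineK// muleC.
have aux a b : a < b -> m1 `]a, b]%classic = m2 `]a, b]%classic.
  move=> ab; rewrite m1E m2E radm0_itv//.
  set a' := Num.max 0 a; set b' := Num.max 0 b.
  have a'0 : 0 <= a' by rewrite le_max lexx.
  have b'0 : 0 <= b' by rewrite le_max lexx.
  have a'b' : a' <= b' by rewrite /a' /b' ge_max !le_max lexx (ltW ab) orbT.
  pose S (t : R) : set (d.-tuple R) := nz_sector B `&` [set x | enorm x <= t].
  have mSt t : measurable (S t).
    apply: measurableI; first exact: measurable_nz_sector.
    rewrite (_ : [set _ | _] = [set x | enorm x \in `]-oo, t]]); first exact: measurable_enorm_itv.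
    by apply/seteqP; split => x /=; rewrite in_itv.
  have SE t : 0 <= t -> lebd (S t) = ((t ^+ d)%:E * lebd ((@unitv R d @^-1` B) `&` nz_ball))%E.
    exact: lebn_sector_ball.
  rewrite (_ : _ `&` _ = S b' `\` S a'); last first.
    apply/seteqP; split => x; rewrite /S /nz_sector/= in_itv/=.
      move=> [/andP[ax xb] [x0 xB]]; split; first by split => //; rewrite le_max xb orbT.
      by move=> [_]; rewrite le_max (lt_geF x0) (lt_geF ax).
    move=> [[[x0 xB] xb] h]; split => //; apply/andP; split; last first.
      by move: xb; rewrite le_max (lt_geF x0).
    rewrite ltNge; apply/negP => xa; apply: h; split => //.
    by rewrite le_max xa orbT.
  have fB : lebd ((@unitv R d @^-1` B) `&` nz_ball) \is a fin_num.
    rewrite ge0_fin_numE//; apply: le_lt_trans lebn_nz_ball.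
    apply: le_measure; rewrite ?inE; [|exact: measurable_nz_ball|exact: subIsetr].
    apply: measurableI; last exact: measurable_nz_ball.
    by rewrite -[X in measurable X]setTI; exact: measurable_unitv.
  have Sfin : (lebd (S b') < +oo)%E by rewrite SE// -(fineK fB) -EFinM ltry.
  have -> : lebd (S b' `\` S a') = (lebd (S b') - lebd (S a'))%E.
    rewrite measureD// setIidr//.
    by move=> x [? /= xa]; split => //=; exact: le_trans xa a'b'.
  rewrite !SE// sphmE -(fineK fB) -!EFinM -EFinB; congr EFin.
  rewrite /=; field.
  by rewrite nat1r pnatr_eq0.
apply: measure_unique_itv => // a b.
have [ab|ba] := ltP a b.
  by rewrite aux// m2E radm0_itv// -EFinM ltry.
by rewrite set_itv_ge -?leNgt ?bnd_simp// measure0.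
Qed.

(** Rectangles determine a product measure, so [polar_rect] identifies the image of Lebesgue measure
    under [(enorm, unitv)] with [radm \x sphm]; Tonelli does the rest. *)
Theorem ge0_polar (f : R -> d.-tuple R -> \bar R) :
  measurable_fun setT (fun p : R * d.-tuple R => f p.1 p.2) ->
  (forall r u, 0 <= f r u)%E ->
  (\int[lebd]_(x in [set x | (0 < enorm x)%R]) f (enorm x) (unitv x) =
   \int[leb]_(r in `]0%R, +oo[) ((\int[sphm]_u f r u) * (r ^+ d')%:E))%E.
Proof.
move=> mf f0.
pose F (p : measurableTypeR R * d.-tuple R) := f p.1 p.2.
have mF : measurable_fun setT F by exact: mf.
have F0 p : (0 <= F p)%E by exact: f0.
transitivity (\int[pfm mnz measurable_polar_map]_p F p)%E.
  rewrite ge0_integral_pfm//.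
  pose w : d.-tuple R -> R := \1_[set x | 0 < enorm x].
  have mw : measurable_fun setT w by apply: measurable_indic; exact: measurable_nz.
  have w0 x : 0 <= w x by [].
  transitivity (\int[mdens lebd mw w0]_x F (polar_map x))%E; last first.
    apply: eq_measure_integral => A mA _.
    rewrite mdensE /mnz/= /mrestr/= /w integral_indic//; last exact: measurable_nz.
    by rewrite setIC.
  rewrite ge0_integral_mdens//; last exact: measurableT_comp.
  rewrite [LHS]integral_mkcond; apply: eq_integral => x _.
  by rewrite patchE /w indicE; case: ifP => _; rewrite ?mule1 ?mule0.
transitivity (\int[radm \x sphm]_p F p)%E.
  apply: eq_measure_integral => A mA _; apply/esym.
  by apply: product_measure_unique => // B C mB mC; exact: polar_rect.
rewrite fubini_tonelli1//.
have mG := @measurable_fun_fubini_tonelli_F _ _ _ _ _ sphm F mF F0.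
transitivity (\int[radm0]_r fubini_F sphm F r)%E; first exact: eq_measure_integral.
rewrite ge0_integral_mdens//; last by move=> r; exact: integral_ge0.
rewrite [RHS]integral_mkcond; apply: eq_integral => r _.
rewrite patchE /radial_w mem_setE/= in_itv/= andbT /fubini_F/=.
by case: ifP => _; rewrite ?mul1r// mul0r mule0.
Qed.

End polar.

(** * Complex series and integrals *)

Section complex_basics.
Context (R : realType).
Implicit Types (x y z w : R[i]).
Local Notation C := R[i].
Local Notation Re := complex.Re.
Local Notation Im := complex.Im.

Lemma cReD x y : Re (x + y) = Re x + Re y. Proof. by case: x; case: y. Qed.
Lemma cImD x y : Im (x + y) = Im x + Im y. Proof. by case: x; case: y. Qed.
Lemma cReN x : Re (- x) = - Re x. Proof. by case: x. Qed.
Lemma cImN x : Im (- x) = - Im x. Proof. by case: x. Qed.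
Lemma cReM x y : Re (x * y) = Re x * Re y - Im x * Im y.
Proof. by case: x; case: y. Qed.
Lemma cImM x y : Im (x * y) = Re x * Im y + Im x * Re y.
Proof. by case: x => a b; case: y => c d /=; rewrite addrC. Qed.

Lemma cRe_sum I (r : seq I) (P : pred I) (F : I -> C) :
  Re (\sum_(i <- r | P i) F i) = \sum_(i <- r | P i) Re (F i).
Proof. by elim/big_rec2: _ => // i y x _ <-; rewrite cReD. Qed.

Lemma cIm_sum I (r : seq I) (P : pred I) (F : I -> C) :
  Im (\sum_(i <- r | P i) F i) = \sum_(i <- r | P i) Im (F i).
Proof. by elim/big_rec2: _ => // i y x _ <-; rewrite cImD. Qed.

Lemma ceqP x y : Re x = Re y -> Im x = Im y -> x = y.
Proof. by case: x => a b; case: y => c d /= -> ->. Qed.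

Lemma rcD (a b : R) : rc (a + b) = rc a + rc b.
Proof. by apply: ceqP => //=; rewrite addr0. Qed.
Lemma rcM (a b : R) : rc (a * b) = rc a * rc b.
Proof. by apply: ceqP => /=; ring. Qed.
Lemma rcN (a : R) : rc (- a) = - rc a.
Proof. by apply: ceqP => //=; rewrite oppr0. Qed.
Lemma rc0 : rc 0 = 0 :> C. Proof. by []. Qed.
Lemma rc1 : rc 1 = 1 :> C. Proof. by []. Qed.
Lemma rcX (a : R) n : rc (a ^+ n) = rc a ^+ n.
Proof. by elim: n => [|n IH]; rewrite ?expr0// !exprS rcM IH. Qed.
Lemma rc_nat n : rc n%:R = n%:R :> C.
Proof. by elim: n => // n IH; rewrite -!natr1 rcD IH. Qed.
Lemma rc_sum I (r : seq I) (P : pred I) (F : I -> R) :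
  rc (\sum_(i <- r | P i) F i) = \sum_(i <- r | P i) rc (F i).
Proof. exact: (big_morph (@rc R) rcD rc0). Qed.
Lemma rc_prod I (r : seq I) (P : pred I) (F : I -> R) :
  rc (\prod_(i <- r | P i) F i) = \prod_(i <- r | P i) rc (F i).
Proof. exact: (big_morph (@rc R) rcM rc1). Qed.
Lemma rc_eq0 (a : R) : (rc a == 0) = (a == 0).
Proof. by apply/eqP/eqP => [[]|->]. Qed.
Lemma rcV (a : R) : rc a^-1 = (rc a)^-1.
Proof.
have [->|a0] := eqVneq a 0; first by rewrite invr0 rc0 invr0.
apply: (mulfI (x := rc a)); first by rewrite rc_eq0.
by rewrite -rcM !mulfV// rc_eq0.
Qed.

Lemma cReMrc (a : R) x : Re (rc a * x) = a * Re x.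
Proof. by rewrite cReM/=; ring. Qed.
Lemma cImMrc (a : R) x : Im (rc a * x) = a * Im x.
Proof. by rewrite cImM/=; ring. Qed.

Lemma cmodE x : cmod x = Normc.normc x. Proof. by case: x. Qed.
Lemma cmod_ge0 x : 0 <= cmod x. Proof. exact: sqrtr_ge0. Qed.
Lemma cmodM x y : cmod (x * y) = cmod x * cmod y.
Proof. by rewrite !cmodE Normc.normcM. Qed.
Lemma cmodD x y : cmod (x + y) <= cmod x + cmod y.
Proof. by rewrite !cmodE le_normcD. Qed.
Lemma cmodN x : cmod (- x) = cmod x.
Proof. by rewrite !cmodE normcN. Qed.
Lemma cmod_rc (a : R) : cmod (rc a) = `|a|.
Proof. by rewrite /cmod/= expr0n/= addr0 sqrtr_sqr. Qed.
Lemma cmod0 : cmod (0 : C) = 0.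
Proof. by rewrite -rc0 cmod_rc normr0. Qed.
Lemma cmod1 : cmod (1 : C) = 1.
Proof. by rewrite -rc1 cmod_rc normr1. Qed.
Lemma cmod_ci : cmod (ci : C) = 1.
Proof. by rewrite /cmod/= expr0n/= add0r expr1n sqrtr1. Qed.
Lemma cmodX x n : cmod (x ^+ n) = cmod x ^+ n.
Proof. by elim: n => [|n IH]; rewrite ?expr0 ?cmod1// !exprS cmodM IH. Qed.
Lemma cmodB x y : cmod (x - y) <= cmod x + cmod y.
Proof. by rewrite (le_trans (cmodD _ _))// cmodN. Qed.
Lemma cmod_sqr x : cmod x ^+ 2 = Re x ^+ 2 + Im x ^+ 2.
Proof. by rewrite sqr_sqrtr// addr_ge0// sqr_ge0. Qed.

Lemma cmod_sum I (r : seq I) (P : pred I) (F : I -> C) :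
  cmod (\sum_(i <- r | P i) F i) <= \sum_(i <- r | P i) cmod (F i).
Proof.
apply: (big_ind2 (fun a b => cmod a <= b)) => // [|a b c d h1 h2].
  by rewrite cmod0.
by rewrite (le_trans (cmodD _ _))// lerD.
Qed.

Lemma Re_le_cmod x : `|Re x| <= cmod x.
Proof.
rewrite -(ler_pXn2r (n:=2)) ?nnegrE ?cmod_ge0// cmod_sqr real_normK ?num_real//.
by rewrite lerDl sqr_ge0.
Qed.

Lemma Im_le_cmod x : `|Im x| <= cmod x.
Proof.
rewrite -(ler_pXn2r (n:=2)) ?nnegrE ?cmod_ge0// cmod_sqr real_normK ?num_real//.
by rewrite lerDr sqr_ge0.
Qed.

Lemma cmod_le_ReIm x : cmod x <= `|Re x| + `|Im x|.
Proof.
rewrite -(ler_pXn2r (n:=2)) ?nnegrE ?cmod_ge0 ?addr_ge0//.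
rewrite cmod_sqr sqrrD !real_normK ?num_real// lerD2r lerDl.
by rewrite mulrn_wge0// mulr_ge0.
Qed.

Lemma cexp0 : cexp (0 : C) = 1.
Proof. by apply: ceqP; rewrite /= ?cos0 ?sin0 expR0 ?mulr1 ?mulr0. Qed.

Lemma cexpD z w : cexp (z + w) = cexp z * cexp w.
Proof.
apply: ceqP; rewrite ?cReM ?cImM /cexp/= cReD cImD expRD ?cosD ?sinD; ring.
Qed.

Lemma cmod_cexp z : cmod (cexp z) = expR (Re z).
Proof.
rewrite /cmod /cexp/= !exprMn -mulrDr cos2Dsin2 mulr1 sqrtr_sqr.
by rewrite ger0_norm// expR_ge0.
Qed.

Lemma cexp_rc (a : R) : cexp (rc a) = rc (expR a).
Proof. by apply: ceqP; rewrite /= ?cos0 ?sin0 ?mulr1 ?mulr0. Qed.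

End complex_basics.

Section csum.
Context (R : realType).
Local Notation C := R[i].
Local Notation Re := complex.Re.
Local Notation Im := complex.Im.
Implicit Types (a b : nat -> C) (l : C).

Lemma csum_to_unique a l1 l2 : csum_to a l1 -> csum_to a l2 -> l1 = l2.
Proof.
move=> [r1 i1] [r2 i2]; apply: ceqP.
  by apply: (cvg_unique _ r1 r2).
by apply: (cvg_unique _ i1 i2).
Qed.

Lemma eq_csum_to a b l : (forall k, a k = b k) -> csum_to a l -> csum_to b l.
Proof. by move=> /funext ->. Qed.

Lemma csum_toZ c a l : csum_to a l -> csum_to (fun k => c * a k) (c * l).
Proof.
move=> [r i]; split.
- rewrite (_ : (fun N => _) = (fun N => Re c * Re (\sum_(k < N) a k)) \-
    (fun N => Im c * Im (\sum_(k < N) a k))); last first.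
    by apply/funext => N /=; rewrite -mulr_sumr cReM.
  by rewrite cReM; apply: cvgB; apply: cvgMr.
- rewrite (_ : (fun N => _) = (fun N => Re c * Im (\sum_(k < N) a k)) \+
    (fun N => Im c * Re (\sum_(k < N) a k))); last first.
    by apply/funext => N /=; rewrite -mulr_sumr cImM.
  by rewrite cImM; apply: cvgD; apply: cvgMr.
Qed.

Lemma csum_toD a b l l' : csum_to a l -> csum_to b l' ->
  csum_to (fun k => a k + b k) (l + l').
Proof.
move=> [r i] [r' i']; split.
- rewrite (_ : (fun N => _) = (fun N => Re (\sum_(k < N) a k)) \+
    (fun N => Re (\sum_(k < N) b k))); last first.
    by apply/funext => N /=; rewrite big_split/= cReD.
  by rewrite cReD; exact: cvgD.
- rewrite (_ : (fun N => _) = (fun N => Im (\sum_(k < N) a k)) \+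
    (fun N => Im (\sum_(k < N) b k))); last first.
    by apply/funext => N /=; rewrite big_split/= cImD.
  by rewrite cImD; exact: cvgD.
Qed.

Lemma csum_to0 : csum_to (fun=> 0 : C) 0.
Proof.
split; rewrite (_ : (fun N => _) = cst 0); try exact: cvg_cst.
- by apply/funext => N; rewrite big1.
- by apply/funext => N; rewrite big1.
Qed.

Lemma csum_to_sum I (r : seq I) (a : I -> nat -> C) (l : I -> C) :
  (forall i, csum_to (a i) (l i)) ->
  csum_to (fun k => \sum_(i <- r) a i k) (\sum_(i <- r) l i).
Proof.
move=> h; elim: r => [|i r IH].
  by rewrite big_nil; apply: eq_csum_to csum_to0 => k; rewrite big_nil.
rewrite big_cons; apply: eq_csum_to (csum_toD (h i) IH) => k.
by rewrite big_cons.
Qed.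

Lemma csum_to_cvg_cmod a l : (forall e, 0 < e -> exists N0 : nat, forall N, (N0 <= N)%N ->
    cmod (\sum_(k < N) a k - l) < e) -> csum_to a l.
Proof.
move=> h; split; apply/cvgrPdist_lt => e e0; have [N0 hN] := h e e0; exists N0 => // N /= NN;
  apply: le_lt_trans (hN N NN).
  by apply: le_trans (Re_le_cmod _); rewrite cReD cReN distrC.
by apply: le_trans (Im_le_cmod _); rewrite cImD cImN distrC.
Qed.

Lemma csum_to_cmod_cvg a l : csum_to a l -> forall e, 0 < e ->
  exists N0 : nat, forall N, (N0 <= N)%N -> cmod (\sum_(k < N) a k - l) < e.
Proof.
move=> [/cvgrPdist_lt hr /cvgrPdist_lt hi] e e0.
have e2 : 0 < e / 2 by rewrite divr_gt0.
have [N1 _ h1] := hr _ e2; have [N2 _ h2] := hi _ e2.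
exists (maxn N1 N2) => N; rewrite geq_max => /andP[n1 n2].
apply: le_lt_trans (cmod_le_ReIm _) _; rewrite cReD cReN cImD cImN.
rewrite (splitr e) ltrD// distrC; [exact: h1|exact: h2].
Qed.

Lemma csum_to_cmod_le a l B : csum_to a l ->
  (forall N, \sum_(k < N) cmod (a k) <= B) -> cmod l <= B.
Proof.
move=> h hB; apply/ler_addgt0Pr => e e0.
have [N0 hN] := csum_to_cmod_cvg h e0.
have := hN N0 (leqnn _) => {}hN.
rewrite -[l](subKr (\sum_(k < N0) a k)); apply: le_trans (cmodB _ _) _.
apply: lerD; last exact: ltW.
exact: le_trans (cmod_sum _ _ _) (hB N0).
Qed.

Lemma csum_to_abs a B : (forall N, \sum_(k < N) cmod (a k) <= B) ->
  exists l, csum_to a l.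
Proof.
move=> hB.
have real_cvg (f : C -> R) : (forall z, `|f z| <= cmod z) ->
    cvgn (fun N => \sum_(k < N) f (a k)).
  move=> fle.
  have -> : (fun N => \sum_(k < N) f (a k)) = [series f (a k)]_k.
    by apply/funext => N; rewrite /series/= big_mkord.
  apply: normed_cvg.
  have -> : [normed [series f (a k)]_k] = (fun N => \sum_(k < N) `|f (a k)|).
    by apply/funext => N; rewrite /= /series/= big_mkord.
  apply: (@nondecreasing_is_cvgn R).
    by apply/nondecreasing_seqP => n; rewrite big_ord_recr/= lerDl.
  exists B => _ [N _ <-].
  by apply: le_trans (hB N); apply: ler_sum.
exists (Complex (limn (fun N => \sum_(k < N) Re (a k))) (limn (fun N => \sum_(k < N) Im (a k)))).
split => /=.
- under eq_fun do rewrite cRe_sum.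
  by apply: real_cvg; exact: Re_le_cmod.
- under eq_fun do rewrite cIm_sum.
  by apply: real_cvg; exact: Im_le_cmod.
Qed.

End csum.

Section cint.
Context dd (T : measurableType dd) (R : realType).
Variable m : {measure set T -> \bar R}.
Local Notation C := R[i].
Local Notation Re := complex.Re.
Local Notation Im := complex.Im.
Implicit Types (f g : T -> C).

Definition cmeas f := measurable_fun setT (fun x => Re (f x)) /\
  measurable_fun setT (fun x => Im (f x)).
Definition cintegrable f := m.-integrable setT (fun x => (Re (f x))%:E) /\
  m.-integrable setT (fun x => (Im (f x))%:E).
Definition cint f : C := Complex (Rintegral m setT (fun x => Re (f x)))
  (Rintegral m setT (fun x => Im (f x))).

Lemma cmeasD f g : cmeas f -> cmeas g -> cmeas (fun x => f x + g x).
Proof.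
move=> [r i] [r' i']; split.
- by under eq_fun do rewrite cReD; exact: measurable_funD.
- by under eq_fun do rewrite cImD; exact: measurable_funD.
Qed.

Lemma cmeasN f : cmeas f -> cmeas (fun x => - f x).
Proof.
move=> [r i]; split.
- by under eq_fun do rewrite cReN; exact: measurableT_comp.
- by under eq_fun do rewrite cImN; exact: measurableT_comp.
Qed.

Lemma cmeasM f g : cmeas f -> cmeas g -> cmeas (fun x => f x * g x).
Proof.
move=> [r i] [r' i']; split.
- under eq_fun do rewrite cReM.
  by apply: measurable_funB; exact: measurable_funM.
- under eq_fun do rewrite cImM.
  by apply: measurable_funD; exact: measurable_funM.
Qed.

Lemma cmeas_cst c : cmeas (fun=> c).
Proof. by split; exact: measurable_cst. Qed.

Lemma cmeasX f n : cmeas f -> cmeas (fun x => f x ^+ n).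
Proof.
move=> mf; elim: n => [|n IH]; first exact: cmeas_cst.
rewrite (_ : (fun x => _) = (fun x => f x * f x ^+ n)); first exact: cmeasM.
by apply/funext => x; rewrite exprS.
Qed.

Lemma cmeas_rc (h : T -> R) : measurable_fun setT h -> cmeas (fun x => rc (h x)).
Proof. by move=> mh; split => //; exact: measurable_cst. Qed.

Lemma cmeas_sum I (r : seq I) (F : I -> T -> C) :
  (forall i, cmeas (F i)) -> cmeas (fun x => \sum_(i <- r) F i x).
Proof.
move=> h; elim: r => [|i r IH].
  rewrite (_ : (fun x => _) = fun=> 0); first exact: cmeas_cst.
  by apply/funext => x; rewrite big_nil.
rewrite (_ : (fun x => _) = (fun x => F i x + \sum_(j <- r) F j x)); first exact: cmeasD.
by apply/funext => x; rewrite big_cons.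
Qed.

Lemma cmeas_prod I (r : seq I) (F : I -> T -> C) :
  (forall i, cmeas (F i)) -> cmeas (fun x => \prod_(i <- r) F i x).
Proof.
move=> h; elim: r => [|i r IH].
  rewrite (_ : (fun x => _) = fun=> 1); first exact: cmeas_cst.
  by apply/funext => x; rewrite big_nil.
rewrite (_ : (fun x => _) = (fun x => F i x * \prod_(j <- r) F j x)); first exact: cmeasM.
by apply/funext => x; rewrite big_cons.
Qed.

Lemma cmeas_cexp f : cmeas f -> cmeas (fun x => cexp (f x)).
Proof.
move=> [r i]; split => /=; apply: measurable_funM; apply: measurableT_comp => //.
- by apply: continuous_measurable_fun; exact: continuous_cos.
- by apply: continuous_measurable_fun; exact: continuous_sin.
Qed.

Lemma cmeas_cmod f : cmeas f -> measurable_fun setT (fun x => cmod (f x)).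
Proof.
move=> [r i]; rewrite /cmod.
apply: (@measurableT_comp _ _ _ _ _ _ (@Num.sqrt R)).
  by apply: continuous_measurable_fun; exact: sqrt_continuous.
by apply: measurable_funD; exact: measurable_funX.
Qed.

Lemma cintegrable_meas f : cintegrable f -> cmeas f.
Proof. by move=> [/measurable_int/measurable_EFinP r /measurable_int/measurable_EFinP i]. Qed.

Lemma cintegrable_le f (G : T -> R) : cmeas f ->
  (forall x, cmod (f x) <= G x) -> m.-integrable setT (EFin \o G) -> cintegrable f.
Proof.
move=> [r i] fG iG; split.
- apply: le_integrable iG => //; first exact/measurable_EFinP.
  move=> x _; rewrite /= lee_fin; apply: le_trans (Re_le_cmod _) _.
  exact: le_trans (fG x) (ler_norm _).
- apply: le_integrable iG => //; first exact/measurable_EFinP.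
  move=> x _; rewrite /= lee_fin; apply: le_trans (Im_le_cmod _) _.
  exact: le_trans (fG x) (ler_norm _).
Qed.

Lemma integrable_cmod f : cintegrable f -> m.-integrable setT (fun x => (cmod (f x))%:E).
Proof.
move=> ifm; have mf := cintegrable_meas ifm; case: ifm => r i.
apply: (@le_integrable _ _ _ m setT _ _
  (fun x => (abse (Re (f x))%:E) + (abse (Im (f x))%:E))%E) => //.
- by apply/measurable_EFinP; exact: cmeas_cmod.
- move=> x _; rewrite /= lee_fin ger0_norm ?cmod_ge0//.
  by rewrite ger0_norm ?addr_ge0// cmod_le_ReIm.
- by apply: integrableD => //; exact: integrable_abse.
Qed.

Lemma cintegrableD f g : cintegrable f -> cintegrable g -> cintegrable (fun x => f x + g x).
Proof.
move=> [r i] [r' i']; split.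
- by under eq_fun do rewrite cReD EFinD; exact: integrableD.
- by under eq_fun do rewrite cImD EFinD; exact: integrableD.
Qed.

Lemma cintD f g : cintegrable f -> cintegrable g ->
  cint (fun x => f x + g x) = cint f + cint g.
Proof.
move=> [r i] [r' i']; apply: ceqP; rewrite ?cReD ?cImD/=.
- by under eq_Rintegral do rewrite cReD; rewrite RintegralD.
- by under eq_Rintegral do rewrite cImD; rewrite RintegralD.
Qed.

Lemma cintegrableZ c f : cintegrable f -> cintegrable (fun x => c * f x).
Proof.
move=> [r i]; split.
- under eq_fun do rewrite cReM EFinB !EFinM.
  by apply: integrableB => //; exact: integrableZl.
- under eq_fun do rewrite cImM EFinD !EFinM.
  by apply: integrableD => //; exact: integrableZl.
Qed.

Lemma cintZ c f : cintegrable f -> cint (fun x => c * f x) = c * cint f.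
Proof.
move=> [r i].
have rZ (k : R) (h : T -> R) : m.-integrable setT (fun x => (h x)%:E) ->
    m.-integrable setT (EFin \o (fun x => k * h x)).
  by move=> ih; rewrite /comp; under eq_fun do rewrite EFinM; exact: integrableZl.
apply: ceqP; rewrite ?cReM ?cImM/=.
- under eq_Rintegral do rewrite cReM.
  by rewrite RintegralB//; [rewrite !RintegralZl|exact: rZ|exact: rZ].
- under eq_Rintegral do rewrite cImM.
  by rewrite RintegralD//; [rewrite !RintegralZl|exact: rZ|exact: rZ].
Qed.

Lemma cintegrable0 : cintegrable (fun=> 0).
Proof. by split; exact: integrable0. Qed.

Lemma cint0 : cint (fun=> 0) = 0.
Proof. by apply: ceqP => /=; rewrite /Rintegral integral0. Qed.

Lemma cintegrable_sum I (r : seq I) (F : I -> T -> C) :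
  (forall i, cintegrable (F i)) -> cintegrable (fun x => \sum_(i <- r) F i x).
Proof.
move=> h; elim: r => [|i r IH].
  rewrite (_ : (fun x => _) = fun=> 0); first exact: cintegrable0.
  by apply/funext => x; rewrite big_nil.
rewrite (_ : (fun x => _) = (fun x => F i x + \sum_(j <- r) F j x)); first exact: cintegrableD.
by apply/funext => x; rewrite big_cons.
Qed.

Lemma cint_sum I (r : seq I) (F : I -> T -> C) : (forall i, cintegrable (F i)) ->
  cint (fun x => \sum_(i <- r) F i x) = \sum_(i <- r) cint (F i).
Proof.
move=> h; elim: r => [|i r IH].
  rewrite big_nil (_ : (fun x => _) = fun=> 0); first exact: cint0.
  by apply/funext => x; rewrite big_nil.
rewrite big_cons -IH -cintD//; last exact: cintegrable_sum.
by congr cint; apply/funext => x; rewrite big_cons.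
Qed.

(** The factor 2 comes from bounding the real and imaginary parts separately; it is immaterial for
    the growth estimates that use this bound. *)
Lemma cmod_cint f (G : T -> R) : cintegrable f ->
  (forall x, cmod (f x) <= G x) -> m.-integrable setT (EFin \o G) ->
  cmod (cint f) <= 2 * Rintegral m setT G.
Proof.
move=> [r i] fG iG; apply: le_trans (cmod_le_ReIm _) _.
rewrite mulr_natl mulr2n; apply: lerD => /=.
- apply: le_trans (le_normr_Rintegral _ r) _ => //.
  apply: le_Rintegral => //; first exact: integrable_norm.
  by move=> x _; exact: le_trans (Re_le_cmod _) (fG x).
- apply: le_trans (le_normr_Rintegral _ i) _ => //.
  apply: le_Rintegral => //; first exact: integrable_norm.
  by move=> x _; exact: le_trans (Im_le_cmod _) (fG x).
Qed.

Lemma Rintegral_dct (f_ : nat -> T -> R) (f G : T -> R) :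
  (forall n, measurable_fun setT (f_ n)) ->
  (forall x, f_ n x @[n --> \oo] --> f x) ->
  (forall n x, `|f_ n x| <= G x) -> m.-integrable setT (EFin \o G) ->
  m.-integrable setT (EFin \o f) /\
  Rintegral m setT (f_ n) @[n --> \oo] --> Rintegral m setT f.
Proof.
move=> mf_ ff fG iG.
have mfE n : measurable_fun setT (EFin \o f_ n) by exact/measurable_EFinP.
have ffE x : setT x -> (f_ n x)%:E @[n --> \oo] --> (f x)%:E.
  by move=> _; apply: cvg_EFin => //; [exact: nearW|exact: ff].
have h n x : setT x -> (`|(f_ n x)%:E| <= (G x)%:E)%E by rewrite lee_fin.
have mf : measurable_fun setT (EFin \o f) by exact: (emeasurable_fun_cvg _ _ mfE ffE).
have [intf _ c] := dominated_convergence measurableT mfE mf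
  (aeW _ (fun x => ffE x)) iG (aeW _ (fun x n => h n x)).
split => //; apply: fine_cvg; rewrite fineK; last exact: integrable_fin_num.
exact: c.
Qed.

(** Dominated convergence for the partial sums. This is the one tool for exchanging a series with an
    integral; the majorant [G] has to bound all partial sums at once. *)
Lemma csum_to_cint (f_ : nat -> T -> C) f (G : T -> R) :
  (forall n, cmeas (f_ n)) -> (forall x, csum_to (fun n => f_ n x) (f x)) ->
  (forall N x, cmod (\sum_(n < N) f_ n x) <= G x) -> m.-integrable setT (EFin \o G) ->
  (forall n, cintegrable (f_ n)) ->
  cintegrable f /\ csum_to (fun n => cint (f_ n)) (cint f).
Proof.
move=> mf_ ff fG iG if_.
have mS N : cmeas (fun x => \sum_(n < N) f_ n x) by exact: cmeas_sum.
have [ir cr] := @Rintegral_dct (fun N x => Re (\sum_(n < N) f_ n x)) (fun x => Re (f x)) G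
  (fun N => (mS N).1) (fun x => (ff x).1)
  (fun N x => le_trans (Re_le_cmod _) (fG N x)) iG.
have [ii ci] := @Rintegral_dct (fun N x => Im (\sum_(n < N) f_ n x)) (fun x => Im (f x)) G
  (fun N => (mS N).2) (fun x => (ff x).2)
  (fun N x => le_trans (Im_le_cmod _) (fG N x)) iG.
split; first by split.
have E N : \sum_(n < N) cint (f_ n) = cint (fun x => \sum_(n < N) f_ n x).
  by rewrite cint_sum.
by split; under eq_fun do rewrite E.
Qed.

End cint.

Arguments cmeas {dd T R}.

(** * The power series of the complex exponential *)

Section cexp_series.
Context (R : realType).
Local Notation C := R[i].
Local Notation Re := complex.Re.
Local Notation Im := complex.Im.

Definition cderiv (f : R -> C) (t : R) (df : C) :=
  is_derive t 1 (fun t => Re (f t)) (Re df) /\ is_derive t 1 (fun t => Im (f t)) (Im df).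

Lemma is_deriveE (f g : R -> R) (t df dg : R) : is_derive t 1 f df -> f =1 g -> df = dg ->
  is_derive t 1 g dg.
Proof. by move=> h /funext <- <-. Qed.

Lemma cderivD f g t df dg : cderiv f t df -> cderiv g t dg ->
  cderiv (fun t => f t + g t) t (df + dg).
Proof.
move=> [r i] [r' i']; split.
- by under eq_fun do rewrite cReD; rewrite cReD; exact: is_deriveD.
- by under eq_fun do rewrite cImD; rewrite cImD; exact: is_deriveD.
Qed.

Lemma is_derive_mul (f g : R -> R) (t df dg : R) : is_derive t 1 f df -> is_derive t 1 g dg ->
  is_derive t 1 (fun t => f t * g t) (df * g t + f t * dg).
Proof.
move=> hf hg; by apply: (is_deriveE (is_deriveM hf hg)) => [s|]; [by []|rewrite /GRing.scale/= addrC (mulrC (g t))].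
Qed.

Lemma cderivM f g t df dg : cderiv f t df -> cderiv g t dg ->
  cderiv (fun t => f t * g t) t (df * g t + f t * dg).
Proof.
move=> [r i] [r' i']; split.
- under eq_fun do rewrite cReM.
  by apply: (is_deriveE (is_deriveB (is_derive_mul r r') (is_derive_mul i i'))) => [s|]; [by []|rewrite cReD !cReM; ring].
- under eq_fun do rewrite cImM.
  by apply: (is_deriveE (is_deriveD (is_derive_mul r i') (is_derive_mul i r'))) => [s|]; [by []|rewrite cImD !cImM; ring].
Qed.

Lemma is_derive_lin (c t : R) : is_derive t 1 (fun t : R => c * t) c.
Proof.
by apply: (is_deriveE (is_derive_mul (is_derive_cst c t 1) (is_derive_id t 1))) => [s|]; [by []|rewrite mul0r add0r mulr1].
Qed.

Lemma cderiv_cexp (w : C) (t : R) :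
  cderiv (fun t => cexp (- (rc t * w))) t (- w * cexp (- (rc t * w))).
Proof.
case: w => a b.
have E s : cexp (- (rc s * Complex a b)) =
    Complex (expR (- a * s) * cos (b * s)) (- (expR (- a * s) * sin (b * s))).
  rewrite /cexp !cReN !cImN cReMrc cImMrc/= cosN sinN mulrN mulNr.
  by rewrite (mulrC s) (mulrC s).
have de := is_derive1_comp (is_derive_expR (- a * t)) (is_derive_lin (- a) t).
have dc := is_derive1_comp (is_derive_cos (b * t)) (is_derive_lin b t).
have ds := is_derive1_comp (is_derive_sin (b * t)) (is_derive_lin b t).
split.
- under eq_fun do rewrite E/=.
  by apply: (is_deriveE (is_derive_mul de dc)) => [s|]; [by []|rewrite E cReM/=; ring].
- under eq_fun do rewrite E/=.
  by apply: (is_deriveE (is_deriveN (is_derive_mul de ds))) => [s|]; [by []|rewrite E cImM/=; ring].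
Qed.

Lemma is_derive_powS n (t : R) :
  is_derive t 1 (fun t : R => t ^+ n.+1 / n.+1`!%:R) (t ^+ n / n`!%:R).
Proof.
elim: n => [|n IH].
  by apply: (is_deriveE (is_derive_mul (is_derive_id t 1) (is_derive_cst (1`!%:R^-1 : R) t 1))) => [s|]; [by []|rewrite mulr0 addr0 expr0].
have E : (fun t : R => t ^+ n.+2 / n.+2`!%:R) =
    (fun t => (n.+2%:R^-1 * t) * (t ^+ n.+1 / n.+1`!%:R)).
  apply/funext => s; rewrite factS natrM exprS; field.
  by rewrite pnatr_eq0 -lt0n fact_gt0/= -natrD pnatr_eq0.
rewrite E; apply: (is_deriveE (is_derive_mul (is_derive_lin (n.+2%:R^-1) t) IH)) => //.
rewrite factS natrM exprS.
have b0 : (n`!%:R : R) != 0 by rewrite pnatr_eq0 -lt0n fact_gt0.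
have a0 : (n.+1%:R : R) != 0 by rewrite pnatr_eq0.
have c0 : (n.+1%:R + 1 : R) != 0 by rewrite natr1 pnatr_eq0.
rewrite -(natr1 n.+1); move: b0 a0 c0; set b := n`!%:R; set a := n.+1%:R => b0 a0 c0.
field.
by apply/and3P; split => //; rewrite ?nat1r ?natr1 pnatr_eq0 -?lt0n ?fact_gt0.
Qed.

(** Taylor polynomial of the exponential along the segment from [0] to [w]; with a real parameter,
    real derivatives suffice. *)
Let F (w : C) n t := \sum_(k < n) rc (t ^+ k / k`!%:R) * w ^+ k.

Let cderivF w n t : cderiv (F w n.+1) t (w * F w n t).
Proof.
elim: n => [|n IH].
  rewrite /F big_ord0 mulr0.
  have -> : (fun t => \sum_(k < 1) rc (t ^+ k / k`!%:R) * w ^+ k) = cst 1.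
    apply/funext => s; rewrite big_ord_recl big_ord0/= !expr0.
    by rewrite fact0 invr1 !mulr1 addr0.
  by split => /=; exact: is_derive_cst.
have -> : F w n.+2 = (fun t => F w n.+1 t + rc (t ^+ n.+1 / n.+1`!%:R) * w ^+ n.+1).
  by apply/funext => s; rewrite /F big_ord_recr.
have -> : w * F w n.+1 t = w * F w n t + rc (t ^+ n / n`!%:R) * w ^+ n.+1.
  rewrite /F big_ord_recr/= mulrDr; congr (_ + _).
  by rewrite exprS mulrCA.
apply: cderivD => //.
split.
- under eq_fun do rewrite cReMrc.
  by apply: (is_deriveE (is_derive_mul (is_derive_powS n t) (is_derive_cst (Re (w ^+ n.+1)) t 1))) => [s|]; [by []|rewrite cReMrc mulr0 addr0].
- under eq_fun do rewrite cImMrc.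
  by apply: (is_deriveE (is_derive_mul (is_derive_powS n t) (is_derive_cst (Im (w ^+ n.+1)) t 1))) => [s|]; [by []|rewrite cImMrc mulr0 addr0].
Qed.

Let D (w : C) n t := cexp (- (rc t * w)) * F w n t.

Let cderivD_ w n t : cderiv (D w n.+1) t
  (- (w ^+ n.+1 * rc (t ^+ n / n`!%:R)) * cexp (- (rc t * w))).
Proof.
have := cderivM (cderiv_cexp w t) (cderivF w n t).
rewrite (_ : _ + _ = - (w ^+ n.+1 * rc (t ^+ n / n`!%:R)) * cexp (- (rc t * w)))//.
rewrite {1}/F big_ord_recr/= -/(F w n t) exprS; ring.
Qed.

(** The product [D] of the Taylor polynomial with [exp(-t w)] equals 1 at [t = 0], and its
    derivative telescopes to the single term [- w^(n+1) t^n / n! exp(-t w)]. The mean value theorem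
    is applied to the two components, whence the factor 2. *)
Let Dbound w n : cmod (D w n.+1 1 - 1) <= 2 * (cmod w ^+ n.+1 / n`!%:R * expR (cmod w)).
Proof.
have D0 : D w n.+1 0 = 1.
  rewrite /D rc0 mul0r oppr0 cexp0 mul1r /F big_ord_recl/= !expr0 fact0 invr1 !mulr1.
  by rewrite big1 ?addr0// => i _; rewrite expr0n/= mul0r rc0 mul0r.
have bnd t : t \in `]0, 1[ ->
  cmod (- (w ^+ n.+1 * rc (t ^+ n / n`!%:R)) * cexp (- (rc t * w)))
    <= cmod w ^+ n.+1 / n`!%:R * expR (cmod w).
  rewrite in_itv/= => /andP[t0 t1].
  rewrite cmodM cmodN cmodM cmodX cmod_rc cmod_cexp.
  apply: ler_pM => //; rewrite ?mulr_ge0 ?exprn_ge0 ?cmod_ge0 ?expR_ge0//.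
    rewrite ler_wpM2l ?exprn_ge0 ?cmod_ge0// ger0_norm; last first.
      by rewrite divr_ge0// exprn_ge0// ltW.
    by rewrite ler_pdivrMr ?ltr0n ?fact_gt0// mulVf ?pnatr_eq0 -?lt0n ?fact_gt0// exprn_ile1// ltW.
  rewrite ler_expR cReN cReMrc.
  apply: le_trans (ler_norm _) _; rewrite normrN normrM (gtr0_norm t0).
  by apply: le_trans (Re_le_cmod w); rewrite ler_piMl// ltW.
have MV (f : C -> R) : (forall z, `|f z| <= cmod z) -> (forall z u, f (z - u) = f z - f u) ->
   (forall t : R, is_derive t 1 (fun t : R => f (D w n.+1 t))
      (f (- (w ^+ n.+1 * rc (t ^+ n / n`!%:R)) * cexp (- (rc t * w))))) ->
   `|f (D w n.+1 1 - 1)| <= cmod w ^+ n.+1 / n`!%:R * expR (cmod w).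
  move=> fle fB df.
  have cont : {within `[0, 1], continuous (fun t : R => f (D w n.+1 t))}.
    apply: continuous_subspaceT => t; apply: differentiable_continuous.
    by apply/derivable1_diffP; apply: ex_derive.
  have [t t01 E] := MVT ltr01 (fun t _ => df t) cont.
  rewrite fB -D0 E subr0 mulr1; apply: le_trans (fle _) _.
  exact: bnd.
apply: le_trans (cmod_le_ReIm _) _; rewrite mulr_natl mulr2n; apply: lerD.
- apply: MV => [z|z u|t]; first exact: Re_le_cmod.
    by rewrite cReD cReN.
  exact: (cderivD_ w n t).1.
- apply: MV => [z|z u|t]; first exact: Im_le_cmod.
    by rewrite cImD cImN.
  exact: (cderivD_ w n t).2.
Qed.

(** [cexp] is defined by real functions, so its series is not given. The error of the Taylor
    polynomial is [exp w] times [D - 1], and [Dbound] compares it with a general term of the real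
    exponential series, which tends to 0. *)
Lemma csum_to_cexp (w : C) : csum_to (fun k => rc (k`!%:R^-1) * w ^+ k) (cexp w).
Proof.
apply: csum_to_cvg_cmod => e e0.
have E N : \sum_(k < N) rc (k`!%:R^-1) * w ^+ k - cexp w = cexp w * (D w N 1 - 1).
  rewrite mulrBr mulr1 /D mulrA -cexpD rc1 mul1r subrr cexp0 mul1r; congr (_ - _).
  by apply: eq_bigr => k _; rewrite expr1n div1r.
set K := expR (cmod w) * 2 * expR (cmod w) * cmod w.
have K0 : 0 <= K by rewrite !mulr_ge0 ?expR_ge0 ?cmod_ge0.
have := cvg_series_cvg_0 (@is_cvg_series_exp_coeff R (cmod w)).
have e' : 0 < e / (K + 1) by rewrite divr_gt0// ltr_wpDl.
move=> /cvgrPdist_lt/(_ _ e')[N0 _ hN].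
exists N0.+1 => -[//|N] NN; rewrite E cmodM cmod_cexp.
apply: (@le_lt_trans _ _ (K * (cmod w ^+ N / N`!%:R))).
  apply: (@le_trans _ _ (expR (cmod w) * (2 * (cmod w ^+ N.+1 / N`!%:R * expR (cmod w))))).
    apply: ler_pM; rewrite ?expR_ge0 ?cmod_ge0 ?Dbound//.
    by rewrite ler_expR; exact: le_trans (ler_norm _) (Re_le_cmod w).
  by rewrite /K exprS le_eqVlt; apply/orP; left; apply/eqP; ring.
have := hN N NN; rewrite sub0r normrN /exp_coeff/= ger0_norm; last first.
  by rewrite divr_ge0// exprn_ge0// cmod_ge0.
rewrite ltr_pdivlMr ?ltr_wpDl// => h.
apply: le_lt_trans h; rewrite mulrC ler_wpM2l ?lerDl//.
by rewrite divr_ge0// exprn_ge0// cmod_ge0.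
Qed.

Lemma exprn_le_expR n (x : R) : 0 <= x -> x ^+ n <= n`!%:R * expR x.
Proof.
move=> x0; rewrite mulrC -ler_pdivrMr ?ltr0n ?fact_gt0//.
have nd : {homo series (exp_coeff x) : n m / (n <= m)%N >-> n <= m}.
  apply/nondecreasing_seqP => m; rewrite /series/= big_nat_recr//= lerDl.
  by rewrite /exp_coeff/= divr_ge0// exprn_ge0.
have h := nondecreasing_cvgn_le nd (@is_cvg_series_exp_coeff R x).
apply: (@le_trans _ _ (series (exp_coeff x) n.+1)).
  rewrite /series/= big_nat_recr//= /exp_coeff/= lerDr.
  by apply: sumr_ge0 => i _; rewrite divr_ge0// exprn_ge0.
exact: h.
Qed.

Lemma sum_exp_coeff_le (x : R) N : 0 <= x ->
  \sum_(k < N) (k`!%:R^-1 * x ^+ k) <= expR x.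
Proof.
move=> x0.
have nd : {homo series (exp_coeff x) : n m / (n <= m)%N >-> n <= m}.
  apply/nondecreasing_seqP => m; rewrite /series/= big_nat_recr//= lerDl.
  by rewrite /exp_coeff/= divr_ge0// exprn_ge0.
have h := nondecreasing_cvgn_le nd (@is_cvg_series_exp_coeff R x).
apply: (@le_trans _ _ (series (exp_coeff x) N)).
  rewrite /series/= big_mkord le_eqVlt; apply/orP; left; apply/eqP.
  by apply: eq_bigr => k _; rewrite /exp_coeff/= mulrC.
exact: h.
Qed.

End cexp_series.

(** * The Gamma function and Gaussian moments *)

Section gamma.
Context (R : realType).
Local Notation leb := (@lebesgue_measure R).

Lemma integral_expRN (c : R) : 0 < c ->
  (\int[leb]_(t in `]0%R, +oo[) (expR (- (c * t)))%:E = (c^-1)%:E)%E.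
Proof.
move=> c0.
have mf : measurable_fun setT (fun t : R => expR (- (c * t))).
  by apply: measurableT_comp => //; apply: measurableT_comp => //.
rewrite integral_itv_obnd_cbnd; last by apply/measurable_EFinP; exact: measurable_funTS.
pose F (t : R) := - c^-1 * expR (- (c * t)).
have dF (t : R) : is_derive t 1 F (expR (- (c * t))).
  have de := is_derive1_comp (is_derive_expR (- c * t)) (is_derive_lin (- c) t).
  apply: (is_deriveE (is_derive_mul (is_derive_cst (- c^-1) t 1) de)) => [s|].
    by rewrite /F/= (mulNr c).
  by rewrite /= mul0r add0r (mulNr c); field; rewrite gt_eqF.
have cexpRN : continuous (fun t : R => expR (- (c * t))).
  move=> t; apply: continuous_comp; last exact: continuous_expR.
  apply: continuousN; apply: mulrl_continuous.
rewrite (@ge0_continuous_FTC2y _ _ F 0 0).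
- by rewrite /F mulr0 oppr0 expR0 mulr1 -EFinB sub0r opprK.
- by move=> t _; exact: expR_ge0.
- exact: continuous_subspaceT.
- rewrite -(mulr0 (- c^-1)); apply: cvgMr; apply: (@cvg_comp _ _ _ (fun t => c * t) (fun x => expR (- x)) _ +oo%R).
    by apply: gt0_cvgMry => //; exact: cvg_id.
  exact: cvgr_expR.
- by move=> t _; apply: ex_derive.
- apply: cvg_at_right_filter; apply: differentiable_continuous.
  by apply/derivable1_diffP; apply: ex_derive.
- by move=> t _; rewrite derive1E; exact: derive_val.
Qed.

(** The Gamma integral with extended real values, so that substitutions can be made before
    finiteness is known. *)
Definition egamma (a : R) : \bar R :=
  (\int[leb]_(t in `]0%R, +oo[) (t `^ (a - 1) * expR (- t))%:E)%E.

Let gint (a t : R) : R := t `^ (a - 1) * expR (- t).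

Let mgint a : measurable_fun setT (gint a).
Proof.
apply: measurable_funM; first exact: measurable_powR.
by apply: measurableT_comp.
Qed.

Let gint_ge0 a t : 0 <= gint a t.
Proof. by rewrite mulr_ge0 ?powR_ge0 ?expR_ge0. Qed.

Lemma powR_le_expR (p : R) : 0 <= p -> exists2 K : R, 0 <= K &
  forall t, 0 <= t -> t `^ p <= K * expR (t / 2).
Proof.
move=> p0; pose n := (Num.truncn `|p|).+1.
have pn : p <= n%:R by rewrite -[p]ger0_norm// ltW// truncnS_gt.
(* For [t > 1] the bound [t^n <= n! 2^n exp(t/2)] is used; the additional 1 covers [t <= 1], where
   [t^p <= 1]. *)
exists (n`!%:R * 2 ^+ n + 1); first by rewrite addr_ge0// mulr_ge0// exprn_ge0.
move=> t t0; have [t1|t1] := leP t 1.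
  apply: (@le_trans _ _ 1).
    by have := @ge0_ler_powR R p p0 t 1; rewrite powR1; apply; rewrite ?nnegrE.
  rewrite -[leLHS]mulr1; apply: ler_pM => //; first by rewrite lerDr mulr_ge0// exprn_ge0.
  by rewrite -expR0 ler_expR divr_ge0.
apply: (@le_trans _ _ (t ^+ n)).
  by rewrite -powR_mulrn//; apply: ler_powR => //; exact: ltW.
have -> : t = 2 * (t / 2) by rewrite mulrCA mulfV ?mulr1.
rewrite exprMn -mulrA.
have := @exprn_le_expR R n (t / 2); rewrite divr_ge0// => /(_ isT) h.
rewrite (_ : 2 * (t / 2 / 2) = t / 2); last by rewrite mulrCA mulfV ?mulr1.
rewrite mulrDl mul1r; apply: le_trans (_ : _ <= n`!%:R * 2 ^+ n * expR (t / 2)) _.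
  rewrite [leRHS](_ : _ = 2 ^+ n * (n`!%:R * expR (t / 2))); last by ring.
  by rewrite ler_wpM2l// exprn_ge0.
by rewrite lerDl expR_ge0.
Qed.

(** Half of the exponential decay absorbs the power. For [a >= 1] there is no singularity at [0],
    and all Gamma values of the series have such arguments because [alpha < 2 <= d]. *)
Lemma egamma_lty a : 1 <= a -> (egamma a < +oo)%E.
Proof.
move=> a1; have [|K K0 hK] := @powR_le_expR (a - 1); first by rewrite subr_ge0.
apply: (@le_lt_trans _ _ (\int[leb]_(t in `]0%R, +oo[) (K%:E * (expR (- (2^-1 * t)))%:E))%E).
  apply: ge0_le_integral => //.
  - by move=> t _; rewrite lee_fin gint_ge0.
  - by apply/measurable_EFinP; apply: measurable_funTS; exact: mgint.
  - apply: emeasurable_funM => //; apply/measurable_EFinP; apply: measurable_funTS.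
    by apply: measurableT_comp => //; apply: measurableT_comp.
  - move=> t; rewrite /= in_itv/= andbT => t0; rewrite -EFinM lee_fin.
    apply: le_trans (ler_wpM2r (expR_ge0 _) (hK t (ltW t0))) _.
    rewrite -mulrA -expRD ler_wpM2l// ler_expR; lra.
rewrite ge0_integralZl//.
- by rewrite integral_expRN// -EFinM ltry.
- apply/measurable_EFinP; apply: measurable_funTS.
  by apply: measurableT_comp => //; apply: measurableT_comp.
Qed.

Lemma egamma_ge0 a : (0 <= egamma a)%E.
Proof. by apply: integral_ge0 => t _; rewrite lee_fin gint_ge0. Qed.

Lemma GammaE (a : R) : 1 <= a -> (Gamma a)%:E = egamma a.
Proof. by move=> a1; rewrite /Gamma /Rintegral fineK// ge0_fin_numE ?egamma_ge0// egamma_lty. Qed.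

Lemma Gamma_ge0 (a : R) : 0 <= Gamma a.
Proof. by rewrite /Gamma /Rintegral fine_ge0// egamma_ge0. Qed.

(** The integral is cut down to [[k+1, k+2]], where the integrand is at least
    [(k+1)^k exp(-(k+2))]. *)
Lemma Gamma_lower (k : nat) (a : R) : k.+1%:R <= a ->
  k.+1%:R ^+ k * expR (- k.+2%:R) <= Gamma a.
Proof.
move=> ka; have a1 : 1 <= a by apply: le_trans ka; rewrite ler1n.
rewrite -lee_fin GammaE//.
set c := k.+1%:R ^+ k * _.
apply: (@le_trans _ _ (\int[leb]_(t in `[k.+1%:R, k.+2%:R]) c%:E)%E).
  rewrite integral_cst//= lebesgue_measure_itv/= lte_fin ltr_nat ltnSn.
  by rewrite -EFinD -natrB// subSnn mule1.
apply: (@le_trans _ _ (\int[leb]_(t in `[k.+1%:R, k.+2%:R]) (gint a t)%:E)%E).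
  apply: ge0_le_integral => //.
  - by move=> t _; rewrite lee_fin mulr_ge0 ?exprn_ge0 ?expR_ge0.
  - by apply/measurable_EFinP; apply: measurable_funTS; exact: mgint.
  - move=> t; rewrite /= in_itv/= => /andP[t1 t2]; rewrite lee_fin.
    apply: ler_pM; rewrite ?exprn_ge0 ?expR_ge0//; last by rewrite ler_expR lerN2.
    have t1' : 1 <= t by apply: le_trans t1; rewrite ler1n.
    apply: (@le_trans _ _ (t ^+ k)).
      have tR : k.+1%:R ^+ k <= (t : R) ^+ k.
        by apply: lerXn2r; rewrite ?nnegrE//; exact: le_trans ler01 t1'.
      exact: tR.
    rewrite -powR_mulrn; last exact: le_trans ler01 t1'.
    by apply: ler_powR => //; rewrite lerBrDr natr1.
apply: ge0_subset_integral => //.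
- by apply/measurable_EFinP; apply: measurable_funTS; exact: mgint.
- by move=> t _; rewrite lee_fin gint_ge0.
- move=> t; rewrite /= !in_itv/= andbT => /andP[t1 _].
  by apply: lt_le_trans t1; rewrite ltr0n.
Qed.

Lemma Gamma_gt0 (a : R) : 1 <= a -> 0 < Gamma a.
Proof.
move=> a1; apply: lt_le_trans (@Gamma_lower 0 a a1).
by rewrite expr0 mul1r expR_gt0.
Qed.

(** From [k! <= (k+1)^k]. The bound loses only an exponential factor against the factorial, which
    the convergence of the series can afford. *)
Lemma Gamma_lower_fact (k : nat) (h : R) : 1 <= h ->
  k`!%:R * expR (- k.+2%:R) <= Gamma (k%:R + h).
Proof.
move=> h1; apply: le_trans (@Gamma_lower k (k%:R + h) _); last first.
  by rewrite -natr1 lerD2l.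
rewrite ler_wpM2r ?expR_ge0// -natrX ler_nat.
elim: k => // k IH; rewrite factS expnS leq_mul//; apply: leq_trans IH _.
by case: (posnP k) => [->//|k0]; rewrite leq_exp2r.
Qed.

Lemma egamma_scale (c a : R) : 0 < c ->
  (\int[leb]_(t in `]0%R, +oo[) (t `^ (a - 1) * expR (- (c * t)))%:E =
   (c `^ (- a))%:E * egamma a)%E.
Proof.
move=> c0.
pose f : R -> \bar R := (fun t => (gint a t)%:E) \_ `]0%R, +oo[%classic.
have mf : measurable_fun setT f.
  apply/(measurable_restrict _ (measurable_itv _)) => //.
  by apply/measurable_EFinP; apply: measurable_funTS; exact: mgint.
have f0 t : (0 <= f t)%E by rewrite /f patchE; case: ifP => // _; rewrite lee_fin gint_ge0.
have := ge0_integral_affine1 0 (lt0r_neq0 c0) mf f0.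
have -> : (\int[leb]_t f t = egamma a)%E by rewrite /egamma [RHS]integral_mkcond.
have -> : (\int[leb]_t f (0 + c * t)%R = (c `^ (a - 1))%:E *
    \int[leb]_(t in `]0%R, +oo[) (t `^ (a - 1) * expR (- (c * t)))%:E)%E.
  rewrite -ge0_integralZl//; last 3 first.
  - apply/measurable_EFinP; apply: measurable_funTS; apply: measurable_funM.
      exact: measurable_powR.
    by apply: measurableT_comp => //; apply: measurableT_comp.
  - by move=> t _; rewrite lee_fin mulr_ge0 ?powR_ge0 ?expR_ge0.
  - by rewrite lee_fin powR_ge0.
  rewrite [RHS]integral_mkcond; apply: eq_integral => t _.
  rewrite /f !patchE add0r !mem_setE/= !in_itv/= !andbT pmulr_rgt0//.
  case: ifPn => // t0; rewrite -EFinM; congr EFin.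
  by rewrite /gint powRM ?ltW// mulrA.
rewrite (gtr0_norm c0) => h.
set X := (\int[leb]_(t in _) _)%E in h *.
have cc : c `^ (- a) * c * c `^ (a - 1) = 1.
  have ca : c * c `^ (a - 1) = c `^ a.
    by rewrite -{1}(powRr1 (ltW c0)) -powRD ?(gt_eqF c0) ?implybT// addrCA subrr addr0.
  by rewrite -mulrA ca powRN mulVf// powR_eq0 gt_eqF.
have -> : X = ((c `^ (- a) * c)%:E * ((c `^ (a - 1))%:E * X))%E.
  by rewrite muleA -EFinM cc mul1e.
by rewrite h muleA -EFinM -mulrA mulfV ?gt_eqF// mulr1.
Qed.

(** The substitution [t = r^p] produces a Gamma integral. With [p = alpha] it yields the
    coefficients of the series, with [p = 2] the radial factors of the Gaussian. *)
Lemma integral_radial (p c s : R) : 1 < p -> 0 < c ->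
  (\int[leb]_(r in `]0%R, +oo[) (r `^ (s - 1) * expR (- (c * r `^ p)))%:E =
   (p^-1 * c `^ (- (s / p)))%:E * egamma (s / p))%E.
Proof.
move=> p1 c0; have p0 : 0 < p by lra.
pose f (t : R) : \bar R := (p^-1 * (t `^ (s / p - 1) * expR (- (c * t))))%:E.
have mf : measurable_fun setT f.
  apply/measurable_EFinP; apply: measurable_funM => //; apply: measurable_funM.
    exact: measurable_powR.
  by apply: measurableT_comp => //; apply: measurableT_comp.
have f0 t : (0 <= f t)%E.
  by rewrite lee_fin !mulr_ge0 ?powR_ge0 ?expR_ge0 ?invr_ge0// ltW.
have := ge0_integral_powR_change p1 mf f0.
have -> : (\int[leb]_(t in `]0%R, +oo[) f t = (p^-1 * c `^ (- (s / p)))%:E * egamma (s / p))%E.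
  under eq_integral do rewrite /f EFinM.
  rewrite ge0_integralZl//; last 3 first.
  - apply/measurable_EFinP; apply: measurable_funTS; apply: measurable_funM.
      exact: measurable_powR.
    by apply: measurableT_comp => //; apply: measurableT_comp.
  - by move=> t _; rewrite lee_fin mulr_ge0 ?powR_ge0 ?expR_ge0.
  - by rewrite lee_fin invr_ge0 ltW.
  by rewrite egamma_scale// muleA -EFinM.
move=> ->; apply: eq_integral => r; rewrite inE/= in_itv/= andbT => r0.
rewrite /f -EFinM; congr EFin.
have -> : r `^ (s - 1) = (r `^ p) `^ (s / p - 1) * r `^ (p - 1).
  rewrite -powRrM -powRD; last by rewrite (gt_eqF r0) implybT.
  by congr (_ `^ _); field; rewrite gt_eqF.
have pN0 : p != 0 by rewrite gt_eqF.
set A := _ `^ (s / p - 1); set B := r `^ (p - 1); set E := expR _.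
by field; rewrite pN0.
Qed.

End gamma.

(** * Moments of the Gaussian weight *)

Section gaussian.
Context (R : realType).
Local Notation leb := (@lebesgue_measure R).
Local Notation C := R[i].

Definition gw (x : R) : R := expR (- (x ^+ 2 / 2)).

Lemma gw_ge0 x : 0 <= gw x. Proof. exact: expR_ge0. Qed.

Lemma measurable_gw : measurable_fun setT gw.
Proof.
apply: measurableT_comp => //; apply: measurableT_comp => //.
by apply: measurable_funM => //; exact: measurable_funX.
Qed.

Lemma integrable_gw_dom (k : nat) (B : R) : 0 <= B ->
  leb.-integrable setT (fun x => (`|x| ^+ k * expR (B * `|x|) * gw x)%:E).
Proof.
move=> B0.
have mf : measurable_fun setT (fun x : R => `|x| ^+ k * expR (B * `|x|) * gw x).
  apply: measurable_funM; last exact: measurable_gw.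
  apply: measurable_funM; first by apply: measurable_funX; exact: normr_measurable.
  by apply: measurableT_comp => //; apply: measurable_funM => //; exact: normr_measurable.
(* The majorant is the normal density of standard deviation 2. With [y = |x|], completing the square
   gives [y + B y - y^2/2 <= 2/3 (B+1)^2 - y^2/8]; the division by [normal_peak 2] removes its
   normalization. *)
pose K := k`!%:R * expR (2 / 3 * (B + 1) ^+ 2) / normal_peak (2 : R).
have pk : 0 < normal_peak (2 : R) by apply: normal_peak_gt0.
apply: (@le_integrable _ (measurableTypeR R) R leb setT measurableT _
  (fun x : R => (K%:E * (normal_pdf 0 2 x)%:E)%E)) => //.
- by apply/measurable_EFinP.
- move=> x _; rewrite -EFinM !abse_EFin lee_fin.
  have K0 : 0 <= K by rewrite /K !mulr_ge0 ?expR_ge0// invr_ge0 ltW.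
  rewrite [leLHS]ger0_norm; last by rewrite !mulr_ge0 ?exprn_ge0 ?expR_ge0.
  rewrite [leRHS]ger0_norm; last by rewrite mulr_ge0 ?normal_pdf_ge0.
  have -> : normal_pdf 0 2 x = normal_peak 2 * normal_fun 0 2 x by rewrite normal_pdfE.
  rewrite /K mulrA (divfK (lt0r_neq0 pk)).
  rewrite /normal_fun /gw subr0.
  apply: (@le_trans _ _ (k`!%:R * expR `|x| * expR (B * `|x|) * expR (- (x ^+ 2 / 2)))).
    rewrite ler_wpM2r ?expR_ge0// ler_wpM2r ?expR_ge0//.
    exact: exprn_le_expR.
  have -> : k`!%:R * expR `|x| * expR (B * `|x|) * expR (- (x ^+ 2 / 2)) =
      k`!%:R * expR (`|x| + B * `|x| - x ^+ 2 / 2) by rewrite !expRD; ring.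
  rewrite -[leRHS]mulrA -expRD ler_wpM2l// ler_expR.
  rewrite -[x ^+ 2]real_normK ?num_real//.
  move: `|x| => y; rewrite -subr_ge0.
  rewrite (_ : _ - _ = (y * 3 - 4 * (B + 1)) ^+ 2 / 24); last by field.
  by rewrite divr_ge0// sqr_ge0.
- by apply: integrableZl => //; exact: integrable_normal_pdf.
Qed.

Lemma integrable_gw_pow (k : nat) :
  leb.-integrable setT (fun x => (x ^+ k * gw x)%:E).
Proof.
have := @integrable_gw_dom k 0 (lexx _).
apply: le_integrable => //.
- apply/measurable_EFinP; apply: measurable_funM; last exact: measurable_gw.
  exact: measurable_funX.
- by move=> x _; rewrite !abse_EFin lee_fin !normrM !normrX !normr_id mul0r expR0 normr1 mulr1.
Qed.

Definition gmom (k : nat) : R := Rintegral leb setT (fun x => x ^+ k * gw x).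

Lemma gmom0 : gmom 0 = Num.sqrt (2 * pi).
Proof.
have := @integral_normal_pdf R 0 1; rewrite normal_pdfE ?oner_neq0//.
have E : (\int[leb]_x (normal_peak 1 * normal_fun 0 1 x)%:E =
   (normal_peak 1)%:E * \int[leb]_x (x ^+ 0 * gw x)%:E)%E.
  rewrite -ge0_integralZl//; last 3 first.
  - apply/measurable_EFinP; apply: measurable_funM; last exact: measurable_gw.
    exact: measurable_funX.
  - by move=> x _; rewrite lee_fin expr0 mul1r gw_ge0.
  - by rewrite lee_fin normal_peak_ge0.
  apply: eq_integral => x _; rewrite -EFinM; congr EFin.
  by rewrite expr0 mul1r /normal_fun /gw subr0 expr1n mulNr.
rewrite [X in X = _ -> _]E.
have fin := integrable_fin_num measurableT (integrable_gw_pow 0).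
rewrite -(fineK fin) -EFinM => -[]; rewrite -/(gmom 0) /normal_peak expr1n mul1r => h.
have s0 : Num.sqrt (pi *+ 2 : R) != 0.
  by rewrite gt_eqF// sqrtr_gt0 pmulrn_lgt0// pi_gt0.
by rewrite mulr_natl -[RHS]mulr1 -h mulrA mulfV// mul1r.
Qed.

Lemma gw_decay (k : nat) (n : nat) : n.+1%:R ^+ k * gw n.+1%:R <= k.+1`!%:R * expR 2 / n.+1%:R.
Proof.
rewrite ler_pdivlMr ?ltr0n// mulrAC -exprSr.
apply: le_trans (ler_wpM2r (gw_ge0 _) (@exprn_le_expR R k.+1 n.+1%:R (ler0n _ _))) _.
rewrite -mulrA -expRD ler_wpM2l// ler_expR.
have := sqr_ge0 (n.+1%:R - 1 : R).
set a := n.+1%:R; nra.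
Qed.

(** Integration by parts: [h] is the derivative of [x^(k+1) gw x]. Its integral over [[-(n+1), n+1]]
    reduces to boundary terms that decay like [1/n], while by dominated convergence it tends to the
    integral over the line. *)
Lemma gmom_rec k : gmom k.+2 = k.+1%:R * gmom k.
Proof.
pose h (x : R) := k.+1%:R * (x ^+ k * gw x) - x ^+ k.+2 * gw x.
have ih : leb.-integrable setT (fun x => (h x)%:E).
  rewrite /h; under eq_fun do rewrite EFinB EFinM.
  by apply: integrableB => //; [apply: integrableZl => //|]; exact: integrable_gw_pow.
suff : Rintegral leb setT h = 0.
  rewrite /h RintegralB//.
  - rewrite RintegralZl//; last exact: integrable_gw_pow.
    by move/eqP; rewrite subr_eq0 => /eqP.
  - rewrite /comp; under eq_fun do rewrite EFinM.
    by apply: integrableZl => //; exact: integrable_gw_pow.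
  - exact: integrable_gw_pow.
have mh : measurable_fun setT h by apply/measurable_EFinP; exact: (measurable_int leb ih).
pose h_ (n : nat) : R -> R := h \_ `[- n.+1%:R, n.+1%:R]%classic.
have H1 n : measurable_fun (setT : set (measurableTypeR R)) (h_ n).
  apply/(measurable_restrict _ (measurable_itv _)) => //.
  exact: measurable_funTS.
have H2 x : h_ n x @[n --> \oo] --> h x.
  apply: cvg_near_cst; exists (Num.truncn `|x|) => // n /= nx.
  rewrite /h_ patchE mem_set//= in_itv/= -ler_norml.
  by apply: ltW; apply: lt_le_trans (truncnS_gt _) _; rewrite ler_nat ltnS.
have H3 n x : `|h_ n x| <= `|h x|.
  by rewrite /h_ patchE; case: ifP => // _; rewrite normr0.
have [_ c] := @Rintegral_dct _ (measurableTypeR R) R leb h_ h (fun x => `|h x|)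
  H1 H2 H3 (integrable_norm ih).
have c0 : Rintegral leb setT (h_ n) @[n --> \oo] --> (0 : R).
  (* Twice the constant of [gw_decay] for the exponent [k+1], once for each end of the interval. *)
  pose K : R := k.+2`!%:R * expR 2 + k.+2`!%:R * expR 2.
  have bnd n : `|Rintegral leb setT (h_ n)| <= K / n.+1%:R.
    have -> : Rintegral leb setT (h_ n) = Rintegral leb `[- n.+1%:R, n.+1%:R]%classic h.
      by rewrite [RHS]Rintegral_mkcond.
    pose F (x : R) := x ^+ k.+1 * gw x.
    have dgw (x : R) : is_derive x 1 gw (- x * gw x).
      have dsq := is_derive_mul (is_derive_id x 1) (is_derive_lin (- 2^-1) x).
      have := @is_derive1_comp R expR (fun t : R => t * (- 2^-1 * t)) x _ _ (is_derive_expR _) dsq.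
      move=> dd; apply: (is_deriveE dd) => [s|].
        by rewrite /= /gw; congr expR; field.
      have -> : x * (- 2^-1 * x) = - (x ^+ 2 / 2) by field.
      by rewrite /gw mulrC; congr (_ * _); field.
    have dF (x : R) : is_derive x 1 F (h x).
      have dp : is_derive x 1 (fun x : R => x ^+ k.+1) (k.+1%:R * x ^+ k).
        apply: (is_deriveE (is_derive_mul (is_derive_cst (k.+1`!%:R : R) x 1)
          (is_derive_powS k x))) => [t|].
          by rewrite /= mulrCA mulfV ?mulr1// pnatr_eq0 -lt0n fact_gt0.
        rewrite /= mul0r add0r factS natrM -mulrA; congr (_ * _).
        by rewrite mulrCA mulfV ?mulr1// pnatr_eq0 -lt0n fact_gt0.
      apply: (is_deriveE (is_derive_mul dp (dgw x))) => //.
      by rewrite /h !exprS; ring.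
    have cgw : continuous gw.
      move=> x; apply: differentiable_continuous.
      by apply/derivable1_diffP; apply: ex_derive.
    have cF : continuous F.
      move=> x; apply: differentiable_continuous.
      by apply/derivable1_diffP; apply: ex_derive.
    have ch : continuous h.
      have cp j : continuous ((fun x : R => x ^+ j) * gw)%R.
        by move=> x; apply: continuousM; [exact: exprn_continuous|exact: cgw].
      have c1 : continuous ((cst k.+1%:R : R -> R) * ((fun x : R => x ^+ k) * gw) - ((fun x : R => x ^+ k.+2) * gw))%R.
        move=> x; apply: continuousB; last exact: cp.
        by apply: continuousM; [exact: cst_continuous|exact: cp].
      exact: c1.
    have nn : (- n.+1%:R : R) < n.+1%:R by rewrite gtrN// ltr0n.
    rewrite /Rintegral (@continuous_FTC2 _ h F)//.
    + rewrite -EFinB/= /F.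
      have gwN : gw (- n.+1%:R) = gw n.+1%:R by rewrite /gw sqrrN.
      rewrite gwN exprNn -mulrA.
      apply: le_trans (ler_normB _ _) _.
      have p0 : 0 <= n.+1%:R ^+ k.+1 * gw n.+1%:R by rewrite mulr_ge0 ?exprn_ge0 ?gw_ge0.
      rewrite [X in _ + X](_ : _ = n.+1%:R ^+ k.+1 * gw n.+1%:R); last first.
        by rewrite normrM normrX normrN1 expr1n mul1r ger0_norm.
      rewrite ger0_norm// /K mulrDl.
      by apply: lerD; exact: gw_decay.
    + exact: continuous_subspaceT.
    + split; first by move=> x _; apply: ex_derive.
      * by apply: cvg_at_right_filter; exact: cF.
      * by apply: cvg_at_left_filter; exact: cF.
    + by move=> x _; rewrite derive1E; exact: derive_val.
  apply/cvgr0Pnorm_le => e e0.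
  exists (Num.truncn (K / e)) => // n /= nK.
  apply: le_trans (bnd n) _; rewrite ler_pdivrMr ?ltr0n// mulrC -ler_pdivrMr//.
  apply: ltW; apply: lt_le_trans (truncnS_gt _) _.
  by rewrite ler_nat ltnS.
exact: cvg_unique c c0.
Qed.

Lemma gmom_odd k : odd k -> gmom k = 0.
Proof.
move=> ok; rewrite /gmom /Rintegral.
pose f (x : R) := (x ^+ k * gw x)%:E.
have mf : measurable_fun setT f by exact: (measurable_int leb (integrable_gw_pow k)).
have fin := integrable_fin_num measurableT (integrable_gw_pow k).
have N10 : (-1 : R) != 0 by rewrite oppr_eq0 oner_eq0.
have E : (\int[leb]_x f x = - \int[leb]_x f x)%E.
  rewrite [in RHS]integralE [in LHS]integralE.
  have p : (\int[leb]_x f^\+ x = \int[leb]_x f^\- x)%E.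
    have := ge0_integral_affine1 0 N10 (measurable_funepos mf) (fun x => funepos_ge0 f x).
    rewrite normrN1 invr1 mul1e => <-; apply: eq_integral => x _.
    rewrite add0r mulN1r funeposE funenegE /f; congr (maxe _ _).
    by rewrite exprNn -signr_odd ok expr1 mulN1r mulNr /gw sqrrN.
  have nf := integrable_neg_fin_num measurableT (integrable_gw_pow k).
  by rewrite p subee ?oppe0.
have {E} : (\int[leb]_x (x ^+ k * gw x)%:E = - \int[leb]_x (x ^+ k * gw x)%:E)%E by exact: E.
rewrite -(fineK fin) => -[]; set a := fine _ => aE.
by rewrite /=; lra.
Qed.

End gaussian.

Section product_integrals.
Context d1 d2 (T1 : measurableType d1) (T2 : measurableType d2) (R : realType).
Variables (m1 : {sigma_finite_measure set T1 -> \bar R})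
  (m2 : {sigma_finite_measure set T2 -> \bar R}).
Local Notation C := R[i].
Local Notation Re := complex.Re.
Local Notation Im := complex.Im.

Lemma integrable_prod2 (f1 : T1 -> R) (f2 : T2 -> R) :
  m1.-integrable setT (EFin \o f1) -> m2.-integrable setT (EFin \o f2) ->
  (m1 \x m2)%E.-integrable setT (fun p => (f1 p.1 * f2 p.2)%:E) /\
  Rintegral (m1 \x m2)%E setT (fun p => f1 p.1 * f2 p.2) =
  Rintegral m1 setT f1 * Rintegral m2 setT f2.
Proof.
move=> i1 i2.
have mf1 : measurable_fun setT f1 by exact/measurable_EFinP/(measurable_int m1 i1).
have mf2 : measurable_fun setT f2 by exact/measurable_EFinP/(measurable_int m2 i2).
have mf : measurable_fun setT (fun p : T1 * T2 => (f1 p.1 * f2 p.2)%:E).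
  apply/measurable_EFinP; apply: measurable_funM.
    exact: (measurableT_comp mf1 measurable_fst).
  exact: (measurableT_comp mf2 measurable_snd).
have fin1 := integrable_fin_num measurableT (integrable_abse i1).
have fin2 := integrable_fin_num measurableT (integrable_abse i2).
have int12 : (m1 \x m2)%E.-integrable setT (fun p => (f1 p.1 * f2 p.2)%:E).
  apply/integrable12ltyP => //.
  rewrite (eq_integral (fun x => (abse (f1 x)%:E * \int[m2]_y (abse (f2 y)%:E))%E)).
    rewrite ge0_integralZr//.
    - by rewrite -(fineK fin1) -(fineK fin2) -EFinM ltry.
    - by apply/measurable_EFinP; apply: measurableT_comp.
    - exact: integral_ge0.
  move=> x _; rewrite -ge0_integralZl//.
  - by apply: eq_integral => y _; rewrite EFinM abseM.
  - by apply/measurable_EFinP; apply: measurableT_comp.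
split => //; rewrite /Rintegral -integral12_prod_meas1// /fubini_F/=.
rewrite (eq_integral (fun x => ((f1 x)%:E * (Rintegral m2 setT f2)%:E)%E)).
  rewrite integralZr// /Rintegral fineM//; exact: integrable_fin_num.
move=> x _; under eq_integral do rewrite EFinM.
by rewrite integralZl// /Rintegral fineK//; exact: integrable_fin_num.
Qed.

Lemma cint_prod2 (f1 : T1 -> C) (f2 : T2 -> C) :
  cintegrable m1 f1 -> cintegrable m2 f2 ->
  cintegrable (m1 \x m2)%E (fun p => f1 p.1 * f2 p.2) /\
  cint (m1 \x m2)%E (fun p => f1 p.1 * f2 p.2) = cint m1 f1 * cint m2 f2.
Proof.
move=> [r1 i1] [r2 i2].
have [irr Err] := integrable_prod2 r1 r2.
have [iri Eri] := integrable_prod2 r1 i2.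
have [iir Eir] := integrable_prod2 i1 r2.
have [iii Eii] := integrable_prod2 i1 i2.
split.
  split.
  - by under eq_fun do rewrite cReM EFinB; exact: integrableB.
  - by under eq_fun do rewrite cImM EFinD; exact: integrableD.
apply: ceqP; rewrite ?cReM ?cImM/=.
- under [LHS]eq_Rintegral do rewrite cReM.
  by rewrite RintegralB// Err Eii.
- under [LHS]eq_Rintegral do rewrite cImM.
  by rewrite RintegralD// Eri Eir.
Qed.

End product_integrals.

Section lebn_product.
Context (R : realType).
Local Notation leb := (@lebesgue_measure R).
Local Notation C := R[i].
Local Notation Re := complex.Re.
Local Notation Im := complex.Im.

Lemma lebn0T : lebn R 0 setT = 1%E.
Proof.
rewrite -(setIT setT) -integral_indic// integral_lebn//=; first by rewrite indicT.
by apply/measurable_EFinP; exact: measurable_indic.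
Qed.

Lemma cint_lebnS n (f : n.+1.-tuple R -> C) : cmeas f ->
  cintegrable (leb \x lebn R n)%E (fun p => f (cons_tuple p.1 p.2)) ->
  cintegrable (lebn R n.+1) f /\
  cint (lebn R n.+1) f = cint (leb \x lebn R n)%E (fun p => f (cons_tuple p.1 p.2)).
Proof.
move=> [mr mi] [ir ii]; split.
  split.
  - by apply/integrable_lebnS => //; exact/measurable_EFinP.
  - by apply/integrable_lebnS => //; exact/measurable_EFinP.
apply: ceqP; rewrite /= /Rintegral integral_lebnS//; exact/measurable_EFinP.
Qed.

Lemma cint_lebn_prod n (f : 'I_n -> R -> C) : (forall i, cintegrable leb (f i)) ->
  cintegrable (lebn R n) (fun x => \prod_(i < n) f i (tnth x i)) /\
  cint (lebn R n) (fun x => \prod_(i < n) f i (tnth x i)) = \prod_(i < n) cint leb (f i).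
Proof.
elim: n => [|n IH] in f * => hf.
  rewrite (_ : (fun x => _) = fun=> 1); last by apply/funext => x; rewrite big_ord0.
  rewrite big_ord0; split.
    split; apply/integrableP; split => //=.
    - under eq_integral do rewrite /= normr1.
      by rewrite integral_cst//= lebn0T mule1 ltry.
    - under eq_integral do rewrite /= normr0.
      by rewrite integral0 ltry.
  have l : fine (lebn R 0 setT) = 1 by rewrite lebn0T.
  apply: ceqP => /=; first by rewrite Rintegral_cst// mul1r; exact: l.
  by rewrite Rintegral_cst// mul0r.
have mf i : cmeas (f i) by exact: cintegrable_meas (hf i).
have mF : cmeas (fun x : n.+1.-tuple R => \prod_(i < n.+1) f i (tnth x i)).
  apply: cmeas_prod => i; have [mr mi] := mf i; split.
  - exact: (measurableT_comp mr (@measurable_tnth _ _ _ i)).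
  - exact: (measurableT_comp mi (@measurable_tnth _ _ _ i)).
have [IHi IHE] := IH (fun i => f (lift ord0 i)) (fun i => hf _).
have [pi pE] := cint_prod2 (hf ord0) IHi.
have E : (fun p : R * n.-tuple R => \prod_(i < n.+1) f i (tnth (cons_tuple p.1 p.2) i)) =
    (fun p => f ord0 p.1 * \prod_(i < n) f (lift ord0 i) (tnth p.2 i)).
  apply/funext => p; rewrite big_ord_recl tnth0; congr (_ * _).
  by apply: eq_bigr => i _; rewrite tnthS.
have [|i1 ->] := @cint_lebnS n (fun x => \prod_(i < n.+1) f i (tnth x i)) mF.
  by rewrite E.
by split => //; rewrite E pE IHE big_ord_recl.
Qed.

End lebn_product.

Section gaussian_ft.
Context (R : realType).
Local Notation leb := (@lebesgue_measure R).
Local Notation C := R[i].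
Local Notation Re := complex.Re.
Local Notation Im := complex.Im.

Lemma gmom_even k : gmom R k.*2 = (k.*2)`!%:R / (2 ^+ k * k`!%:R) * Num.sqrt (2 * pi).
Proof.
elim: k => [|k IH]; first by rewrite double0 gmom0 fact0 expr0 mulr1 divr1 mul1r.
rewrite doubleS gmom_rec IH mulrA; congr (_ * _).
have e : (k.*2.+2%:R : R) = 2 * k.+1%:R by rewrite -doubleS -mul2n natrM.
have f1 : (k.+1%:R : R) != 0 by rewrite pnatr_eq0.
have f2 : (k`!%:R : R) != 0 by rewrite pnatr_eq0 -lt0n fact_gt0.
have f3 : (2 ^+ k : R) != 0 by rewrite expf_neq0.
rewrite (factS k.*2.+1) (factS k.*2) (factS k) !natrM exprS e.
have H (p q r u v : R) : p != 0 -> q != 0 -> r != 0 ->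
    u * (v / (r * q)) = 2 * p * (u * v) / (2 * r * (p * q)).
  by move=> p0 q0 r0; field; rewrite p0 q0 r0.
rewrite (mulrA (2 * _)) -(mulrA (2 * _)); exact: H.
Qed.

(** The exponential is expanded and integrated term by term against the moments. Odd moments vanish
    and even ones rebuild the exponential series of [- t^2/2]; accordingly partial sums of length
    [2N] are compared with those of length [N]. *)
Lemma gaussian_ft (t : R) :
  cintegrable leb (fun x => cexp (rc (t * x) * ci) * rc (gw x)) /\
  cint leb (fun x => cexp (rc (t * x) * ci) * rc (gw x)) = rc (Num.sqrt (2 * pi) * gw t).
Proof.
pose f_ (n : nat) (x : R) : C := (rc (n`!%:R^-1) * (rc (t * x) * ci) ^+ n) * rc (gw x).
pose G (x : R) := `|x| ^+ 0 * expR (`|t| * `|x|) * gw x.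
have mtx : measurable_fun (setT : set (measurableTypeR R)) (fun x : R => t * x) by exact: measurable_funM.
have mz : cmeas (fun x : measurableTypeR R => rc (t * x) * ci).
  by apply: cmeasM; [exact: cmeas_rc|exact: cmeas_cst].
have mgw : cmeas (fun x : measurableTypeR R => rc (gw x)) by apply: cmeas_rc; exact: measurable_gw.
have mf n : cmeas (f_ n : measurableTypeR R -> C).
  apply: cmeasM => //; apply: cmeasM; first exact: cmeas_cst.
  exact: cmeasX.
have cf x : csum_to (fun n => f_ n x) (cexp (rc (t * x) * ci) * rc (gw x)).
  have h := csum_toZ (rc (gw x)) (csum_to_cexp (rc (t * x) * ci)).
  rewrite (mulrC (cexp _)); apply: eq_csum_to h => k.
  by rewrite /f_ [RHS]mulrC.
have bf n x : cmod (f_ n x) = n`!%:R^-1 * (`|t| * `|x|) ^+ n * gw x.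
  rewrite /f_ !cmodM !cmod_rc cmodX cmodM cmod_rc cmod_ci mulr1 normrM.
  by rewrite (ger0_norm (gw_ge0 x)) (@ger0_norm _ n`!%:R^-1) ?invr_ge0.
have bS N x : cmod (\sum_(n < N) f_ n x) <= G x.
  apply: le_trans (cmod_sum _ _ _) _.
  under eq_bigr do rewrite bf.
  rewrite -mulr_suml /G expr0 mul1r ler_wpM2r ?gw_ge0//.
  by apply: sum_exp_coeff_le; rewrite mulr_ge0.
have iG : leb.-integrable setT (EFin \o G) by apply: integrable_gw_dom.
have if_ n : cintegrable leb (f_ n).
  apply: (@cintegrable_le _ (measurableTypeR R) R leb (f_ n) G (mf n) _ iG) => x.
  rewrite bf /G expr0 mul1r ler_wpM2r ?gw_ge0//.
  rewrite mulrC ler_pdivrMr ?ltr0n ?fact_gt0//.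
  have h : 0 <= `|t| * `|x : R| by rewrite mulr_ge0.
  by rewrite [leRHS]mulrC; exact: (exprn_le_expR n h).
have [iF sF] := csum_to_cint mf cf bS iG if_.
split => //.
have E n : cint leb (f_ n) = rc (n`!%:R^-1 * t ^+ n * gmom R n) * ci ^+ n.
  have -> : f_ n = fun x => (rc (n`!%:R^-1 * t ^+ n) * ci ^+ n) * rc (x ^+ n * gw x).
    apply/funext => x; rewrite /f_ exprMn -rcX exprMn !rcM; ring.
  have ir : cintegrable leb (fun x => rc (x ^+ n * gw x)).
    by split => /=; [exact: integrable_gw_pow|exact: integrable0].
  rewrite cintZ// (_ : cint leb _ = rc (gmom R n)); first by rewrite !rcM; ring.
  by apply: ceqP => //=; rewrite /Rintegral integral0.
have s2 : csum_to (fun k => rc (Num.sqrt (2 * pi)) * (rc (k`!%:R^-1) * (rc (- (t ^+ 2 / 2))) ^+ k))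
    (rc (Num.sqrt (2 * pi)) * cexp (rc (- (t ^+ 2 / 2)))).
  by apply: csum_toZ; exact: csum_to_cexp.
have -> : rc (Num.sqrt (2 * pi) * gw t) = rc (Num.sqrt (2 * pi)) * cexp (rc (- (t ^+ 2 / 2))).
  by rewrite rcM cexp_rc.
have par N : \sum_(n < N.*2) cint leb (f_ n) = \sum_(k < N)
    rc (Num.sqrt (2 * pi)) * (rc (k`!%:R^-1) * (rc (- (t ^+ 2 / 2))) ^+ k).
  elim: N => [|N IH]; first by rewrite !big_ord0.
  rewrite doubleS !big_ord_recr/= IH -addrA; congr (_ + _).
  rewrite !E (@gmom_odd _ N.*2.+1) ?mulr0 ?rc0 ?mul0r ?addr0; last by rewrite /= odd_double.
  have -> : ci ^+ N.*2 = rc ((-1) ^+ N) :> C.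
    rewrite -mul2n exprM (_ : ci ^+ 2 = rc (-1)) ?rcX//.
    by apply: ceqP; rewrite expr2 ?cReM ?cImM/=; ring.
  rewrite -!rcX -!rcM; congr rc; rewrite gmom_even (exprNn (t ^+ 2 / 2)) expr_div_n -mul2n (exprM t).
  have f1 : ((2 * N)`!%:R : R) != 0 by rewrite pnatr_eq0 -lt0n fact_gt0.
  have f2 : (N`!%:R : R) != 0 by rewrite pnatr_eq0 -lt0n fact_gt0.
  have f3 : (2 ^+ N : R) != 0 by rewrite expf_neq0.
  set a := (2 * N)`!%:R in f1 *; set b := N`!%:R in f2 *.
  set c := 2 ^+ N in f3 *.
  by field; rewrite f1 f2 f3.
case: sF => sFr sFi; case: s2 => s2r s2i.
have dbl : (fun N => N.*2) @ \oo --> \oo.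
  apply/cvgnyPge => N; near=> n; apply: (@leq_trans n); last by rewrite -addnn leq_addr.
  by near: n; exact: nbhs_infty_ge.
apply: (@csum_to_unique R (fun k => rc (Num.sqrt (2 * pi)) *
    (rc (k`!%:R^-1) * (rc (- (t ^+ 2 / 2))) ^+ k)) _ _ _ (conj s2r s2i)); split.
- rewrite (_ : (fun N => _) = (fun N => Re (\sum_(n < N) cint leb (f_ n))) \o (fun N => N.*2)).
    exact: (cvg_comp _ _ dbl sFr).
  by apply/funext => N; rewrite /= par.
- rewrite (_ : (fun N => _) = (fun N => Im (\sum_(n < N) cint leb (f_ n))) \o (fun N => N.*2)).
    exact: (cvg_comp _ _ dbl sFi).
  by apply/funext => N; rewrite /= par.
Unshelve. all: by end_near. Qed.

End gaussian_ft.

(** * Harmonic polynomials *)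

Section harmonic_algebra.
Context (R : realType) (d : nat).
Local Notation C := R[i].
Local Notation P := {mpoly R[i][d]}.
Local Notation Xv i := (mpolyX R[i] U_(i)%MM : P).
Local Notation D := (@mderiv d R[i]).
Local Notation lap := (@laplacian R d).
Local Notation harm := (@homog_harmonic R d).
Implicit Types (p q : P) (i : 'I_d) (T : P -> C).

(** Linearity is a predicate on plain functions, so that [Pn] can recurse on [fun p => T (Xv i * p)]
    without rebuilding a bundled linear map. *)
Definition lin T := (forall p q, T (p + q) = T p + T q) /\ (forall c p, T (c *: p) = c * T p).

Lemma lin0 T : lin T -> T 0 = 0.
Proof. by move=> [_ h]; rewrite -[X in T X](scale0r (0 : P)) h mul0r. Qed.

Lemma lin_sum T I (r : seq I) (Q : pred I) (F : I -> P) : lin T ->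
  T (\sum_(i <- r | Q i) F i) = \sum_(i <- r | Q i) T (F i).
Proof.
move=> lT; apply: (big_morph T) => [p q|]; first by case: lT.
exact: lin0.
Qed.

Lemma linM T p : lin T -> lin (fun q => T (p * q)).
Proof.
move=> [hD hZ]; split => [q r|c q]; first by rewrite mulrDr hD.
by rewrite -scalerAr hZ.
Qed.

Lemma D_X i j : D i (Xv j) = (i == j)%:R.
Proof.
rewrite mderivX mnm1E eq_sym; case: eqVneq => [->|_].
  rewrite scale1r -mpolyX0; congr ('X_[_]); apply/mnmP => k; by rewrite mnmBE subnn mnm0E.
by rewrite scale0r.
Qed.

Lemma D_XM i j p : D i (Xv j * p) = (i == j)%:R * p + Xv j * D i p.
Proof. by rewrite mderivM D_X. Qed.

Lemma D_sum i I (r : seq I) (Q : pred I) (F : I -> P) :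
  D i (\sum_(k <- r | Q k) F k) = \sum_(k <- r | Q k) D i (F k).
Proof. exact: linear_sum. Qed.

Lemma homogP n p : (forall m, m \in msupp p -> mdeg m = n) <-> p \is n.-homog.
Proof. by split => [h|/dhomogP h]; [apply/dhomogP|]. Qed.

Lemma D_homog i n p : p \is n.-homog -> D i p \is n.-1.-homog.
Proof.
move=> /dhomogP hp; apply/dhomogP => m; rewrite mcoeff_msupp mcoeff_mderiv => h.
have : (m + U_(i))%MM \in msupp p.
  by rewrite mcoeff_msupp; apply: contraNneq h => ->; rewrite mul0rn.
by move=> /hp /=; rewrite mdegD mdeg1 addn1 => <-.
Qed.

Lemma D_homog0 i p : p \is 0.-homog -> D i p = 0.
Proof.
move=> /dhomogP hp; apply/mpolyP => m; rewrite mcoeff0 mcoeff_mderiv.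
case: (boolP ((m + U_(i))%MM \in msupp p)) => [/hp /=|].
  by rewrite mdegD mdeg1 addn1.
by rewrite mcoeff_msupp negbK => /eqP ->; rewrite mul0rn.
Qed.

Lemma homog0C p : p \is 0.-homog -> p = (p@_0%MM)%:MP.
Proof.
move=> /dhomogP hp; apply/mpolyP => m; rewrite mcoeffC.
case: (eqVneq m 0%MM) => [->|m0]; first by rewrite mulr1.
rewrite mulr0; apply/eqP; rewrite mcoeff_eq0.
by apply: contra m0 => /hp /= /eqP; rewrite mdeg_eq0.
Qed.

Lemma euler n p : p \is n.-homog -> \sum_i Xv i * D i p = n%:R *: p.
Proof.
move=> /dhomogP hp.
rewrite [in RHS](mpolyE p) scaler_sumr.
transitivity (\sum_i Xv i * D i (\sum_(m <- msupp p) p@_m *: 'X_[m])).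
  by rewrite -mpolyE.
transitivity (\sum_i \sum_(m <- msupp p) ((m i)%:R * p@_m) *: 'X_[m] : P).
  apply: eq_bigr => i _; rewrite D_sum mulr_sumr; apply: eq_bigr => m _.
  rewrite mderivZ mderivX -!scalerAr scalerA -mpolyXD mulrC.
  case: (posnP (m i)) => [->|mi0]; first by rewrite !mul0r !scale0r.
  congr (_ *: 'X_[_]); apply/mnmP => k; rewrite mnmDE mnmBE mnm1E.
  by case: eqVneq => [<-|_]; rewrite ?subn0// subnKC.
rewrite exchange_big/= big_seq [RHS]big_seq; apply: eq_bigr => m ms.
rewrite -scaler_suml -mulr_suml scalerA; congr (_ * _ *: _).
by rewrite -(hp m ms) /= mdegE natr_sum.
Qed.

Lemma lapD p q : lap (p + q) = lap p + lap q.
Proof. by rewrite /laplacian -big_split; apply: eq_bigr => i _; rewrite !mderivD. Qed.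

Lemma lapZ c p : lap (c *: p) = c *: lap p.
Proof. by rewrite /laplacian scaler_sumr; apply: eq_bigr => i _; rewrite !mderivZ. Qed.

Lemma lap_D i p : lap (D i p) = D i (lap p).
Proof.
rewrite /laplacian D_sum; apply: eq_bigr => k _.
by rewrite !(mderiv_comm i k).
Qed.

Lemma harm_D i n p : harm n p -> harm n.-1 (D i p).
Proof.
move=> [/homogP hp lp]; split; first by apply/homogP; exact: D_homog.
by rewrite lap_D lp mderiv0.
Qed.

Lemma harmZ n c p : harm n p -> harm n (c *: p).
Proof.
move=> [/homogP hp lp]; split; first by apply/homogP; exact: dhomogZ.
by rewrite lapZ lp scaler0.
Qed.

Definition r2 : P := \sum_i Xv i * Xv i.

Lemma X_homog i : Xv i \is 1.-homog.
Proof. by rewrite dhomogX /= mdeg1. Qed.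

Lemma r2_homog : r2 \is 2.-homog.
Proof. by rewrite /r2; apply: rpred_sum => i _; apply: (@dhomogM _ _ _ 1 _ 1); exact: X_homog. Qed.

Lemma r2X_homog l n p : p \is n.-homog -> r2 ^+ l * p \is (2 * l + n).-homog.
Proof. by move=> hp; apply: dhomogM => //; apply: dhomogMn; exact: r2_homog. Qed.

Lemma D_r2 i : D i r2 = 2%:R *: Xv i.
Proof.
rewrite /r2 D_sum (bigD1 i)//= big1 ?addr0.
  by rewrite D_XM D_X eqxx mul1r mulr1 scaler_nat mulr2n.
by move=> k ki; rewrite D_XM D_X eq_sym (negbTE ki) mul0r mulr0 addr0.
Qed.

Lemma lap_r2 n p : p \is n.-homog ->
  lap (r2 * p) = r2 * lap p + (2 * d + 4 * n)%:R *: p.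
Proof.
move=> hp; rewrite /laplacian.
have E i : D i (D i (r2 * p)) = r2 * D i (D i p) + (2%:R *: p + 4%:R *: (Xv i * D i p)).
  rewrite !mderivM !mderivD !mderivM D_r2 mderivZ D_X eqxx.
  rewrite -!scalerAl mul1r -!mul_mpolyC !mpolyC_nat; ring.
under eq_bigr do rewrite E.
rewrite big_split/= -mulr_sumr; congr (_ + _).
rewrite big_split/= sumr_const card_ord -scaler_sumr (euler hp) scalerA.
by rewrite -scaler_nat scalerA -scalerDl -!natrM -natrD mulnC.
Qed.

Lemma lap_r2X l n p : p \is n.-homog ->
  lap (r2 ^+ l.+1 * p) = (2 * l.+1 * (d + 2 * n + 2 * l))%:R *: (r2 ^+ l * p) +
    r2 ^+ l.+1 * lap p.
Proof.
move=> hp; elim: l => [|l IH].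
  rewrite expr1 expr0 mul1r (lap_r2 hp) addrC; congr (_%:R *: _ + _); lia.
rewrite exprS -mulrA (lap_r2 (r2X_homog l.+1 hp)) IH mulrDr -scalerAr.
rewrite [r2 * (r2 ^+ l * p)]mulrA -exprS [r2 * (r2 ^+ l.+1 * _)]mulrA -exprS.
rewrite addrAC -scalerDl -natrD; congr (_%:R *: _ + _); lia.
Qed.

(* [Pn n T] is the polynomial [xi |-> T (<xi, x>^n)], [T] acting on polynomials in [x]. *)
Fixpoint Pn n T : P := match n with
  | 0 => (T 1)%:MP
  | n'.+1 => \sum_i Xv i * Pn n' (fun p => T (Xv i * p))
  end.

Lemma Pn_homog n T : Pn n T \is n.-homog.
Proof.
elim: n T => [|n IH] T /=.
  by rewrite mpolyC_eq0 || (rewrite -mul_mpolyC1 || idtac); rewrite -[_%:MP]mulr1 mul_mpolyC; apply: dhomogZ; exact: dhomog1.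
by apply: rpred_sum => i _; apply: (@dhomogM _ _ _ 1 _ n); [exact: X_homog|exact: IH].
Qed.

Lemma D_Pn i n T : D i (Pn n.+1 T) = n.+1%:R *: Pn n (fun p => T (Xv i * p)).
Proof.
elim: n T => [|n IH] T.
  rewrite /= D_sum (bigD1 i)//= big1 ?addr0.
    by rewrite D_XM eqxx mul1r mderivC mulr0 addr0 scale1r.
  by move=> k ki; rewrite D_XM eq_sym (negbTE ki) mul0r mderivC mulr0 addr0.
have -> : Pn n.+2 T = \sum_k Xv k * Pn n.+1 (fun p => T (Xv k * p)) by [].
rewrite D_sum.
under eq_bigr do rewrite D_XM IH.
have E1 (F : 'I_d -> P) : \sum_k (i == k)%:R * F k = F i.
  rewrite (bigD1 i)//= big1 ?addr0 ?eqxx ?mul1r// => k ki.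
  by rewrite eq_sym (negbTE ki) mul0r.
rewrite big_split E1 -[n.+2%:R]nat1r scalerDl scale1r; congr (_ + _).
rewrite scaler_sumr; apply: eq_bigr => k _; rewrite scalerAr; congr (_ * (_ *: Pn n _)).
by apply/funext => p; rewrite mulrCA.
Qed.

Lemma Pn_sum n I (r : seq I) (F : I -> P -> C) :
  Pn n (fun p => \sum_(k <- r) F k p) = \sum_(k <- r) Pn n (F k).
Proof.
elim: n F => [|n IH] F /=.
  by apply: (big_morph (@mpolyC d R[i])); [exact: mpolyCD|exact: mpolyC0].
under eq_bigr do rewrite IH mulr_sumr.
by rewrite exchange_big.
Qed.

(** Differentiating [<xi, x>^n] twice in [xi] and summing brings out [<x, x>]. For a functional that
    ignores the factor [r2], the polynomials [Pn] therefore satisfy [lap p_k = k (k-1) p_(k-2)]. *)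
Lemma lap_Pn n T : lin T ->
  lap (Pn n.+2 T) = (n.+2 * n.+1)%:R *: Pn n (fun p => T (r2 * p)).
Proof.
move=> lT; rewrite /laplacian.
under eq_bigr do rewrite D_Pn mderivZ D_Pn scalerA -natrM.
rewrite -scaler_sumr -Pn_sum; congr (_ *: Pn n _); apply/funext => p.
rewrite /r2 mulr_suml lin_sum//; apply: eq_bigr => i _.
by rewrite mulrA.
Qed.

Lemma lap_Pn01 n T : (n < 2)%N -> lap (Pn n T) = 0.
Proof.
rewrite /laplacian; case: n => [|[|//]] _; apply: big1 => i _.
  by rewrite /= mderivC mderiv0.
by rewrite D_Pn mderivZ /= mderivC scaler0.
Qed.

Definition linform (v : 'I_d -> C) : P := \sum_i v i *: Xv i.

Lemma meval_Pn n T v : lin T -> meval v (Pn n T) = T (linform v ^+ n).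
Proof.
elim: n T => [|n IH] T lT; first by rewrite /= mevalC expr0.
rewrite /= raddf_sum/= exprS /linform mulr_suml lin_sum//.
apply: eq_bigr => i _; rewrite mevalM mevalXU IH; last exact: linM.
by rewrite -scalerAl lT.2.
Qed.

End harmonic_algebra.

(** * Funk-Hecke theory from Gaussian integration by parts, for abstract functionals *)

Section gaussian_sphere.
Context (R : realType) (d : nat) (hd : (2 <= d)%N).
Local Notation C := R[i].
Local Notation P := {mpoly R[i][d]}.
Local Notation Xv i := (mpolyX R[i] U_(i)%MM : P).
Local Notation D := (@mderiv d R[i]).
Local Notation lap := (@laplacian R d).
Local Notation harm := (@homog_harmonic R d).
Local Notation r2 := (r2 R d).
(* Chosen so that [\sum_l bz n l r2^l p_(n-2l)] is harmonic as soon as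
   [lap p_k = k (k-1) p_(k-2)]. *)
Fixpoint bz n l : R := match l with
  | 0 => 1
  | l'.+1 => - bz n l' * ((n - 2 * l') * (n - 2 * l').-1)%:R /
      (2 * l'.+1 * (d + 2 * (n - 2 * l'.+1) + 2 * l'))%:R
  end.

(** Successive coefficients have ratio at most [n / (l+1)] in modulus. Their moduli thus sum to at
    most [exp n], which bounds the zonal polynomials on the sphere. *)
Lemma bz_bound n l : `|bz n l| <= n%:R ^+ l / l`!%:R.
Proof.
elim: l => [|l IH]; first by rewrite /= normr1 expr0 fact0 divr1.
have -> : n%:R ^+ l.+1 / l.+1`!%:R = (n%:R ^+ l / l`!%:R) * (n%:R / l.+1%:R) :> R.
  by rewrite exprSr factS natrM invfM [_^-1 * _^-1]mulrC mulrACA.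
have -> : bz n l.+1 = - bz n l * (((n - 2 * l) * (n - 2 * l).-1)%:R /
    (2 * l.+1 * (d + 2 * (n - 2 * l.+1) + 2 * l))%:R).
  by rewrite mulrA.
have l0 : (0 : R) < l.+1%:R by rewrite ltr0n.
have h : (((n - 2 * l) * (n - 2 * l).-1)%:R : R) / (2 * l.+1 * (d + 2 * (n - 2 * l.+1) + 2 * l))%:R
    <= n%:R / l.+1%:R.
  rewrite ler_pdivrMr; last by rewrite ltr0n; nia.
  rewrite mulrAC ler_pdivlMr// -!natrM ler_nat.
  case: (leqP (2 * l.+1) n) => hl; last first.
    have -> : ((n - 2 * l) * (n - 2 * l).-1 = 0)%N by nia.
    by rewrite mul0n.
  have -> : ((n - 2 * l) * (n - 2 * l).-1 = (n - 2 * l) * (n - 2 * l - 1))%N by nia.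
  by nia.
rewrite normrM normrN; apply: ler_pM => //.
by rewrite ger0_norm// divr_ge0.
Qed.

(* [G] stands for the integral against [exp(-|x|^2/2)], [L] for the integral over the
   sphere and [rad n] for the radial integral relating them in degree [n]. *)
Variables (G L : P -> C) (rad : nat -> C).
Hypotheses (linG : lin G) (linL : lin L).
Hypothesis GX : forall i p, G (Xv i * p) = G (D i p).
Hypothesis Lr2 : forall p, L (r2 * p) = L p.
Hypothesis Grad : forall n p, p \is n.-homog -> G p = rad n * L p.
Hypothesis rad0 : forall n, rad n != 0.
Hypothesis G10 : G 1 != 0.

Lemma Lr2X l p : L (r2 ^+ l * p) = L p.
Proof. by elim: l => [|l IH]; rewrite ?expr0 ?mul1r// exprS -mulrA Lr2. Qed.

(** By Euler's identity [j q] is the sum of the [X_i D_i q], and integration by parts turns its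
    image under [G] into that of the Laplacian of [q]. *)
Lemma G_harm0 j q : (0 < j)%N -> harm j q -> G q = 0.
Proof.
move=> j0 [/homogP hq lq].
have := congr1 G (euler hq); rewrite lin_sum// linG.2.
under eq_bigr do rewrite GX.
rewrite -lin_sum// -/(laplacian q) lq lin0// => /esym/eqP.
by rewrite mulf_eq0 pnatr_eq0 eqn0Ngt j0/= => /eqP.
Qed.

(** Euler's identity for [p] and one integration by parts replace the pair [(p, q)] by
    [(D_i D_i p, q)] and [(D_i p, D_i q)]. The degree of the first factor drops and stays below that
    of the second, so the induction ends with a constant [p]. *)
Lemma G_orth k j p q : p \is k.-homog -> harm j q -> (k < j)%N -> G (p * q) = 0.
Proof.
elim/ltn_ind: k j p q => -[|k] IH j p q hp hq kj.
  by rewrite (homog0C hp) mul_mpolyC linG.2 (G_harm0 kj hq) mulr0.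
have : k.+1%:R * G (p * q) = 0; last first.
  by move/eqP; rewrite mulf_eq0 pnatr_eq0 => /eqP.
rewrite -linG.2 scalerAl -(euler hp) mulr_suml lin_sum//.
apply: big1 => i _; rewrite -mulrA GX mderivM linG.1.
have hD : D i p \is k.-homog by have := D_homog i hp.
have h1 : G (D i (D i p) * q) = 0.
  by apply: (IH k.-1 _ j) hq _; [lia|exact: D_homog|lia].
have h2 : G (D i p * D i q) = 0.
  by apply: (IH k _ j.-1) hD (harm_D i hq) _; lia.
by rewrite h1 h2 addr0.
Qed.

(** One factor [X_i] of [Pn] is removed by integration by parts. The derivative falls either on [q],
    which contributes the weight [j] through Euler's identity, or on the rest of [Pn], which
    contributes the weight [2m]; together they give the next factor [j + 2m] of the factorial. *)
Lemma G_Pn n : forall j m T q, lin T -> (forall p, T (r2 * p) = T p) ->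
  n = (j + 2 * m)%N -> harm j q ->
  G (Pn n T * q) = n`!%:R / (2 ^+ m * m`!%:R) * T q * G 1.
Proof.
elim/ltn_ind: n => -[|n] IH j m T q lT rT njm hq.
  have [-> j0] : m = 0%N /\ j = 0%N by lia.
  rewrite j0 in hq; case: hq => /homogP hq _.
  rewrite (homog0C hq) /= fact0 expr0 mulr1 divr1 mul1r.
  rewrite -mpolyCM -[_%:MP]mulr1 mul_mpolyC linG.2 -[(q@_0)%:MP]mulr1 mul_mpolyC lT.2.
  by rewrite (mulrC (T 1)).
have lTi i : lin (fun p => T (Xv i * p)) by exact: linM.
have rTi i p : T (Xv i * (r2 * p)) = T (Xv i * p) by rewrite mulrCA rT.
have -> : Pn n.+1 T = \sum_i Xv i * Pn n (fun p => T (Xv i * p)) by [].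
rewrite mulr_suml lin_sum//.
have E i : G (Xv i * Pn n (fun p => T (Xv i * p)) * q) =
    G (D i (Pn n (fun p => T (Xv i * p))) * q) +
    n`!%:R / (2 ^+ m * m`!%:R) * T (Xv i * D i q) * G 1.
  rewrite -mulrA GX mderivM linG.1; congr (_ + _).
  case: j => [|j] in njm hq *.
    have -> : D i q = 0 by apply: D_homog0; apply/homogP; case: hq.
    by rewrite !mulr0 !lin0// mulr0 mul0r.
  have njm' : n = (j + 2 * m)%N by lia.
  exact: (IH n (ltnSn n) j m (fun p => T (Xv i * p)) _ (lTi i) (rTi i) njm' (harm_D i hq)).
under eq_bigr do rewrite E.
rewrite big_split/=.
have -> : \sum_i n`!%:R / (2 ^+ m * m`!%:R) * T (Xv i * D i q) * G 1 =
    n`!%:R / (2 ^+ m * m`!%:R) * (j%:R * T q) * G 1.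
  rewrite -mulr_suml -mulr_sumr -lin_sum// (euler (n := j)) ?lT.2//.
  by apply/homogP; case: hq.
have f2 : (2 ^+ m : C) != 0 by rewrite expf_neq0// pnatr_eq0.
have fm : (m`!%:R : C) != 0 by rewrite pnatr_eq0 -lt0n fact_gt0.
have -> : \sum_i G (D i (Pn n (fun p => T (Xv i * p))) * q) =
    n`!%:R / (2 ^+ m * m`!%:R) * ((2 * m)%:R * T q) * G 1.
  case: n => [|n] in IH E njm *.
    have -> : m = 0%N by lia.
    rewrite muln0 mul0r mulr0 mul0r; apply: big1 => i _.
    by rewrite /= mderivC mul0r lin0.
  (* Summing over [i] brings together two factors [X_i], that is [r2], which [T] does not see. *)
  have -> : \sum_i G (D i (Pn n.+1 (fun p => T (Xv i * p))) * q) =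
     n.+1%:R * G (Pn n T * q).
    rewrite -lin_sum// -mulr_suml -linG.2 scalerAl; congr (G (_ * _)).
    under eq_bigr do rewrite D_Pn.
    rewrite -scaler_sumr -Pn_sum; congr (_ *: Pn n _); apply/funext => p.
    rewrite -[RHS]rT /r2 mulr_suml lin_sum//; apply: eq_bigr => i _.
    by rewrite mulrA.
  clear E; case: m => [|m] in njm f2 fm *.
    (* For [m = 0] the remaining [Pn] has degree below [j], and orthogonality makes the term
       vanish. *)
    rewrite muln0 mul0r mulr0 mul0r (G_orth (Pn_homog n T) hq) ?mulr0//; lia.
  rewrite (IH n _ j m T)//; [|lia..].
  rewrite factS factS in fm *; rewrite exprS in f2 *.
  rewrite !natrM in fm *; set u := n.+1%:R; set v := n`!%:R.
  move: f2 fm; rewrite !mulf_eq0 !negb_or => /andP[t0 f2] /andP[m0 fm].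
  have H (a b p y r t g : C) : p != 0 -> y != 0 -> r != 0 ->
      a * (b / (p * y) * t * g) = a * b / (2 * p * (r * y)) * (2 * r * t) * g.
    by move=> p0 y0 r0; field; rewrite p0 y0 r0.
  exact: H.
have -> : n.+1`!%:R = n`!%:R * ((2 * m)%:R + j%:R) :> C.
  by rewrite -natrD -natrM factS mulnC njm addnC.
by field; rewrite f2 fm.
Qed.

(* The Funk-Hecke coefficients of [s^n]. *)
Definition cnm n m : C := n`!%:R / (2 ^+ m * m`!%:R) * (G 1 / rad (2 * n - 2 * m)).

Lemma L_orth k j p q : p \is k.-homog -> harm j q -> (k < j)%N -> L (p * q) = 0.
Proof.
move=> hp hq kj; have h := G_orth hp hq kj.
have hpq : p * q \is (k + j).-homog by apply: dhomogM => //; apply/homogP; case: hq.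
by move: h; rewrite (Grad hpq) => /eqP; rewrite mulf_eq0 (negbTE (rad0 _)) => /eqP.
Qed.

Lemma L_Pn n j m T q : lin T -> (forall p, T (r2 * p) = T p) ->
  n = (j + 2 * m)%N -> harm j q -> L (Pn n T * q) = cnm n m * T q.
Proof.
move=> lT rT njm hq; have h := G_Pn lT rT njm hq.
have hpq : Pn n T * q \is (n + j).-homog.
  by apply: dhomogM => //; [exact: Pn_homog|apply/homogP; case: hq].
apply: (mulfI (rad0 (n + j))); rewrite -(Grad hpq) h /cnm.
have -> : (2 * n - 2 * m = n + j)%N by lia.
have f2 : (2 ^+ m : C) != 0 by rewrite expf_neq0// pnatr_eq0.
have fm : (m`!%:R : C) != 0 by rewrite pnatr_eq0 -lt0n fact_gt0.
by field; rewrite rad0 f2 fm.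
Qed.

Lemma cnm0 n m : cnm n m != 0.
Proof.
have f2 : (2 ^+ m : C) != 0 by rewrite expf_neq0// pnatr_eq0.
have fm : (m`!%:R : C) != 0 by rewrite pnatr_eq0 -lt0n fact_gt0.
have fn : (n`!%:R : C) != 0 by rewrite pnatr_eq0 -lt0n fact_gt0.
by rewrite /cnm !mulf_neq0// ?invr_neq0// mulf_neq0.
Qed.

(* The harmonic part of [Pn n T]. *)
Definition zon n T : P := \sum_(l < n./2.+1) rc (bz n l) *: (r2 ^+ l * Pn (n - 2 * l) T).

Lemma zon_harm n T : lin T -> (forall p, T (r2 * p) = T p) -> harm n (zon n T).
Proof.
move=> lT rT; split.
  apply/homogP; apply: rpred_sum => l _; apply: dhomogZ.
  have := r2X_homog l (Pn_homog (n - 2 * l) T).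
  by rewrite subnKC//; have := ltn_ord l; lia.
(* What is left of the Laplacian of a partial sum: the recursion of [bz] cancels everything else. At
   the last index [n - 2 l] is 0 or 1, and the remainder vanishes as well. *)
pose a l := (rc (bz n l) * ((n - 2 * l) * (n - 2 * l).-1)%:R) *: (r2 ^+ l * Pn (n - 2 * l.+1) T) : P.
have lapP k : lap (Pn k T) = (k * k.-1)%:R *: Pn (k - 2) T.
  case: k => [|[|k]]; first by rewrite lap_Pn01// mul0n scale0r.
    by rewrite lap_Pn01// muln0 scale0r.
  rewrite lap_Pn// !subSS subn0; congr (_ *: Pn k _).
  by apply/funext => p; rewrite rT.
have tele N : (2 * N <= n)%N ->
    lap (\sum_(l < N.+1) rc (bz n l) *: (r2 ^+ l * Pn (n - 2 * l) T)) = a N.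
  elim: N => [_|N IH hN].
    by rewrite big_ord1 lapZ expr0 mul1r muln0 subn0 lapP /a scalerA expr0 mul1r muln0 subn0 muln1.
  rewrite big_ord_recr lapD IH; last by lia.
  rewrite /= lapZ (lap_r2X N (Pn_homog _ T)) lapP scalerDr addrA.
  have -> : (n - 2 * N.+1 - 2 = n - 2 * N.+2)%N by lia.
  rewrite -scalerAr !scalerA /a -scalerDl.
  set b := rc (bz n N) * _ + _; have -> : b = 0; last by rewrite scale0r add0r.
  rewrite /b; set A := ((n - 2 * N) * _)%N; set B := (2 * N.+1 * _)%N.
  have B0 : (B%:R : R) != 0 by rewrite pnatr_eq0 /B; nia.
  rewrite -!rc_nat -!rcM -rcD (_ : _ + _ = 0) ?rc0//.
  by rewrite divfK// mulNr subrr.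
rewrite /zon tele; last by lia.
rewrite /a (_ : (n - _) * _ = 0)%N ?mulr0 ?scale0r//; nia.
Qed.

(** The reproducing property of the zonal polynomial: terms with [l > 0] reduce, once [r2] is
    dropped, to degrees below [n] and are orthogonal to [q]. *)
Lemma L_zon n T q : lin T -> (forall p, T (r2 * p) = T p) -> harm n q ->
  L (zon n T * q) = cnm n 0 * T q.
Proof.
move=> lT rT hq; rewrite /zon mulr_suml lin_sum// big_ord_recl big1 ?addr0.
  by rewrite /= rc1 scale1r expr0 mul1r muln0 subn0 (@L_Pn n n 0)//; lia.
move=> i _; rewrite -scalerAl linL.2 -mulrA Lr2X.
rewrite (L_orth (Pn_homog _ T) hq) ?mulr0//.
by have := ltn_ord i; rewrite /= /bump/=; lia.
Qed.

Variables (T : P -> C) (linT : lin T) (Tr2 : forall p, T (r2 * p) = T p).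

(** The harmonic polynomial representing [T] is a normalised zonal polynomial, so the projection is
    explicit and calls for no basis of the harmonic polynomials. *)
Lemma proj_exists n : exists2 h, harm n h & forall q, harm n q -> L (h * q) = T q.
Proof.
exists ((cnm n 0)^-1 *: zon n T); first by apply: harmZ; exact: zon_harm.
move=> q hq; rewrite -scalerAl linL.2 L_zon// mulKf//; exact: cnm0.
Qed.

Variables (h : nat -> P).
Hypothesis hh : forall n, harm n (h n).
Hypothesis hL : forall n q, harm n q -> L (h n * q) = T q.

(** The product of [h n] with the zonal polynomial of [T'] is integrated in two ways: through the
    reproducing property, and through the property defining [h n]. For [T'] the evaluation at a
    point, this writes the value of a projection as an integral. *)
Lemma proj_eval n T' : lin T' -> (forall p, T' (r2 * p) = T' p) ->
  cnm n 0 * T' (h n) = T (zon n T').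
Proof.
move=> lT' rT'; rewrite -L_zon// mulrC hL//; exact: zon_harm.
Qed.

(** On [p], the functional [T] is recovered from its projections of degrees [n], [n-2], and so
    on. *)
Let Q n p := T p = \sum_(m < n./2.+1) L (p * h (n - 2 * m)).

Let Q_harm n p : harm n p -> Q n p.
Proof.
move=> hp; rewrite /Q big_ord_recl muln0 subn0 mulrC hL// big1 ?addr0// => i _.
rewrite mulrC; apply: (L_orth (proj1 (homogP _ _) (proj1 (hh (n - 2 * lift ord0 i)))) hp).
by have := ltn_ord i; rewrite /= /bump/=; lia.
Qed.

(** A factor [r2] adds one projection, whose degree exceeds that of [p] and which is therefore
    orthogonal to it. The other terms do not change, since [T] and [L] ignore [r2]. *)
Let Q_r2X l n p : p \is n.-homog -> Q n p -> Q (2 * l + n) (r2 ^+ l * p).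
Proof.
move=> hp Qp; elim: l => [|l IH]; first by rewrite expr0 mul1r muln0.
have -> : (2 * l.+1 + n = (2 * l + n).+2)%N by lia.
rewrite /Q exprS -mulrA Tr2 IH [RHS]big_ord_recl muln0 subn0.
rewrite -!mulrA Lr2 Lr2X (L_orth hp (hh _)) ?add0r; last by lia.
apply: eq_bigr => i _; rewrite -!mulrA Lr2; congr (L (_ * (_ * h _))).
by rewrite /= /bump/=; lia.
Qed.

Let Q_lin n c p q : Q n p -> Q n q -> Q n (c *: p + q).
Proof.
rewrite /Q => hp hq; rewrite linT.1 linT.2 hp hq mulr_sumr -big_split.
by apply: eq_bigr => i _; rewrite mulrDl linL.1 -scalerAl linL.2.
Qed.

(** Up to its harmonic part, [Pn n T'] is a combination of multiples of [r2] by polynomials [Pn] of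
    lower order, to which the induction applies. *)
Let Q_Pn n T' : lin T' -> (forall p, T' (r2 * p) = T' p) -> Q n (Pn n T').
Proof.
move=> lT' rT'; elim/ltn_ind: n => n IH.
have -> : Pn n T' = (-1) *: (\sum_(l < n./2) rc (bz n l.+1) *: (r2 ^+ l.+1 * Pn (n - 2 * l.+1) T')) + zon n T'.
  rewrite /zon big_ord_recl/= rc1 scale1r expr0 mul1r muln0 subn0 scaleN1r.
  by rewrite addrCA addNr addr0.
apply: Q_lin; last by apply: Q_harm; exact: zon_harm.
apply: (big_ind (Q n)).
- by rewrite /Q lin0// big1// => i _; rewrite mul0r lin0.
- by move=> p q hp hq; rewrite -[p]scale1r; exact: Q_lin.
- move=> l _; have hl := ltn_ord l.
  rewrite -[X in Q n X]addr0; apply: Q_lin; last first.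
    by rewrite /Q lin0// big1// => i _; rewrite mul0r lin0.
  have {1}-> : n = (2 * l.+1 + (n - 2 * l.+1))%N by lia.
  apply: Q_r2X; first exact: Pn_homog.
  by apply: IH; lia.
Qed.

(** With [T] the integration against a function on the sphere and [T'] the evaluation at [xi], this
    is the Funk-Hecke formula for the kernel [s^n]. *)
Lemma T_Pn n T' : lin T' -> (forall p, T' (r2 * p) = T' p) ->
  T (Pn n T') = \sum_(m < n./2.+1) cnm n m * T' (h (n - 2 * m)).
Proof.
move=> lT' rT'; rewrite (Q_Pn n lT' rT'); apply: eq_bigr => m _.
apply: L_Pn => //; by have := ltn_ord m; lia.
Qed.

End gaussian_sphere.

(** * Integrals over the sphere and of products of radial and angular functions *)

Section sphere_integrals.
Context (R : realType) (d' : nat).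
Local Notation d := d'.+1.
Local Notation leb := (@lebesgue_measure R).
Local Notation lebd := (lebn R d).
Local Notation sphm := (sphm R d').
Local Notation C := R[i].
Local Notation Re := complex.Re.
Local Notation Im := complex.Im.

Lemma measurable_sphere : measurable (@sphere R d).
Proof.
rewrite (_ : @sphere R d = [set x | enorm x \in `[1, 1]]).
  exact: measurable_enorm_itv.
by apply/seteqP; split => x /=; rewrite in_itv/= -eq_le eq_sym => /eqP.
Qed.

Lemma integrable_sphm (f : d.-tuple R -> R) K : measurable_fun setT f ->
  (forall u, enorm u = 1 -> `|f u| <= K) -> sphm.-integrable setT (EFin \o f).
Proof.
move=> mf fK; apply/integrableP; split; first exact/measurable_EFinP.
have mn : measurable_fun setT (fun u => `|f u|) by exact: measurableT_comp.
(* The bound is known on the sphere only; multiplication by its indicator makes it global without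
   changing the integral. *)
pose g (u : d.-tuple R) := (`|f u| * \1_(@sphere R d) u).
have mg : measurable_fun setT g.
  by apply: measurable_funM => //; apply: measurable_indic; exact: measurable_sphere.
have g0 u : 0 <= g u by rewrite mulr_ge0.
rewrite (ge0_eq_integral_sphm (g := EFin \o g)).
- apply: (@le_lt_trans _ _ (\int[sphm]_u (`|K|)%:E)%E).
    apply: ge0_le_integral => //.
    + by move=> u _; rewrite /= lee_fin.
    + exact/measurable_EFinP.
    + move=> u _; rewrite lee_fin /g indicE.
      case: (boolP (u \in _)) => [|_]; last by rewrite mulr0.
      by rewrite inE mulr1 => /fK h; exact: le_trans h (ler_norm _).
  rewrite integral_cst//= -(fineK (fin_num_measure sphm _ measurableT)).
  by rewrite -EFinM ltry.
- exact/measurable_EFinP.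
- by move=> u; rewrite /= lee_fin.
- exact/measurable_EFinP.
- by move=> u; rewrite /= lee_fin.
- by move=> u u1; rewrite /= /g indicE mem_set//= mulr1.
Qed.

Lemma cintegrable_sphm (F : d.-tuple R -> C) K : cmeas F ->
  (forall u, enorm u = 1 -> cmod (F u) <= K) -> cintegrable sphm F.
Proof.
move=> [mr mi] FK; split.
- apply: (@integrable_sphm _ K) => // u u1; exact: le_trans (Re_le_cmod _) (FK u u1).
- apply: (@integrable_sphm _ K) => // u u1; exact: le_trans (Im_le_cmod _) (FK u u1).
Qed.

Lemma eq_cint_sphm (F F' : d.-tuple R -> C) : cmeas F -> cmeas F' ->
  (forall u, enorm u = 1 -> F u = F' u) -> cint sphm F = cint sphm F'.
Proof.
move=> [mr mi] [mr' mi'] FF; apply: ceqP; rewrite /= /Rintegral; congr fine.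
- apply: eq_integral_sphm => [||u u1]; [exact/measurable_EFinP|exact/measurable_EFinP|].
  by rewrite FF.
- apply: eq_integral_sphm => [||u u1]; [exact/measurable_EFinP|exact/measurable_EFinP|].
  by rewrite FF.
Qed.

Lemma csph_intE (F : d.-tuple R -> C) K : cmeas F ->
  (forall u, enorm u = 1 -> cmod (F u) <= K) -> csph_int F = cint sphm F.
Proof.
move=> [mr mi] FK; apply: ceqP => /=.
- apply: (@sph_intE _ _ _ K) => // u u1; exact: le_trans (Re_le_cmod _) (FK u u1).
- apply: (@sph_intE _ _ _ K) => // u u1; exact: le_trans (Im_le_cmod _) (FK u u1).
Qed.

Lemma cmod_cint_sphm (F : d.-tuple R -> C) K : cmeas F -> 
  (forall u, enorm u = 1 -> cmod (F u) <= K) -> 0 <= K ->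
  cmod (cint sphm F) <= 2 * (K * fine (sphm setT)).
Proof.
move=> mF FK K0.
pose i1 (u : d.-tuple R) : R := \1_(@sphere R d) u.
have mi1 : measurable_fun setT i1 by apply: measurable_indic; exact: measurable_sphere.
have mF' : cmeas (fun u => rc (i1 u) * F u) by apply: cmeasM => //; exact: cmeas_rc.
have b u : cmod (rc (i1 u) * F u) <= K.
  rewrite cmodM cmod_rc /i1 indicE; case: (boolP (u \in _)) => [|_]; last by rewrite normr0 mul0r.
  by rewrite inE normr1 mul1r => /FK.
rewrite (eq_cint_sphm (F' := fun u => rc (i1 u) * F u))//; last first.
  by move=> u u1; rewrite /i1 indicE mem_set// rc1 mul1r.
have iK : sphm.-integrable setT (EFin \o (fun=> K)).
  by apply: (@integrable_sphm _ `|K|) => // u _.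
apply: le_trans (cmod_cint (@cintegrable_sphm _ K mF' (fun u _ => b u)) b iK) _.
by rewrite Rintegral_cst.
Qed.

Section polar_product.
Variables (phi : R -> R) (I : R).
Hypotheses (mphi : measurable_fun setT phi) (phi0 : forall r, 0 <= phi r).
Hypothesis phiI : (\int[leb]_(r in `]0%R, +oo[) (phi r * r ^+ d')%:E = I%:E)%E.

(** The origin is a null set; elsewhere polar coordinates separate the variables, and [phi] enters
    only through its radial integral [I]. *)
Lemma ge0_polar_prod (f : d.-tuple R -> R) :
  measurable_fun setT f -> (forall u, 0 <= f u) ->
  (\int[lebd]_x (phi (enorm x) * f (unitv x))%:E = I%:E * \int[sphm]_u (f u)%:E)%E.
Proof.
move=> mf f0.
have mx : measurable_fun setT (fun x : d.-tuple R => (phi (enorm x) * f (unitv x))%:E).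
  apply/measurable_EFinP; apply: measurable_funM.
    exact: (measurableT_comp mphi (@measurable_enorm _ _)).
  exact: (measurableT_comp mf (@measurable_unitv _ _)).
have p0 x : (0 <= (phi (enorm x) * f (unitv x))%:E)%E by rewrite lee_fin mulr_ge0.
have mxT : measurable_fun (~` [set x : d.-tuple R | 0 < enorm x] `|` [set x | 0 < enorm x])
   (fun x : d.-tuple R => (phi (enorm x) * f (unitv x))%:E) by rewrite setvU.
have nz := @measurable_nz R d'.
have nzC := measurableC nz.
rewrite -{1}(setvU [set x : d.-tuple R | 0 < enorm x]) (ge0_integral_setU _ nzC nz mxT)//; last first.
  by apply/disj_setPS => x [].
rewrite null_set_integral ?add0e//; [|exact: measurable_funTS|exact: lebn_enorm0].
pose f2 (r : R) (u : d.-tuple R) := (phi r * f u)%:E.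
rewrite (@ge0_polar _ _ f2).
- rewrite -phiI -ge0_integralZr//; last first.
  + by apply: integral_ge0 => u _; rewrite lee_fin.
  + by move=> r; rewrite /= in_itv/= andbT => r0; rewrite lee_fin mulr_ge0// exprn_ge0// ltW.
  + apply/measurable_EFinP; apply: measurable_funM; first exact: measurable_funTS.
    exact: measurable_funX.
  apply: eq_integral => r; rewrite inE/= in_itv/= andbT => r0.
  rewrite /f2; under eq_integral do rewrite EFinM.
  rewrite ge0_integralZl_EFin//; [|by move=> u _; rewrite lee_fin|exact/measurable_EFinP].
  by rewrite EFinM [RHS]muleAC.
- apply/measurable_EFinP; apply: measurable_funM.
    exact: (measurableT_comp mphi measurable_fst).
  exact: (measurableT_comp mf measurable_snd).
- by move=> r u; rewrite lee_fin mulr_ge0.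
Qed.

Lemma polar_prodR (f : d.-tuple R -> R) K : measurable_fun setT f ->
  (forall u, enorm u = 1 -> `|f u| <= K) ->
  lebd.-integrable setT (fun x => (phi (enorm x) * f (unitv x))%:E) /\
  Rintegral lebd setT (fun x => phi (enorm x) * f (unitv x)) = I * Rintegral sphm setT f.
Proof.
move=> mf fK.
have ge0 (h : d.-tuple R -> R) : measurable_fun setT h -> (forall u, 0 <= h u) ->
    (forall u, enorm u = 1 -> `|h u| <= K) ->
    lebd.-integrable setT (fun x => (phi (enorm x) * h (unitv x))%:E) /\
    Rintegral lebd setT (fun x => phi (enorm x) * h (unitv x)) = I * Rintegral sphm setT h.
  move=> mh h0 hK; have E := ge0_polar_prod mh h0.
  have fin := integrable_fin_num measurableT (integrable_sphm mh hK).
  split; last by rewrite /Rintegral E fineM.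
  apply/integrableP; split.
    apply/measurable_EFinP; apply: measurable_funM.
      exact: (measurableT_comp mphi (@measurable_enorm _ _)).
    exact: (measurableT_comp mh (@measurable_unitv _ _)).
  under eq_integral do rewrite gee0_abs ?lee_fin ?mulr_ge0//.
  by rewrite E -(fineK fin) -EFinM ltry.
have mp : measurable_fun setT (f^\+) by exact: measurable_funrpos.
have mn : measurable_fun setT (f^\-) by exact: measurable_funrneg.
have [ip Ep] : lebd.-integrable setT (fun x => (phi (enorm x) * f^\+ (unitv x))%:E) /\
    Rintegral lebd setT (fun x => phi (enorm x) * f^\+ (unitv x)) = I * Rintegral sphm setT f^\+.
  apply: ge0 => // u u1; apply: le_trans (fK u u1).
  by rewrite ger0_norm// /funrpos ge_max ler_norm normr_ge0.
have [in_ En] : lebd.-integrable setT (fun x => (phi (enorm x) * f^\- (unitv x))%:E) /\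
    Rintegral lebd setT (fun x => phi (enorm x) * f^\- (unitv x)) = I * Rintegral sphm setT f^\-.
  apply: ge0 => // u u1; apply: le_trans (fK u u1).
  by rewrite ger0_norm// /funrneg ge_max -normrN ler_norm normr_ge0.
have fE u : f u = f^\+ u - f^\- u.
  rewrite /funrpos /funrneg; have [h|h] := leP 0 (f u).
    by rewrite (_ : Num.max (- f u) 0 = 0) ?subr0//; apply/max_idPr; rewrite oppr_le0.
  rewrite (_ : Num.max (- f u) 0 = - f u) ?sub0r ?opprK//.
  by apply/max_idPl; rewrite oppr_ge0 ltW.
have Kp u : enorm u = 1 -> `|f^\+ u| <= K.
  by move=> u1; apply: le_trans (fK u u1); rewrite ger0_norm// /funrpos ge_max ler_norm normr_ge0.
have Kn u : enorm u = 1 -> `|f^\- u| <= K.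
  by move=> u1; apply: le_trans (fK u u1); rewrite ger0_norm// /funrneg ge_max -normrN ler_norm normr_ge0.
have E x : phi (enorm x) * f (unitv x) = phi (enorm x) * f^\+ (unitv x) - phi (enorm x) * f^\- (unitv x).
  by rewrite -mulrBr -fE.
split.
  by under eq_fun do rewrite E EFinB; exact: integrableB.
under eq_Rintegral do rewrite E.
rewrite RintegralB// Ep En -mulrBr; congr (_ * _).
rewrite -RintegralB//; first by apply: eq_Rintegral => u _; rewrite -fE.
  exact: integrable_sphm mp Kp.
exact: integrable_sphm mn Kn.
Qed.

Lemma polar_prod (F : d.-tuple R -> C) K : cmeas F ->
  (forall u, enorm u = 1 -> cmod (F u) <= K) ->
  cintegrable lebd (fun x => rc (phi (enorm x)) * F (unitv x)) /\
  cint lebd (fun x => rc (phi (enorm x)) * F (unitv x)) = rc I * cint sphm F.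
Proof.
move=> [mr mi] FK.
have [ir Er] := polar_prodR mr (fun u u1 => le_trans (Re_le_cmod _) (FK u u1)).
have [ii Ei] := polar_prodR mi (fun u u1 => le_trans (Im_le_cmod _) (FK u u1)).
split.
  by split; [under eq_fun do rewrite cReMrc|under eq_fun do rewrite cImMrc].
apply: ceqP; rewrite ?cReMrc ?cImMrc /=.
- by under eq_Rintegral do rewrite cReMrc.
- by under eq_Rintegral do rewrite cImMrc.
Qed.

End polar_product.

End sphere_integrals.

(** * Spherical harmonics: the concrete functionals *)

Section spherical_harmonics.
Context (R : realType) (d' : nat).
Local Notation d := d'.+1.
Hypothesis hd : (2 <= d)%N.
Local Notation leb := (@lebesgue_measure R).
Local Notation lebd := (lebn R d).
Local Notation sphm := (sphm R d').
Local Notation C := R[i].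
Local Notation Re := complex.Re.
Local Notation Im := complex.Im.
Local Notation P := {mpoly R[i][d]}.
Local Notation Xv i := (mpolyX R[i] U_(i)%MM : P).
Local Notation D := (@mderiv d R[i]).
Local Notation harm := (@homog_harmonic R d).

Lemma peval_lin (u : d.-tuple R) : lin (fun p => peval p u).
Proof. by split => [p q|c p]; rewrite /peval ?mevalD ?mevalZ. Qed.

Lemma pevalM (p q : P) u : peval (p * q) u = peval p u * peval q u.
Proof. exact: mevalM. Qed.

Lemma pevalXn (p : P) n u : peval (p ^+ n) u = peval p u ^+ n.
Proof.
elim: n => [|n IH]; last by rewrite !exprS pevalM IH.
by rewrite !expr0 /peval meval1.
Qed.

Lemma peval_sum (u : d.-tuple R) I (r : seq I) (Q : pred I) (F : I -> P) :
  peval (\sum_(i <- r | Q i) F i) u = \sum_(i <- r | Q i) peval (F i) u.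
Proof. exact: (lin_sum _ _ _ (peval_lin u)). Qed.

Lemma peval_r2 (u : d.-tuple R) : peval (r2 R d) u = rc (enorm u ^+ 2).
Proof.
rewrite /r2 peval_sum.
rewrite enorm_sqr /dotp rc_sum; apply: eq_bigr => i _.
by rewrite pevalM /peval mevalXU rcM.
Qed.

Lemma peval_r2_sphere (u : d.-tuple R) p : enorm u = 1 ->
  peval (r2 R d * p) u = peval p u.
Proof. by move=> u1; rewrite pevalM peval_r2 u1 expr1n rc1 mul1r. Qed.

Lemma peval_X m (x : d.-tuple R) : peval ('X_[m] : P) x = \prod_i rc (tnth x i ^+ m i).
Proof. by rewrite /peval mevalX; apply: eq_bigr => i _; rewrite rcX. Qed.

Lemma peval_linform (u v : d.-tuple R) n :
  peval (linform (fun i => rc (tnth u i)) ^+ n) v = rc (dotp u v) ^+ n.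
Proof.
rewrite pevalXn; congr (_ ^+ _).
rewrite /linform peval_sum.
rewrite /dotp rc_sum; apply: eq_bigr => i _.
by rewrite (peval_lin v).2 /peval mevalXU rcM.
Qed.

Lemma cmeas_peval (p : P) : cmeas (fun x => peval p x).
Proof.
have E : (fun x => peval p x) = fun x => \sum_(m <- msupp p) p@_m * \prod_i rc (tnth x i ^+ m i).
  apply/funext => x; rewrite [in LHS](mpolyE p) peval_sum.
  by apply: eq_bigr => m _; rewrite (peval_lin x).2 peval_X.
rewrite E; apply: cmeas_sum => m; apply: cmeasM; first exact: cmeas_cst.
apply: cmeas_prod => i; apply: cmeas_rc; apply: measurable_funX.
exact: measurable_tnth.
Qed.

Lemma tnth_le_enorm (x : d.-tuple R) i : `|tnth x i| <= enorm x.
Proof.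
rewrite -(@ler_pXn2r _ 2)// ?nnegrE ?enorm_ge0// enorm_sqr /dotp.
rewrite real_normK ?num_real// (bigD1 i)//= -expr2 lerDl.
by apply: sumr_ge0 => j _; rewrite -expr2 sqr_ge0.
Qed.

Lemma peval_bounded (p : P) : exists K, forall u, enorm u = 1 -> cmod (peval p u) <= K.
Proof.
exists (\sum_(m <- msupp p) cmod p@_m) => u u1.
rewrite [in leLHS](mpolyE p) peval_sum.
apply: le_trans (cmod_sum _ _ _) _; apply: ler_sum => m _.
rewrite (peval_lin u).2 cmodM -[leRHS]mulr1 ler_wpM2l ?cmod_ge0// peval_X -rc_prod cmod_rc.
rewrite normr_prod; apply: prodr_ile1 => i _.
by rewrite normrX exprn_ge0//= exprn_ile1// -u1 tnth_le_enorm.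
Qed.

Lemma vscale_enorm_unitv (x : d.-tuple R) : vscale (enorm x) (unitv x) = x.
Proof.
have [x0|x0] := ltP 0 (enorm x); first exact: vscale_unitv.
have -> : x = vzero by apply: enorm0_eq0; apply/eqP; rewrite eq_le x0 enorm_ge0.
apply: eq_from_tnth => i; rewrite tnth_vscale enorm_vzero mul0r.
by rewrite tnth_nseq.
Qed.

Lemma peval_scale n (p : P) (t : R) (x : d.-tuple R) : p \is n.-homog ->
  peval p (vscale t x) = rc (t ^+ n) * peval p x.
Proof.
move=> /dhomogP hp; rewrite [in LHS](mpolyE p) [in RHS](mpolyE p).
rewrite !peval_sum.
rewrite mulr_sumr big_seq [RHS]big_seq; apply: eq_bigr => m ms.
rewrite !(peval_lin _).2 !peval_X mulrCA; congr (_ * _).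
rewrite -(hp m ms) /= mdegE -prodrXr rc_prod -big_split/=; apply: eq_bigr => i _.
by rewrite tnth_vscale exprMn rcM.
Qed.

(** The form in which [f] enters the algebra; [f = 1] gives the functional [L] of the abstract
    theory. *)
Definition Tf (f : d.-tuple R -> C) (p : P) : C := cint sphm (fun u => f u * peval p u).

Section functional.
Variables (f : d.-tuple R -> C) (K : R).
Hypotheses (mf : cmeas f) (fK : forall u, enorm u = 1 -> cmod (f u) <= K).

Lemma Tf_integrable p : cintegrable sphm (fun u => f u * peval p u).
Proof.
have [K' hK'] := peval_bounded p.
apply: (@cintegrable_sphm _ _ _ (K * K')); first by apply: cmeasM => //; exact: cmeas_peval.
by move=> u u1; rewrite cmodM ler_pM ?cmod_ge0 ?fK ?hK'.
Qed.

Lemma Tf_lin : lin (Tf f).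
Proof.
split => [p q|c p]; rewrite /Tf.
- rewrite -cintD; [|exact: Tf_integrable|exact: Tf_integrable].
  by congr cint; apply/funext => u; rewrite (peval_lin u).1 mulrDr.
- rewrite -cintZ; last exact: Tf_integrable.
  by congr cint; apply/funext => u; rewrite (peval_lin u).2 mulrCA.
Qed.

Lemma Tf_r2 p : Tf f (r2 R d * p) = Tf f p.
Proof.
apply: eq_cint_sphm.
- by apply: cmeasM => //; exact: cmeas_peval.
- by apply: cmeasM => //; exact: cmeas_peval.
- by move=> u u1; rewrite peval_r2_sphere.
Qed.

End functional.

Let one_meas : cmeas (fun _ : d.-tuple R => (1 : C)). Proof. exact: cmeas_cst. Qed.
Let one_le (u : d.-tuple R) : enorm u = 1 -> cmod (1 : C) <= 1. Proof. by rewrite cmod1. Qed.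

Definition Lf : P -> C := Tf (fun=> 1).

Lemma gwn_prod (x : d.-tuple R) : \prod_i gw (tnth x i) = gw (enorm x).
Proof.
rewrite /gw enorm_sqr /dotp -expR_sum; congr expR.
rewrite sumrN; congr (- _); rewrite mulr_suml; apply: eq_bigr => i _.
by rewrite expr2.
Qed.

Definition Gf (p : P) : C := cint lebd (fun x => peval p x * rc (gw (enorm x))).

Lemma Gf_X m : cintegrable lebd (fun x => peval ('X_[m] : P) x * rc (gw (enorm x))) /\
  Gf 'X_[m] = \prod_i rc (gmom R (m i)).
Proof.
pose f i (t : R) : C := rc (t ^+ m i * gw t).
have fi i : cintegrable leb (f i).
  by split => /=; [exact: integrable_gw_pow|exact: integrable0].
have [I E] := cint_lebn_prod fi.
have fE : (fun x => peval ('X_[m] : P) x * rc (gw (enorm x))) =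
    (fun x => \prod_i f i (tnth x i)).
  apply/funext => x; rewrite peval_X -gwn_prod rc_prod -big_split/=.
  by apply: eq_bigr => i _; rewrite /f rcM.
rewrite /Gf fE; split => //; rewrite E; apply: eq_bigr => i _.
by apply: ceqP => //=; rewrite /Rintegral integral0.
Qed.

Lemma Gf_integrable p : cintegrable lebd (fun x => peval p x * rc (gw (enorm x))).
Proof.
have -> : (fun x => peval p x * rc (gw (enorm x))) =
    fun x => \sum_(m <- msupp p) p@_m * (peval ('X_[m] : P) x * rc (gw (enorm x))).
  apply/funext => x; rewrite [in LHS](mpolyE p) peval_sum.
  by rewrite mulr_suml; apply: eq_bigr => m _; rewrite (peval_lin x).2 mulrA.
apply: cintegrable_sum => m; apply: cintegrableZ; exact: (Gf_X m).1.
Qed.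

Lemma Gf_lin : lin Gf.
Proof.
split => [p q|c p]; rewrite /Gf.
- rewrite -cintD; [|exact: Gf_integrable|exact: Gf_integrable].
  by congr cint; apply/funext => u; rewrite (peval_lin u).1 mulrDl.
- rewrite -cintZ; last exact: Gf_integrable.
  by congr cint; apply/funext => u; rewrite (peval_lin u).2 mulrA.
Qed.

(** On monomials the Gaussian integral is a product of one-dimensional moments, and the identity is
    their recursion in the coordinate [i]. If [X_i] does not occur, both sides vanish, the left one
    by oddness. *)
Lemma Gf_parts i p : Gf (Xv i * p) = Gf (D i p).
Proof.
rewrite (mpolyE p) mulr_sumr D_sum !(lin_sum _ _ _ Gf_lin); apply: eq_bigr => m _.
rewrite -scalerAr mderivZ mderivX scalerA !Gf_lin.2 -mulrA; congr (_ * _).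
rewrite -mpolyXD !(Gf_X _).2 (bigD1 i)//= [in RHS](bigD1 i)//= mulrA.
rewrite mnmDE mnmBE mnm1E eqxx add1n subn1.
congr (_ * _).
  case: (m i) => [|k]; first by rewrite gmom_odd// rc0 mul0r.
  by rewrite gmom_rec rcM rc_nat.
by apply: eq_bigr => j ji; rewrite mnmDE mnmBE mnm1E eq_sym (negbTE ji) add0n subn0.
Qed.

Lemma Gf1 : Gf 1 = rc (Num.sqrt (2 * pi) ^+ d).
Proof.
rewrite -mpolyX0 (Gf_X _).2 rcX; under eq_bigr do rewrite mnm0E gmom0.
by rewrite prodr_const card_ord.
Qed.

(** The integral of [r^(n+d-1) exp(-r^2/2)] over the half-line, by [integral_radial] with [p = 2]
    and [c = 1/2]. *)
Definition radR (n : nat) : R :=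
  2^-1 * 2^-1 `^ (- ((n + d)%:R / 2)) * Gamma ((n + d)%:R / 2).

Lemma radR_gt0 n : 0 < radR n.
Proof.
rewrite /radR !mulr_gt0 ?powR_gt0 ?invr_gt0// Gamma_gt0//.
by rewrite ler_pdivlMr// mul1r ler_nat; lia.
Qed.

Lemma radR_int n :
  (\int[leb]_(r in `]0%R, +oo[) (r ^+ n * gw r * r ^+ d')%:E = (radR n)%:E)%E.
Proof.
have l1 : 1 <= (n + d)%:R / 2 :> R by rewrite ler_pdivlMr// mul1r ler_nat; lia.
rewrite /radR EFinM GammaE// -integral_radial ?ltr1n//.
apply: eq_integral => r; rewrite inE/= in_itv/= andbT => r0; congr EFin.
rewrite mulrAC -exprD /gw; congr (_ * expR _); last first.
  by rewrite powR_mulrn ?ltW// mulrC.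
rewrite (_ : (n + d)%:R - 1 = (n + d')%:R); first by rewrite powR_mulrn// ltW.
by rewrite addnS -natr1 addrK.
Qed.

Lemma Gf_rad n p : p \is n.-homog -> Gf p = rc (radR n) * Lf p.
Proof.
move=> hp; have [K hK] := peval_bounded p.
pose phi (r : R) := `|r| ^+ n * gw r.
have mphi : measurable_fun setT phi.
  apply: measurable_funM; last exact: measurable_gw.
  by apply: measurable_funX; exact: normr_measurable.
have phi0 (r : R) : 0 <= phi r by rewrite mulr_ge0 ?exprn_ge0 ?gw_ge0.
have phiI : (\int[leb]_(r in `]0%R, +oo[) (phi r * r ^+ d')%:E = (radR n)%:E)%E.
  rewrite -radR_int; apply: eq_integral => r; rewrite inE/= in_itv/= andbT => r0.
  by rewrite /phi gtr0_norm.
have [_ E] := polar_prod mphi phi0 phiI (cmeas_peval p) hK.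
rewrite /Lf /Tf; under [in RHS]eq_fun do rewrite mul1r.
rewrite -E /Gf; congr cint; apply/funext => x.
rewrite -{1}(vscale_enorm_unitv x) (peval_scale _ _ hp) /phi ger0_norm ?enorm_ge0//.
by rewrite rcM mulrAC.
Qed.

Let GfX := Gf_parts.
Let Lfr2 p : Lf (r2 R d * p) = Lf p.
Proof. exact: (Tf_r2 one_meas). Qed.
Let linL : lin Lf. Proof. exact: (Tf_lin one_meas one_le). Qed.
Let rad0 n : rc (radR n) != 0 :> C.
Proof. by rewrite rc_eq0 gt_eqF// radR_gt0. Qed.
Let Gf10 : Gf 1 != 0.
Proof.
rewrite Gf1 rc_eq0 expf_neq0// gt_eqF// sqrtr_gt0 mulr_gt0// pi_gt0.
by [].
Qed.

Lemma peval_conj (p : P) (u : d.-tuple R) :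
  peval (map_mpoly (@conjc R) p) u = conjc (peval p u).
Proof.
elim/mpolyind: p => [|c m p _ _ IH].
  by rewrite raddf0 /peval !meval0 rmorph0.
rewrite raddfD/= map_mpolyZ map_mpolyX !(peval_lin u).1 !(peval_lin u).2 IH rmorphD rmorphM.
congr (_ * _ + _); rewrite !peval_X rmorph_prod; apply: eq_bigr => i _.
by rewrite /rc /= oppr0.
Qed.

Lemma harm_conj j (p : P) : harm j p -> harm j (map_mpoly (@conjc R) p).
Proof.
move=> [hp lp]; split.
  move=> m; rewrite mcoeff_msupp mcoeff_map_mpoly => h; apply: hp.
  by rewrite mcoeff_msupp; apply: contraNneq h => e; rewrite /= e conjc0.
apply/mpolyP => m; rewrite mcoeff0 -(rmorph0 (@conjc R)).
have <- : (laplacian p)@_m = 0 by rewrite lp mcoeff0.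
rewrite /laplacian !raddf_sum/=; apply: eq_bigr => i _.
by rewrite !mcoeff_mderiv mcoeff_map_mpoly !raddfMn.
Qed.

Section projection.
Variables (f : d.-tuple R -> C) (K : R).
Hypotheses (mf : cmeas f) (fK : forall u, enorm u = 1 -> cmod (f u) <= K).

(** The definition pairs with conjugates, the algebra with the polynomials themselves. Conjugating
    coefficients preserves harmonic polynomials, and at real points it conjugates the values, so the
    two conditions agree. *)
Lemma is_proj_harmP j p : is_proj_harm j f p <->
  harm j p /\ forall q, harm j q -> Lf (p * q) = Tf f q.
Proof.
have [Kp hKp] := peval_bounded p.
have E (q : P) : csph_int (fun u => (f u - peval p u) * peval q u) = Tf f q - Lf (p * q).
  have [Kq hKq] := peval_bounded q.
  have i1 := Tf_integrable mf fK q; have i2 := Tf_integrable one_meas one_le (p * q).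
  rewrite (@csph_intE _ _ _ ((K + Kp) * Kq)).
  - rewrite /Lf /Tf -[- _]mulN1r -cintZ// -cintD//; last exact: cintegrableZ.
    by congr cint; apply/funext => u; rewrite pevalM; ring.
  - apply: cmeasM; last exact: cmeas_peval.
    by apply: cmeasD => //; apply: cmeasN; exact: cmeas_peval.
  - move=> u u1; rewrite cmodM ler_pM ?cmod_ge0 ?hKq//.
    by apply: le_trans (cmodB _ _) _; rewrite lerD ?fK ?hKp.
split => -[hp h]; (split; first exact: hp) => q hq.
- have := h _ (harm_conj hq); under eq_fun do rewrite peval_conj conjcK.
  rewrite E => /subr0_eq h'; exact: esym h'.
- under eq_fun do rewrite -peval_conj.
  rewrite E h; [exact: subrr|exact: harm_conj].
Qed.

Definition hproj j : P := xget 0 (is_proj_harm j f).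

(** The definition of [proj_harm] is a choice with default [0]; existence of the projection makes it
    meaningful. *)
Lemma hprojP j : harm j (hproj j) /\ forall q, harm j q -> Lf (hproj j * q) = Tf f q.
Proof.
have [h hh hL] := proj_exists hd Gf_lin linL GfX Lfr2 Gf_rad rad0 Gf10 (Tf_lin mf fK) (Tf_r2 mf) j.
apply/is_proj_harmP; rewrite /hproj; apply: (@xgetPex _ 0 (is_proj_harm j f)).
by exists h; apply/is_proj_harmP.
Qed.

Definition cn n m : C := cnm Gf (fun n => rc (radR n)) n m.

Lemma funk_hecke n (xi : d.-tuple R) : enorm xi = 1 ->
  cint sphm (fun u => f u * rc (dotp xi u) ^+ n) =
  \sum_(m < n./2.+1) cn n m * proj_harm (n - 2 * m) f xi.
Proof.
move=> xi1.
have h := T_Pn hd Gf_lin linL GfX Lfr2 Gf_rad rad0 Gf10 (Tf_lin mf fK) (Tf_r2 mf)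
  (fun j => (hprojP j).1) (fun j => (hprojP j).2) n (peval_lin xi)
  (fun p => peval_r2_sphere p xi1).
rewrite /proj_harm -/(hproj _) -h /Tf; congr cint; apply/funext => u; congr (_ * _).
rewrite [RHS]meval_Pn; last exact: peval_lin.
by rewrite [RHS]peval_linform dotpC.
Qed.

Lemma proj_zon n (xi : d.-tuple R) : enorm xi = 1 ->
  cn n 0 * proj_harm n f xi = Tf f (zon n (fun p => peval p xi)).
Proof.
move=> xi1.
exact: (proj_eval hd Gf_lin linL GfX Lfr2 Gf_rad rad0 Gf10
  (fun j => (hprojP j).1) (fun j => (hprojP j).2) n (peval_lin xi)
  (fun p => peval_r2_sphere p xi1)).
Qed.

(** By [proj_zon] the value is an integral of [f] against a zonal polynomial. For unit [u] and [xi]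
    one has [|<u, xi>| <= 1], so [bz_bound] bounds that polynomial by [exp n]. *)
Lemma proj_bound_aux n (xi : d.-tuple R) : enorm xi = 1 -> 0 <= K ->
  cmod (cn n 0 * proj_harm n f xi) <= 2 * (K * expR n%:R * fine (sphm setT)).
Proof.
move=> xi1 K0; rewrite proj_zon//.
apply: cmod_cint_sphm.
- by apply: cmeasM => //; exact: cmeas_peval.
- move=> u u1; rewrite cmodM ler_pM ?cmod_ge0 ?fK//.
  rewrite /zon peval_sum; apply: le_trans (cmod_sum _ _ _) _.
  apply: le_trans (_ : \sum_(l < n./2.+1) l`!%:R^-1 * n%:R ^+ l <= _).
    apply: ler_sum => l _; rewrite (peval_lin u).2 cmodM cmod_rc pevalM cmodM.
    rewrite [leRHS]mulrC -[leRHS]mulr1; apply: ler_pM => //.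
      by rewrite mulr_ge0 ?cmod_ge0.
      exact: (bz_bound R hd).
    rewrite pevalXn peval_r2 u1 expr1n rc1 expr1n cmod1 mul1r.
    (* For the evaluation at [xi], the polynomial [Pn] at [u] is a power of [<u, xi>]. *)
    rewrite (_ : peval (Pn _ _) u = peval (linform (fun i => rc (tnth u i)) ^+ (n - 2 * l)) xi); last first.
      by rewrite [LHS]meval_Pn//; exact: peval_lin.
    rewrite peval_linform cmodX cmod_rc exprn_ile1//.
    by apply: le_trans (cauchy_schwarz _ _) _; rewrite u1 xi1 mulr1.
  exact: sum_exp_coeff_le.
- by rewrite mulr_ge0 ?expR_ge0.
Qed.

End projection.

End spherical_harmonics.

Section harmonic_constants.
Context (R : realType).
Local Notation leb := (@lebesgue_measure R).

(** Half of the exponential is spent on [t^j <= j! 2^j exp(t/2)]; the other half leaves a multiple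
    of [Gamma h]. It serves to bound the coefficient [chat n 0] from below. *)
Lemma Gamma_upper_fact (j : nat) (h : R) : 1 <= h ->
  Gamma (j%:R + h) <= j`!%:R * 2 ^+ j * (2^-1 `^ (- h) * Gamma h).
Proof.
move=> h1.
have pw (s : R) : 0 < s -> s `^ (j%:R + h - 1) = s ^+ j * s `^ (h - 1).
  move=> s0; rewrite -addrA [LHS]powRD; first by rewrite powR_mulrn// ltW.
  by apply/implyP => _; rewrite gt_eqF.
have jh1 : 1 <= j%:R + h by rewrite -[1]add0r lerD.
rewrite -lee_fin (EFinM (_ * _)) (EFinM (2^-1 `^ _)) !GammaE// -egamma_scale ?invr_gt0//.
have mb : measurable_fun (`]0%R, +oo[%classic : set (measurableTypeR R))
    (fun t : R => (t `^ (h - 1) * expR (- (2^-1 * t)))%:E).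
  apply/measurable_EFinP; apply: measurable_funTS; apply: measurable_funM.
    exact: measurable_powR.
  apply: measurableT_comp => //; under eq_fun do rewrite -mulNr.
  exact: measurable_funM.
rewrite -ge0_integralZl_EFin//; last first.
  by move=> t _; rewrite lee_fin mulr_ge0 ?powR_ge0 ?expR_ge0.
apply: ge0_le_integral => //.
- by move=> t _; rewrite lee_fin mulr_ge0 ?powR_ge0 ?expR_ge0.
- apply/measurable_EFinP; apply: measurable_funTS; apply: measurable_funM.
    exact: measurable_powR.
  by apply: measurableT_comp => //; exact: measurableT_comp.
- exact: measurable_funeM.
- move=> t; rewrite /= in_itv/= andbT => t0; rewrite lee_fin.
  have -> : (t : R) `^ (j%:R + h - 1) = t ^+ j * t `^ (h - 1).
    exact: pw.
  have -> : expR (- (t : R)) = expR (- (2^-1 * t)) * expR (- (2^-1 * t)).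
    rewrite -expRD; congr expR; lra.
  have h2 : (2^-1 * t : R) ^+ j <= j`!%:R * expR (2^-1 * t).
    by apply: exprn_le_expR; rewrite mulr_ge0 ?invr_ge0// ltW.
  have h3 : t ^+ j * expR (- (2^-1 * t)) <= (j`!%:R * 2 ^+ j : R).
    rewrite expRN ler_pdivrMr ?expR_gt0// mulrAC -ler_pdivrMr ?exprn_gt0//.
    by move: h2; rewrite exprMn exprVn mulrC.
  rewrite mulrACA [leRHS]mulrA -[leLHS]mulrA [leRHS]mulrAC -[leRHS]mulrA.
  rewrite [leLHS](_ : _ = (t ^+ j * expR (- (2^-1 * t))) * (t `^ (h - 1) * expR (- (2^-1 * t)))); last by ring.
  rewrite [leRHS](_ : _ = (j`!%:R * 2 ^+ j) * (t `^ (h - 1) * expR (- (2^-1 * t)))); last by ring.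
  by rewrite ler_wpM2r// mulr_ge0 ?powR_ge0 ?expR_ge0.
Qed.

End harmonic_constants.

Section projection_bound.
Context (R : realType) (d' : nat).
Local Notation d := d'.+1.
Hypothesis hd : (2 <= d)%N.
Local Notation C := R[i].

(* Closed form of the Funk-Hecke coefficients [cn]. *)
Definition chat (n m : nat) : R :=
  2 * pi `^ (d%:R / 2) * n`!%:R / (2 ^+ n * (m`!%:R * Gamma (n%:R - m%:R + d%:R / 2))).

Lemma d2_ge1 : 1 <= d%:R / 2 :> R.
Proof. by rewrite ler_pdivlMr// mul1r ler_nat. Qed.

Lemma cnE n m : (m <= n)%N -> cn R d' n m = rc (chat n m).
Proof.
move=> mn; rewrite /cn /cnm Gf1 /radR.
have e : ((2 * n - 2 * m + d)%:R / 2 : R) = n%:R - m%:R + d%:R / 2.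
  by rewrite -mulnBr natrD natrM natrB// mulrDl mulrAC mulfV ?mul1r.
have g1 : 1 <= n%:R - m%:R + d%:R / 2 :> R.
  by apply: le_trans d2_ge1 _; rewrite lerDr subr_ge0 ler_nat.
rewrite e; set g := Gamma _.
have g0 : g != 0 by rewrite gt_eqF// Gamma_gt0.
have -> : (2^-1 : R) `^ (- (n%:R - m%:R + d%:R / 2)) = 2 ^+ (n - m) * 2 `^ (d%:R / 2).
  rewrite -[2^-1]powR_inv1// -powRrM mulN1r opprK -natrB// powRD ?pnatr_eq0 ?implybT//.
  by rewrite powR_mulrn.
have -> : Num.sqrt (2 * pi) ^+ d = 2 `^ (d%:R / 2) * pi `^ (d%:R / 2) :> R.
  rewrite -powRM ?pi_ge0// -powR12_sqrt; last by rewrite mulr_ge0// pi_ge0.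
  by rewrite -powR_mulrn ?powR_ge0// -powRrM (mulrC 2^-1).
rewrite -!rc_nat -rcX -!rcM -!rcV -!rcM; congr rc; rewrite /chat -/g.
have -> : 2 ^+ n = 2 ^+ m * 2 ^+ (n - m) :> R by rewrite -exprD subnKC.
have p0 : (2 `^ (d%:R / 2) : R) != 0 by rewrite gt_eqF// powR_gt0.
have m0 : (m`!%:R : R) != 0 by rewrite pnatr_eq0 -lt0n fact_gt0.
have f1 : (2 ^+ m : R) != 0 by rewrite expf_neq0.
have f2 : (2 ^+ (n - m) : R) != 0 by rewrite expf_neq0.
by field; rewrite p0 m0 f1 f2 g0.
Qed.

Lemma chat_gt0 n m : (m <= n)%N -> 0 < chat n m.
Proof.
move=> mn; rewrite /chat divr_gt0// ?mulr_gt0 ?powR_gt0 ?pi_gt0 ?ltr0n ?fact_gt0 ?exprn_gt0//.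
by apply: Gamma_gt0; apply: le_trans d2_ge1 _; rewrite lerDr subr_ge0 ler_nat.
Qed.

(** The estimate of [proj_bound_aux] is divided by [chat n 0], which is at least a constant times
    [4^-n] by [Gamma_upper_fact]. The rate [4 e] combines this loss with the factor [exp n]; [A]
    depends on the dimension only. *)
Lemma proj_bound : exists2 A : R, 0 <= A & forall (f : d.-tuple R -> C) (K : R),
  cmeas f -> (forall u, enorm u = 1 -> cmod (f u) <= K) -> 0 <= K ->
  forall n (xi : d.-tuple R), enorm xi = 1 ->
  cmod (proj_harm n f xi) <= A * (4 * expR 1) ^+ n * K.
Proof.
pose G0 : R := 2^-1 `^ (- (d%:R / 2)) * Gamma (d%:R / 2).
pose S : R := fine (sphm R d' setT).
have S0 : 0 <= S by exact: fine_ge0.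
have G00 : 0 <= G0 by rewrite mulr_ge0 ?powR_ge0 ?Gamma_ge0.
have pp : 0 < pi `^ (d%:R / 2) :> R by rewrite powR_gt0 ?pi_gt0.
have gu n := @Gamma_upper_fact R n _ d2_ge1; rewrite -/G0 in gu.
have G0p : 0 < G0 by rewrite mulr_gt0 ?powR_gt0 ?invr_gt0// Gamma_gt0// d2_ge1.
have SE : S = fine (sphm R d' setT) by [].
clearbody G0 S.
exists (S * G0 / pi `^ (d%:R / 2)); first by rewrite divr_ge0 ?mulr_ge0 ?powR_ge0.
move=> f K mf fK K0 n xi xi1.
have h := proj_bound_aux hd mf fK n xi1 K0; move: h.
rewrite cnE// cmodM cmod_rc gtr0_norm ?chat_gt0// -SE => h.
have c1 : (pi `^ (d%:R / 2) * 2) / (4 ^+ n * G0) <= chat n 0.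
  rewrite /chat fact0 mul1r subr0.
  have gl : 0 < Gamma (n%:R + d%:R / 2) :> R.
    by apply: Gamma_gt0; apply: le_trans d2_ge1 _; rewrite lerDr.
  rewrite ler_pdivrMr; last by rewrite mulr_gt0 ?exprn_gt0.
  rewrite mulrAC ler_pdivlMr; last by rewrite mulr_gt0 ?exprn_gt0.
  rewrite [leLHS](_ : _ = 2 * pi `^ (d%:R / 2) * (2 ^+ n * Gamma (n%:R + d%:R / 2))); last by ring.
  rewrite -[leRHS]mulrA ler_wpM2l//; first by rewrite mulr_ge0// ltW.
  have -> : (4 : R) ^+ n = 2 ^+ n * 2 ^+ n by rewrite -exprMn -natrM.
  rewrite [leRHS](_ : _ = 2 ^+ n * (n`!%:R * 2 ^+ n * G0)); last by ring.
  by rewrite ler_wpM2l ?exprn_ge0.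
have c1p : 0 < (pi `^ (d%:R / 2) * 2) / (4 ^+ n * G0).
  by rewrite divr_gt0 ?mulr_gt0 ?exprn_gt0.
rewrite -(ler_pM2l c1p); apply: le_trans (_ : 2 * (K * expR n%:R * S) <= _).
  by apply: le_trans h; rewrite ler_wpM2r ?cmod_ge0.
rewrite exprMn -expRM_natl mulr1.
have f4 : (4 ^+ n : R) != 0 by rewrite expf_neq0.
have ppn := lt0r_neq0 pp; have G0n := lt0r_neq0 G0p.
rewrite le_eqVlt; apply/orP; left; apply/eqP; field.
by rewrite f4 ppn G0n.
Qed.

End projection_bound.

(** * The exponent V *)

Section stable_exponent.
Context (R : realType) (d' : nat).
Local Notation d := d'.+1.
Local Notation C := R[i].
Local Notation Re := complex.Re.
Local Notation Im := complex.Im.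
Variables (alpha : R) (halpha : 1 < alpha < 2).
Variable lam : {finite_measure set (d.-tuple R) -> \bar R}.
Hypothesis hlam_sph : lam (~` @sphere R d) = 0%E.
Local Notation V := (stableV alpha lam).
Local Notation S := (@sphere R d).

Let a0 : 0 <= alpha. Proof. by case/andP: halpha => h _; rewrite (le_trans _ (ltW h)). Qed.
Let mS : measurable S. Proof. exact: measurable_sphere. Qed.
Let mSC : measurable (~` S). Proof. exact: measurableC. Qed.
Let TS : setT `\` ~` S = S. Proof. by rewrite setTD setCK. Qed.
Definition Lam : R := fine (lam setT).
(** [lam] lives on the whole space and the complement of the sphere is null, so bounds on the sphere
    are enough. *)
Lemma integrable_lam (f : d.-tuple R -> R) K : measurable_fun setT f ->
  (forall v, enorm v = 1 -> `|f v| <= K) -> lam.-integrable setT (EFin \o f).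
Proof.
move=> mf fK; apply/integrableP; split; first exact/measurable_EFinP.
have mn : measurable_fun setT (fun u => (`|f u|)%:E).
  by apply/measurable_EFinP; exact: measurableT_comp.
rewrite (ge0_negligible_integral mSC _ mn)// TS.
apply: (@le_lt_trans _ _ (\int[lam]_(u in S) (`|K|)%:E)%E).
  apply: ge0_le_integral => //.
  - exact: measurable_funTS.
  - by move=> u /fK h; rewrite lee_fin; exact: le_trans h (ler_norm _).
rewrite integral_cst//= -(fineK (fin_num_measure lam _ mS)).
by rewrite -EFinM ltry.
Qed.

Lemma Rint_lamS (f : d.-tuple R -> R) : lam.-integrable setT (EFin \o f) ->
  Rintegral lam setT f = Rintegral lam S f.
Proof. by move=> i; rewrite /Rintegral (negligible_integral mSC _ i)// TS. Qed.

Lemma le_Rint_lam (f g : d.-tuple R -> R) :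
  lam.-integrable setT (EFin \o f) -> lam.-integrable setT (EFin \o g) ->
  (forall v, enorm v = 1 -> f v <= g v) ->
  Rintegral lam setT f <= Rintegral lam setT g.
Proof.
move=> i1 i2 fg; rewrite !Rint_lamS//; apply: le_Rintegral => //.
- exact: integrableS i1.
- exact: integrableS i2.
Qed.

Definition dpow (u v : d.-tuple R) : R := `|dotp u v| `^ alpha.

Lemma measurable_dotp2 : measurable_fun setT (fun p : d.-tuple R * d.-tuple R => dotp p.1 p.2).
Proof.
apply: measurable_sum => i; apply: measurable_funM.
- exact: (measurableT_comp (@measurable_tnth _ _ _ i) measurable_fst).
- exact: (measurableT_comp (@measurable_tnth _ _ _ i) measurable_snd).
Qed.

Lemma measurable_dpow2 : measurable_fun setT (fun p : d.-tuple R * d.-tuple R => dpow p.1 p.2).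
Proof.
apply: (measurableT_comp (@measurable_powR R alpha)).
by apply: measurableT_comp => //; exact: measurable_dotp2.
Qed.

Let mpair (u : d.-tuple R) : measurable_fun setT (fun v : d.-tuple R => (u, v)).
Proof. exact: measurable_fun_pair. Qed.

Lemma measurable_dpow u : measurable_fun setT (dpow u).
Proof. exact: (measurableT_comp measurable_dpow2 (mpair u)). Qed.

Lemma measurable_sg : measurable_fun setT (@Num.sg R).
Proof.
have -> : @Num.sg R = fun x => (0 < x)%R%:R - (x < 0)%R%:R.
  by apply/funext => x; case: sgrP => h; rewrite ?subrr ?subr0 ?sub0r.
apply: measurable_funB.
- rewrite (_ : (fun x : R => _) = \1_`]0%R, +oo[%classic).
    by apply: measurable_indic.
  by apply/funext => x; rewrite indicE mem_setE in_itv/= andbT.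
- rewrite (_ : (fun x : R => _) = \1_`]-oo, 0%R[%classic).
    by apply: measurable_indic.
  by apply/funext => x; rewrite indicE mem_setE in_itv/=.
Qed.

Definition dsg (u v : d.-tuple R) : R := dpow u v * Num.sg (dotp u v).

Lemma measurable_dsg2 : measurable_fun setT (fun p : d.-tuple R * d.-tuple R => dsg p.1 p.2).
Proof.
apply: measurable_funM; first exact: measurable_dpow2.
by apply: measurableT_comp; [exact: measurable_sg|exact: measurable_dotp2].
Qed.

Lemma measurable_dsg u : measurable_fun setT (dsg u).
Proof. exact: (measurableT_comp measurable_dsg2 (mpair u)). Qed.

Lemma dpow_ge0 u v : 0 <= dpow u v. Proof. exact: powR_ge0. Qed.

Lemma dpow_le u v : enorm v = 1 -> dpow u v <= enorm u `^ alpha.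
Proof.
move=> v1; apply: ge0_ler_powR => //; rewrite ?nnegrE ?enorm_ge0//.
by apply: le_trans (cauchy_schwarz _ _) _; rewrite v1 mulr1.
Qed.

Lemma dsg_abs u v : `|dsg u v| <= dpow u v.
Proof.
rewrite /dsg normrM ger0_norm ?dpow_ge0// -[leRHS]mulr1 ler_wpM2l ?dpow_ge0//.
by rewrite normr_sg; case: (_ == _).
Qed.

Lemma integrable_dpow u : lam.-integrable setT (EFin \o dpow u).
Proof.
apply: (@integrable_lam _ (enorm u `^ alpha)); first exact: measurable_dpow.
by move=> v v1; rewrite ger0_norm ?dpow_ge0// dpow_le.
Qed.

Lemma integrable_dsg u : lam.-integrable setT (EFin \o dsg u).
Proof.
apply: (@integrable_lam _ (enorm u `^ alpha)); first exact: measurable_dsg.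
by move=> v v1; apply: le_trans (dsg_abs _ _) _; rewrite dpow_le.
Qed.

Lemma cmeas_V : cmeas V.
Proof.
have mRe : measurable_fun setT (fun u => Rintegral lam setT (dpow u)).
  have := @measurable_fun_fubini_tonelli_F _ _ _ _ R lam (fun p => (dpow p.1 p.2)%:E).
  move=> /(_ _ _)/wrap[]; first by apply/measurable_EFinP; exact: measurable_dpow2.
    by move=> p; rewrite lee_fin dpow_ge0.
  by move=> h; apply: measurableT_comp h.
split; first exact: mRe.
apply: measurable_funM; first exact: measurable_cst.
(* Measurability in [u] comes from Tonelli, hence for nonnegative integrands. As [|dsg| <= dpow],
   adding [dpow] makes the signed integrand nonnegative, and its integral is subtracted again. *)
have E u : Rintegral lam setT (dsg u) =
    Rintegral lam setT (fun v => dpow u v + dsg u v) - Rintegral lam setT (dpow u).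
  rewrite RintegralD//; [|exact: integrable_dpow|exact: integrable_dsg].
  by rewrite addrAC subrr add0r.
rewrite (_ : (fun u => _) = (fun u => Rintegral lam setT (fun v => dpow u v + dsg u v) -
  Rintegral lam setT (dpow u))); last by apply/funext => u; rewrite -E.
apply: measurable_funB => //.
have := @measurable_fun_fubini_tonelli_F _ _ _ _ R lam (fun p => (dpow p.1 p.2 + dsg p.1 p.2)%:E).
move=> /(_ _ _)/wrap[].
- by apply/measurable_EFinP; apply: measurable_funD; [exact: measurable_dpow2|exact: measurable_dsg2].
- move=> p; rewrite lee_fin -lerBlDr sub0r.
  by have := dsg_abs p.1 p.2; rewrite ler_norml lerNl => /andP[].
- by move=> h; apply: measurableT_comp h.
Qed.

Definition tanc : R := `|tan (pi * alpha / 2)|.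

Lemma ReV_ge0 u : 0 <= Re (V u).
Proof. by apply: Rintegral_ge0 => v _; exact: dpow_ge0. Qed.

Lemma ImV_le u : `|Im (V u)| <= tanc * Re (V u).
Proof.
rewrite /= normrM normrN ler_wpM2l//.
apply: le_trans (le_normr_Rintegral _ (integrable_dsg u)) _ => //.
apply: le_Rintegral => //; [exact: integrable_norm (integrable_dsg u)|exact: integrable_dpow|].
by move=> v _; exact: dsg_abs.
Qed.

Lemma ReV_le u : enorm u = 1 -> Re (V u) <= Lam.
Proof.
move=> u1; have -> : Lam = Rintegral lam setT (fun=> 1) by rewrite Rintegral_cst// mul1r.
apply: le_Rint_lam; [exact: integrable_dpow|by apply: (@integrable_lam _ 1) => // v _; rewrite normr1|].
by move=> v v1; apply: le_trans (dpow_le _ v1) _; rewrite u1 powR1.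
Qed.

Lemma cmodV_le u : enorm u = 1 -> cmod (V u) <= (1 + tanc) * Lam.
Proof.
move=> u1; apply: le_trans (cmod_le_ReIm _) _; rewrite mulrDl mul1r lerD//.
  by rewrite ger0_norm ?ReV_ge0// ReV_le.
by apply: le_trans (ImV_le u) _; rewrite ler_wpM2l ?normr_ge0// ReV_le.
Qed.

(** For [x < y] put [t = x/y]. Since [alpha < 2] one has [t^2 <= t^alpha], so [y^alpha - x^alpha <=
    y^alpha (1 - t^2) <= 2 y (1 - t)], and [y^alpha <= y] was used because [y <= 1]. *)
Lemma powR_lip (x y : R) : 0 <= x -> x <= 1 -> 0 <= y -> y <= 1 ->
  y `^ alpha <= x `^ alpha + 2 * `|y - x|.
Proof.
have [a1 a2] := andP halpha.
move=> x0 x1 y0 y1; have [yx|xy] := leP y x.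
  have : y `^ alpha <= x `^ alpha by apply: ge0_ler_powR; rewrite ?nnegrE.
  by move=> h; apply: le_trans h _; rewrite lerDl mulr_ge0.
have yp : 0 < y by exact: le_lt_trans xy.
rewrite ger0_norm ?subr_ge0 ?(ltW xy)//.
pose t := x / y.
have t0 : 0 <= t by rewrite divr_ge0// ltW.
have t1 : t <= 1 by rewrite ler_pdivrMr// mul1r ltW.
have xE : x = t * y by rewrite divfK// gt_eqF.
have tt : t ^+ 2 <= t `^ alpha.
  have [->|tn0] := eqVneq t 0; first by rewrite expr0n powR_ge0.
  have tp : 0 < t by rewrite lt_neqAle eq_sym tn0.
  rewrite -powR_mulrn// /powR (negbTE tn0) ler_expR ler_wnM2r ?ln_le0//; exact: ltW.
have ya : y `^ alpha <= y by apply: ge1r_powR; rewrite ?yp//= ltW.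
have ya0 : 0 <= y `^ alpha by exact: powR_ge0.
rewrite {1}xE powRM ?(ltW yp)//.
have -> : y - x = y * (1 - t) by rewrite mulrBr mulr1 mulrC -xE.
have : y `^ alpha * (1 - t ^+ 2) <= y * (2 * (1 - t)).
  apply: ler_pM => //; last by nra.
  by rewrite subr_ge0 exprn_ile1.
by nra.
Qed.

Lemma ReV_lip u w : enorm u = 1 -> enorm w = 1 ->
  Re (V u) <= Re (V w) + 2 * enorm (vsub u w) * Lam.
Proof.
move=> u1 w1.
have -> : 2 * enorm (vsub u w) * Lam = Rintegral lam setT (fun=> 2 * enorm (vsub u w)).
  by rewrite Rintegral_cst.
have ic : lam.-integrable setT (EFin \o (fun _ : d.-tuple R => 2 * enorm (vsub u w))).
  by apply: (@integrable_lam _ `|2 * enorm (vsub u w)|).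
rewrite /= -RintegralD//; last exact: integrable_dpow.
apply: le_Rint_lam; [exact: integrable_dpow| |].
  by have := integrableD measurableT (integrable_dpow w) ic.
move=> v v1.
have b (z : d.-tuple R) : enorm z = 1 -> `|dotp z v| <= 1.
  by move=> z1; apply: le_trans (cauchy_schwarz _ _) _; rewrite z1 v1 mulr1.
apply: le_trans (@powR_lip `|dotp w v| `|dotp u v| _ _ _ _) _ => //; [exact: b|exact: b|].
rewrite lerD2l ler_wpM2l//; apply: le_trans (ler_dist_dist _ _) _.
by rewrite -dotpBl; apply: le_trans (cauchy_schwarz _ _) _; rewrite v1 mulr1.
Qed.

(** Transfers the compactness argument to row vectors, which carry a norm. *)
Definition tup (w : 'rV[R]_d) : d.-tuple R := [tuple w 0 i | i < d].

Lemma enorm_le_sum (x : d.-tuple R) : enorm x <= \sum_i `|tnth x i|.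
Proof.
rewrite -(@ler_pXn2r _ 2)// ?nnegrE ?enorm_ge0 ?sumr_ge0// enorm_sqr /dotp.
rewrite expr2 mulr_suml; apply: ler_sum => i _.
rewrite -expr2 -(real_normK (num_real (tnth x i))) expr2.
by rewrite ler_wpM2l// (bigD1 i)//= lerDl sumr_ge0.
Qed.

(** The one-sided Lipschitz bound, used in both directions, gives continuity on the sphere, which is
    closed and bounded among row vectors; the extreme value theorem concludes. *)
Lemma sphere_min (f : d.-tuple R -> R) (L : R) :
  (forall u w, enorm u = 1 -> enorm w = 1 -> f u <= f w + L * enorm (vsub u w)) ->
  exists2 u0, enorm u0 = 1 & forall u, enorm u = 1 -> f u0 <= f u.
Proof.
move=> fL.
pose A := [set w : 'rV[R]_d | enorm (tup w) = 1].
have Ane : A !=set0.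
  exists (\row_i (i == ord0)%:R); rewrite /A/= /enorm /dotp (bigD1 ord0)//= big1.
    by rewrite tnth_mktuple mxE eqxx mulr1 addr0 sqrtr1.
  by move=> i i0; rewrite tnth_mktuple mxE (negbTE i0) mulr0.
pose q (w : 'rV[R]_d) : R := \sum_i w 0 i * w 0 i.
have qE w : q w = enorm (tup w) ^+ 2.
  by rewrite enorm_sqr /dotp; apply: eq_bigr => i _; rewrite tnth_mktuple.
have AE : A = q @^-1` [set 1].
  apply/seteqP; split => w; rewrite /A/= qE; first by move=> ->; rewrite expr1n.
  by move=> /eqP; rewrite sqrp_eq1 ?enorm_ge0// => /eqP.
have cq : continuous q.
  rewrite /q; elim: (index_enum _) => [|i s IH].
    rewrite (_ : (fun w => _) = fun=> 0); first exact: cst_continuous.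
    by apply/funext => w; rewrite big_nil.
  rewrite (_ : (fun w => _) = fun w : 'rV[R]_d => w 0 i * w 0 i + \sum_(j <- s) w 0 j * w 0 j).
    move=> w; have c1 := @coord_continuous R 1 d 0 i w.
    exact: (cvgD (cvgM c1 c1) (IH w)).
  by apply/funext => w; rewrite big_cons.
have clA : closed A.
  rewrite AE; apply: closed_comp; first by move=> w _; exact: cq.
  exact: closed_eq.
have bA : bounded_set A.
  exists 1; split => // M M1 w; rewrite /A/= => w1; apply: le_trans (ltW M1).
  rewrite [leLHS]mx_normrE; apply/bigmax_leP; split => // ij _.
  have := tnth_le_enorm (tup w) ij.2; rewrite tnth_mktuple w1 [ij.1]ord1.
  by [].
have cf : {within A, continuous (f \o tup)}.
  apply/subspace_continuousP => w Aw; apply/cvgrPdist_lt => e e0 /=.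
  (* The Euclidean norm is at most [d] times the maximum norm of row vectors; the summand 1 keeps
     the divisor positive when [L = 0]. *)
  have Lp : 0 < `|L| * d%:R + 1 by rewrite ltr_wpDl// mulr_ge0.
  rewrite near_withinE; near=> z => Az.
  have h1 := fL _ _ Aw Az; have h2 := fL _ _ Az Aw.
  have zw : `|w - z| < e / (`|L| * d%:R + 1).
    near: z; apply/nbhs_ballP; exists (e / (`|L| * d%:R + 1)); first by rewrite /= divr_gt0.
    by move=> z; rewrite -ball_normE.
  have bd (x y : 'rV[R]_d) : `|x - y| = `|w - z| -> L * enorm (vsub (tup x) (tup y)) < e.
    move=> xy; apply: le_lt_trans (_ : (`|L| * d%:R) * `|w - z| < _); last first.
      apply: (@le_lt_trans _ _ ((`|L| * d%:R + 1) * `|w - z|)).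
        by rewrite ler_wpM2r// lerDl.
      by rewrite mulrC -ltr_pdivlMr.
    apply: le_trans (_ : `|L| * enorm (vsub (tup x) (tup y)) <= _).
      by rewrite ler_wpM2r ?enorm_ge0// ler_norm.
    rewrite -mulrA ler_wpM2l//; apply: le_trans (enorm_le_sum _) _.
    rewrite -xy mulr_natl -[Y in _ *+ Y](card_ord d) -sumr_const; apply: ler_sum => i _.
    rewrite !tnth_mktuple [leRHS]mx_normrE.
    have h := le_bigmax 0 (fun ij : 'I_1 * 'I_d => `|(x - y) ij.1 ij.2|) (ord0, i).
    by move: h; rewrite /= !mxE.
  have b1 := bd w z erefl; have b2 := bd z w (distrC _ _).
  have H : `|f (tup w) - f (tup z)| < e.
    move: h1 h2 b1 b2 (e0 : 0 < e :> R); move: (f (tup w)) (f (tup z)) (L * _) (L * _) => p1 p2 p3 p4 *.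
    by rewrite ltr_norml; apply/andP; split; lra.
  exact: H.
have [c Ac cmin] := EVT_min_rV Ane (bounded_closed_compact bA clA) cf.
exists (tup c); first by move: Ac; rewrite inE.
move=> u u1; pose w : 'rV[R]_d := \row_i tnth u i.
have tw : tup w = u by apply: eq_from_tnth => i; rewrite tnth_mktuple mxE.
have := cmin w; rewrite /= tw; apply.
by rewrite inE /A/= tw.
Unshelve. all: by end_near. Qed.

Variable mu : probability (d.-tuple R) R.
Hypothesis hchf : forall z : d.-tuple R, 0 < enorm z ->
  charfun mu z = cexp (- (rc (enorm z `^ alpha) * V (unitv z))).
Hypothesis hnd : nondegenerate_law mu.

Lemma cos_eq1 (y : R) : `|y| < 1 -> cos y = 1 -> y = 0.
Proof.
move=> y1 c1.
have sy : sin y = 0 by apply: cos1sin0; rewrite c1 normr1.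
have pi1 : 1 < pi :> R by have := @pi_ge2 R; lra.
move: y1; rewrite ltr_norml => /andP[yl yr].
have [y0|y0|//] := ltgtP y 0.
- have : 0 < sin (- y) by apply: sin_gt0_pi; lra.
  by rewrite sinN sy oppr0 ltxx.
- have : 0 < sin y by apply: sin_gt0_pi; lra.
  by rewrite sy ltxx.
Qed.

Lemma integrable_cos (w : d.-tuple R) : mu.-integrable setT (EFin \o (fun x => cos (dotp w x))).
Proof.
have ic : mu.-integrable setT (EFin \o (fun=> 1 : R)).
  exact: finite_measure_integrable_cst.
apply: le_integrable ic => //.
- apply/measurable_EFinP; apply: measurableT_comp.
    by apply: continuous_measurable_fun; exact: continuous_cos.
  exact: (measurable_dotp (measurable_cst w) (@measurable_id _ _ _)).
- by move=> x _; rewrite /= lee_fin normr1 ler_norml cos_geN1 cos_le1.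
Qed.

(** If [Re V(u) = 0] then [V(u) = 0] by [ImV_le], and the characteristic function equals 1 along the
    ray through [u]. Hence [cos (<u, x> / (n+1)) = 1] almost surely for every [n], which forces
    [<u, x> = 0]: the law would sit on a hyperplane, against nondegeneracy. *)
Lemma ReV_gt0 u : enorm u = 1 -> 0 < Re (V u).
Proof.
move=> u1; rewrite lt_neqAle ReV_ge0 andbT; apply/eqP => V0; apply: hnd.
have VE : V u = 0.
  apply: ceqP => //; apply/eqP; rewrite -normr_le0.
  by apply: le_trans (ImV_le u) _; rewrite -V0 mulr0.
pose E (n : nat) := [set x : d.-tuple R | cos (dotp (vscale n.+1%:R^-1 u) x) != 1].
have En n : mu.-negligible (E n).
  pose w := vscale n.+1%:R^-1 u.
  have wn : 0 < enorm w by rewrite enormZ u1 mulr1 gtr0_norm invr_gt0.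
  have wu : unitv w = u.
    by rewrite unitvZ ?invr_gt0// unitv_id.
  have := hchf wn; rewrite wu VE mulr0 oppr0 cexp0 => /(congr1 (@complex.Re R)) /= h.
  have ic : mu.-integrable setT (EFin \o (fun=> 1 : R)).
    exact: finite_measure_integrable_cst.
  have mc : measurable_fun setT (fun x => (1 - cos (dotp w x))%:E).
    have := measurable_int _ (integrableB measurableT ic (integrable_cos w)).
    by apply: eq_measurable_fun.
  have h0 : (\int[mu]_x `|(1 - cos (dotp w x))%:E| = 0)%E.
    under eq_integral do rewrite gee0_abs ?lee_fin ?subr_ge0 ?cos_le1//.
    have ii : mu.-integrable setT (fun x => (1 - cos (dotp w x))%:E).
      by have := integrableB measurableT ic (integrable_cos w).
    rewrite -(fineK (integrable_fin_num measurableT ii)); congr EFin.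
    have := @RintegralB _ _ _ mu setT (fun=> 1) (fun x => cos (dotp w x)) measurableT ic (integrable_cos w).
    have e1 : Rintegral mu setT (fun=> 1) = 1.
      by rewrite Rintegral_cst// mul1r; exact: (congr1 fine (probability_setT mu)).
    by rewrite h e1 subrr.
  have [/(_ h0) ae _] := ae_eq_integral_abs mu measurableT mc.
  apply: negligibleS ae => x /= /eqP nx; apply: contra_not nx => /(_ I) [].
  by move=> /eqP; rewrite subr_eq0 => /eqP <-.
have [B [mB B0 EB]] := negligible_bigcup En.
have nz x : dotp u x != 0 -> B x.
  (* With this [n] one has [|<u, x>| / (n+1) < 1], where the cosine equals 1 only at 0. *)
  move=> ux; apply: EB; exists (Num.truncn `|dotp u x|) => //; rewrite /E/=.
  apply: contraNneq ux => c1; rewrite dotpZl in c1.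
  set n := Num.truncn _ in c1; have n0 : (0 : R) < n.+1%:R by rewrite ltr0n.
  have := cos_eq1 _ c1; rewrite normrM ger0_norm ?invr_ge0// mulrC ltr_pdivrMr// mul1r.
  move=> /(_ (truncnS_gt _)) /eqP; rewrite mulf_eq0 invr_eq0.
  by rewrite (gt_eqF n0).
exists [set x | dotp u x = 0]; split; [split|split].
- by exists vzero; exact: dotp0.
- move=> x y t /= x0 y0.
  have -> : dotp u (acomb t x y) = (1 - t) * dotp u x + t * dotp u y.
    rewrite /dotp !mulr_sumr -big_split; apply: eq_bigr => i _.
    by rewrite tnth_mktuple /=; ring.
  by rewrite x0 y0 !mulr0 addr0.
- apply/eqP => /(congr1 (fun A : set (d.-tuple R) => A u)) /= h.
  have : True by []. rewrite -h => /eqP; rewrite -enorm_sqr u1 expr1n.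
  by rewrite oner_eq0.
(* If [<u, x>] is nonzero, the ball around [x] of radius [|<u, x>|] misses the hyperplane, hence is
   null, and [x] is not in the support. *)
- move=> x xs /=; apply/eqP; apply/negPn/negP => ux.
  have e0 : 0 < `|dotp u x| by rewrite normr_gt0.
  have := xs _ e0; apply/negP; rewrite -leNgt -B0; apply: le_measure; rewrite ?inE//.
    rewrite (_ : [set y | _] = [set y | enorm (aff (vscale (-1) x) 1 y) \in `]-oo, `|dotp u x|[ ]).
      rewrite -[Y in measurable Y]setTI.
      have mm := measurableT_comp (@measurable_enorm R d) (@measurable_aff R d (vscale (-1) x) 1).
      exact: (mm measurableT _ (measurable_itv `]-oo, `|dotp u x|[)).
    have vE y : vsub y x = aff (vscale (-1) x) 1 y.
      by apply: eq_from_tnth => i; rewrite !tnth_mktuple; ring.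
    by apply/seteqP; split => y; rewrite /= in_itv/= vE.
  move=> y /= yx; apply: nz; apply: contraTneq yx => uy.
  rewrite -leNgt (_ : `|dotp u x| = `|dotp u (vsub y x)|).
    by apply: le_trans (cauchy_schwarz _ _) _; rewrite u1 mul1r.
  by rewrite dotpBr uy sub0r normrN.
Qed.

Lemma ReV_lower : exists2 c, 0 < c & forall u, enorm u = 1 -> c <= Re (V u).
Proof.
have [u w u1 w1|u0 u01 h] := @sphere_min (fun u => Re (V u)) (2 * Lam).
  by rewrite mulrAC; exact: ReV_lip.
by exists (Re (V u0)); [exact: ReV_gt0|].
Qed.

Variables (Rr : R) (hR : rho0 V < Rr).

(** A supremum bounds its set only if the set is bounded above. Here [|V| <= (1 + tanc) Re V]
    together with [|V| <= (1 + tanc) Lam] bounds the quotients. *)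
Lemma le_rho0 u : enorm u = 1 -> cmod (V u) ^+ 2 <= 2 * rho0 V * Re (V u).
Proof.
move=> u1; have Vp := ReV_gt0 u1.
rewrite mulrAC mulrC -ler_pdivrMr ?mulr_gt0//.
apply: ub_le_sup; last by exists u.
exists (((1 + tanc) * Lam) * (1 + tanc) / 2) => _ [w w1 <-].
have Wp := ReV_gt0 w1.
rewrite ler_pdivrMr ?mulr_gt0//.
have t0 : 0 <= tanc by exact: normr_ge0.
have b1 : cmod (V w) <= (1 + tanc) * Re (V w).
  apply: le_trans (cmod_le_ReIm _) _; rewrite (ger0_norm (ltW Wp)) mulrDl mul1r.
  by apply: lerD; [exact: lexx|exact: ImV_le].
have b2 := cmodV_le w1.
rewrite [leRHS](_ : _ = ((1 + tanc) * Lam) * ((1 + tanc) * Re (V w))); last by field.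
by rewrite expr2 ler_pM ?cmod_ge0.
Qed.

Lemma sphere_ne : exists u : d.-tuple R, enorm u = 1.
Proof.
have [|u0 u1 _] := @sphere_min (fun=> 0) 0; last by exists u0.
by move=> u w _ _; rewrite mul0r addr0.
Qed.

Lemma rho0_ge0 : 0 <= rho0 V.
Proof.
have [u u1] := sphere_ne; have := le_rho0 u1.
move=> /(le_trans (sqr_ge0 _)); rewrite pmulr_lge0 ?ReV_gt0//.
by rewrite pmulr_rge0.
Qed.

Lemma Rr_gt0 : 0 < Rr. Proof. exact: le_lt_trans rho0_ge0 hR. Qed.

(** Expanding, [|R - V|^2 = R^2 - 2 R Re V + |V|^2 <= R^2 - 2 (R - rho_0) Re V] by the definition of
    [rho_0]. The positive lower bound [c] of [Re V] makes this uniformly smaller than [R^2], and [q]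
    is the square root of the resulting bound. *)
Lemma Vstar_bound : exists2 q, 0 <= q < Rr & forall u, enorm u = 1 -> cmod (rc Rr - V u) <= q.
Proof.
have [c c0 hc] := ReV_lower.
have h u : enorm u = 1 -> cmod (rc Rr - V u) ^+ 2 <= Rr ^+ 2 - 2 * (Rr - rho0 V) * c.
  move=> u1; rewrite cmod_sqr cReD cImD cReN cImN [Re (rc _)]/= [Im (rc _)]/= sub0r.
  have := le_rho0 u1; rewrite cmod_sqr => h1; have h2 := hc u u1.
  have := hR; move: h1 h2; move: (rho0 V) (Re (V u)) (Im (V u)) => p r i; nra.
have Rp := Rr_gt0.
exists (Num.sqrt (Rr ^+ 2 - 2 * (Rr - rho0 V) * c)).
  rewrite sqrtr_ge0/= -[ltRHS](ger0_norm (ltW Rp)) -sqrtr_sqr ltr_sqrt ?exprn_gt0//.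
  by have := hR; nra.
move=> u u1; rewrite -[leLHS]ger0_norm ?cmod_ge0// -sqrtr_sqr ler_wsqrtr//.
exact: h.
Qed.

End stable_exponent.

(** * Fourier inversion *)

Section tuple_measure_unique.
Context (R : realType) (d : nat).

Definition obox (a b : 'I_d -> R) : set (d.-tuple R) :=
  [set x | forall i, a i < tnth x i < b i].

Lemma measurable_obox a b : measurable (obox a b).
Proof.
rewrite (_ : obox a b = \bigcap_(i in [set: 'I_d]) ((fun x => tnth x i) @^-1` `]a i, b i[)).
  apply: fin_bigcap_measurable => // i _; rewrite -[Y in measurable Y]setTI.
  have mt := @measurable_tnth _ R d i.
  exact: (mt measurableT _ (measurable_itv `]a i, b i[)).
apply/seteqP; split => x.
  by move=> h i _; rewrite /= in_itv/=; exact: h.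
by move=> h i; have := h i I; rewrite /= in_itv/=.
Qed.

Definition oboxes := [set A | exists a b, A = obox a b].

Lemma obox_gen : @measurable _ (d.-tuple R) = <<s oboxes >>.
Proof.
apply/seteqP; split => [A mA|]; last first.
  apply: smallest_sub; first exact: sigma_algebra_measurable.
  by move=> _ [a [b ->]]; exact: measurable_obox.
have mid : measurable_fun (setT : set (g_sigma_algebraType oboxes)) (fun x : g_sigma_algebraType oboxes => (x : d.-tuple R)).
  apply/measurable_fun_tnthP => i.
  apply: (@measurability _ _ (g_sigma_algebraType oboxes) (measurableTypeR R) setT
    (fun x => tnth (x : d.-tuple R) i) _ (RGenOInfty.measurableE R)) => _ [_ [r ->] <-].
  (* The half-space [x_i > r] is exhausted by boxes whose other sides grow with [k]. *)
  rewrite setTI (_ : _ @^-1` _ = \bigcup_k obox (fun j => if j == i then r else - k%:R) (fun=> k%:R)).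
    apply: bigcup_measurable => k _; apply: sub_sigma_algebra.
    by do 2 eexists; reflexivity.
  apply/seteqP; split => x /=; rewrite in_itv/= andbT.
    move=> rx; exists (Num.truncn (\sum_j `|tnth x j|)).+1 => // j.
    have xj : `|tnth x j| < (Num.truncn (\sum_j `|tnth x j|)).+1%:R.
      apply: le_lt_trans (truncnS_gt _).
      by rewrite (bigD1 j)//= lerDl sumr_ge0.
    move: xj; rewrite ltr_norml => /andP[h1 h2]; rewrite h2 andbT.
    by case: eqP => [->|_].
  by move=> [k _ /(_ i)]; rewrite eqxx => /andP[].
by have := mid measurableT A mA; rewrite setTI.
Qed.

Lemma tuple_measure_unique (m1 m2 : {measure set (d.-tuple R) -> \bar R}) :
  (forall a b, m1 (obox a b) = m2 (obox a b)) -> (forall a b, m1 (obox a b) < +oo)%E ->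
  forall A, measurable A -> m1 A = m2 A.
Proof.
move=> m12 fin.
apply: (@measure_unique _ R _ oboxes (fun k => obox (fun=> - k%:R) (fun=> k%:R))).
- exact: obox_gen.
- move=> _ _ [a [b ->]] [a' [b' ->]].
  exists (fun i => Num.max (a i) (a' i)), (fun i => Num.min (b i) (b' i)).
  apply/seteqP; split => x.
    by move=> [h h'] i; rewrite gt_max lt_min; move: (h i) (h' i) => /andP[-> ->] /andP[-> ->].
  move=> h; split => i; have := h i; rewrite gt_max lt_min.
    by move=> /andP[/andP[-> _] /andP[-> _]].
  by move=> /andP[/andP[_ ->] /andP[_ ->]].
- by move=> k; do 2 eexists; reflexivity.
- apply/seteqP; split => // x _; exists (Num.truncn (\sum_j `|tnth x j|)).+1 => // j.
  have xj : `|tnth x j| < (Num.truncn (\sum_j `|tnth x j|)).+1%:R.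
    apply: le_lt_trans (truncnS_gt _).
    by rewrite (bigD1 j)//= lerDl sumr_ge0.
  by rewrite -ltr_norml.
- by move=> _ [a [b ->]]; exact: m12.
- by move=> k; exact: fin.
Qed.

End tuple_measure_unique.

Section cint_extra.
Context d1 d2 (T1 : measurableType d1) (T2 : measurableType d2) (R : realType).
Variables (m1 : {sigma_finite_measure set T1 -> \bar R})
  (m2 : {sigma_finite_measure set T2 -> \bar R}).
Local Notation C := R[i].
Local Notation Re := complex.Re.
Local Notation Im := complex.Im.

Lemma Rfubini (f : T1 * T2 -> R) :
  (m1 \x m2)%E.-integrable setT (EFin \o f) ->
  (forall x, m2.-integrable setT (fun y => (f (x, y))%:E)) ->
  (forall y, m1.-integrable setT (fun x => (f (x, y))%:E)) ->
  Rintegral m1 setT (fun x => Rintegral m2 setT (fun y => f (x, y))) =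
  Rintegral m2 setT (fun y => Rintegral m1 setT (fun x => f (x, y))).
Proof.
move=> i12 i2 i1; rewrite {1 3}/Rintegral; congr fine.
have := Fubini i12; rewrite /= => E.
transitivity (\int[m1]_x \int[m2]_y (f (x, y))%:E)%E.
  by apply: eq_integral => x _; rewrite /Rintegral fineK//; exact: integrable_fin_num.
by rewrite E; apply: eq_integral => x _; rewrite /Rintegral fineK//; exact: integrable_fin_num.
Qed.

Lemma cfubini (f : T1 * T2 -> C) : cintegrable (m1 \x m2)%E f ->
  (forall x, cintegrable m2 (fun y => f (x, y))) ->
  (forall y, cintegrable m1 (fun x => f (x, y))) ->
  cint m1 (fun x => cint m2 (fun y => f (x, y))) =
  cint m2 (fun y => cint m1 (fun x => f (x, y))).
Proof.
move=> [ir ii] i2 i1; apply: ceqP => /=.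
- exact: (Rfubini ir (fun x => (i2 x).1) (fun y => (i1 y).1)).
- exact: (Rfubini ii (fun x => (i2 x).2) (fun y => (i1 y).2)).
Qed.

End cint_extra.

Section cint_dct.
Context dd (T : measurableType dd) (R : realType) (m : {measure set T -> \bar R}).
Local Notation C := R[i].
Local Notation Re := complex.Re.
Local Notation Im := complex.Im.

Lemma cint_dct (f_ : nat -> T -> C) (f : T -> C) (G : T -> R) :
  (forall n, cmeas (f_ n)) ->
  (forall x, Re (f_ n x) @[n --> \oo] --> Re (f x)) ->
  (forall x, Im (f_ n x) @[n --> \oo] --> Im (f x)) ->
  (forall n x, cmod (f_ n x) <= G x) -> m.-integrable setT (EFin \o G) ->
  cintegrable m f /\
  (Re (cint m (f_ n)) @[n --> \oo] --> Re (cint m f)) /\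
  (Im (cint m (f_ n)) @[n --> \oo] --> Im (cint m f)).
Proof.
move=> mf fr fi fG iG.
have [ir cr] := Rintegral_dct (fun n => (mf n).1) fr (fun n x => le_trans (Re_le_cmod _) (fG n x)) iG.
have [ii ci] := Rintegral_dct (fun n => (mf n).2) fi (fun n x => le_trans (Im_le_cmod _) (fG n x)) iG.
by split; [split|split].
Qed.

Lemma cexp_sum I (r : seq I) (P : pred I) (F : I -> C) :
  cexp (\sum_(i <- r | P i) F i) = \prod_(i <- r | P i) cexp (F i).
Proof. apply: (big_morph _ (@cexpD R)); exact: cexp0. Qed.

End cint_dct.

Section gauss_nd.
Context (R : realType) (d' : nat).
Local Notation d := d'.+1.
Local Notation leb := (@lebesgue_measure R).
Local Notation lebd := (lebn R d).
Local Notation C := R[i].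
Local Notation Re := complex.Re.
Local Notation Im := complex.Im.

Lemma cint_aff (y : d.-tuple R) (c : R) (f : d.-tuple R -> C) : c != 0 ->
  cintegrable lebd f -> cintegrable lebd (fun x => f (aff y c x)) /\
  cint lebd (fun x => f (aff y c x)) = rc (`|c| ^- d) * cint lebd f.
Proof.
move=> c0 [ir ii]; split.
  split.
  - exact: (integrable_aff y c0 ir).
  - exact: (integrable_aff y c0 ii).
have mr := measurable_int _ ir; have mi := measurable_int _ ii.
apply: ceqP; rewrite ?cReMrc ?cImMrc /= /Rintegral.
- rewrite (integral_aff y c0 mr ir) fineM//; exact: integrable_fin_num ir.
- rewrite (integral_aff y c0 mi ii) fineM//; exact: integrable_fin_num ii.
Qed.

Lemma gauss_nd (t : d.-tuple R) :
  cintegrable lebd (fun z => cexp (rc (dotp t z) * ci) * rc (gw (enorm z))) /\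
  cint lebd (fun z => cexp (rc (dotp t z) * ci) * rc (gw (enorm z))) =
    rc (Num.sqrt (2 * pi) ^+ d * gw (enorm t)).
Proof.
pose f i (x : R) : C := cexp (rc (tnth t i * x) * ci) * rc (gw x).
have [I E] := @cint_lebn_prod R d f (fun i => (gaussian_ft (tnth t i)).1).
have fE : (fun z => cexp (rc (dotp t z) * ci) * rc (gw (enorm z))) =
    fun z => \prod_i f i (tnth z i).
  apply/funext => z; rewrite /dotp rc_sum mulr_suml cexp_sum -gwn_prod rc_prod -big_split.
  by [].
rewrite fE; split => //; rewrite E.
under eq_bigr do rewrite (gaussian_ft _).2.
by rewrite -rc_prod big_split/= prodr_const card_ord gwn_prod.
Qed.

Lemma gauss_nd_scaled (e : R) (w : d.-tuple R) : 0 < e ->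
  cintegrable lebd (fun z => cexp (- (rc (dotp w z) * ci)) * rc (gw (e * enorm z))) /\
  cint lebd (fun z => cexp (- (rc (dotp w z) * ci)) * rc (gw (e * enorm z))) =
    rc (e^-1 ^+ d * (Num.sqrt (2 * pi) ^+ d * gw (enorm w / e))).
Proof.
move=> e0; have [I E] := gauss_nd (vscale (- e^-1) w).
have en0 : e != 0 by rewrite gt_eqF.
have [I' E'] := cint_aff vzero en0 I.
have fE : (fun z => cexp (- (rc (dotp w z) * ci)) * rc (gw (e * enorm z))) =
   (fun z => cexp (rc (dotp (vscale (- e^-1) w) (aff vzero e z)) * ci) * rc (gw (enorm (aff vzero e z)))).
  apply/funext => z; rewrite -vscale_aff enormZ gtr0_norm// dotpZl dotpZr.
  by rewrite mulNr mulKf// rcN mulNr.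
rewrite fE; split => //; rewrite E' E -rcM gtr0_norm// exprVn enormZ normrN gtr0_norm ?invr_gt0//.
by rewrite (mulrC (e^-1)).
Qed.

End gauss_nd.

Section sequence_limits.
Context (R : realType).
Implicit Types (u : nat -> R) (a c l : R).

Lemma cvg_seq_ge u l a : u n @[n --> \oo] --> l -> (forall n, a <= u n) -> a <= l.
Proof.
move=> h au; have hc : (fun _ : nat => a) n @[n --> \oo] --> a by exact: cvg_cst.
by apply: (ler_cvg_to hc h); exact: nearW.
Qed.

Lemma cvg_seq_le u l a : u n @[n --> \oo] --> l -> (forall n, u n <= a) -> l <= a.
Proof.
move=> h au; have hc : (fun _ : nat => a) n @[n --> \oo] --> a by exact: cvg_cst.
by apply: (ler_cvg_to h hc); exact: nearW.
Qed.

Lemma cvg_seq_unique u l l' : u n @[n --> \oo] --> l -> u n @[n --> \oo] --> l' -> l = l'.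
Proof. by move=> h h'; apply/eqP; rewrite eq_le; apply/andP; split;
  [apply: (ler_cvg_to h h')|apply: (ler_cvg_to h' h)]; exact: nearW. Qed.

Lemma cvg_mul1 u c : u n @[n --> \oo] --> (1 : R) -> u n * c @[n --> \oo] --> c.
Proof. by move=> hu; rewrite -{2}(mul1r c); apply: cvgM => //; exact: cvg_cst. Qed.

End sequence_limits.

(** * Gaussian smoothing and the inversion formula *)

Section fourier_inversion.
Context (R : realType) (d' : nat).
Local Notation d := d'.+1.
Local Notation leb := (@lebesgue_measure R).
Local Notation lebd := (lebn R d).
Local Notation C := R[i].
Local Notation Re := complex.Re.
Local Notation Im := complex.Im.
Variable mu : probability (d.-tuple R) R.
Variables (Phi : d.-tuple R -> C) (Dom : d.-tuple R -> R).
Hypothesis muPhi : forall z, charfun mu z = Phi z.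
Hypothesis mPhi : cmeas Phi.
Hypothesis PhiDom : forall z, cmod (Phi z) <= Dom z.
Hypothesis iDom : lebd.-integrable setT (EFin \o Dom).

Let c0 : R := (2 * pi) ^- d.
Let s0 : R := Num.sqrt (2 * pi) ^+ d.

Let pi2 : 0 < 2 * pi :> R. Proof. by rewrite mulr_gt0 ?pi_gt0. Qed.
Let c0_gt0 : 0 < c0. Proof. by rewrite invr_gt0 exprn_gt0. Qed.
Let s0_gt0 : 0 < s0. Proof. by rewrite exprn_gt0// sqrtr_gt0. Qed.
Let c0s0 : c0 * (s0 * s0) = 1.
Proof.
rewrite /c0 /s0 -exprMn -expr2 sqr_sqrtr ?ltW// mulVf// expf_neq0// gt_eqF//.
Qed.

(* The centred Gaussian density of variance [e^2]. *)
Definition kr (e : R) (w : d.-tuple R) : R :=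
  c0 * (e^-1 ^+ d * (s0 * gw (enorm w / e))).

Lemma kr_ge0 e w : 0 < e -> 0 <= kr e w.
Proof.
move=> e0; apply: mulr_ge0; first exact: ltW.
apply: mulr_ge0; first by rewrite exprn_ge0// invr_ge0 ltW.
by apply: mulr_ge0; [exact: ltW|exact: gw_ge0].
Qed.

Lemma gw_le1 (x : R) : gw x <= 1.
Proof. by rewrite /gw -expR0 ler_expR oppr_le0 divr_ge0// sqr_ge0. Qed.

Lemma kr_le e w : 0 < e -> kr e w <= c0 * (e^-1 ^+ d * s0).
Proof.
move=> e0; apply: ler_wpM2l; first exact: ltW.
apply: ler_wpM2l; first by rewrite exprn_ge0// invr_ge0 ltW.
by rewrite -[leRHS]mulr1; apply: ler_wpM2l; [exact: ltW|exact: gw_le1].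
Qed.

Lemma measurable_kr e : measurable_fun setT (kr e).
Proof.
rewrite /kr; do 3 (apply: measurable_funM => //).
apply: (measurableT_comp (@measurable_gw R)).
by apply: measurable_funM => //; exact: measurable_enorm.
Qed.

Lemma measurable_vsub dd (T : measurableType dd) (f g : T -> d.-tuple R) :
  measurable_fun setT f -> measurable_fun setT g ->
  measurable_fun setT (fun t => vsub (f t) (g t)).
Proof.
move=> /measurable_fun_tnthP mf /measurable_fun_tnthP mg.
apply/measurable_fun_tnthP => i.
rewrite (_ : _ \o _ = fun t => tnth (f t) i - tnth (g t) i).
  by apply: measurable_funB; [exact: (mf i)|exact: (mg i)].
by apply/funext => t /=; rewrite tnth_mktuple.
Qed.

Lemma measurable_kr_sub e x : measurable_fun setT (fun y => kr e (vsub x y)).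
Proof.
by apply: (measurableT_comp (measurable_kr e)); apply: measurable_vsub.
Qed.

Lemma integrable_prob_bounded (f : d.-tuple R -> R) K : measurable_fun setT f ->
  (forall y, `|f y| <= K) -> mu.-integrable setT (EFin \o f).
Proof.
move=> mf fK.
have ic : mu.-integrable setT (EFin \o (fun=> K)).
  exact: finite_measure_integrable_cst.
apply: le_integrable ic => //; first exact/measurable_EFinP.
by move=> y _; rewrite /= lee_fin; apply: le_trans (fK y) (ler_norm _).
Qed.

Lemma cintegrable_prob_bounded (f : d.-tuple R -> C) K : cmeas f ->
  (forall y, cmod (f y) <= K) -> cintegrable mu f.
Proof.
move=> [mr mi] fK; split.
- by apply: (@integrable_prob_bounded _ K) => // y; exact: le_trans (Re_le_cmod _) (fK y).
- by apply: (@integrable_prob_bounded _ K) => // y; exact: le_trans (Im_le_cmod _) (fK y).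
Qed.

Let cmod_cis (a : R) : cmod (cexp (- (rc a * ci))) = 1.
Proof. by rewrite cmod_cexp cReN cReMrc/= mulr0 oppr0 expR0. Qed.

Let cmod_cis' (a : R) : cmod (cexp (rc a * ci)) = 1.
Proof. by rewrite cmod_cexp cReMrc/= mulr0 expR0. Qed.

Lemma charfunE z : cint mu (fun y => cexp (rc (dotp z y) * ci)) = charfun mu z.
Proof.
apply: ceqP => /=; apply: eq_Rintegral => y _; rewrite ?cReMrc ?cImMrc /=.
- by rewrite !mulr0 !mulr1 subr0 addr0 expR0 mul1r.
- by rewrite !mulr0 !mulr1 subr0 addr0 expR0 mul1r.
Qed.

Lemma cmeas_cis dd (T : measurableType dd) (f g : T -> d.-tuple R) :
  measurable_fun setT f -> measurable_fun setT g ->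
  cmeas (fun t => cexp (- (rc (dotp (f t) (g t)) * ci))).
Proof.
move=> mf mg; apply: cmeas_cexp; apply: cmeasN; apply: cmeasM; last exact: cmeas_cst.
by apply: cmeas_rc; exact: measurable_dotp.
Qed.

(* The density of [mu] convolved with the Gaussian. *)
Definition ge (e : R) (x : d.-tuple R) : R := Rintegral mu setT (fun y => kr e (vsub x y)).

(** The kernel is itself the Fourier transform of a Gaussian. The factor [gw (e |z|)] makes the
    double integral against [mu] and Lebesgue measure absolutely convergent, and exchanging the
    order produces the characteristic function of [mu]. *)
Lemma smooth_ft (e : R) (x : d.-tuple R) : 0 < e ->
  rc (ge e x) = rc c0 * cint lebd (fun z => cexp (- (rc (dotp x z) * ci)) * rc (gw (e * enorm z)) * Phi z).
Proof.
move=> e0.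
pose H (p : d.-tuple R * d.-tuple R) : C :=
  cexp (- (rc (dotp (vsub x p.1) p.2) * ci)) * rc (gw (e * enorm p.2)).
have mg : measurable_fun setT (fun z : d.-tuple R => gw (e * enorm z)).
  apply: (measurableT_comp (@measurable_gw R)).
  by apply: measurable_funM => //; exact: measurable_enorm.
have mH : cmeas H.
  apply: cmeasM.
    apply: cmeas_cis; last exact: measurable_snd.
    by apply: measurable_vsub => //; exact: measurable_fst.
  by apply: cmeas_rc; exact: (measurableT_comp mg measurable_snd).
have HE (y z : d.-tuple R) : cmod (H (y, z)) = gw (e * enorm z).
  by rewrite cmodM cmod_cis mul1r cmod_rc ger0_norm ?gw_ge0.
have i2 y : cintegrable lebd (fun z => H (y, z)) by exact: (gauss_nd_scaled (vsub x y) e0).1.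
have ig : lebd.-integrable setT (EFin \o (fun z => gw (e * enorm z))).
  have := integrable_cmod (i2 x); under eq_fun do rewrite HE.
  by [].
have i1mu : mu.-integrable setT (EFin \o (fun=> 1)).
  exact: finite_measure_integrable_cst.
have [iG _] := integrable_prod2 i1mu ig.
have i12 : cintegrable (mu \x lebd)%E H.
  apply: (@cintegrable_le _ _ _ _ _ (fun p => 1 * gw (e * enorm p.2))) => //.
  by move=> [y z]; rewrite HE mul1r.
have i1 z : cintegrable mu (fun y => H (y, z)).
  apply: (@cintegrable_prob_bounded _ 1).
    have mz : cmeas (fun y : d.-tuple R => cexp (- (rc (dotp (vsub x y) z) * ci)) * rc (gw (e * enorm z))).
      apply: cmeasM; last exact: cmeas_cst.
      by apply: cmeas_cis => //; exact: measurable_vsub.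
    exact: mz.
  by move=> y; rewrite HE gw_le1.
have := cfubini i12 i2 i1.
have -> : (fun y => cint lebd (fun z => H (y, z))) = fun y => rc (c0^-1 * kr e (vsub x y)).
  apply/funext => y; rewrite [LHS](gauss_nd_scaled (vsub x y) e0).2.
  by rewrite /kr mulKf// gt_eqF.
have -> : cint mu (fun y => rc (c0^-1 * kr e (vsub x y))) = rc (c0^-1 * ge e x).
  apply: ceqP => /=; last by rewrite /Rintegral integral0.
  rewrite RintegralZl//; apply: (@integrable_prob_bounded _ (c0 * (e^-1 ^+ d * s0))).
    exact: measurable_kr_sub.
  by move=> y; rewrite ger0_norm ?kr_ge0// kr_le.
rewrite rcM => /(congr1 (fun t => rc c0 * t)); rewrite mulrA -rcM mulfV ?gt_eqF// rc1 mul1r => ->.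
congr (_ * cint lebd _); apply/funext => z.
have -> : (fun y => H (y, z)) = fun y => (cexp (- (rc (dotp x z) * ci)) * rc (gw (e * enorm z))) * cexp (rc (dotp z y) * ci).
  apply/funext => y; rewrite /H/= dotpBl mulrAC -cexpD (dotpC z); congr (cexp _ * _).
  by rewrite rcD rcN; ring.
rewrite cintZ ?charfunE ?muPhi//; apply: (@cintegrable_prob_bounded _ 1).
  apply: cmeas_cexp; apply: cmeasM; last exact: cmeas_cst.
  by apply: cmeas_rc; apply: measurable_dotp => //; exact: measurable_id.
by move=> y; rewrite cmod_cis'.
Qed.

Definition ginv (x : d.-tuple R) : C := rc c0 * cint lebd (fun z => cexp (- (rc (dotp x z) * ci)) * Phi z).
Definition gdens x : R := Re (ginv x).
Definition en (n : nat) : R := n.+1%:R^-1.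
Definition K0 : R := c0 * (2 * Rintegral lebd setT Dom).

Lemma en_gt0 n : 0 < en n. Proof. by rewrite invr_gt0 ltr0n. Qed.

Lemma cvg_en : en n @[n --> \oo] --> 0.
Proof. exact: cvg_harmonic. Qed.

Lemma ge_ge0 e x : 0 < e -> 0 <= ge e x.
Proof. by move=> e0; apply: Rintegral_ge0 => y _; exact: kr_ge0. Qed.

Let bound0 e x z : cmod (cexp (- (rc (dotp x z) * ci)) * rc (gw (e * enorm z)) * Phi z) <= Dom z.
Proof.
rewrite !cmodM cmod_cis mul1r cmod_rc ger0_norm ?gw_ge0//.
by apply: le_trans (PhiDom z); rewrite -[leRHS]mul1r ler_wpM2r ?cmod_ge0 ?gw_le1.
Qed.

Let meas0 e x : cmeas (fun z => cexp (- (rc (dotp x z) * ci)) * rc (gw (e * enorm z)) * Phi z).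
Proof.
apply: cmeasM => //; apply: cmeasM.
  by apply: cmeas_cis => //; exact: measurable_id.
apply: cmeas_rc; apply: (measurableT_comp (@measurable_gw R)).
by apply: measurable_funM => //; exact: measurable_enorm.
Qed.

Lemma ge_le e x : 0 < e -> ge e x <= K0.
Proof.
move=> e0; rewrite -[leLHS]ger0_norm ?ge_ge0// -cmod_rc smooth_ft// cmodM cmod_rc gtr0_norm//.
rewrite /K0 ler_wpM2l ?(ltW c0_gt0)//; apply: cmod_cint => //.
by apply: cintegrable_le iDom => //; exact: meas0.
Qed.

Lemma cvg_gw_en (a : R) : gw (en n * a) @[n --> \oo] --> (1 : R).
Proof.
have h1 : en n * a @[n --> \oo] --> (0 : R).
  by rewrite -(mul0r a); apply: cvgM; [exact: cvg_en|exact: cvg_cst].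
have h2 : (en n * a) ^+ 2 @[n --> \oo] --> (0 : R).
  by rewrite -(mul0r 0); under eq_fun do rewrite expr2; exact: cvgM.
have h : - ((en n * a) ^+ 2 / 2) @[n --> \oo] --> (0 : R).
  rewrite -oppr0; apply: cvgN; rewrite -(mul0r (2 : R)^-1).
  by apply: cvgM => //; exact: cvg_cst.
have := cvg_comp _ _ h (@continuous_expR R 0).
by rewrite expR0.
Qed.

(** Dominated convergence with the majorant [Dom]. The smoothed densities are real and nonnegative,
    so the inversion integral is real; nonnegativity and the bound [K0] of its real part follow from
    the same limit. *)
Lemma ge_cvg x : (ge (en n) x @[n --> \oo] --> gdens x) /\ Im (ginv x) = 0.
Proof.
pose f_ n z := cexp (- (rc (dotp x z) * ci)) * rc (gw (en n * enorm z)) * Phi z.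
pose f z := cexp (- (rc (dotp x z) * ci)) * Phi z.
have fE n z : f_ n z = rc (gw (en n * enorm z)) * f z by rewrite /f_ /f mulrAC mulrC.
have [_ [cr ci']] : cintegrable lebd f /\
  (Re (cint lebd (f_ n)) @[n --> \oo] --> Re (cint lebd f)) /\
  (Im (cint lebd (f_ n)) @[n --> \oo] --> Im (cint lebd f)).
  apply: (@cint_dct _ _ _ _ f_ f Dom) => //.
  - by move=> n; exact: meas0.
  - by move=> z; under eq_fun do rewrite fE cReMrc; apply: cvg_mul1; exact: cvg_gw_en.
  - by move=> z; under eq_fun do rewrite fE cImMrc; apply: cvg_mul1; exact: cvg_gw_en.
  - by move=> n z; exact: bound0.
have E n := smooth_ft x (en_gt0 n).
split.
  have -> : (fun n => ge (en n) x) = fun n => c0 * Re (cint lebd (f_ n)).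
    by apply/funext => n; have := congr1 (@complex.Re R) (E n); rewrite cReMrc.
  rewrite /gdens /ginv cReMrc; apply: cvgM; [exact: cvg_cst|exact: cr].
have z0 n : Im (cint lebd (f_ n)) = 0.
  have := congr1 (@complex.Im R) (E n); rewrite cImMrc /= => /esym/eqP.
  by rewrite mulf_eq0 gt_eqF//= => /eqP.
rewrite /ginv cImMrc; apply/eqP; rewrite mulf_eq0; apply/orP; right; apply/eqP.
have zz : (fun n => Im (cint lebd (f_ n))) = fun=> 0 by apply/funext => n; rewrite z0.
rewrite zz in ci'.
by apply: (cvg_seq_unique ci'); exact: cvg_cst.
Qed.

Lemma gdensE x : rc (gdens x) = ginv x.
Proof. by apply: ceqP; [|rewrite (ge_cvg x).2]. Qed.

Lemma gdens_ge0 x : 0 <= gdens x.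
Proof.
by apply: (cvg_seq_ge (ge_cvg x).1) => n; exact: ge_ge0 (en_gt0 n).
Qed.

Lemma gdens_le x : gdens x <= K0.
Proof. by apply: (cvg_seq_le (ge_cvg x).1) => n; exact: ge_le (en_gt0 n). Qed.

Lemma measurable_ge n : measurable_fun setT (ge (en n)).
Proof.
have := @measurable_fun_fubini_tonelli_F _ _ _ _ R mu (fun p => (kr (en n) (vsub p.1 p.2))%:E).
move=> /(_ _ _)/wrap[].
- apply/measurable_EFinP; apply: (measurableT_comp (measurable_kr (en n))).
  by apply: measurable_vsub; [exact: measurable_fst|exact: measurable_snd].
- by move=> p; rewrite lee_fin kr_ge0// en_gt0.
- by move=> h; apply: measurableT_comp h.
Qed.

Lemma measurable_gdens : measurable_fun setT gdens.
Proof.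
apply: measurable_fun_cvg; first exact: measurable_ge.
by move=> x _; exact: (ge_cvg x).1.
Qed.

Lemma krn_int : lebd.-integrable setT (EFin \o kr 1) /\ Rintegral lebd setT (kr 1) = 1.
Proof.
have [[I _] E] := gauss_nd (@vzero R d).
have krE : kr 1 = fun z => (c0 * s0) * gw (enorm z).
  by apply/funext => z; rewrite /kr invr1 expr1n mul1r mulr1 mulrA.
have gE : (fun z : d.-tuple R => Re (cexp (rc (dotp vzero z) * ci) * rc (gw (enorm z)))) =
    fun z => gw (enorm z).
  apply/funext => z; rewrite dotpC dotp0 rc0 mul0r cexp0 mul1r.
  by [].
have I1 : lebd.-integrable setT (EFin \o (fun z => gw (enorm z))).
  by move: I; under eq_fun do rewrite (congr1 (fun f => f _) gE).
have E1 : Rintegral lebd setT (fun z => gw (enorm z)) = s0.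
  have := congr1 (@complex.Re R) E; rewrite /= gE => ->.
  by rewrite enorm_vzero /gw expr0n/= mul0r oppr0 expR0 mulr1.
rewrite krE; split.
  exact: (integrableZl measurableT (c0 * s0) I1).
by rewrite RintegralZl// E1 -mulrA c0s0.
Qed.

Section test_function.
Variables (T : d.-tuple R -> R) (Cg : R).
Hypothesis mT : measurable_fun setT T.
Hypothesis T0 : forall x, 0 <= T x.
Hypothesis T1 : forall x, T x <= 1.
Hypothesis TC : forall x, T x <= Cg * gw (enorm x).
Hypothesis Tc : forall y w, T (aff y (en n) w) @[n --> \oo] --> T y.

Lemma test_function_integrable : lebd.-integrable setT (EFin \o (fun x => K0 * (Cg * gw (enorm x)))).
Proof.
have [I _] := krn_int.
have -> : EFin \o (fun x => K0 * (Cg * gw (enorm x))) =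
   fun x => ((K0 * Cg / (c0 * s0))%:E * (kr 1 x)%:E)%E.
  apply/funext => x; rewrite /= -EFinM /kr invr1 expr1n mul1r mulr1; congr EFin.
  by field; rewrite !gt_eqF.
exact: integrableZl.
Qed.

Let Tk0 x w : 0 <= T x * kr 1 w.
Proof. by apply: mulr_ge0 => //; exact: kr_ge0. Qed.

Let Tk1 x w : `|T x * kr 1 w| <= kr 1 w.
Proof.
rewrite (ger0_norm (Tk0 x w)) -[leRHS]mul1r; apply: ler_wpM2r => //; exact: kr_ge0.
Qed.

Let a_ n := Rintegral lebd setT (fun x => T x * ge (en n) x).
Let b_ n y := Rintegral lebd setT (fun w => T (aff y (en n) w) * kr 1 w).

(** After Tonelli, the substitution [x = y + e_n w] replaces the kernel of width [e_n] by the fixed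
    kernel [kr 1]; the dependence on [n] moves into the argument of the test function. *)
Lemma test_swap n : a_ n = Rintegral mu setT (b_ n).
Proof.
have e0 := en_gt0 n.
have mk2 : measurable_fun setT (fun p : d.-tuple R * d.-tuple R => kr (en n) (vsub p.1 p.2)).
  apply: (measurableT_comp (measurable_kr (en n))).
  by apply: measurable_vsub; [exact: measurable_fst|exact: measurable_snd].
pose F (p : d.-tuple R * d.-tuple R) : \bar R := (T p.1 * kr (en n) (vsub p.1 p.2))%:E.
have mF : measurable_fun setT F.
  apply/measurable_EFinP; apply: measurable_funM => //.
  exact: (measurableT_comp mT measurable_fst).
have F0 p : (0 <= F p)%E by rewrite lee_fin mulr_ge0// kr_ge0.
have ik x : mu.-integrable setT (EFin \o (fun y => kr (en n) (vsub x y))).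
  apply: (@integrable_prob_bounded _ (c0 * ((en n)^-1 ^+ d * s0))).
    exact: measurable_kr_sub.
  by move=> y; rewrite ger0_norm ?kr_ge0// kr_le.
rewrite /a_ {1}/Rintegral [RHS]/Rintegral; congr fine.
transitivity (\int[lebd]_x \int[mu]_y F (x, y))%E.
  apply: eq_integral => x _; rewrite EFinM /ge /Rintegral fineK; last first.
    exact: integrable_fin_num (ik x).
  rewrite -ge0_integralZl_EFin//.
    by move=> y _; rewrite lee_fin kr_ge0.
  by apply/measurable_EFinP; exact: measurable_kr_sub.
rewrite -fubini_tonelli1// fubini_tonelli2//.
apply: eq_integral => y _; rewrite /fubini_G/b_ /Rintegral fineK; last first.
  apply: (@integrable_fin_num _ _ _ _ _ measurableT).
  have [I _] := krn_int; apply: le_integrable I => //.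
    apply/measurable_EFinP; apply: measurable_funM; last exact: measurable_kr.
    exact: (measurableT_comp mT (@measurable_aff R d y (en n))).
  by move=> w _; rewrite /= lee_fin; apply: le_trans (Tk1 _ _) (ler_norm _).
have mFy : measurable_fun setT (fun x => F (x, y)).
  apply: (measurableT_comp mF); exact: measurable_fun_pair.
have en0 : en n != 0 by rewrite gt_eqF.
have := ge0_integral_aff y en0 mFy (fun x => F0 (x, y)).
have E w : F (aff y (en n) w, y) = ((`|en n| ^- d)%:E * (T (aff y (en n) w) * kr 1 w)%:E)%E.
  rewrite -EFinM /F/=; congr EFin.
  have -> : vsub (aff y (en n) w) y = vscale (en n) w.
    by apply: eq_from_tnth => i; rewrite !tnth_mktuple addrAC subrr add0r.
  rewrite /kr enormZ gtr0_norm// invr1 expr1n mul1r mulr1 exprVn [en n * _]mulrC mulfK//.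
  have H (a b c e : R) : a * (b * (c * e)) = c * (a * (b * e)) by ring.
  exact: H.
have E2 : (\int[lebd]_w F (aff y (en n) w, y) =
    \int[lebd]_w ((`|en n| ^- d)%:E * (T (aff y (en n) w) * kr 1 w)%:E))%E.
  by apply: eq_integral => w _; exact: E.
have m1 : measurable_fun setT (fun w => (T (aff y (en n) w) * kr 1 w)%:E).
  apply/measurable_EFinP; apply: measurable_funM; last exact: measurable_kr.
  exact: (measurableT_comp mT (@measurable_aff R d y (en n))).
have n1 w : setT w -> (0 <= (T (aff y (en n) w) * kr 1 w)%:E)%E by rewrite lee_fin Tk0.
have p1 : 0 <= `|en n| ^- d by rewrite invr_ge0 exprn_ge0.
rewrite E2 ge0_integralZl_EFin; [|exact: measurableT|exact: n1|exact: m1|exact: p1].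
have q1 : `|en n| ^+ d * `|en n| ^- d = 1.
  by rewrite mulfV// expf_neq0// normr_eq0.
set X1 := (\int[lebd]_x F _)%E; set X2 := (\int[lebd]_x _)%E; clearbody X1 X2.
move=> /(congr1 (fun t => (`|en n| ^+ d)%:E * t)%E).
by rewrite !muleA -!EFinM q1 !mul1e.
Qed.

(** On the left [ge] converges to [gdens], dominated by [K0] times the Gaussian bound of [T]. On the
    right the averages [b_ n y] tend to [T y] and stay below 1. Continuity of [T] is only used along
    the points [y + e_n w]. *)
Lemma test_limit : Rintegral lebd setT (fun x => T x * gdens x) = Rintegral mu setT T.
Proof.
have [_ ca] : lebd.-integrable setT (EFin \o (fun x => T x * gdens x)) /\
    a_ n @[n --> \oo] --> Rintegral lebd setT (fun x => T x * gdens x).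
  apply: (@Rintegral_dct _ _ _ _ (fun n x => T x * ge (en n) x) _ (fun x => K0 * (Cg * gw (enorm x)))).
  - by move=> n; apply: measurable_funM => //; exact: measurable_ge.
  - by move=> x; apply: cvgM; [exact: cvg_cst|exact: (ge_cvg x).1].
  - move=> n x; rewrite ger0_norm ?mulr_ge0 ?ge_ge0 ?en_gt0// mulrC.
    by apply: ler_pM; [exact: ge_ge0 (en_gt0 n)|exact: T0|exact: ge_le (en_gt0 n)|exact: TC].
  - exact: test_function_integrable.
have cb y : b_ n y @[n --> \oo] --> T y.
  have [I E] := krn_int.
  have [_] : lebd.-integrable setT (EFin \o (fun w => T y * kr 1 w)) /\
      b_ n y @[n --> \oo] --> Rintegral lebd setT (fun w => T y * kr 1 w).
    apply: (@Rintegral_dct _ _ _ _ (fun n w => T (aff y (en n) w) * kr 1 w) _ (kr 1)) => //.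
    - move=> n; apply: measurable_funM; last exact: measurable_kr.
      exact: (measurableT_comp mT (@measurable_aff R d y (en n))).
    - by move=> w; apply: cvgM; [exact: Tc|exact: cvg_cst].
  by rewrite RintegralZl// E mulr1.
have b0 n y : 0 <= b_ n y.
  by apply: Rintegral_ge0 => w _; exact: Tk0.
have b1 n y : b_ n y <= 1.
  have [I <-] := krn_int; apply: le_Rintegral => //.
    apply: le_integrable I => //.
      apply/measurable_EFinP; apply: measurable_funM; last exact: measurable_kr.
      exact: (measurableT_comp mT (@measurable_aff R d y (en n))).
    by move=> w _; rewrite /= lee_fin; apply: le_trans (Tk1 _ _) (ler_norm _).
  by move=> w _; apply: le_trans (ler_norm _) (Tk1 _ _).
have mb n : measurable_fun setT (b_ n).
  have := @measurable_fun_fubini_tonelli_F _ _ _ _ R lebd (fun p => (T (aff p.1 (en n) p.2) * kr 1 p.2)%:E).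
  move=> /(_ _ _)/wrap[].
  - apply/measurable_EFinP; apply: measurable_funM.
      apply: (measurableT_comp mT); apply/measurable_fun_tnthP => i.
      rewrite (_ : _ \o _ = fun p : d.-tuple R * d.-tuple R => tnth p.1 i + en n * tnth p.2 i).
        apply: measurable_funD.
          exact: (measurableT_comp (@measurable_tnth _ _ _ i) measurable_fst).
        apply: measurable_funM => //.
        exact: (measurableT_comp (@measurable_tnth _ _ _ i) measurable_snd).
      by apply/funext => p /=; rewrite tnth_mktuple.
    exact: (measurableT_comp (measurable_kr 1) measurable_snd).
  - by move=> p; rewrite lee_fin; exact: Tk0.
  - by move=> h; apply: measurableT_comp h.
have [_ cmu] : mu.-integrable setT (EFin \o T) /\
    Rintegral mu setT (b_ n) @[n --> \oo] --> Rintegral mu setT T.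
  apply: (@Rintegral_dct _ _ _ _ b_ _ (fun=> 1)) => //.
    by move=> n y; rewrite ger0_norm.
  exact: finite_measure_integrable_cst.
apply: (cvg_seq_unique ca); under eq_fun do rewrite test_swap.
exact: cmu.
Qed.

End test_function.

(** Truncation to [[0, 1]], written with absolute values so that continuity is immediate. *)
Definition clamp01 (s : R) : R := (`|s| - `|s - 1| + 1) / 2.

Lemma clamp01_le0 s : s <= 0 -> clamp01 s = 0.
Proof. by move=> h; rewrite /clamp01 ler0_norm// ler0_norm; lra. Qed.
Lemma clamp01_ge1 s : 1 <= s -> clamp01 s = 1.
Proof. by move=> h; rewrite /clamp01 !ger0_norm; lra. Qed.
Lemma clamp01_ge0 s : 0 <= clamp01 s.
Proof.
rewrite /clamp01; have [h|h] := leP 0 s; have [h'|h'] := leP 0 (s - 1);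
  rewrite ?(ger0_norm h) ?(ltr0_norm h) ?(ger0_norm h') ?(ltr0_norm h'); lra.
Qed.
Lemma clamp01_le1 s : clamp01 s <= 1.
Proof.
rewrite /clamp01; have [h|h] := leP 0 s; have [h'|h'] := leP 0 (s - 1);
  rewrite ?(ger0_norm h) ?(ltr0_norm h) ?(ger0_norm h') ?(ltr0_norm h'); lra.
Qed.

(* Continuous functions increasing to the indicator of the open interval. *)
Definition tent (n : nat) (a b t : R) : R :=
  clamp01 (n%:R * ((b - a) / 2 - `|t - (a + b) / 2|)).

Lemma tent_cvg n a b (u : nat -> R) t : u k @[k --> \oo] --> t ->
  tent n a b (u k) @[k --> \oo] --> tent n a b t.
Proof.
move=> ut; rewrite /tent /clamp01.
have h : n%:R * ((b - a) / 2 - `|u k - (a + b) / 2|) @[k --> \oo] -->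
    n%:R * ((b - a) / 2 - `|t - (a + b) / 2|).
  apply: cvgM; first exact: cvg_cst.
  apply: cvgB; first exact: cvg_cst.
  by apply: cvg_norm; apply: cvgB => //; exact: cvg_cst.
apply: cvgM; last exact: cvg_cst.
apply: cvgD; last exact: cvg_cst.
apply: cvgB; first exact: cvg_norm.
by apply: cvg_norm; apply: cvgB => //; exact: cvg_cst.
Qed.

Lemma measurable_tent n a b : measurable_fun setT (tent n a b).
Proof.
apply: continuous_measurable_fun => t; rewrite /continuous_at /tent /clamp01.
have h : n%:R * ((b - a) / 2 - `|s - (a + b) / 2|) @[s --> t] -->
    n%:R * ((b - a) / 2 - `|t - (a + b) / 2|).
  apply: cvgM; first exact: cvg_cst.
  apply: cvgB; first exact: cvg_cst.
  by apply: cvg_norm; apply: cvgB; [exact: cvg_id|exact: cvg_cst].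
apply: cvgM; last exact: cvg_cst.
apply: cvgD; last exact: cvg_cst.
apply: cvgB; first exact: cvg_norm.
by apply: cvg_norm; apply: cvgB => //; exact: cvg_cst.
Qed.

Lemma tent_out n a b t : ~~ (a < t < b) -> tent n a b t = 0.
Proof.
move=> h; apply: clamp01_le0; rewrite mulr_ge0_le0//; move: h.
rewrite negb_and -!leNgt => /orP[h|h].
- have := ler_norm (- (t - (a + b) / 2)); rewrite normrN; lra.
- have := ler_norm (t - (a + b) / 2); lra.
Qed.

Lemma tent_in a b t : a < t < b -> exists N : nat, forall n, (N <= n)%N -> tent n a b t = 1.
Proof.
move=> /andP[ht hb]; set m := (b - a) / 2 - `|t - (a + b) / 2|.
have m0 : 0 < m by rewrite subr_gt0 ltr_norml; apply/andP; split; lra.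
exists (Num.truncn m^-1).+1 => n nN; apply: clamp01_ge1; rewrite -/m.
rewrite -ler_pdivrMr// mul1r; apply: le_trans (ltW (truncnS_gt _)) _.
by rewrite ler_nat.
Qed.

Definition tbox n (a b : 'I_d -> R) (x : d.-tuple R) : R := \prod_i tent n (a i) (b i) (tnth x i).

Lemma tbox_ge0 n a b x : 0 <= tbox n a b x.
Proof. by apply: prodr_ge0 => i _; exact: clamp01_ge0. Qed.
Lemma tbox_le1 n a b x : tbox n a b x <= 1.
Proof. by apply: prodr_ile1 => i _; rewrite clamp01_ge0 clamp01_le1. Qed.
Lemma tbox_out n a b x : ~ obox a b x -> tbox n a b x = 0.
Proof.
move=> h; have [i hi] : exists i, ~~ (a i < tnth x i < b i).
  by apply: contrapT => h'; apply: h => i; apply/negPn/negP => hi; apply: h'; exists i.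
by rewrite /tbox (bigD1 i)//= tent_out// mul0r.
Qed.
Lemma measurable_tbox n a b : measurable_fun setT (tbox n a b).
Proof.
apply: measurable_prod => i _.
exact: (measurableT_comp (@measurable_tent n (a i) (b i)) (@measurable_tnth _ _ _ i)).
Qed.

Lemma cvg_prod_seq I (s : seq I) (u : nat -> I -> R) (l : I -> R) :
  (forall i, u n i @[n --> \oo] --> l i) ->
  (\prod_(i <- s) u n i) @[n --> \oo] --> \prod_(i <- s) l i.
Proof.
move=> ul; elim: s => [|i s IH].
  by under eq_fun do rewrite big_nil; rewrite big_nil; exact: cvg_cst.
by under eq_fun do rewrite big_cons; rewrite big_cons; exact: cvgM.
Qed.

Lemma tbox_aff n a b y w : tbox n a b (aff y (en k) w) @[k --> \oo] --> tbox n a b y.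
Proof.
apply: cvg_prod_seq => i; apply: tent_cvg.
have h : tnth y i + en k * tnth w i @[k --> \oo] --> tnth y i + 0 * tnth w i.
  apply: cvgD; first exact: cvg_cst.
  by apply: cvgM; [exact: cvg_en|exact: cvg_cst].
rewrite mul0r addr0 in h; apply: cvg_trans h; apply: near_eq_cvg; apply: nearW => k.
by rewrite tnth_mktuple.
Qed.

Lemma tbox_cvg a b x : tbox n a b x @[n --> \oo] --> (\1_(obox a b) x : R).
Proof.
rewrite indicE; case: (boolP (x \in _)) => [|/negP]; rewrite inE => hx.
  rewrite -[Y in _ --> Y](_ : \prod_(i < d) 1 = _); last by rewrite big1.
  apply: cvg_prod_seq => i; have [N hN] := tent_in (hx i).
  apply: cvg_near_cst; exists N => // n /= nN; exact: hN.
by under eq_fun do rewrite (tbox_out _ hx); exact: cvg_cst.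
Qed.

(** [M] bounds the norm on the box, where the Gaussian is therefore at least [gw M]. This supplies
    the Gaussian domination required of test functions. *)
Lemma obox_gw (a b : 'I_d -> R) : exists2 Cg : R, 0 <= Cg &
  forall x : d.-tuple R, (\1_(obox a b) x : R) <= Cg * gw (enorm x).
Proof.
pose M : R := \sum_i (`|a i| + `|b i|).
exists (gw M)^-1; first by rewrite invr_ge0 gw_ge0.
move=> x; rewrite indicE; case: (boolP (x \in _)) => [|_]; last first.
  by rewrite mulr_ge0 ?gw_ge0// invr_ge0 gw_ge0.
rewrite inE => hx; rewrite mulrC ler_pdivlMr ?expR_gt0// mul1r /gw ler_expR lerN2.
rewrite ler_pM2r// lerXn2r ?nnegrE ?enorm_ge0//.
  by apply: sumr_ge0 => i _; rewrite addr_ge0.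
apply: le_trans (enorm_le_sum _) _; apply: ler_sum => i _.
have /andP[h1 h2] := hx i; have := ler_norm (b i); have := ler_norm (- a i).
by rewrite normrN ler_norml => *; apply/andP; split; have := normr_ge0 (a i); have := normr_ge0 (b i); lra.
Qed.

Lemma obox_dens a b : Rintegral lebd setT (fun x => \1_(obox a b) x * gdens x) = fine (mu (obox a b)).
Proof.
have [Cg Cg0 hCg] := obox_gw a b.
have tC n x : tbox n a b x <= Cg * gw (enorm x).
  case: (pselect (obox a b x)) => hx; last by rewrite tbox_out// mulr_ge0// gw_ge0.
  by apply: le_trans (tbox_le1 _ _ _ _) _; have := hCg x; rewrite indicE mem_set.
have E n := test_limit (@measurable_tbox n a b) (tbox_ge0 n a b) (tbox_le1 n a b) (tC n) (@tbox_aff n a b).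
have [_ c1] : lebd.-integrable setT (EFin \o (fun x => \1_(obox a b) x * gdens x)) /\
   Rintegral lebd setT (fun x => tbox n a b x * gdens x) @[n --> \oo] -->
   Rintegral lebd setT (fun x => \1_(obox a b) x * gdens x).
  apply: (@Rintegral_dct _ _ _ _ (fun n x => tbox n a b x * gdens x) _ (fun x => K0 * (Cg * gw (enorm x)))).
  - by move=> n; apply: measurable_funM; [exact: measurable_tbox|exact: measurable_gdens].
  - by move=> x; apply: cvgM; [exact: tbox_cvg|exact: cvg_cst].
  - move=> n x; rewrite ger0_norm; last by rewrite mulr_ge0 ?tbox_ge0 ?gdens_ge0.
    by rewrite mulrC; apply: ler_pM; [exact: gdens_ge0|exact: tbox_ge0|exact: gdens_le|exact: tC].
  - exact: test_function_integrable.
have [_ c2] : mu.-integrable setT (EFin \o (\1_(obox a b) : d.-tuple R -> R)) /\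
   Rintegral mu setT (tbox n a b) @[n --> \oo] --> Rintegral mu setT (\1_(obox a b) : d.-tuple R -> R).
  apply: (@Rintegral_dct _ _ _ _ (fun n => tbox n a b) _ (fun=> 1)).
  - by move=> n; exact: measurable_tbox.
  - exact: tbox_cvg.
  - by move=> n x; rewrite ger0_norm ?tbox_ge0 ?tbox_le1.
  - exact: finite_measure_integrable_cst.
have -> : Rintegral lebd setT (fun x => \1_(obox a b) x * gdens x) = Rintegral mu setT (\1_(obox a b) : d.-tuple R -> R).
  by apply: (cvg_seq_unique c1); under eq_fun do rewrite E.
by rewrite /Rintegral integral_indic ?setIT//; exact: measurable_obox.
Qed.

(** Both sides are measures, finite on open boxes, which generate the sigma-algebra and are stable
    under intersection. On a box the equality is the limit of [test_limit] for tent functions. *)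
Theorem density A : measurable A -> mu A = (\int[lebd]_(x in A) (gdens x)%:E)%E.
Proof.
move=> mA; rewrite -(mdensE lebd measurable_gdens gdens_ge0 A).
apply: (tuple_measure_unique (m1 := mu)) => // a b; last first.
  by have := fin_num_measure mu _ (measurable_obox a b); rewrite fin_numElt => /andP[_].
rewrite mdensE -[LHS](fineK (fin_num_measure mu _ (measurable_obox a b))) -obox_dens.
rewrite /Rintegral fineK.
  rewrite [RHS]integral_mkcond; apply: eq_integral => x _.
  by rewrite patchE indicE; case: ifP => _; rewrite ?mul1r ?mul0r.
have [Cg Cg0 hCg] := obox_gw a b.
apply: integrable_fin_num => //; apply: le_integrable (test_function_integrable Cg) => //.
  apply/measurable_EFinP; apply: measurable_funM; last exact: measurable_gdens.
  by apply: measurable_indic; exact: measurable_obox.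
move=> x _; rewrite /= lee_fin; apply: le_trans (ler_norm _).
rewrite ger0_norm; last by rewrite mulr_ge0 ?gdens_ge0.
by rewrite mulrC; apply: ler_pM; [exact: gdens_ge0| |exact: gdens_le|exact: hCg].
Qed.

End fourier_inversion.

(** * The series of the density *)

Section radial_bounds.
Context (R : realType) (d' : nat).
Local Notation d := d'.+1.
Hypothesis hd : (2 <= d)%N.
Local Notation leb := (@lebesgue_measure R).
Local Notation lebd := (lebn R d).
Local Notation sphm := (sphm R d').
Local Notation H := (`]0%R, +oo[%classic : set (measurableTypeR R)).
Variables (alpha : R) (halpha : 1 < alpha < 2).

(** Sums of Gamma values are estimated by reading each one as a radial integral and bounding the sum
    of the integrands pointwise. *)
Lemma sum_int_le (f_ : nat -> R -> R) (v_ : nat -> R) (g : R -> R) (I : R) N :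
  (forall k, measurable_fun setT (f_ k)) -> (forall k r, 0 < r -> 0 <= f_ k r) ->
  (forall k, (\int[leb]_(r in H) (f_ k r)%:E = (v_ k)%:E)%E) ->
  measurable_fun setT g -> (forall r, 0 < r -> \sum_(k < N) f_ k r <= g r) ->
  (\int[leb]_(r in H) (g r)%:E = I%:E)%E ->
  \sum_(k < N) v_ k <= I.
Proof.
move=> mf f0 fv mg fg gI; rewrite -lee_fin -gI -sumEFin.
have r0 (r : R) : H r -> 0 < r by rewrite /= in_itv/= andbT.
have mfE k : measurable_fun H (fun r : R => (f_ k r)%:E).
  by apply/measurable_EFinP; apply: measurable_funTS; exact: mf.
under eq_bigr do rewrite -fv.
rewrite -ge0_integral_sum//; last by move=> k r /r0 h; rewrite lee_fin f0.
apply: ge0_le_integral => //.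
- by move=> r /r0 h; apply: sume_ge0 => k _; rewrite lee_fin f0.
- exact: emeasurable_sum.
- by apply/measurable_EFinP; apply: measurable_funTS; exact: mg.
- by move=> r /r0 h; rewrite sumEFin lee_fin fg.
Qed.

Let a0 : 0 < alpha. Proof. by case/andP: halpha => h _; exact: lt_trans h. Qed.

(** Holds because [alpha < 2 <= d]; it places all Gamma values in the range where [GammaE]
    applies. *)
Lemma sge1 n k : 1 <= k%:R + (n%:R + d%:R) / alpha.
Proof.
apply: le_trans (_ : (n%:R + d%:R) / alpha <= _); last by rewrite lerDr.
rewrite ler_pdivlMr// mul1r; apply: le_trans (_ : 2 <= _).
  by case/andP: halpha => _ /ltW.
by rewrite -natrD ler_nat; lia.
Qed.

Lemma radial_nk (c : R) n k : 0 < c ->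
  (\int[leb]_(r in H) (`|r| ^+ n * (r `^ alpha) ^+ k * expR (- (c * r `^ alpha)) * r ^+ d')%:E =
   (alpha^-1 * (Gamma (k%:R + (n%:R + d%:R) / alpha) / c `^ (k%:R + (n%:R + d%:R) / alpha)))%:E)%E.
Proof.
move=> c0; have a1 : 1 < alpha by case/andP: halpha.
pose s : R := n%:R + d%:R + alpha * k%:R.
have sE : s / alpha = k%:R + (n%:R + d%:R) / alpha.
  by rewrite /s mulrDl [alpha * _]mulrC mulfK ?gt_eqF// addrC.
rewrite -sE.
have -> : alpha^-1 * (Gamma (s / alpha) / c `^ (s / alpha)) = alpha^-1 * c `^ (- (s / alpha)) * Gamma (s / alpha).
  by rewrite powRN; ring.
rewrite EFinM GammaE; last by rewrite sE sge1.
rewrite -integral_radial//; apply: eq_integral => r.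
rewrite inE/= in_itv/= andbT => r0; congr EFin.
rewrite mulrAC; congr (_ * _).
have pw (t : R) : 0 < t -> `|t| ^+ n * (t `^ alpha) ^+ k * t ^+ d' = t `^ (s - 1).
  move=> t0; rewrite (gtr0_norm t0) mulrAC -exprD -!powR_mulrn ?powR_ge0 ?(ltW t0)//.
  rewrite -powRrM -powRD; last by rewrite (gt_eqF t0) implybT.
  by congr (_ `^ _); rewrite /s natrD -[d%:R]natr1; ring.
exact: pw.
Qed.

(** This is where [alpha > 1] enters. Beyond the threshold [r0 = (B/c)^(1/(alpha-1))] one has
    [B <= c r^(alpha-1)]; below it the constant [B r0] suffices. *)
Lemma linear_le_powR (B c : R) : 0 <= B -> 0 < c ->
  exists2 C : R, 0 <= C & forall r, 0 <= r -> B * r <= c * r `^ alpha + C.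
Proof.
move=> B0 c0; have a1 : 0 < alpha - 1 by case/andP: halpha => h _; rewrite subr_gt0.
pose r0 : R := (B / c) `^ (alpha - 1)^-1.
have r00 : 0 <= r0 by exact: powR_ge0.
exists (B * r0); first by rewrite mulr_ge0.
move=> r rp; have [h|h] := leP r r0.
  by apply: le_trans (_ : B * r0 <= _); [rewrite ler_wpM2l|rewrite lerDr mulr_ge0 ?powR_ge0// ltW].
have rp' : 0 < r by exact: le_lt_trans h.
apply: le_trans (_ : c * r `^ alpha <= _); last by rewrite lerDl mulr_ge0.
have -> : r `^ alpha = r `^ (alpha - 1) * r.
  rewrite -[X in _ * X]powRr1// -powRD ?subrK//.
  by rewrite (gt_eqF rp') implybT.
rewrite mulrA ler_wpM2r// mulrC -ler_pdivrMr//.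
have -> : B / c = r0 `^ (alpha - 1).
  by rewrite /r0 -powRrM mulVf ?powRr1 ?gt_eqF// divr_ge0// ltW.
by apply: ge0_ler_powR; [exact: ltW a1|rewrite nnegrE; exact: r00|rewrite nnegrE; exact: rp|exact: ltW h].
Qed.

Lemma measurable_radial (K c : R) (n : nat) : measurable_fun setT
  (fun r : R => `|r| ^+ n * expR (K * r) * expR (- (c * r `^ alpha)) * r ^+ d').
Proof.
apply: measurable_funM; last exact: measurable_funX.
apply: measurable_funM.
  apply: measurable_funM; first by apply: measurable_funX; exact: normr_measurable.
  apply: (measurableT_comp (@measurable_expR R)); exact: measurable_funM.
apply: (measurableT_comp (@measurable_expR R)); under eq_fun do rewrite -mulNr.
by apply: measurable_funM => //; exact: measurable_powR.
Qed.

(** Half of the decay [c r^alpha] absorbs the linear exponent [K r] up to a constant, and the other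
    half is integrable. *)
Lemma expfin (K c : R) : 0 <= K -> 0 < c -> exists2 W : R, 0 <= W &
  (\int[leb]_(r in H) (expR (K * r) * expR (- (c * r `^ alpha)) * r ^+ d')%:E = W%:E)%E.
Proof.
move=> K0 c0; have c20 : 0 < c / 2 by rewrite divr_gt0.
have [C C0 hC] := linear_le_powR K0 c20.
pose F (r : R) := expR (K * r) * expR (- (c * r `^ alpha)) * r ^+ d'.
have mF : measurable_fun setT F.
  have := measurable_radial K c 0; rewrite /F.
  by under eq_fun do rewrite expr0 mul1r.
have F0 r : 0 < r -> 0 <= F r by move=> r0; rewrite !mulr_ge0 ?expR_ge0 ?exprn_ge0// ltW.
have Ffin : (\int[leb]_(r in H) (F r)%:E < +oo)%E.
  apply: (@le_lt_trans _ _ (\int[leb]_(r in H) ((expR C)%:E *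
    (`|r| ^+ 0 * (r `^ alpha) ^+ 0 * expR (- (c / 2 * r `^ alpha)) * r ^+ d')%:E))%E).
    apply: ge0_le_integral => //.
    - by move=> r; rewrite /= in_itv/= andbT => r0; rewrite lee_fin F0.
    - by apply/measurable_EFinP; apply: measurable_funTS; exact: mF.
    - apply: measurable_funeM; apply/measurable_EFinP; apply: measurable_funTS.
      have := measurable_radial 0 (c / 2) 0.
      by under eq_fun do rewrite mul0r expR0 mulr1 -[_ ^+ 0]mulr1.
    - move=> r; rewrite /= in_itv/= andbT => r0; rewrite -EFinM lee_fin.
      have FF (t : R) : 0 < t -> F t <= expR C * (`|t| ^+ 0 * (t `^ alpha) ^+ 0 * expR (- (c / 2 * t `^ alpha)) * t ^+ d').
        move=> t0; rewrite /F !expr0 !mul1r mulrA ler_wpM2r ?exprn_ge0 ?(ltW t0)//.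
        by rewrite -!expRD ler_expR; have := hC t (ltW t0); lra.
      exact: FF.
  rewrite ge0_integralZl_EFin ?expR_ge0//.
  - by rewrite (radial_nk 0 0 c20) -EFinM ltry.
  - move=> r; rewrite /= in_itv/= andbT => r0.
    by rewrite lee_fin !mulr_ge0 ?expR_ge0 ?exprn_ge0 ?powR_ge0// ltW.
  - apply/measurable_EFinP; apply: measurable_funTS.
    have := measurable_radial 0 (c / 2) 0.
    by under eq_fun do rewrite mul0r expR0 mulr1 -[_ ^+ 0]mulr1.
have F0' : (0 <= \int[leb]_(r in H) (F r)%:E)%E.
  by apply: integral_ge0 => r; rewrite /= in_itv/= andbT => r0; rewrite lee_fin F0.
exists (fine (\int[leb]_(r in H) (F r)%:E)%E); first exact: fine_ge0.
by rewrite fineK// ge0_fin_numE.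
Qed.

(* The integral of [r^(n+d-1) exp(-c r^alpha)] over the half-line. *)
Definition Jr (c : R) (n : nat) : R :=
  alpha^-1 * (Gamma (0%:R + (n%:R + d%:R) / alpha) / c `^ (0%:R + (n%:R + d%:R) / alpha)).

Lemma Jr_ge0 c n : 0 <= Jr c n.
Proof. by rewrite /Jr mulr_ge0 ?invr_ge0 ?divr_ge0 ?Gamma_ge0 ?powR_ge0// ltW. Qed.

(** Up to the factor [alpha], the integral over the half-line of [r^(n+d-1) (r^alpha)^k / k! exp(-R
    r^alpha)]. *)
Definition Gk (Rr : R) n k : R :=
  Gamma (k%:R + (n%:R + d%:R) / alpha) / (k`!%:R * Rr `^ (k%:R + (n%:R + d%:R) / alpha)).

Lemma Gk_ge0 Rr n k : 0 <= Gk Rr n k.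
Proof. by rewrite /Gk divr_ge0 ?Gamma_ge0 ?mulr_ge0 ?powR_ge0. Qed.

(** Under the integral, [sum_k (q r^alpha)^k / k! <= exp(q r^alpha)], which lowers the rate of decay
    from [R] to [R - q]. *)
Lemma sum_Gk (Rr q : R) n N : 0 <= q -> q < Rr ->
  \sum_(k < N) q ^+ k * Gk Rr n k <= alpha * Jr (Rr - q) n.
Proof.
move=> q0 qR; have R0 : 0 < Rr by exact: le_lt_trans qR.
have c0 : 0 < Rr - q by rewrite subr_gt0.
rewrite mulrC -ler_pdivrMr// mulr_suml.
pose f_ k (r : R) := (q ^+ k / k`!%:R) * (`|r| ^+ n * (r `^ alpha) ^+ k * expR (- (Rr * r `^ alpha)) * r ^+ d').
apply: (@sum_int_le f_ (fun k => q ^+ k * Gk Rr n k / alpha) (fun r => `|r| ^+ n * (r `^ alpha) ^+ 0 * expR (- ((Rr - q) * r `^ alpha)) * r ^+ d') (Jr (Rr - q) n) N).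
- move=> k; apply: measurable_funM => //; apply: measurable_funM; last exact: measurable_funX.
  apply: measurable_funM.
    apply: measurable_funM; first by apply: measurable_funX; exact: normr_measurable.
    by apply: measurable_funX; exact: measurable_powR.
  apply: (measurableT_comp (@measurable_expR R)); under eq_fun do rewrite -mulNr.
  by apply: measurable_funM => //; exact: measurable_powR.
- move=> k r r0; rewrite /f_ !mulr_ge0 ?expR_ge0 ?exprn_ge0 ?powR_ge0 ?invr_ge0//.
  exact: ltW.
- move=> k; rewrite /f_; under eq_integral do rewrite EFinM.
  rewrite ge0_integralZl_EFin//.
  + rewrite (radial_nk n k R0) -EFinM; congr EFin; rewrite /Gk invfM; ring.
  + move=> r; rewrite /= in_itv/= andbT => r0.
    by rewrite lee_fin !mulr_ge0 ?expR_ge0 ?exprn_ge0 ?powR_ge0// ltW.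
  + apply/measurable_EFinP; apply: measurable_funTS.
    apply: measurable_funM; last exact: measurable_funX.
    apply: measurable_funM.
      apply: measurable_funM; first by apply: measurable_funX; exact: normr_measurable.
      by apply: measurable_funX; exact: measurable_powR.
    apply: (measurableT_comp (@measurable_expR R)); under eq_fun do rewrite -mulNr.
    by apply: measurable_funM => //; exact: measurable_powR.
  + by rewrite divr_ge0 ?exprn_ge0.
- have := measurable_radial 0 (Rr - q) n.
  by under eq_fun do rewrite mul0r expR0.
- move=> r r0; rewrite /f_.
  have -> : \sum_(k < N) q ^+ k / k`!%:R * (`|r| ^+ n * (r `^ alpha) ^+ k * expR (- (Rr * r `^ alpha)) * r ^+ d') =
    (\sum_(k < N) k`!%:R^-1 * (q * r `^ alpha) ^+ k) * (`|r| ^+ n * expR (- (Rr * r `^ alpha)) * r ^+ d').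
    by rewrite mulr_suml; apply: eq_bigr => k _; rewrite exprMn; ring.
  apply: le_trans (_ : expR (q * r `^ alpha) * (`|r| ^+ n * expR (- (Rr * r `^ alpha)) * r ^+ d') <= _).
    rewrite ler_wpM2r ?mulr_ge0 ?expR_ge0 ?exprn_ge0 ?(ltW r0)//.
    by apply: sum_exp_coeff_le; rewrite mulr_ge0 ?powR_ge0.
  rewrite expr0 mulr1 le_eqVlt; apply/orP; left; apply/eqP.
  have -> : expR (- ((Rr - q) * r `^ alpha)) = expR (q * r `^ alpha) * expR (- (Rr * r `^ alpha)).
    by rewrite -expRD; congr expR; ring.
  ring.
- exact: (radial_nk n 0 c0).
Qed.

(** Under the integral, [sum_n (K r)^n / n! <= exp(K r)], and [expfin] provides a finite bound that
    does not depend on [N]. *)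
Lemma sum_Jr (c K : R) : 0 < c -> 0 <= K -> exists2 W : R, 0 <= W &
  forall N, \sum_(n < N) K ^+ n / n`!%:R * Jr c n <= W.
Proof.
move=> c0 K0; have [W W0 hW] := expfin K0 c0; exists W => // N.
pose f_ n (r : R) := (K ^+ n / n`!%:R) * (`|r| ^+ n * (r `^ alpha) ^+ 0 * expR (- (c * r `^ alpha)) * r ^+ d').
have mf n : measurable_fun setT (fun r : R => `|r| ^+ n * (r `^ alpha) ^+ 0 * expR (- (c * r `^ alpha)) * r ^+ d').
  have := measurable_radial 0 c n.
  by under eq_fun do rewrite mul0r expR0.
apply: (@sum_int_le f_ (fun n => K ^+ n / n`!%:R * Jr c n)
  (fun r => expR (K * r) * expR (- (c * r `^ alpha)) * r ^+ d') W N).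
- by move=> n; apply: measurable_funM.
- move=> n r r0; rewrite /f_ !mulr_ge0 ?expR_ge0 ?exprn_ge0 ?powR_ge0 ?invr_ge0//.
  exact: ltW.
- move=> n; rewrite /f_; under eq_integral do rewrite EFinM.
  rewrite ge0_integralZl_EFin//.
  + by rewrite (radial_nk n 0 c0) -EFinM.
  + move=> r; rewrite /= in_itv/= andbT => r0.
    by rewrite lee_fin !mulr_ge0 ?expR_ge0 ?exprn_ge0 ?powR_ge0// ltW.
  + by apply/measurable_EFinP; apply: measurable_funTS; exact: mf.
  + by rewrite divr_ge0 ?exprn_ge0.
- have := measurable_radial K c 0.
  by under eq_fun do rewrite expr0 mul1r.
- move=> r r0; rewrite /f_.
  have -> : \sum_(n < N) K ^+ n / n`!%:R * (`|r| ^+ n * (r `^ alpha) ^+ 0 * expR (- (c * r `^ alpha)) * r ^+ d') =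
    (\sum_(n < N) n`!%:R^-1 * (K * r) ^+ n) * (expR (- (c * r `^ alpha)) * r ^+ d').
    by rewrite mulr_suml; apply: eq_bigr => n _; rewrite exprMn expr0 (gtr0_norm r0); ring.
  rewrite -mulrA ler_wpM2r ?mulr_ge0 ?expR_ge0 ?exprn_ge0 ?(ltW r0)//.
  by apply: sum_exp_coeff_le; rewrite mulr_ge0// ltW.
- exact: hW.
Qed.

Lemma integrable_exp_stable (K c : R) : 0 <= K -> 0 < c ->
  lebd.-integrable setT (fun z => (expR (K * enorm z) * expR (- (c * enorm z `^ alpha)))%:E).
Proof.
move=> K0 c0; have [W W0 hW] := expfin K0 c0.
have mphi : measurable_fun setT (fun r : R => expR (K * r) * expR (- (c * r `^ alpha))).
  apply: measurable_funM.
    apply: (measurableT_comp (@measurable_expR R)); exact: measurable_funM.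
  apply: (measurableT_comp (@measurable_expR R)); under eq_fun do rewrite -mulNr.
  by apply: measurable_funM => //; exact: measurable_powR.
have phi0 (r : R) : 0 <= expR (K * r) * expR (- (c * r `^ alpha)).
  by rewrite mulr_ge0 ?expR_ge0.
have m1 : measurable_fun setT (fun _ : d.-tuple R => 1 : R) by exact: measurable_cst.
have b1 (u : d.-tuple R) : enorm u = 1 -> `|1 : R| <= 1 by rewrite normr1.
have [I _] := @polar_prodR R d' _ W mphi phi0 hW (fun=> 1) 1 m1 b1.
by move: I; under eq_fun do rewrite mulr1.
Qed.

End radial_bounds.

Lemma double_half_ord n (m : 'I_(n./2.+1)) : (2 * m <= n)%N.
Proof. by have := ltn_ord m; lia. Qed.

Lemma leq_sub_add2 n m : ((n - m).+2 <= 2 + n)%N.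
Proof. lia. Qed.

Lemma half_lt_exp2 n : (n./2.+1 <= 2 ^ n)%N.
Proof. by apply: leq_trans (ltn_expl n (ltnSn 1)); lia. Qed.

(** * Expansion of the inversion integral *)

Section series_expansion.
Context (R : realType) (d' : nat).
Local Notation d := d'.+1.
Hypothesis hd : (2 <= d)%N.
Local Notation leb := (@lebesgue_measure R).
Local Notation lebd := (lebn R d).
Local Notation sphm := (sphm R d').
Local Notation C := R[i].
Local Notation Re := complex.Re.
Local Notation Im := complex.Im.
Variables (alpha : R) (halpha : 1 < alpha < 2).
Variables (V : d.-tuple R -> C) (c q Rr : R).
Hypothesis mV : cmeas V.
Hypotheses (c_gt0 : 0 < c) (hc : forall u, enorm u = 1 -> c <= Re (V u)).
Hypotheses (q0 : 0 <= q) (qR : q < Rr).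
Hypothesis hq : forall u, enorm u = 1 -> cmod (rc Rr - V u) <= q.

Let a_gt0 : 0 < alpha. Proof. by case/andP: halpha => h _; exact: lt_trans h. Qed.
Let Rr_gt0 : 0 < Rr. Proof. exact: le_lt_trans qR. Qed.
Let Rq_gt0 : 0 < Rr - q. Proof. by rewrite subr_gt0. Qed.

(** At the origin [unitv] returns the null vector, but the factor [|z|^alpha] vanishes and the value
    is 1. *)
Definition Phi (z : d.-tuple R) : C := cexp (- (rc (enorm z `^ alpha) * V (unitv z))).

Lemma measurable_enorm_powR : measurable_fun setT (fun z : d.-tuple R => enorm z `^ alpha).
Proof. exact: (measurableT_comp (@measurable_powR R alpha) (@measurable_enorm R d)). Qed.

Lemma cmeas_unitv (F : d.-tuple R -> C) : cmeas F -> cmeas (fun z => F (unitv z)).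
Proof.
move=> [mr mi]; split.
- exact: (measurableT_comp mr (@measurable_unitv R d)).
- exact: (measurableT_comp mi (@measurable_unitv R d)).
Qed.

Lemma cmeas_Phi : cmeas Phi.
Proof.
apply: cmeas_cexp; apply: cmeasN; apply: cmeasM; last exact: cmeas_unitv.
by apply: cmeas_rc; exact: measurable_enorm_powR.
Qed.

Lemma enorm_pow0 (z : d.-tuple R) : ~~ (0 < enorm z) -> enorm z `^ alpha = 0.
Proof.
rewrite -leNgt => h; have -> : enorm z = 0 by apply/eqP; rewrite eq_le h enorm_ge0.
by rewrite powR0// gt_eqF.
Qed.

(* The null exponent matches the form of [integrable_exp_stable]. *)
Definition Dom (z : d.-tuple R) : R := expR (0 * enorm z) * expR (- (c * enorm z `^ alpha)).

Lemma Phi_le z : cmod (Phi z) <= Dom z.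
Proof.
rewrite /Dom mul0r expR0 mul1r /Phi cmod_cexp cReN cReMrc ler_expR lerN2 mulrC.
case: (boolP (0 < enorm z)) => h; last by rewrite enorm_pow0// !mul0r.
by rewrite ler_wpM2l ?powR_ge0// hc// enorm_unitv.
Qed.

Lemma integrable_Dom : lebd.-integrable setT (EFin \o Dom).
Proof. exact: integrable_exp_stable. Qed.

Definition vs k (u : d.-tuple R) : C := (rc Rr - V u) ^+ k.

Lemma cmeas_vs k : cmeas (vs k).
Proof. by apply: cmeasX; apply: cmeasD; [exact: cmeas_cst|exact: cmeasN]. Qed.

Lemma vs_le k u : enorm u = 1 -> cmod (vs k u) <= q ^+ k.
Proof. by move=> u1; rewrite cmodX lerXn2r ?nnegrE ?cmod_ge0 ?hq. Qed.

Lemma unit_exists : exists xi : d.-tuple R, enorm xi = 1.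
Proof.
exists [tuple (i == ord0)%:R | i < d]; rewrite /enorm /dotp (bigD1 ord0)//= big1.
  by rewrite tnth_mktuple eqxx mulr1 addr0 sqrtr1.
by move=> i i0; rewrite tnth_mktuple (negbTE i0) mulr0.
Qed.

Lemma unitv0 (x : d.-tuple R) : ~~ (0 < enorm x) -> enorm x = 0 /\ unitv x = vzero.
Proof.
rewrite -leNgt => h; have e : enorm x = 0 by apply/eqP; rewrite eq_le h enorm_ge0.
by split => //; rewrite (enorm0_eq0 e) unitv_vzero.
Qed.

(** A homogeneous polynomial of positive degree vanishes at the null vector and one of degree 0 is
    constant. This covers [x = 0], whose direction is the null vector. *)
Lemma proj_vzero (f : d.-tuple R -> C) K n xi : cmeas f ->
  (forall u, enorm u = 1 -> cmod (f u) <= K) ->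
  proj_harm n f vzero = rc (0 ^+ n) * proj_harm n f xi.
Proof.
move=> mf fK; have [[/homogP hh _] _] := hprojP hd mf fK n.
rewrite /proj_harm -/(hproj f n) -(peval_scale 0 xi hh); congr peval.
by apply: eq_from_tnth => i; rewrite tnth_vscale mul0r tnth_nseq.
Qed.

Lemma proj_bound_unitv : exists2 A : R, 0 <= A & forall k n (x : d.-tuple R),
  cmod (proj_harm n (vs k) (unitv x)) <= A * (4 * expR 1) ^+ n * q ^+ k.
Proof.
have [A A0 hA] := proj_bound R hd; exists A => // k n x.
have qk0 : 0 <= q ^+ k by rewrite exprn_ge0.
have h := hA (vs k) (q ^+ k) (cmeas_vs k) (@vs_le k) qk0 n.
case: (boolP (0 < enorm x)) => x0; first by apply: h; exact: enorm_unitv.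
have [_ ->] := unitv0 x0; have [xi xi1] := unit_exists.
rewrite (proj_vzero n xi (cmeas_vs k) (@vs_le k)) cmodM cmod_rc.
apply: le_trans (h xi xi1); rewrite -[leRHS]mul1r ler_wpM2r ?cmod_ge0//.
by case: n {h} => [|n]; rewrite ?expr0 ?normr1// exprS mul0r normr0.
Qed.

Lemma dotp_unitv_le (x u : d.-tuple R) : enorm u = 1 -> `|dotp (unitv x) u| <= 1.
Proof.
move=> u1; apply: le_trans (cauchy_schwarz _ _) _; rewrite u1 mulr1.
case: (boolP (0 < enorm x)) => x0; first by rewrite enorm_unitv.
by have [_ ->] := unitv0 x0; rewrite enorm_vzero.
Qed.

(** The factor [|x|^n] is what makes the formula valid at [x = 0]: it vanishes for [n > 0], and for
    [n = 0] both sides do not depend on the direction. *)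
Lemma funk_hecke_unitv n k x :
  rc (enorm x ^+ n) * cint sphm (fun u => vs k u * rc (dotp (unitv x) u) ^+ n) =
  rc (enorm x ^+ n) * \sum_(m < n./2.+1) rc (chat R d' n m) * proj_harm (n - 2 * m) (vs k) (unitv x).
Proof.
have cE (m : 'I_(n./2.+1)) : cn R d' n m = rc (chat R d' n m).
  by apply: cnE => //; have := ltn_ord m; lia.
have fh := funk_hecke hd (cmeas_vs k) (@vs_le k) n.
case: (boolP (0 < enorm x)) => x0.
  rewrite fh; last exact: enorm_unitv.
  by under eq_bigr do rewrite cE.
have [-> ->] := unitv0 x0; have [xi xi1] := unit_exists.
case: n => [|n] in cE fh *; last by rewrite exprS mul0r rc0 !mul0r.
have e0 (y : d.-tuple R) : (fun u => vs k u * rc (dotp y u) ^+ 0) = vs k.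
  by apply/funext => u; rewrite expr0 mulr1.
congr (_ * _); rewrite e0; have := fh xi xi1; rewrite e0.
move=> ->; apply: eq_bigr => m _; rewrite cE; congr (_ * _).
rewrite (proj_vzero _ xi (cmeas_vs k) (@vs_le k)).
by rewrite sub0n expr0 rc1 mul1r.
Qed.

(* The terms of the expansion of [exp(-i<x,z>) Phi(z)] in powers of [<x,z>]. *)
Definition an n (x z : d.-tuple R) : C :=
  rc (n`!%:R^-1) * (- (rc (dotp x z) * ci)) ^+ n * Phi z.

Lemma cmeas_an n x : cmeas (an n x).
Proof.
apply: cmeasM; last exact: cmeas_Phi.
apply: cmeasM; first exact: cmeas_cst.
apply: cmeasX; apply: cmeasN; apply: cmeasM; last exact: cmeas_cst.
by apply: cmeas_rc; apply: measurable_dotp => //; exact: measurable_id.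
Qed.

Definition Gx (x z : d.-tuple R) : R := expR (enorm x * enorm z) * expR (- (c * enorm z `^ alpha)).

Lemma integrable_Gx x : lebd.-integrable setT (EFin \o Gx x).
Proof. by apply: integrable_exp_stable => //; exact: enorm_ge0. Qed.

Lemma cmod_an n x z : cmod (an n x z) <= (n`!%:R^-1 * (enorm x * enorm z) ^+ n) * expR (- (c * enorm z `^ alpha)).
Proof.
rewrite /an !cmodM cmod_rc cmodX cmodN cmodM cmod_rc cmod_ci mulr1.
rewrite ger0_norm ?invr_ge0//; apply: ler_pM; rewrite ?mulr_ge0 ?exprn_ge0 ?invr_ge0 ?cmod_ge0//.
- rewrite ler_wpM2l ?invr_ge0// lerXn2r ?nnegrE ?mulr_ge0 ?enorm_ge0//.
  exact: cauchy_schwarz.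
- by have := Phi_le z; rewrite /Dom mul0r expR0 mul1r.
Qed.

Lemma sum_an N x z : \sum_(n < N) cmod (an n x z) <= Gx x z.
Proof.
apply: le_trans (_ : \sum_(n < N) (n`!%:R^-1 * (enorm x * enorm z) ^+ n) * expR (- (c * enorm z `^ alpha)) <= _).
  by apply: ler_sum => n _; exact: cmod_an.
rewrite -mulr_suml ler_wpM2r ?expR_ge0//; apply: sum_exp_coeff_le.
by rewrite mulr_ge0 ?enorm_ge0.
Qed.

Lemma cintegrable_an n x : cintegrable lebd (an n x).
Proof.
apply: (@cintegrable_le _ _ _ _ _ (Gx x)); [exact: cmeas_an| |exact: integrable_Gx].
move=> z; apply: le_trans (sum_an n.+1 x z).
by rewrite big_ord_recr/= lerDr sumr_ge0// => i _; exact: cmod_ge0.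
Qed.

Lemma sum_n x : csum_to (fun n => cint lebd (an n x))
  (cint lebd (fun z => cexp (- (rc (dotp x z) * ci)) * Phi z)).
Proof.
apply: (@csum_to_cint _ _ _ _ (fun n => an n x) _ (Gx x) _ _ _ _ _).2.
- by move=> n; exact: cmeas_an.
- move=> z; rewrite mulrC; apply: eq_csum_to (csum_toZ (Phi z) (csum_to_cexp (- (rc (dotp x z) * ci)))).
  by move=> n; rewrite /an mulrC.
- move=> N z; exact: le_trans (cmod_sum _ _ _) (sum_an N x z).
- exact: integrable_Gx.
- by move=> n; exact: cintegrable_an.
Qed.

Definition ph n k (r : R) : R := k`!%:R^-1 * (`|r| ^+ n * (r `^ alpha) ^+ k * expR (- (Rr * r `^ alpha))).
Definition kap n (x : d.-tuple R) : C := rc (n`!%:R^-1) * (- ci) ^+ n * rc (enorm x ^+ n).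
(* Expansion of [an] in powers of [V_*], in polar coordinates. *)
Definition bn n k (x z : d.-tuple R) : C :=
  kap n x * (rc (ph n k (enorm z)) * (vs k (unitv z) * rc (dotp (unitv x) (unitv z)) ^+ n)).

Lemma ph_ge0 n k r : 0 <= ph n k r.
Proof. by rewrite /ph !mulr_ge0 ?invr_ge0 ?exprn_ge0 ?powR_ge0 ?expR_ge0. Qed.

Lemma measurable_ph n k : measurable_fun setT (ph n k).
Proof.
apply: measurable_funM => //; apply: measurable_funM.
  apply: measurable_funM; first by apply: measurable_funX; exact: normr_measurable.
  by apply: measurable_funX; exact: measurable_powR.
apply: (measurableT_comp (@measurable_expR R)); under eq_fun do rewrite -mulNr.
by apply: measurable_funM => //; exact: measurable_powR.
Qed.

Lemma ph_int n k :
  (\int[leb]_(r in `]0%R, +oo[) (ph n k r * r ^+ d')%:E = (alpha^-1 * Gk d' alpha Rr n k)%:E)%E.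
Proof.
rewrite /ph; under eq_integral do rewrite -(mulrA k`!%:R^-1) EFinM.
rewrite ge0_integralZl_EFin ?invr_ge0//.
- rewrite (radial_nk hd halpha n k Rr_gt0) -EFinM; congr EFin; rewrite /Gk invfM; ring.
- move=> r; rewrite /= in_itv/= andbT => r0.
  by rewrite lee_fin !mulr_ge0 ?expR_ge0 ?exprn_ge0 ?powR_ge0// ltW.
- apply/measurable_EFinP; apply: measurable_funTS.
  apply: measurable_funM; last exact: measurable_funX.
  apply: measurable_funM.
    apply: measurable_funM; first by apply: measurable_funX; exact: normr_measurable.
    by apply: measurable_funX; exact: measurable_powR.
  apply: (measurableT_comp (@measurable_expR R)); under eq_fun do rewrite -mulNr.
  by apply: measurable_funM => //; exact: measurable_powR.
Qed.

Lemma bn_int n k x : cintegrable lebd (bn n k x) /\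
  cint lebd (bn n k x) = kap n x * (rc (alpha^-1 * Gk d' alpha Rr n k) *
    cint sphm (fun u => vs k u * rc (dotp (unitv x) u) ^+ n)).
Proof.
have mF : cmeas (fun u => vs k u * rc (dotp (unitv x) u) ^+ n).
  apply: cmeasM; first exact: cmeas_vs.
  by apply: cmeasX; apply: cmeas_rc; apply: measurable_dotp => //; exact: measurable_id.
have bF (u : d.-tuple R) : enorm u = 1 -> cmod (vs k u * rc (dotp (unitv x) u) ^+ n) <= q ^+ k * 1.
  move=> u1; rewrite cmodM; apply: ler_pM; rewrite ?cmod_ge0 ?vs_le//.
  by rewrite cmodX cmod_rc exprn_ile1// dotp_unitv_le.
have [I E] := polar_prod (measurable_ph n k) (ph_ge0 n k) (ph_int n k) mF bF.
by split; [exact: cintegrableZ|rewrite cintZ// E].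
Qed.

Lemma dotp_polar (x z : d.-tuple R) : dotp x z = enorm x * enorm z * dotp (unitv x) (unitv z).
Proof.
rewrite -{1}(vscale_enorm_unitv x) -{1}(vscale_enorm_unitv z) dotpZl dotpZr.
by rewrite mulrA.
Qed.

Lemma Phi_split z : Phi z = rc (expR (- (Rr * enorm z `^ alpha))) * cexp (rc (enorm z `^ alpha) * (rc Rr - V (unitv z))).
Proof.
rewrite /Phi -cexp_rc -cexpD; congr cexp; rewrite rcN rcM; ring.
Qed.

Lemma sum_bn n x z : csum_to (fun k => bn n k x z) (an n x z).
Proof.
have h := csum_toZ (kap n x * (rc (`|enorm z| ^+ n * expR (- (Rr * enorm z `^ alpha))) * rc (dotp (unitv x) (unitv z)) ^+ n))
  (csum_to_cexp (rc (enorm z `^ alpha) * (rc Rr - V (unitv z)))).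
have E : an n x z = kap n x * (rc (`|enorm z| ^+ n * expR (- (Rr * enorm z `^ alpha))) * rc (dotp (unitv x) (unitv z)) ^+ n) *
  cexp (rc (enorm z `^ alpha) * (rc Rr - V (unitv z))).
  rewrite /an Phi_split /kap dotp_polar !rcM !rcX exprNn !exprMn ger0_norm ?enorm_ge0// (exprNn ci).
  by move: (cexp _) (rc (expR _)) => w1 w2; ring.
rewrite E; apply: eq_csum_to h => k.
rewrite /bn /ph /vs exprMn !rcM rcX.
by move: ((rc Rr - V (unitv z)) ^+ k) (rc (expR _)) => w1 w2; ring.
Qed.

(** Since [|V_*| <= q] in every direction, the sum over [k] costs at most [exp(q |z|^alpha)] against
    [exp(-R |z|^alpha)]. The resulting majorant does not depend on [N]. *)
Lemma bn_sum_le N n x z : \sum_(k < N) cmod (bn n k x z) <= n`!%:R^-1 * (enorm x * enorm z) ^+ n * expR (- ((Rr - q) * enorm z `^ alpha)).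
Proof.
pose r := enorm z `^ alpha.
have r0 : 0 <= r by exact: powR_ge0.
have qr : r * cmod (rc Rr - V (unitv z)) <= r * q.
  case: (boolP (0 < enorm z)) => z0; last by rewrite /r enorm_pow0// !mul0r.
  by rewrite ler_wpM2l// hq// enorm_unitv.
have t k : cmod (bn n k x z) <= (k`!%:R^-1 * (r * q) ^+ k) * (n`!%:R^-1 * (enorm x * enorm z) ^+ n * expR (- (Rr * r))).
  rewrite /bn /kap !cmodM !cmod_rc !cmodX cmodN cmod_ci expr1n mulr1 cmod_rc.
  rewrite ger0_norm ?invr_ge0// (ger0_norm (exprn_ge0 _ (enorm_ge0 x))) (ger0_norm (ph_ge0 _ _ _)).
  rewrite /ph -/r ger0_norm ?enorm_ge0//.
  have dle : `|dotp (unitv x) (unitv z)| ^+ n <= 1.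
    apply: exprn_ile1 => //; case: (boolP (0 < enorm z)) => z0.
      by apply: dotp_unitv_le; exact: enorm_unitv.
    by have [_ ->] := unitv0 z0; rewrite dotp0 normr0.
  have kle : r ^+ k * cmod (rc Rr - V (unitv z)) ^+ k <= (r * q) ^+ k.
    by rewrite -exprMn lerXn2r ?nnegrE ?mulr_ge0 ?cmod_ge0.
  rewrite [(enorm x * _) ^+ n]exprMn.
  set e1 := expR _; set vv := cmod _ ^+ k; set dd := `|_| ^+ n.
  have e10 : 0 <= e1 by exact: expR_ge0.
  have dd0 : 0 <= dd by exact: exprn_ge0.
  have vv0 : 0 <= vv by rewrite exprn_ge0// cmod_ge0.
  rewrite [leLHS](_ : _ = (n`!%:R^-1 * (enorm x ^+ n * enorm z ^+ n) * e1 * k`!%:R^-1) * ((r ^+ k * vv) * dd)); last by ring.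
  rewrite [leRHS](_ : _ = (n`!%:R^-1 * (enorm x ^+ n * enorm z ^+ n) * e1 * k`!%:R^-1) * ((r * q) ^+ k * 1)); last by ring.
  rewrite ler_wpM2l ?mulr_ge0 ?invr_ge0 ?exprn_ge0 ?enorm_ge0//.
  by apply: ler_pM => //; apply: mulr_ge0 => //; exact: exprn_ge0.
apply: le_trans (_ : \sum_(k < N) (k`!%:R^-1 * (r * q) ^+ k) *
    (n`!%:R^-1 * (enorm x * enorm z) ^+ n * expR (- (Rr * r))) <= _).
  by apply: ler_sum => k _; exact: t.
rewrite -mulr_suml; apply: le_trans (_ : expR (r * q) * (n`!%:R^-1 * (enorm x * enorm z) ^+ n * expR (- (Rr * r))) <= _).
  rewrite ler_wpM2r ?mulr_ge0 ?invr_ge0 ?exprn_ge0 ?mulr_ge0 ?enorm_ge0 ?expR_ge0//.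
  by apply: sum_exp_coeff_le; rewrite mulr_ge0.
rewrite mulrCA -expRD le_eqVlt; apply/orP; left; apply/eqP; congr (_ * expR _).
by rewrite -/r; ring.
Qed.

Lemma sum_k n x : csum_to (fun k => cint lebd (bn n k x)) (cint lebd (an n x)).
Proof.
pose G (z : d.-tuple R) := expR (enorm x * enorm z) * expR (- ((Rr - q) * enorm z `^ alpha)).
apply: (@csum_to_cint _ _ _ _ (fun k => bn n k x) _ G _ _ _ _ _).2.
- by move=> k; exact: cintegrable_meas (bn_int n k x).1.
- by move=> z; exact: sum_bn.
- move=> N z; apply: le_trans (cmod_sum _ _ _) _; apply: le_trans (bn_sum_le N n x z) _.
  rewrite /G ler_wpM2r ?expR_ge0// ler_pdivrMl ?ltr0n ?fact_gt0//.
  by apply: exprn_le_expR; rewrite mulr_ge0 ?enorm_ge0.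
- by apply: integrable_exp_stable => //; exact: enorm_ge0.
- by move=> k; exact: (bn_int n k x).1.
Qed.

Let c0 : R := (2 * pi) ^- d.

(** The constants combine as follows: [(2 pi)^-d] times the factor [2 pi^(d/2)] of [chat] and
    [1/alpha] is [gconst]; [n!] cancels, and the [2^-n] of [chat] joins [|x|^n]. *)
Lemma coef_match n k x : rc c0 * cint lebd (bn n k x) =
  rc (gconst d alpha) * \sum_(m < n./2.+1) gterm alpha V Rr n m k x.
Proof.
rewrite (bn_int n k x).2 /kap.
rewrite [LHS](_ : _ = (rc c0 * rc n`!%:R^-1 * (- ci) ^+ n * rc (alpha^-1 * Gk d' alpha Rr n k)) *
  (rc (enorm x ^+ n) * cint sphm (fun u => vs k u * rc (dotp (unitv x) u) ^+ n))); last first.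
  by move: (cint _ _) => w; ring.
rewrite funk_hecke_unitv mulr_sumr !mulr_sumr; apply: eq_bigr => m _.
have mn := double_half_ord m.
have mn' : (m <= n)%N by lia.
rewrite /gterm /Sstar -/(vs k).
(* This is the origin of the sign [(-1)^m] and of the power of [-i] in [Sstar]. *)
have -> : (- ci) ^+ n = (- ci) ^+ (n - 2 * m) * rc ((-1) ^+ m) :> C.
  rewrite -{1}(subnK mn) exprD exprM; congr (_ * _); rewrite rcX; congr (_ ^+ _).
  by apply: ceqP; rewrite expr2 ?cReM ?cImM/=; ring.
rewrite (_ : proj_harm _ (vs k) _ = proj_harm (n - 2 * m) (fun v => (rc Rr - V v) ^+ k) (unitv x))//.
move: (proj_harm _ _ _) ((- ci) ^+ (n - 2 * m)) => w1 w2.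
rewrite [LHS](_ : _ = rc (c0 * n`!%:R^-1 * (-1) ^+ m * (alpha^-1 * Gk d' alpha Rr n k) * enorm x ^+ n * chat R d' n m) * (w2 * w1)); last by rewrite !rcM; ring.
rewrite mulrA -rcM; congr (rc _ * _).
rewrite /gconst /chat /Gk /c0 expr_div_n.
set g1 := Gamma (k%:R + _); set g2 := Gamma (n%:R - _ + _); set p2 := Rr `^ _; set s1 := (-1) ^+ m.
have -> : (2 : R) `^ (1 - d%:R) = 2 * 2 ^- d.
  by rewrite powRD ?powRr1// ?powRN ?powR_mulrn// pnatr_eq0 implybT.
set pp := pi `^ (d%:R / 2).
have pp0 : pp != 0 by rewrite gt_eqF// powR_gt0// pi_gt0.
have -> : ((2 : R) * pi) ^- d = 2 ^- d * (pp * pp)^-1.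
  rewrite exprMn invfM; congr (_ / _); rewrite /pp -powRD -?splitr ?powR_mulrn ?pi_ge0//.
  by apply/implyP => _; rewrite gt_eqF// pi_gt0.
have f1 : (n`!%:R : R) != 0 by rewrite pnatr_eq0 -lt0n fact_gt0.
have f2 : (k`!%:R : R) != 0 by rewrite pnatr_eq0 -lt0n fact_gt0.
have f3 : (m`!%:R : R) != 0 by rewrite pnatr_eq0 -lt0n fact_gt0.
have f4 : (2 ^+ d : R) != 0 by rewrite expf_neq0.
have f5 : (2 ^+ n : R) != 0 by rewrite expf_neq0.
have f6 : p2 != 0 by rewrite gt_eqF// powR_gt0.
have f7 : g2 != 0.
  rewrite gt_eqF// Gamma_gt0//; apply: le_trans (d2_ge1 R hd) _.
  by rewrite lerDr subr_ge0 ler_nat.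
have f8 : alpha != 0 by rewrite gt_eqF.
move: n`!%:R k`!%:R m`!%:R (2 ^+ d : R) (2 ^+ n : R) p2 g2 f1 f2 f3 f4 f5 f6 f7 => z1 z2 z3 z4 z5 z6 z7 *.
by field; rewrite pp0 f8; do ?[apply/andP; split].
Qed.

Definition sfun n m x : C := xget 0 (csum_to (fun k => gterm alpha V Rr n m k x)).

(** Modulus of the part of the coefficient that does not depend on [k]; the absolute value makes it
    nonnegative for all indices. *)
Definition gco n m (x : d.-tuple R) : R :=
  (enorm x / 2) ^+ n / (m`!%:R * `|Gamma (n%:R - m%:R + d%:R / 2)|).

Lemma gterm_le A n m k x : (forall k n (x : d.-tuple R),
    cmod (proj_harm n (vs k) (unitv x)) <= A * (4 * expR 1) ^+ n * q ^+ k) ->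
  cmod (gterm alpha V Rr n m k x) <=
  gco n m x * (A * (4 * expR 1) ^+ (n - 2 * m)) * (q ^+ k * Gk d' alpha Rr n k).
Proof.
move=> hA; rewrite /gterm /Sstar !cmodM cmod_rc cmodX cmodN cmod_ci expr1n mul1r -/(vs k).
have -> : `|(enorm x / 2) ^+ n * (-1) ^+ m / (m`!%:R * Gamma (n%:R - m%:R + d%:R / 2)) *
     Gamma (k%:R + (n%:R + d%:R) / alpha) / (k`!%:R * Rr `^ (k%:R + (n%:R + d%:R) / alpha))| =
   gco n m x * Gk d' alpha Rr n k.
  rewrite -mulrA -/(Gk d' alpha Rr n k) normrM (ger0_norm (Gk_ge0 _ _ _ _ _)); congr (_ * _).
  rewrite /gco normf_div normrM (normrM m`!%:R) !normrX normrN1 expr1n mulr1 normr_nat.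
  by rewrite (ger0_norm (divr_ge0 (enorm_ge0 x) (ler0n _ 2))).
have g0 : 0 <= gco n m x.
  by rewrite /gco divr_ge0 ?mulr_ge0 ?exprn_ge0 ?divr_ge0 ?enorm_ge0.
rewrite [leRHS](_ : _ = gco n m x * Gk d' alpha Rr n k * (A * (4 * expR 1) ^+ (n - 2 * m) * q ^+ k)); last by ring.
by rewrite ler_wpM2l ?hA// mulr_ge0// Gk_ge0.
Qed.

Lemma bin_le_exp2 n m : ('C(n, m) <= 2 ^ n)%N.
Proof.
elim: n m => [|n IH] [|m]; rewrite ?bin0 ?expn_gt0// binS expnS mul2n -addnn.
by apply: leq_add; exact: IH.
Qed.

Lemma gco_ge0 n m x : 0 <= gco n m x.
Proof. by rewrite /gco divr_ge0 ?mulr_ge0 ?exprn_ge0 ?divr_ge0 ?enorm_ge0. Qed.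

(** The [2^-n] of [(|x|/2)^n] absorbs the binomial coefficient in [n! <= 2^n m! (n-m)!], and
    [Gamma_lower_fact] costs a factor [exp(n-m+2)], at most [exp(n+2)]. *)
Lemma gco_le n m x : (2 * m <= n)%N ->
  gco n m x <= expR 2 * (expR 1 ^+ n * enorm x ^+ n / n`!%:R).
Proof.
move=> mn; have mn' : (m <= n)%N by lia.
rewrite /gco -natrB//; have gl := Gamma_lower_fact (n - m) (d2_ge1 R hd).
set g := Gamma _ in gl *.
have f1 : (0 : R) < n`!%:R by rewrite ltr0n fact_gt0.
have f2 : (0 : R) < (n - m)`!%:R by rewrite ltr0n fact_gt0.
have f3 : (0 : R) < m`!%:R by rewrite ltr0n fact_gt0.
have e0 : (0 : R) < expR (- (n - m).+2%:R) by exact: expR_gt0.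
have g0 : 0 < g by apply: lt_le_trans gl; exact: mulr_gt0.
rewrite (gtr0_norm g0) expr_div_n ler_pdivrMr ?mulr_gt0//.
have h1 : (n`!%:R : R) <= 2 ^+ n * (m`!%:R * (n - m)`!%:R).
  rewrite -(bin_fact mn') natrM natrM ler_wpM2r ?mulr_ge0//.
  by rewrite -natrX ler_nat bin_le_exp2.
have h2 : 1 <= expR 2 * expR 1 ^+ n * expR (- (n - m).+2%:R) :> R.
  have nm : ((n - m).+2%:R : R) <= 2 + n%:R by rewrite -natrD ler_nat leq_sub_add2.
  rewrite -expRM_natl mulr1 -!expRD -[leLHS]expR0 ler_expR.
  by move: nm; move: ((n - m).+2%:R : R) => w; lra.
rewrite [leRHS](_ : _ = (enorm x ^+ n / n`!%:R) * (m`!%:R * (expR 2 * expR 1 ^+ n * g))); last by ring.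
rewrite -[leLHS]mulr1 -!mulrA ler_wpM2l ?exprn_ge0 ?enorm_ge0//.
rewrite ler_pdivlMl// mulrCA ler_pdivrMl ?exprn_gt0// mulr1.
apply: le_trans h1 _; rewrite ler_wpM2l ?exprn_ge0// ler_wpM2l ?(ltW f3)//.
apply: le_trans (_ : (n - m)`!%:R * (expR 2 * expR 1 ^+ n * expR (- (n - m).+2%:R)) <= _).
  by rewrite -[leLHS]mulr1 ler_wpM2l// ltW.
rewrite [leLHS](_ : _ = expR 2 * (expR 1 ^+ n * ((n - m)`!%:R * expR (- (n - m).+2%:R)))); last by ring.
by rewrite ler_wpM2l ?expR_ge0// ler_wpM2l ?exprn_ge0 ?expR_ge0.
Qed.

Lemma sum_gterm A n m x N : 0 <= A -> (forall k n (x : d.-tuple R),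
    cmod (proj_harm n (vs k) (unitv x)) <= A * (4 * expR 1) ^+ n * q ^+ k) ->
  \sum_(k < N) cmod (gterm alpha V Rr n m k x) <=
  gco n m x * (A * (4 * expR 1) ^+ (n - 2 * m)) * (alpha * Jr d' alpha (Rr - q) n).
Proof.
move=> A0 hA.
apply: le_trans (_ : \sum_(k < N) gco n m x * (A * (4 * expR 1) ^+ (n - 2 * m)) * (q ^+ k * Gk d' alpha Rr n k) <= _).
  by apply: ler_sum => k _; exact: gterm_le.
rewrite -mulr_sumr ler_wpM2l; first by [].
  apply: mulr_ge0; first exact: gco_ge0.
  by apply: mulr_ge0 => //; rewrite exprn_ge0// mulr_ge0 ?expR_ge0.
exact: (sum_Gk hd halpha).
Qed.

Lemma sfunP n m x : csum_to (fun k => gterm alpha V Rr n m k x) (sfun n m x).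
Proof.
have [A A0 hA] := proj_bound_unitv.
have [l hl] := @csum_to_abs R (fun k => gterm alpha V Rr n m k x) _ (fun N => @sum_gterm A n m x N A0 hA).
by apply: (@xgetPex _ 0 (csum_to (fun k => gterm alpha V Rr n m k x))); exists l.
Qed.

Definition gn n x : C := rc (gconst d alpha) * \sum_(m < n./2.+1) sfun n m x.

(** Both sides are sums over [k] of the same terms, by [coef_match]; convergence of the Fourier
    expansion thus carries over to the series. *)
Lemma gnE n x : gn n x = rc c0 * cint lebd (an n x).
Proof.
apply: (@csum_to_unique R (fun k => rc c0 * cint lebd (bn n k x))); last first.
  exact: csum_toZ (sum_k n x).
apply: (@eq_csum_to R (fun k => rc (gconst d alpha) * \sum_(m < n./2.+1) gterm alpha V Rr n m k x)).
  by move=> k; rewrite coef_match.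
apply: csum_toZ; apply: csum_to_sum => m; exact: sfunP.
Qed.

Lemma sum_gn x : csum_to (fun n => gn n x) (ginv Phi x).
Proof.
apply: (@eq_csum_to R (fun n => rc c0 * cint lebd (an n x))); first by move=> n; rewrite gnE.
exact: csum_toZ (sum_n x).
Qed.

(** One summable majorant, common to all [x] in the ball of radius [M], from which both the uniform
    convergence and the integration over spheres are deduced. *)
Lemma tau_exists (M : R) : 0 <= M -> exists (tau : nat -> R) (W : R),
  [/\ forall n, 0 <= tau n, forall N, \sum_(n < N) tau n <= W &
   forall n x N, enorm x <= M ->
     \sum_(m < n./2.+1) \sum_(k < N) cmod (gterm alpha V Rr n m k x) <= tau n].
Proof.
move=> M0; have [A A0 hA] := proj_bound_unitv.
(* The 8 is 2 times 4: there are at most [2^n] indices [m], and the projections grow like [(4 e)^n].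
   The second factor [e] is the loss in the Gamma bound. *)
pose K : R := 8 * expR 1 ^+ 2 * M.
have K0 : 0 <= K by rewrite !mulr_ge0 ?exprn_ge0 ?expR_ge0.
have [W W0 hW] := sum_Jr hd halpha Rq_gt0 K0.
pose cc := A * alpha * expR 2.
have cc0 : 0 <= cc by rewrite !mulr_ge0 ?expR_ge0// ltW.
have J0 n : 0 <= Jr d' alpha (Rr - q) n by apply: Jr_ge0.
exists (fun n => K ^+ n / n`!%:R * Jr d' alpha (Rr - q) n * cc), (W * cc); split.
- by move=> n; apply: mulr_ge0 => //; apply: mulr_ge0 => //; apply: divr_ge0 => //; exact: exprn_ge0.
- by move=> N; rewrite -mulr_suml ler_wpM2r.
move=> n x N xM.
pose t := expR 2 * (expR 1 ^+ n * M ^+ n / n`!%:R) * (A * (4 * expR 1) ^+ n) * (alpha * Jr d' alpha (Rr - q) n).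
have t0 : 0 <= t.
  apply: mulr_ge0; last by apply: mulr_ge0 => //; exact: ltW.
  apply: mulr_ge0; last by apply: mulr_ge0 => //; apply: exprn_ge0; rewrite mulr_ge0 ?expR_ge0.
  apply: mulr_ge0; first exact: expR_ge0.
  by apply: divr_ge0 => //; apply: mulr_ge0; apply: exprn_ge0 => //; exact: expR_ge0.
apply: le_trans (_ : \sum_(m < n./2.+1) t <= _).
  apply: ler_sum => m _; apply: le_trans (sum_gterm n m x N A0 hA) _.
  have mn := double_half_ord m.
  apply: ler_wpM2r; first by rewrite mulr_ge0// ltW.
  apply: ler_pM.
  - exact: gco_ge0.
  - by rewrite mulr_ge0// exprn_ge0// mulr_ge0 ?expR_ge0.
  - apply: le_trans (gco_le x mn) _; rewrite ler_wpM2l ?expR_ge0// ler_wpM2r ?invr_ge0//.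
    by rewrite ler_wpM2l ?exprn_ge0 ?expR_ge0// lerXn2r ?nnegrE ?enorm_ge0.
  - rewrite ler_wpM2l// ler_weXn2l ?leq_subr//.
    have e1 : 1 <= expR 1 :> R by rewrite -expR0 ler_expR.
    by have := e1; lra.
rewrite sumr_const card_ord -(mulr_natl t).
apply: le_trans (_ : 2 ^+ n * t <= _).
  rewrite ler_wpM2r// -natrX ler_nat; exact: half_lt_exp2.
rewrite le_eqVlt; apply/orP; left; apply/eqP.
have E8 : (8 : R) ^+ n = 2 ^+ n * 4 ^+ n by rewrite -exprMn -natrM.
have KE : K ^+ n = 2 ^+ n * 4 ^+ n * (expR 1 ^+ n * expR 1 ^+ n) * M ^+ n by rewrite /K expr2 !exprMn E8.
rewrite KE /t /cc exprMn.
by move: (expR 1 ^+ n) (expR 2) (Jr _ _ _ _) n`!%:R^-1 => w1 w2 w3 w4; ring.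
Qed.

End series_expansion.

Section tails.
Context (R : realType).
Local Notation C := R[i].
Local Notation Re := complex.Re.
Local Notation Im := complex.Im.

Lemma nonneg_tail_small (tau : nat -> R) (W e : R) : (forall n, 0 <= tau n) ->
  (forall N, \sum_(n < N) tau n <= W) -> 0 < e ->
  exists N0, forall N, (N0 <= N)%N -> forall k, \sum_(i < k) tau (N + i)%N <= e.
Proof.
move=> t0 tW e0; pose S N := \sum_(n < N) tau n.
have SD N k : S (N + k)%N = S N + \sum_(i < k) tau (N + i)%N by rewrite /S big_split_ord.
have hs : has_sup (range S).
  by split; [exists (S 0%N), 0%N|exists W => _ [N _ <-]; exact: tW].
have [_ [N0 _ <-] hN0] := sup_adherent e0 hs.
exists N0 => N N0N k.
have h1 : S (N + k)%N <= sup (range S).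
  by apply: ub_le_sup; [exact: hs.2|exists (N + k)%N].
have h2 : S N0 <= S N.
  by rewrite -(subnKC N0N) SD lerDl sumr_ge0.
by move: h1; rewrite SD => h1; move: hN0 h1 h2; lra.
Qed.

Lemma csum_to_shift (a : nat -> C) l N : csum_to a l ->
  csum_to (fun k => a (N + k)%N) (l - \sum_(n < N) a n).
Proof.
have sD k : \sum_(i < k) a (N + i)%N = \sum_(n < N + k) a n - \sum_(n < N) a n.
  by rewrite big_split_ord/= addrAC subrr add0r.
move=> [hr hi]; split.
- rewrite cReD cReN (_ : (fun _ => _) = fun k => Re (\sum_(n < N + k) a n) - Re (\sum_(n < N) a n)); last first.
    by apply/funext => k; rewrite sD cReD cReN.
  apply: cvgB; last exact: cvg_cst.
  have := hr; rewrite -(cvg_shiftn N) /=; under eq_fun do rewrite addnC; exact.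
- rewrite cImD cImN (_ : (fun _ => _) = fun k => Im (\sum_(n < N + k) a n) - Im (\sum_(n < N) a n)); last first.
    by apply/funext => k; rewrite sD cImD cImN.
  apply: cvgB; last exact: cvg_cst.
  have := hi; rewrite -(cvg_shiftn N) /=; under eq_fun do rewrite addnC; exact.
Qed.

Lemma csum_to_even (b : nat -> C) l : (forall n, b n.*2.+1 = 0) -> csum_to b l ->
  csum_to (fun n => b n.*2) l.
Proof.
move=> b0 [hr hi].
have par N : \sum_(n < N) b n.*2 = \sum_(n < N.*2) b n.
  elim: N => [|N IH]; first by rewrite !big_ord0.
  by rewrite doubleS !big_ord_recr/= IH b0 addr0.
have dbl : (fun N => N.*2) @ \oo --> \oo.
  apply/cvgnyPge => N; near=> n; apply: (@leq_trans n); last by rewrite -addnn leq_addr.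
  by near: n; exact: nbhs_infty_ge.
split.
- rewrite (_ : (fun N => _) = (fun N => Re (\sum_(n < N) b n)) \o (fun N => N.*2)).
    exact: (cvg_comp _ _ dbl hr).
  by apply/funext => N; rewrite /= par.
- rewrite (_ : (fun N => _) = (fun N => Im (\sum_(n < N) b n)) \o (fun N => N.*2)).
    exact: (cvg_comp _ _ dbl hi).
  by apply/funext => N; rewrite /= par.
Unshelve. all: by end_near.
Qed.

Lemma nneseries_EFin_le N (a : nat -> R) (B : R) : (forall n, 0 <= a n) ->
  (forall k, \sum_(i < k) a (N + i)%N <= B) ->
  (\sum_(N <= n <oo) (a n)%:E <= B%:E)%E.
Proof.
move=> a0 aB; apply: lime_le.
  by apply: is_cvg_nneseries => n _ _; rewrite lee_fin.
apply: nearW => n.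
rewrite sumEFin lee_fin -{1}(add0n N) big_addn big_mkord.
by under eq_bigr do rewrite addnC; exact: aB.
Qed.

End tails.

Section density_series.
Context (R : realType) (d' : nat).
Local Notation d := d'.+1.
Hypothesis hd : (2 <= d)%N.
Local Notation leb := (@lebesgue_measure R).
Local Notation lebd := (lebn R d).
Local Notation sphm := (sphm R d').
Local Notation C := R[i].
Local Notation Re := complex.Re.
Local Notation Im := complex.Im.
Variables (alpha : R) (halpha : 1 < alpha < 2).
Variables (V : d.-tuple R -> C) (c q Rr : R).
Hypothesis mV : cmeas V.
Hypotheses (c_gt0 : 0 < c) (hc : forall u, enorm u = 1 -> c <= Re (V u)).
Hypotheses (q0 : 0 <= q) (qR : q < Rr).
Hypothesis hq : forall u, enorm u = 1 -> cmod (rc Rr - V u) <= q.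
Local Notation s := (sfun alpha V Rr).
Local Notation gt := (gterm alpha V Rr).

Let sP := sfunP hd halpha mV q0 qR hq.
Let gnP := sum_gn hd halpha mV c_gt0 hc q0 qR hq.

Lemma gseries_abs_unif M e : 0 < M -> 0 < e -> exists N0 : nat,
  forall N : nat, (N0 <= N)%N -> forall x, enorm x <= M ->
  (\sum_(N <= n <oo) \sum_(m < n./2.+1) \sum_(k <oo) (cmod (gt n m k x))%:E < e%:E)%E.
Proof.
move=> M0 e0; have [tau [W [t0 tW tle]]] := tau_exists hd halpha mV c_gt0 q0 qR hq (ltW M0).
have e20 : 0 < e / 2 by rewrite divr_gt0.
have [N0 hN0] := nonneg_tail_small t0 tW e20; exists N0 => N N0N x xM.
(* The bound on tails is a weak inequality, hence the halved tolerance. *)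
apply: (@le_lt_trans _ _ (e / 2)%:E); last by rewrite lte_fin; lra.
apply: le_trans (nneseries_EFin_le t0 (hN0 N N0N)).
apply: lee_nneseries => n _.
  by move=> _; apply: sume_ge0 => m _; apply: nneseries_ge0 => k _ _; rewrite lee_fin cmod_ge0.
rewrite -nneseries_sum; last by move=> m k _; rewrite lee_fin cmod_ge0.
under eq_eseriesr do rewrite sumEFin.
apply: nneseries_EFin_le => [k|k]; first by rewrite sumr_ge0// => m _; exact: cmod_ge0.
by rewrite exchange_big; exact: tle.
Qed.

Lemma gn_le tau M n x :
  (forall n x N, enorm x <= M ->
     \sum_(m < n./2.+1) \sum_(k < N) cmod (gt n m k x) <= tau n) ->
  enorm x <= M -> cmod (gn alpha V Rr n x) <= `|gconst d alpha| * tau n.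
Proof.
move=> tle xM; rewrite /gn cmodM cmod_rc ler_wpM2l//.
apply: (@csum_to_cmod_le R (fun k => \sum_(m < n./2.+1) gt n m k x)).
  by apply: csum_to_sum => m; exact: sP.
move=> N; apply: le_trans (tle n x N xM); rewrite [leRHS]exchange_big/=.
by apply: ler_sum => k _; exact: cmod_sum.
Qed.

Lemma gseries_unif M e : 0 < M -> 0 < e -> exists N0 : nat,
  forall N : nat, (N0 <= N)%N -> forall x, enorm x <= M ->
  cmod (\sum_(n < N) gn alpha V Rr n x - ginv (Phi alpha V) x) < e.
Proof.
move=> M0 e0; have [tau [W [t0 tW tle]]] := tau_exists hd halpha mV c_gt0 q0 qR hq (ltW M0).
have e20 : 0 < e / 2 by rewrite divr_gt0.
pose tau' n := `|gconst d alpha| * tau n.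
have t0' n : 0 <= tau' n by exact: mulr_ge0.
have tW' N : \sum_(n < N) tau' n <= `|gconst d alpha| * W by rewrite -mulr_sumr ler_wpM2l.
have [N0 hN0] := nonneg_tail_small t0' tW' e20; exists N0 => N N0N x xM.
apply: (@le_lt_trans _ _ (e / 2)); last by lra.
rewrite -cmodN opprB.
apply: (csum_to_cmod_le (csum_to_shift N (gnP x))) => k.
apply: le_trans (hN0 N N0N k); apply: ler_sum => i _; exact: gn_le tle xM.
Qed.

End density_series.

(** * The density of the norm *)

Lemma double_half_even n : odd n = false -> (2 * n./2)%N = n.
Proof. by move=> on; lia. Qed.

Section radial_series.
Context (R : realType) (d' : nat).
Local Notation d := d'.+1.
Hypothesis hd : (2 <= d)%N.
Local Notation leb := (@lebesgue_measure R).
Local Notation lebd := (lebn R d).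
Local Notation sphm := (sphm R d').
Local Notation C := R[i].
Local Notation Re := complex.Re.
Local Notation Im := complex.Im.
Variables (alpha : R) (halpha : 1 < alpha < 2).
Variables (V : d.-tuple R -> C) (c q Rr : R).
Hypothesis mV : cmeas V.
Hypotheses (c_gt0 : 0 < c) (hc : forall u, enorm u = 1 -> c <= Re (V u)).
Hypotheses (q0 : 0 <= q) (qR : q < Rr).
Hypothesis hq : forall u, enorm u = 1 -> cmod (rc Rr - V u) <= q.
Local Notation s := (sfun alpha V Rr).
Local Notation gt := (gterm alpha V Rr).
Local Notation vsk := (vs V Rr).

Let sP := sfunP hd halpha mV q0 qR hq.
Let gnP := sum_gn hd halpha mV c_gt0 hc q0 qR hq.
Let mvs k : cmeas (vsk k). Proof. exact: cmeas_vs. Qed.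
Let vsle k u : enorm u = 1 -> cmod (vsk k u) <= q ^+ k. Proof. exact: (vs_le q0 hq). Qed.

Lemma homog_harmonic1 : homog_harmonic 0 (1 : {mpoly C[d]}).
Proof.
split; first by move=> m; rewrite msupp1 inE => /eqP ->; rewrite mdeg0.
by rewrite /laplacian big1// => i _; rewrite -mpolyC1 mderivC mderiv0.
Qed.

Lemma Lf_harm0 j (p : {mpoly C[d]}) : (0 < j)%N -> homog_harmonic j p -> Lf p = 0.
Proof.
move=> j0 hp; have /eqP := G_harm0 (@Gf_lin R d') (@Gf_parts R d') j0 hp.
have /homogP hh := hp.1.
by rewrite (Gf_rad hd hh) mulf_eq0 rc_eq0 gt_eqF ?radR_gt0//= => /eqP.
Qed.

Lemma cint_proj0 k j : (0 < j)%N -> cint sphm (fun u => proj_harm j (vsk k) u) = 0.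
Proof.
move=> j0; have [hh _] := hprojP hd (mvs k) (@vsle k) j.
rewrite -(Lf_harm0 j0 hh) /Lf /Tf; congr cint; apply/funext => u.
by rewrite mul1r.
Qed.

(** The defining property of the projection of degree 0, tested on the constant polynomial 1. *)
Lemma cint_proj_eq k : cint sphm (fun u => proj_harm 0 (vsk k) u) = csph_int (vsk k).
Proof.
have [_ hh] := hprojP hd (mvs k) (@vsle k) 0.
have := hh _ homog_harmonic1; rewrite mulr1 (csph_intE (mvs k) (@vsle k)) /Lf /Tf => E.
transitivity (cint sphm (fun u => 1 * peval (hproj (vsk k) 0) u)).
  by congr cint; apply/funext => u; rewrite mul1r.
by rewrite E; congr cint; apply/funext => u; rewrite /peval meval1 mulr1.
Qed.

(* [unitv u = u] on the sphere; normalizing makes the bounds hold off the sphere too. *)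
Definition pt (r : R) (u : d.-tuple R) : d.-tuple R := vscale r (unitv u).

Lemma measurable_pt r : measurable_fun setT (pt r).
Proof. by apply: measurable_vscale => //; exact: measurable_unitv. Qed.

Lemma cmeas_pt r (F : d.-tuple R -> C) : cmeas F -> cmeas (fun u => F (pt r u)).
Proof.
move=> [mr mi]; split.
- exact: (measurableT_comp mr (measurable_pt r)).
- exact: (measurableT_comp mi (measurable_pt r)).
Qed.

Lemma enorm_pt r u : 0 <= r -> enorm (pt r u) <= r.
Proof.
move=> r0; rewrite /pt enormZ ger0_norm//.
case: (boolP (0 < enorm u)) => u0; first by rewrite enorm_unitv// mulr1.
by have [_ ->] := unitv0 u0; rewrite enorm_vzero mulr0.
Qed.

Lemma cmeas_gterm n m k : cmeas (gt n m k).
Proof.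
apply: cmeasM.
  apply: cmeas_rc; do 4 (apply: measurable_funM => //).
  by apply: measurable_funX; apply: measurable_funM => //; exact: measurable_enorm.
apply: (@cmeas_unitv _ _ (Sstar V Rr (n - 2 * m) k)).
by apply: cmeasM; [exact: cmeas_cst|exact: cmeas_peval].
Qed.

Definition gcoef n m (r : R) : R :=
  (r / 2) ^+ n * (-1) ^+ m / (m`!%:R * Gamma (n%:R - m%:R + d%:R / 2)).

Lemma gterm_pt n m k r u : (2 * m <= n)%N -> 0 <= r -> enorm u = 1 ->
  gt n m k (pt r u) = rc (gcoef n m r * Gk d' alpha Rr n k) * (- ci) ^+ (n - 2 * m) *
    proj_harm (n - 2 * m) (vsk k) u.
Proof.
move=> mn r0 u1; rewrite /gterm /Sstar -/(vsk k) /pt enormZ unitv_id// u1 mulr1 ger0_norm//.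
rewrite -[in LHS](mulrA _ (Gamma (k%:R + _))) -/(Gk d' alpha Rr n k) -/(gcoef n m r) -mulrA.
case: (ltP 0 r) => r1; first by rewrite (unitvZ _ r1) (unitv_id u1).
(* At radius 0 the factor [r^n] vanishes unless [n = 0], and then the projection is constant. *)
have -> : r = 0 by apply/eqP; rewrite eq_le r1 r0.
case: n mn => [|n] mn.
  2: by have -> : gcoef n.+1 m 0 = 0; [rewrite /gcoef mul0r expr0n !mul0r|rewrite !mul0r].
have -> : vscale 0 u = vzero.
  by apply: eq_from_tnth => i; rewrite tnth_vscale mul0r tnth_nseq.
rewrite unitv_vzero; congr (_ * (_ * _)).
by rewrite (proj_vzero hd _ u (mvs k) (@vsle k)) sub0n expr0 rc1 mul1r.
Qed.

Lemma proj_integrable j k : cintegrable sphm (fun u => proj_harm j (vsk k) u).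
Proof.
have [K hK] := peval_bounded (hproj (vsk k) j).
by apply: (cintegrable_sphm (cmeas_peval _) hK).
Qed.

Lemma cint_gterm n m k r : (2 * m <= n)%N -> 0 <= r ->
  cint sphm (fun u => gt n m k (pt r u)) =
  rc (gcoef n m r * Gk d' alpha Rr n k) * (- ci) ^+ (n - 2 * m) *
    cint sphm (fun u => proj_harm (n - 2 * m) (vsk k) u).
Proof.
move=> mn r0; rewrite -cintZ; last exact: proj_integrable.
apply: eq_cint_sphm.
- by apply: cmeas_pt; exact: cmeas_gterm.
- by apply: cmeasM; [exact: cmeas_cst|exact: cmeas_peval].
- by move=> u u1; exact: gterm_pt.
Qed.

Lemma cint_gterm_lt n m k r : (2 * m < n)%N -> 0 <= r ->
  cint sphm (fun u => gt n m k (pt r u)) = 0.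
Proof. by move=> mn r0; rewrite cint_gterm ?(ltnW mn)// cint_proj0 ?mulr0// subn_gt0. Qed.

Lemma cint_gterm_eq m k r : 0 <= r ->
  cint sphm (fun u => gt (2 * m) m k (pt r u)) = rterm alpha V Rr m k r.
Proof.
move=> r0; rewrite (cint_gterm k (leqnn _) r0) subnn expr0 mulr1 cint_proj_eq /rterm.
have -> : gcoef (2 * m) m r = (- r ^+ 2 / 4) ^+ m / (m`!%:R * Gamma (m%:R + d%:R / 2)).
  rewrite /gcoef natrM; have -> : (2 * m%:R - m%:R : R) = m%:R by ring.
  rewrite exprM -exprMn; congr (_ ^+ m / _); by field.
have -> : Gk d' alpha Rr (2 * m) k = Gamma (k%:R + (2 * m%:R + d%:R) / alpha) /
   (k`!%:R * Rr `^ (k%:R + (2 * m%:R + d%:R) / alpha)) by rewrite /Gk natrM.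
by rewrite mulrA.
Qed.

(** The sum over [k] in the series of the norm, obtained as a spherical integral of the terms with
    [n - 2m = 0]; its convergence comes with that of the density series. *)
Definition tfun n r : C := cint sphm (fun u => s (2 * n) n (pt r u)).

Lemma sfun_int n m r : (2 * m <= n)%N -> 0 <= r ->
  cintegrable sphm (fun u => s n m (pt r u)) /\
  csum_to (fun k => cint sphm (fun u => gt n m k (pt r u))) (cint sphm (fun u => s n m (pt r u))).
Proof.
move=> mn r0; have [tau [W [t0 tW tle]]] := tau_exists hd halpha mV c_gt0 q0 qR hq r0.
have bd N u : \sum_(k < N) cmod (gt n m k (pt r u)) <= tau n.
  apply: le_trans (tle n (pt r u) N (enorm_pt u r0)).
  have mlt : (m < n./2.+1)%N by lia.
  rewrite (bigD1 (Ordinal mlt))//= lerDl sumr_ge0// => i _.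
  by rewrite sumr_ge0// => k _; exact: cmod_ge0.
have mg k : cmeas (fun u => gt n m k (pt r u)) by apply: cmeas_pt; exact: cmeas_gterm.
apply: (@csum_to_cint _ _ _ sphm (fun k u => gt n m k (pt r u)) _ (fun=> tau n)) => //.
- by move=> N u; apply: le_trans (cmod_sum _ _ _) (bd N u).
- exact: finite_measure_integrable_cst.
- move=> k; apply: (@cintegrable_sphm _ _ _ (tau n)) => // u _.
  apply: le_trans (bd k.+1 u); rewrite big_ord_recr/= lerDr sumr_ge0// => i _.
  exact: cmod_ge0.
Qed.

Lemma tfunP n r : 0 <= r -> csum_to (fun k => rterm alpha V Rr n k r) (tfun n r).
Proof.
move=> r0; have [_ h] := sfun_int (leqnn (2 * n)) r0.
by apply: eq_csum_to h => k; rewrite cint_gterm_eq.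
Qed.

Lemma cint_sfun_lt n m r : (2 * m < n)%N -> 0 <= r -> cint sphm (fun u => s n m (pt r u)) = 0.
Proof.
move=> mn r0; have [_ h] := sfun_int (ltnW mn) r0.
apply: csum_to_unique h _; apply: eq_csum_to (@csum_to0 R) => k.
by rewrite cint_gterm_lt.
Qed.

Lemma gn_int n r : 0 <= r -> cintegrable sphm (fun u => gn alpha V Rr n (pt r u)) /\
  cint sphm (fun u => gn alpha V Rr n (pt r u)) =
  rc (gconst d alpha) * (if odd n then 0 else tfun n./2 r).
Proof.
move=> r0.
have si (m : 'I_(n./2.+1)) := (sfun_int (double_half_ord m) r0).1.
have sI := cintegrable_sum (index_enum 'I_(n./2.+1)) si.
rewrite /gn; split; first exact: cintegrableZ.
rewrite cintZ// cint_sum//; congr (_ * _).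
rewrite big_ord_recr/= big1 ?add0r; last first.
  by move=> m _; apply: cint_sfun_lt => //=; have := ltn_ord m; lia.
case: ifP => on; first by apply: cint_sfun_lt => //; lia.
by rewrite /tfun (double_half_even on).
Qed.

Variable g : d.-tuple R -> R.
Hypothesis gE : forall x, rc (g x) = ginv (Phi alpha V) x.

Definition gr (r : R) : R := r ^+ d' * Rintegral sphm setT (fun u => g (pt r u)).

Lemma gr_series r : 0 <= r ->
  csum_to (fun n => rc (rconst d alpha r) * tfun n r) (rc (gr r)).
Proof.
move=> r0; have [tau [W [t0 tW tle]]] := tau_exists hd halpha mV c_gt0 q0 qR hq r0.
have W0 : 0 <= `|gconst d alpha| * W by rewrite mulr_ge0//; have := tW 0%N; rewrite big_ord0.
have h : csum_to (fun n => cint sphm (fun u => gn alpha V Rr n (pt r u)))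
    (cint sphm (fun u => rc (g (pt r u)))).
  apply: (@csum_to_cint _ _ _ sphm (fun n u => gn alpha V Rr n (pt r u)) _
    (fun=> `|gconst d alpha| * W) _ _ _ _ _).2.
  - by move=> n; exact: cintegrable_meas (gn_int n r0).1.
  - by move=> u; rewrite gE; exact: gnP.
  - move=> N u; apply: le_trans (cmod_sum _ _ _) _.
    apply: le_trans (_ : \sum_(n < N) `|gconst d alpha| * tau n <= _); last first.
      by rewrite -mulr_sumr ler_wpM2l.
    apply: ler_sum => n _.
    exact: (gn_le hd halpha mV q0 qR hq _ tle (enorm_pt u r0)).
  - exact: finite_measure_integrable_cst.
  - by move=> n; exact: (gn_int n r0).1.
have hI : cint sphm (fun u => rc (g (pt r u))) = rc (Rintegral sphm setT (fun u => g (pt r u))).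
  by apply: ceqP => //=; rewrite /Rintegral integral0.
have h2 := csum_toZ (rc (r ^+ d')) h; rewrite hI -rcM -/(gr r) in h2.
(* Terms of odd index integrate to 0, so the series is reindexed by its even terms. The [2^(1-d)] of
   [gconst] and [r^(d-1)] form the [(r/2)^(d-1)] of [rconst]. *)
have h3 := @csum_to_even R (fun n => rc (r ^+ d') * (rc (gconst d alpha) * (if odd n then 0 else tfun n./2 r))) (rc (gr r)).
apply: (@eq_csum_to R (fun n => rc (r ^+ d') * (rc (gconst d alpha) * (if odd n.*2 then 0 else tfun n.*2./2 r)))).
  move=> n; rewrite odd_double doubleK mulrA -rcM; congr (rc _ * _).
  rewrite /rconst /gconst /= expr_div_n.
  have -> : (2 : R) `^ (1 - d%:R) = 2 ^- d'.
    have -> : (1 - d%:R : R) = - d'%:R by rewrite -natr1; ring.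
    by rewrite powRN powR_mulrn.
  by rewrite mulrA.
apply: h3; first by move=> n; rewrite /= odd_double/= !mulr0.
by apply: eq_csum_to h2 => n; rewrite (gn_int n r0).2.
Qed.

End radial_series.

(** * The law of the norm from the density of the vector *)

Section radial_density.
Context (R : realType) (d' : nat).
Local Notation d := d'.+1.
Hypothesis hd : (2 <= d)%N.
Local Notation leb := (@lebesgue_measure R).
Local Notation lebd := (lebn R d).
Local Notation sphm := (sphm R d').
Variables (mu : probability (d.-tuple R) R) (g : d.-tuple R -> R) (K : R).
Hypotheses (mg : measurable_fun setT g) (g0 : forall x, 0 <= g x) (gK : forall x, g x <= K).
Hypothesis mug : forall A, measurable A -> mu A = (\int[lebd]_(x in A) (g x)%:E)%E.

Lemma radial_density (B : set R) : measurable B ->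
  mu [set x | B (enorm x)] = (\int[leb]_(r in B `&` `[0%R, +oo[%classic) (gr g r)%:E)%E.
Proof.
move=> mB.
have mA : measurable [set x : d.-tuple R | B (enorm x)].
  rewrite -[X in measurable X]setTI.
  exact: (@measurable_enorm R d measurableT B mB).
have nz := @measurable_nz R d'; have nzC := measurableC nz.
have mgE D : measurable_fun D (EFin \o g).
  by apply/measurable_EFinP; exact: measurable_funTS.
rewrite mug// -(setIT [set x | B (enorm x)]) -(setvU [set x : d.-tuple R | 0 < enorm x]) setIUr.
have mA1 := measurableI _ _ mA nzC; have mA2 := measurableI _ _ mA nz.
rewrite (ge0_integral_setU _ mA1 mA2 (mgE _)); last 2 first.
- by move=> x _; rewrite lee_fin.
- by apply/disj_setPS => x [[_ ?] [_ ?]].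
(* The origin, where polar coordinates are undefined, is a null set and is discarded. *)
- rewrite null_set_integral ?add0e; last 3 first.
  + exact: measurableI.
  + exact: mgE.
  + by apply: subset_measure0 (lebn_enorm0 R d') => //; exact: measurableI.
  pose f (r : R) (u : d.-tuple R) : \bar R := (\1_B r * g (pt r u))%:E.
  transitivity (\int[lebd]_(x in [set x | (0 < enorm x)%R]) f (enorm x) (unitv x))%E.
    rewrite setIC integral_mkcondr; apply: eq_integral => x; rewrite inE/= => x0.
    have -> : f (enorm x) (unitv x) = (\1_B (enorm x) * g x)%:E.
      rewrite /f /pt (unitv_id (enorm_unitv x0)) vscale_unitv//.
    rewrite patchE indicE; case: (boolP (_ \in _)) => h.
      by rewrite (_ : enorm x \in B) ?mul1r//; move: h; rewrite !inE.
    by rewrite (_ : enorm x \in B = false) ?mul0r//; apply: contraNF h; rewrite !inE.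
  rewrite (@ge0_polar R d' f).
  + rewrite [RHS]integral_mkcond [LHS]integral_mkcond; apply: eq_integral => r _.
    rewrite !patchE.
    have fI (r0 : 0 <= r) : (\int[sphm]_u f r u * (r ^+ d')%:E)%E = (\1_B r * gr g r)%:E.
      have ir : sphm.-integrable setT (EFin \o (fun u => g (pt r u))).
        apply: (@integrable_sphm _ _ _ K) => [|u _]; last by rewrite ger0_norm.
        exact: (measurableT_comp mg (measurable_pt r)).
      rewrite /f; under eq_integral do rewrite EFinM.
      rewrite ge0_integralZl_EFin//; last 2 first.
      * by move=> u _; rewrite lee_fin.
      * apply/measurable_EFinP.
        exact: (measurableT_comp mg (measurable_pt r)).
      have -> : (\int[sphm]_u (g (pt r u))%:E = (Rintegral sphm setT (fun u => g (pt r u)))%:E)%E.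
        by rewrite /Rintegral fineK//; exact: integrable_fin_num.
      rewrite -!EFinM; congr EFin; rewrite /gr; move: (Rintegral _ _ _) => w.
      by rewrite -mulrA (mulrC w).
    have [r0|r0|r0] := ltgtP 0 r.
    * rewrite (_ : r \in `]0%R, +oo[%classic); last by rewrite inE/= in_itv/= r0.
      rewrite fI ?(ltW r0)// indicE; case: (boolP (r \in B)) => h.
        rewrite mul1r (_ : r \in _ = true)//.
        by apply/mem_set; split; [exact: set_mem|rewrite /= in_itv/= (ltW r0)].
      rewrite mul0r (_ : r \in _ `&` _ = false)//; apply: contraNF h.
      by rewrite in_setI => /andP[].
    * rewrite (_ : r \in _ = false); last by apply/negbTE/negP; rewrite inE/= in_itv/= ltNge (ltW r0).
      rewrite (_ : r \in _ `&` _ = false)//.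
      by apply/negbTE/negP; rewrite inE/= in_itv/= => -[_]; rewrite leNgt r0.
    * rewrite (_ : r \in _ = false); last by apply/negbTE/negP; rewrite inE/= in_itv/= -r0 ltxx.
      (* The half-line of the statement contains [r = 0], that of polar coordinates does not; [gr]
         vanishes there because [d >= 2]. *)
      case: ifP => // _; rewrite /gr -r0 expr0n (_ : d' == 0%N = false) ?mul0r//.
      by move: hd; case: d'.
  + apply/measurable_EFinP; apply: measurable_funM.
      exact: (measurableT_comp (measurable_indic mB) measurable_fst).
    apply: (measurableT_comp mg); apply: measurable_vscale; first exact: measurable_fst.
    exact: (measurableT_comp (@measurable_unitv R d) measurable_snd).
  + by move=> r u; rewrite lee_fin mulr_ge0// indicE.
Qed.

End radial_density.

(** The formula is assumed away from the origin; there both sides equal 1, since [mu] has total mass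
    1. *)
Lemma charfun_Phi (R : realType) d' (alpha : R) (halpha : 1 < alpha < 2) (V : d'.+1.-tuple R -> R[i])
    (mu : probability (d'.+1.-tuple R) R) :
  (forall z : d'.+1.-tuple R, 0 < enorm z ->
     charfun mu z = cexp (- (rc (enorm z `^ alpha) * V (unitv z)))) ->
  forall z, charfun mu z = Phi alpha V z.
Proof.
move=> h z; case: (ltP 0 (enorm z)) => z0; first exact: h.
have z1 : ~~ (0 < enorm z) by rewrite -leNgt.
rewrite /Phi (enorm_pow0 halpha z1) rc0 mul0r oppr0.
have zE : z = vzero by apply: enorm0_eq0; apply/eqP; rewrite eq_le z0 enorm_ge0.
have d0 x : dotp z x = 0 by rewrite zE dotpC dotp0.
apply: ceqP; rewrite /charfun /cexp /=.
- under eq_Rintegral do rewrite d0 cos0.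
  rewrite expR0 cos0 mul1r /Rintegral integral_cst// mul1e.
  by rewrite [X in fine X](@probability_setT _ _ _ mu).
- under eq_Rintegral do rewrite d0 sin0.
  by rewrite sin0 mulr0 /Rintegral integral0.
Qed.

(** The inner sums over [k] are limits and enter as the functions [s] and [t]. Absolute convergence,
    uniform on balls, is expressed by uniformly small tails of the triple series of moduli in the
    extended reals, where such sums always make sense. *)
Theorem theorem5p4 (R : realType) (d : nat) (hd : (2 <= d)%N)
  (alpha : R) (halpha : 1 < alpha < 2)
  (lam : {finite_measure set (d.-tuple R) -> \bar R})
  (hlam_sph : lam (~` @sphere R d) = 0%E) (hlam0 : lam setT != 0%E)
  (mu : probability (d.-tuple R) R)
  (hchf : forall z : d.-tuple R, 0 < enorm z ->
     charfun mu z = cexp (- (rc (enorm z `^ alpha) * stableV alpha lam (unitv z))))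
  (hnd : nondegenerate_law mu)
  (Rr : R) (hR : rho0 (stableV alpha lam) < Rr) :
  let V := stableV alpha lam in
  (exists g : d.-tuple R -> R,
     (exists s : nat -> nat -> d.-tuple R -> R[i],
        (forall n m x, csum_to (fun k => gterm alpha V Rr n m k x) (s n m x)) /\
        (forall x, csum_to
           (fun n => rc (gconst d alpha) * \sum_(m < n./2.+1) s n m x) (rc (g x))) /\
        (forall M, 0 < M -> forall e, 0 < e -> exists N0 : nat,
           forall N : nat, (N0 <= N)%N -> forall x, enorm x <= M ->
           cmod (\sum_(n < N) rc (gconst d alpha) * \sum_(m < n./2.+1) s n m x
                 - rc (g x)) < e)) /\
     (forall M, 0 < M -> forall e, 0 < e -> exists N0 : nat,
        forall N : nat, (N0 <= N)%N -> forall x, enorm x <= M ->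
        (\sum_(N <= n <oo) \sum_(m < n./2.+1) \sum_(k <oo)
            (cmod (gterm alpha V Rr n m k x))%:E < e%:E)%E) /\
     (forall A : set (d.-tuple R), measurable A ->
        mu A = leb_int (fun x => (\1_A x * g x)%:E))) /\
  (exists gr : R -> R,
     (exists t : nat -> R -> R[i],
        (forall n r, 0 <= r -> csum_to (fun k => rterm alpha V Rr n k r) (t n r)) /\
        (forall r, 0 <= r ->
           csum_to (fun n => rc (rconst d alpha r) * t n r) (rc (gr r)))) /\
     (forall B : set R, measurable B ->
        mu [set x | B (enorm x)] =
        (\int[@lebesgue_measure R]_(r in B `&` `[0%R, +oo[%classic) (gr r)%:E)%E)).
Proof.
case: d hd lam hlam_sph hlam0 mu hchf hnd hR => [//|d'] hd' lam' hsph hlam0' mu' hchf' hnd' hR' V.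
have [c c0 hc] := ReV_lower halpha hsph hchf' hnd'.
have [q /andP[q0 qR] hq] := Vstar_bound halpha hsph hchf' hnd' hR'.
have mV := cmeas_V halpha hsph.
have muPhi := charfun_Phi halpha hchf'.
have mPhi := cmeas_Phi alpha mV.
have PhiD := Phi_le halpha hc.
have iD := integrable_Dom hd' halpha c0.
pose g := gdens (Phi alpha V).
have gE x : rc (g x) = ginv (Phi alpha V) x := gdensE muPhi mPhi PhiD iD x.
have g0 x : 0 <= g x := gdens_ge0 muPhi mPhi PhiD iD x.
have gK x := gdens_le muPhi mPhi PhiD iD x.
have mg := measurable_gdens muPhi mPhi PhiD iD.
have mug A (mA : measurable A) := density muPhi mPhi PhiD iD mA.
split.
  exists g; split.
    exists (sfun alpha V Rr); split; last split.
    - exact: (sfunP hd' halpha mV q0 qR hq).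
    - by move=> x; rewrite gE; exact: (sum_gn hd' halpha mV c0 hc q0 qR hq x).
    - move=> M M0 e e0.
      have [N0 h] := gseries_unif hd' halpha mV c0 hc q0 qR hq M0 e0.
      by exists N0 => N N0N x xM; rewrite gE; exact: h.
  split; first by move=> M M0 e e0; exact: (gseries_abs_unif hd' halpha mV c0 q0 qR hq M0 e0).
  (* The integrand is nonnegative, so the integral against [lebn] is the iterated integral of the
     statement. *)
  move=> A mA; rewrite (mug _ mA) -integral_lebn.
  - rewrite integral_mkcond; apply: eq_integral => x _.
    by rewrite patchE indicE; case: ifP => _; rewrite ?mul1r ?mul0r.
  - by apply/measurable_EFinP; apply: measurable_funM => //; exact: measurable_indic.
  - by move=> x; rewrite lee_fin mulr_ge0// indicE.
exists (gr g); split.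
  exists (tfun alpha V Rr); split.
  - by move=> n r r0; exact: (tfunP hd' halpha mV c0 q0 qR hq n r0).
  - by move=> r r0; exact: (gr_series hd' halpha mV c0 hc q0 qR hq gE r0).
by move=> B mB; exact: (radial_density hd' mg g0 gK mug mB).
Qed.
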